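(* Let $M$ be a Lie triple system of Volterra operators on a complex Banach space $\mathcal{X}$, i.e. a linear subspace of $\mathcal{B}(\mathcal{X})$ consisting of compact quasinilpotent operators with $[a,[b,c]]\in M$ for all $a,b,c\in M$. Then $M$ is triangularizable.
   Context: $[a,b]=ab-ba$. A set of operators is triangularizable if there is a maximal chain of closed subspaces of $\mathcal{X}$ each invariant under every operator in the set. *)

(* Defs.v *)
From mathcomp Require Import all_boot all_order all_algebra.
From mathcomp Require Import all_classical all_reals all_analysis.
From mathcomp Require Export complex.
Export numFieldNormedType.Exports.

Set Implicit Arguments.
Unset Strict Implicit.
Unset Printing Implicit Defensive.

Import GRing.Theory Num.Theory.
Local Open Scope ring_scope.
Local Open Scope classical_set_scope.

Section Operators.
Context {R : realType} {V : normedModType R[i]}.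

Definition lin_op (f : V -> V) : Prop :=
  forall (a : R[i]) (x y : V), f (a *: x + y) = a *: f x + f y.

Definition bounded_op (f : V -> V) : Prop := lin_op f /\ continuous f.

Definition compact_op (f : V -> V) : Prop :=
  bounded_op f /\ compact (closure (f @` ball (0 : V) 1)).

(* quasinilpotent: spectrum contained in {0}, i.e. f - lam is invertible in
   B(X) for every nonzero complex lam *)
Definition quasinilpotent (f : V -> V) : Prop :=
  bounded_op f /\
  forall lam : R[i], lam != 0 ->
    exists g : V -> V, bounded_op g /\
      (forall x, g (f x - lam *: x) = x) /\
      (forall x, f (g x) - lam *: g x = x).

Definition volterra_op (f : V -> V) : Prop := compact_op f /\ quasinilpotent f.

Definition lie_br (f g : V -> V) : V -> V := fun x => f (g x) - g (f x).

Definition lie_triple_system (M : set (V -> V)) : Prop :=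
  [/\ forall f, M f -> bounded_op f,
      M (fun _ => 0),
      forall (a : R[i]) f g, M f -> M g -> M (fun x => a *: f x + g x)
    & forall f g h, M f -> M g -> M h -> M (lie_br f (lie_br g h))].

Definition closed_subspace (W : set V) : Prop :=
  [/\ closed W, W 0 & forall (a : R[i]) x y, W x -> W y -> W (a *: x + y)].

Definition subspace_chain (C : set (set V)) : Prop :=
  (forall W, C W -> closed_subspace W) /\
  (forall W1 W2, C W1 -> C W2 -> W1 `<=` W2 \/ W2 `<=` W1).

Definition maximal_subspace_chain (C : set (set V)) : Prop :=
  subspace_chain C /\ forall C', subspace_chain C' -> C `<=` C' -> C' = C.

Definition invariant (f : V -> V) (W : set V) : Prop :=
  forall x, W x -> W (f x).

Definition triangularizable (M : set (V -> V)) : Prop :=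
  exists C, maximal_subspace_chain C /\
    forall W, C W -> forall f, M f -> invariant f W.

End Operators.

(* Main.v *)
(* Along a maximal chain of closed invariant subspaces, [M] acts irreducibly on every gap, so
   everything reduces to showing that an irreducible Lie triple system [M] of Volterra operators
   is zero.

   Suppose it is not. The algebra generated by [M] acts irreducibly and consists of compact
   operators, so it contains an element [w] with a nonzero eigenvalue (words in a suitably
   normalised family accumulate at a nonzero idempotent, or Lomonosov's argument applies).
   After passing to a gap, [w] lies in the algebra generated by finitely many elements of [M]
   which already act irreducibly. The same accumulation argument for products of exponentials
   of these elements gives such a product [g] with a nonzero finite-rank spectral projection
   [p] such that [(1 - p) a p = 0] whenever [g^-n a g^n] grows subexponentially.

   The triple system embeds into the closed Lie algebra [L] of operators [(d + a, d - a)] on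
   the square of the space, [a] in the closure of [M] and [d] in that of [span [M, M]].
   Conjugation by [g] on [L] differs from the identity by a quasinilpotent operator unless [L]
   contains nonzero finite-rank operators, because eigenvectors of the conjugation for
   eigenvalues other than 1 have finite rank. In the first case the range of [p] is invariant,
   so the identity has finite rank: [L] has nonzero finite-rank elements in both cases.

   Let [L_F] be the ideal of these elements and [J = span [L_F, L]]. The trace form vanishes
   on [L_F x L]; as in Cartan's criterion the elements of [J] are nilpotent, and by
   polarisation all words in [J] have trace zero. If [w] is a nonzero word of least rank and
   [g] a product of exponentials, then [w g w g^-1] is a nilpotent word, so [w g w = 0] or
   [w g^-1 w = 0]; comparing power series gives [w g w = 0] for all [g], which contradicts
   irreducibility. If [J = 0], an element of [L_F] is a scalar, and its trace is zero. *)

Require Import Defs.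
From HB Require Import structures.
From mathcomp Require Import all_boot all_order all_algebra.
From mathcomp Require Import all_classical all_reals all_analysis.
From mathcomp Require Import complex.
From mathcomp Require Import ring lra zify.

Set Implicit Arguments.
Unset Strict Implicit.
Unset Printing Implicit Defensive.

Import Order.TTheory GRing.Theory Num.Theory.
Local Open Scope ring_scope.
Local Open Scope classical_set_scope.

(** [M] is not closed under the bracket, while conjugation by exponentials and Cartan's argument
    live in a Lie algebra. Inside the operators on one space, [M + [M, M]] is such an algebra, but
    its elements are not known to be quasinilpotent and nothing controls the trace of a product of
    an element of [M] with one of [[M, M]]. On the square, [M] sits as [(a, -a)] and [[M, M]] as
    [(d, d)], so the mixed terms of the trace form cancel between the two coordinates.

    Products of exponentials are the identity plus a compact operator, so their words are not
    compact. This is repaired by scaling: large multiples of the generators make the joint growth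
    rate exceed 1, and after normalisation the identity parts decay geometrically. Total boundedness
    of the family of exponentials needs finitely many generators, hence the gap on which finitely
    many elements act irreducibly.

    Contour integrals are replaced by averages over roots of unity of order [N = 2^n]: the average
    of [u (u - B)^-1] is exactly [(1 - B^N)^-1], and the spectral theory below rests on this
    identity. *)

Section ComplexModulus.
Context {R : realType}.
Implicit Types (z w : R[i]) (r : R).

(** * The complex modulus with real values *)

Definition cabs z : R := complex.Re `|z|.

Lemma normE z : `|z| = (cabs z)%:C%C.
Proof. by rewrite /cabs normc_def. Qed.

Lemma real_complex_inj : injective (@real_complex_def R (Phant R)).
Proof. by move=> x y /eqP; rewrite eq_complex /= eqxx andbT => /eqP. Qed.

Lemma cabs_ge0 z : 0 <= cabs z.
Proof. by have := normr_ge0 z; rewrite normE lecR. Qed.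

Lemma cabsM z w : cabs (z * w) = cabs z * cabs w.
Proof. by apply: real_complex_inj; rewrite rmorphM -!normE normrM. Qed.

Lemma cabsD z w : cabs (z + w) <= cabs z + cabs w.
Proof. by have := ler_normD z w; rewrite !normE -rmorphD lecR. Qed.

Lemma cabs_eq0 z : (cabs z == 0) = (z == 0).
Proof.
rewrite -[RHS]normr_eq0 normE; apply/eqP/eqP => [->|] //.
by move=> /real_complex_inj.
Qed.

Lemma cabs0 : cabs 0 = 0. Proof. by apply/eqP; rewrite cabs_eq0. Qed.

Lemma cabs_gt0 z : (0 < cabs z) = (z != 0).
Proof. by rewrite lt_neqAle cabs_ge0 andbT eq_sym cabs_eq0. Qed.

Lemma cabsN z : cabs (- z) = cabs z.
Proof. by rewrite /cabs normrN. Qed.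

Lemma cabsB z w : cabs (z - w) = cabs (w - z).
Proof. by rewrite -cabsN opprB. Qed.

Lemma cabs_real r : cabs r%:C%C = `|r|.
Proof. by rewrite /cabs normc_def /= expr0n addr0 sqrtr_sqr. Qed.

Lemma cabs_nneg r : 0 <= r -> cabs r%:C%C = r.
Proof. by move=> r0; rewrite cabs_real ger0_norm. Qed.

Lemma cabs1 : cabs 1 = 1.
Proof. by apply: real_complex_inj; rewrite -normE normr1. Qed.

Lemma cabs_nat n : cabs n%:R = n%:R.
Proof. by apply: real_complex_inj; rewrite -normE normr_nat rmorph_nat. Qed.

Lemma cabsV z : cabs z^-1 = (cabs z)^-1.
Proof. by apply: real_complex_inj; rewrite -normE normfV normE -fmorphV. Qed.

Lemma cabsX z n : cabs (z ^+ n) = cabs z ^+ n.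
Proof. by elim: n => [|n IH]; rewrite ?expr0 ?cabs1 // !exprS cabsM IH. Qed.

Lemma cabsBD z w : cabs z - cabs w <= cabs (z - w).
Proof. by rewrite lerBlDr; apply: le_trans (cabsD _ _); rewrite subrK. Qed.

Lemma cabs_sum (I : Type) (s : seq I) (P : pred I) (F : I -> R[i]) :
  cabs (\sum_(i <- s | P i) F i) <= \sum_(i <- s | P i) cabs (F i).
Proof.
elim/big_rec2: _ => [|i x y _ h]; first by rewrite cabs0.
by apply: le_trans (cabsD _ _) _; rewrite lerD2l.
Qed.

Lemma cabs_Re z : `|complex.Re z| <= cabs z.
Proof. by have := normc_ge_Re z; rewrite normE lecR. Qed.

Lemma cabs_sqr z : cabs z ^+ 2 = complex.Re z ^+ 2 + complex.Im z ^+ 2.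
Proof.
by rewrite /cabs normc_def /= sqr_sqrtr // addr_ge0 // sqr_ge0.
Qed.

Lemma cabs_le_ReIm z : cabs z <= `|complex.Re z| + `|complex.Im z|.
Proof.
rewrite -[leLHS]ger0_norm ?cabs_ge0 // -[leRHS]ger0_norm ?addr_ge0 //.
rewrite -ler_sqr ?nnegrE ?normr_ge0 // !real_normK ?num_real //.
rewrite cabs_sqr -[in X in X <= _](real_normK (num_real (complex.Re z))).
rewrite -[in X in X <= _](real_normK (num_real (complex.Im z))).
have := normr_ge0 (complex.Re z); have := normr_ge0 (complex.Im z).
move: (`|complex.Re z|) (`|complex.Im z|) => x y; nra.
Qed.

Lemma half_gt0 r : 0 < r -> 0 < r / 2.
Proof. by move=> ?; rewrite divr_gt0. Qed.

Lemma geo_small (C t e : R) : 0 <= t -> t < 1 -> 0 < e ->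
  exists N, forall n, (N <= n)%N -> C * t ^+ n < e.
Proof.
move=> t0 t1 e0.
have ht : `|t| < 1 by rewrite ger0_norm.
have e1 : 0 < e / (`|C| + 1) by rewrite divr_gt0 // ltr_pwDr.
have /cvgrPdist_lt /(_ _ e1) [N _ hN] := cvg_expr ht; exists N => n hn.
have := hN n hn; rewrite sub0r normrN ger0_norm ?exprn_ge0 // ltr_pdivlMr ?ltr_pwDr // => h.
apply: le_lt_trans h; rewrite mulrC ler_wpM2l ?exprn_ge0 //.
by rewrite (le_trans (ler_norm _)) // lerDl.
Qed.

Lemma pow_fact_le (M : R) : 0 <= M ->
  exists2 C : R, 0 <= C & forall n, M ^+ n / n`!%:R <= C * 2^-1 ^+ n.
Proof.
move=> M0.
(* Beyond [K] each further factor [M / n] is at most one half; up to [K] each term is dominated by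
   one of the summands of the constant. *)
pose K := Num.truncn (2 * M).
have hK : forall n, (K < n)%N -> M / n%:R <= 2^-1.
  move=> n hn; rewrite ler_pdivrMr ?ltr0n ?(leq_ltn_trans _ hn) //.
  have := @truncnS_gt R (2 * M); rewrite -/K => h.
  have : (K.+1)%:R <= n%:R :> R by rewrite ler_nat.
  lra.
exists (\sum_(j < K.+1) (2 * M) ^+ j / j`!%:R).
  by apply: sumr_ge0 => j _; rewrite divr_ge0 ?exprn_ge0 ?mulr_ge0.
move=> n; have [hn|hn] := leqP n K.
  rewrite (bigD1 (Ordinal (hn : (n < K.+1)%N))) //= mulrDl -[leLHS]addr0 lerD //.
    rewrite exprMn exprVn [2 ^+ n * _]mulrC -!mulrA ler_wpM2l ?exprn_ge0 //.
    by rewrite mulrCA mulfV ?mulr1 // expf_neq0.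
  rewrite mulr_ge0 ?exprn_ge0 ?invr_ge0 //.
  by apply: sumr_ge0 => j _; rewrite divr_ge0 ?exprn_ge0 ?mulr_ge0.
rewrite big_ord_recr /=.
have {hn} [m ->] : exists m, n = (K + m)%N by exists (n - K)%N; rewrite subnKC // ltnW.
elim: m => [|m IH].
  rewrite addn0 mulrDl ler_wpDl //.
    rewrite mulr_ge0 ?exprn_ge0 ?invr_ge0 //.
    by apply: sumr_ge0 => j _; rewrite divr_ge0 ?exprn_ge0 ?mulr_ge0.
  rewrite exprMn exprVn [2 ^+ K * _]mulrC -!mulrA ler_wpM2l ?exprn_ge0 //.
  by rewrite mulrCA mulfV ?mulr1 // expf_neq0.
have h1 : M / (K + m).+1%:R <= 2^-1 by apply: hK; rewrite ltnS leq_addr.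
rewrite addnS factS natrM !exprS invfM mulrACA [leRHS]mulrCA.
by apply: ler_pM => //; rewrite ?mulr_ge0 ?invr_ge0 ?exprn_ge0.
Qed.

End ComplexModulus.

(* Norms of [normedModType R[i]] take values in [R[i]]; here they are real. *)
HB.mixin Record isBanach (R : realType) V of GRing.Lmodule R[i] V := {
  nm : V -> R;
  nm_eq0 : forall x, nm x = 0 -> x = 0;
  nmD : forall x y, nm (x + y) <= nm x + nm y;
  nmZ : forall a x, nm (a *: x) = cabs a * nm x;
  nm_complete : forall u : nat -> V,
    (forall e, 0 < e -> exists N, forall m n, (N <= m)%N -> (N <= n)%N ->
       nm (u m - u n) < e) ->
    exists l, forall e, 0 < e -> exists N, forall n, (N <= n)%N -> nm (u n - l) < e
}.

#[short(type="banType")]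
HB.structure Definition Banach (R : realType) :=
  { V of isBanach R V & GRing.Lmodule R[i] V }.

(** * Norms and convergence of sequences *)

Section Norm.
Context {R : realType} {V : banType R}.
Implicit Types (x y z l : V) (u v : nat -> V) (a : R[i]).

Definition tends u l := forall e : R, 0 < e ->
  exists N, forall n, (N <= n)%N -> nm (u n - l) < e.

Definition cauchys u := forall e : R, 0 < e ->
  exists N, forall m n, (N <= m)%N -> (N <= n)%N -> nm (u m - u n) < e.

Lemma cauchys_tends u : cauchys u -> exists l, tends u l.
Proof. exact: nm_complete. Qed.

Lemma nm0 : nm (0 : V) = 0.
Proof. by rewrite -(scale0r (0 : V)) nmZ cabs0 mul0r. Qed.

Lemma nmN x : nm (- x) = nm x.
Proof. by rewrite -scaleN1r nmZ cabsN cabs1 mul1r. Qed.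

Lemma nmC x y : nm (x - y) = nm (y - x).
Proof. by rewrite -nmN opprB. Qed.

Lemma nm_ge0 x : 0 <= nm x.
Proof. by have := nmD x (- x); rewrite nmN subrr nm0; lra. Qed.

Lemma nmE0 x : (nm x == 0) = (x == 0).
Proof. by apply/eqP/eqP => [/nm_eq0 //|->]; rewrite nm0. Qed.

Lemma nm_gt0 x : (0 < nm x) = (x != 0).
Proof. by rewrite lt_neqAle nm_ge0 andbT eq_sym nmE0. Qed.

Lemma nmB x y : nm (x - y) <= nm x + nm y.
Proof. by rewrite -(nmN y) nmD. Qed.

Lemma nm_tri z x y : nm (x - y) <= nm (x - z) + nm (z - y).
Proof. by apply: le_trans (nmD _ _); rewrite addrA subrK. Qed.

Lemma nmBD x y : nm x - nm y <= nm (x - y).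
Proof. by rewrite lerBlDr; apply: le_trans (nmD _ _); rewrite subrK. Qed.

Lemma nm_sum (I : Type) (s : seq I) (P : pred I) (F : I -> V) :
  nm (\sum_(i <- s | P i) F i) <= \sum_(i <- s | P i) nm (F i).
Proof.
elim/big_rec2: _ => [|i x y _ h]; first by rewrite nm0.
by apply: le_trans (nmD _ _) _; rewrite lerD2l.
Qed.

Lemma nm_small x : (forall e : R, 0 < e -> nm x <= e) -> x = 0.
Proof.
move=> h; apply/eqP; apply/negPn; apply/negP; rewrite -nm_gt0 => x0.
by have := h _ (half_gt0 x0); rewrite leNgt; lra.
Qed.

Lemma tends_uniq u l l' : tends u l -> tends u l' -> l = l'.
Proof.
move=> h h'; apply/eqP; rewrite -subr_eq0; apply/eqP/nm_small => e e0.
have [N hN] := h _ (half_gt0 e0); have [N' hN'] := h' _ (half_gt0 e0).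
have := nm_tri (u (maxn N N')) l l'; rewrite (nmC l (u _)).
have := hN _ (leq_maxl N N'); have := hN' _ (leq_maxr N N'); lra.
Qed.

End Norm.

(** * Limits, closed subspaces and bounded operators *)

Section Limits.
Context {R : realType} {V : banType R}.
Implicit Types (x y z l : V) (u v : nat -> V) (a : R[i]) (W : set V).

Lemma tends_cst l : tends (fun=> l) l.
Proof. by move=> e e0; exists 0%N => n _; rewrite subrr nm0. Qed.

Lemma tends_cauchys u l : tends u l -> cauchys u.
Proof.
move=> h e e0; have [N hN] := h _ (half_gt0 e0); exists N => m n hm hn.
have := nm_tri l (u m) (u n); have := hN _ hm; have := hN _ hn.
by rewrite (nmC l); lra.
Qed.

Lemma tendsD u v l l' : tends u l -> tends v l' -> tends (fun n => u n + v n) (l + l').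
Proof.
move=> h h' e e0; have [N hN] := h _ (half_gt0 e0); have [M hM] := h' _ (half_gt0 e0).
exists (maxn N M) => n; rewrite geq_max => /andP[/hN hn /hM hm].
by rewrite opprD addrACA; apply: le_lt_trans (nmD _ _) _; lra.
Qed.

Lemma tendsZ a u l : tends u l -> tends (fun n => a *: u n) (a *: l).
Proof.
move=> h e e0; have c1 : 0 < cabs a + 1 by rewrite ltr_wpDl ?cabs_ge0.
have [N hN] := h _ (divr_gt0 e0 c1); exists N => n /hN.
rewrite -scalerBr nmZ ltr_pdivlMr // mulrDr mulr1 mulrC => h1.
by apply: le_lt_trans h1; rewrite lerDl nm_ge0.
Qed.

Lemma tendsN u l : tends u l -> tends (fun n => - u n) (- l).
Proof.
by move=> h e e0; have [N hN] := h _ e0; exists N => n /hN; rewrite -opprD nmN.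
Qed.

Lemma tendsB u v l l' : tends u l -> tends v l' -> tends (fun n => u n - v n) (l - l').
Proof. by move=> hu hv; apply: tendsD => //; apply: tendsN. Qed.

Lemma tends_eq u v l : u =1 v -> tends u l -> tends v l.
Proof. by move=> uv h e e0; have [N hN] := h e e0; exists N => n; rewrite -uv; apply: hN. Qed.

Lemma tends_sub u l (p : nat -> nat) : (forall n, (n <= p n)%N) ->
  tends u l -> tends (fun n => u (p n)) l.
Proof.
move=> hp h e e0; have [N hN] := h e e0; exists N => n hn.
by apply: hN; apply: leq_trans (hp n).
Qed.

Lemma tends_squeeze (b : nat -> R) u l :
  (forall e, 0 < e -> exists N, forall n, (N <= n)%N -> b n < e) ->
  (forall n, nm (u n - l) <= b n) -> tends u l.
Proof.
move=> hb h e e0; have [N hN] := hb e e0; exists N => n hn.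
exact: le_lt_trans (hN _ hn).
Qed.

Lemma tends_nm_le u l (C : R) N : tends u l ->
  (forall n, (N <= n)%N -> nm (u n) <= C) -> nm l <= C.
Proof.
move=> h hC; rewrite leNgt; apply/negP => hl.
have [M hM] := h (nm l - C) ltac:(by rewrite subr_gt0).
have := hM _ (leq_maxr N M); have := hC _ (leq_maxl N M).
by have := nmBD l (u (maxn N M)); rewrite (nmC l); lra.
Qed.

Lemma tends_nm_leB u l z (C : R) N : tends u l ->
  (forall n, (N <= n)%N -> nm (u n - z) <= C) -> nm (l - z) <= C.
Proof. by move=> h; apply: tends_nm_le; apply: tendsB h (tends_cst _). Qed.

Lemma geo_tends u (C t : R) : 0 <= t -> t < 1 ->
  (forall n, nm (u n.+1 - u n) <= C * t ^+ n) ->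
  exists2 l, tends u l & forall n, nm (u n - l) <= C * t ^+ n / (1 - t).
Proof.
move=> t0 t1 h; have t1' : 0 < 1 - t by rewrite subr_gt0.
have hC : 0 <= C by have := h 0%N; rewrite expr0 mulr1; apply: le_trans; exact: nm_ge0.
have hk n k : nm (u (n + k)%N - u n) <= C * t ^+ n / (1 - t) * (1 - t ^+ k).
  elim: k => [|k IH]; first by rewrite addn0 subrr nm0 expr0 subrr mulr0.
  apply: le_trans (nm_tri (u (n + k)%N) _ _) _.
  rewrite addnS; apply: le_trans (lerD (h _) IH) _.
  rewrite exprD le_eqVlt; apply/orP; left; apply/eqP; rewrite exprS.
  by field; rewrite gt_eqF.
have hk' n m : (n <= m)%N -> nm (u m - u n) <= C * t ^+ n / (1 - t).
  move=> nm; rewrite -(subnKC nm); apply: le_trans (hk _ _) _.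
  rewrite ler_piMr ?mulr_ge0 ?invr_ge0 ?exprn_ge0 ?(ltW t1') //.
  by rewrite gerBl exprn_ge0.
have cu : cauchys u.
  move=> e e0; have [N hN] := geo_small (C / (1 - t)) t0 t1 (half_gt0 e0).
  exists N => m n hm hn; apply: le_lt_trans (nm_tri (u N) _ _) _.
  have := hN _ (leqnn N); rewrite mulrAC => h1.
  by have := hk' _ _ hm; have := hk' _ _ hn; rewrite [nm (u N - _)]nmC; lra.
have [l hl] := cauchys_tends cu; exists l => // n.
by rewrite nmC; apply: (tends_nm_leB (N := n)) hl _ => m /hk'.
Qed.

Definition clos W : set V := [set x | forall e : R, 0 < e -> exists2 y, W y & nm (x - y) < e].

Definition subsp W := W 0 /\ forall a x y, W x -> W y -> W (a *: x + y).

Definition csub W := subsp W /\ clos W `<=` W.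

Lemma sub_clos W : W `<=` clos W.
Proof. by move=> x Wx e e0; exists x; rewrite // subrr nm0. Qed.

Lemma closK W : clos (clos W) `<=` clos W.
Proof.
move=> x h e e0; have [y /(_ _ (half_gt0 e0)) [z Wz yz] xy] := h _ (half_gt0 e0).
by exists z => //; have := nm_tri y x z; lra.
Qed.

Lemma clos_sub W W' : W `<=` W' -> clos W `<=` clos W'.
Proof. by move=> WW x h e e0; have [y /WW Wy xy] := h e e0; exists y. Qed.

Lemma clos_seq W x : clos W x -> exists2 u, (forall n, W (u n)) & tends u x.
Proof.
move=> h.
have hn (n : nat) : 0 < 2^-1 ^+ n :> R by rewrite exprn_gt0 // invr_gt0.
have h' n : exists y, W y /\ nm (x - y) < 2^-1 ^+ n.
  by have [y Wy xy] := h _ (hn n); exists y.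
exists (fun n => sval (cid (h' n))) => [n|]; first by case: cid => y [].
apply: (@tends_squeeze (fun n => 2^-1 ^+ n)) => [e e0|n].
  have := @geo_small R 1 2^-1 e _ _ e0; case; rewrite ?invr_ge0 ?invf_lt1 ?ltr1n // => N hN.
  by exists N => n /hN; rewrite mul1r.
by case: cid => y [] /= _ /ltW; rewrite nmC.
Qed.

Lemma seq_clos W u x : (forall n, W (u n)) -> tends u x -> clos W x.
Proof.
move=> h hu e e0; have [N hN] := hu e e0.
by exists (u N); rewrite // nmC; apply: hN.
Qed.

Lemma subspZ W a x : subsp W -> W x -> W (a *: x).
Proof. by move=> [W0 h] Wx; rewrite -[_ *: _]addr0; apply: h. Qed.

Lemma subspD W x y : subsp W -> W x -> W y -> W (x + y).
Proof. by move=> [W0 h] Wx Wy; rewrite -[x]scale1r; apply: h. Qed.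

Lemma subspN W x : subsp W -> W x -> W (- x).
Proof. by move=> h Wx; rewrite -scaleN1r; apply: subspZ. Qed.

Lemma subspB W x y : subsp W -> W x -> W y -> W (x - y).
Proof. by move=> h Wx Wy; apply: subspD => //; apply: subspN. Qed.

Lemma subsp_sum W (I : Type) (s : seq I) (P : pred I) (F : I -> V) : subsp W ->
  (forall i, P i -> W (F i)) -> W (\sum_(i <- s | P i) F i).
Proof.
by move=> sW h; elim/big_rec: _ => [|i x Pi Wx]; [exact: sW.1 | apply: subspD; auto].
Qed.

Lemma csub_tends W u x : csub W -> (forall n, W (u n)) -> tends u x -> W x.
Proof. by move=> [_ cW] hu hx; apply: cW; apply: seq_clos hx. Qed.

Lemma clos_subsp W : subsp W -> subsp (clos W).
Proof.
move=> sW; split; first by apply: sub_clos; exact: sW.1.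
move=> a x y /clos_seq[u uW ux] /clos_seq[v vW vy].
apply: (@seq_clos _ (fun n => a *: u n + v n)) => [n|]; first exact: sW.2.
by apply: tendsD => //; apply: tendsZ.
Qed.

Lemma clos_csub W : subsp W -> csub (clos W).
Proof. by move=> sW; split; [exact: clos_subsp | exact: closK]. Qed.

Lemma csub0 : csub [set (0 : V)].
Proof.
split; first by split=> // a x y -> ->; rewrite scaler0 addr0.
move=> x h; apply: nm_small => e e0; have [y /= -> ] := h e e0.
by rewrite subr0 => /ltW.
Qed.

Lemma csubI (F : set (set V)) : (forall W, F W -> csub W) ->
  csub [set x | forall W, F W -> W x].
Proof.
move=> hF; split.
  split=> [W /hF[[]] //|a x y hx hy W FW].
  by have [[_ h] _] := hF W FW; apply: h; [apply: hx | apply: hy].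
move=> x h W FW; have [_ cW] := hF W FW; apply: cW => e e0.
by have [y hy xy] := h e e0; exists y => //; apply: hy.
Qed.

End Limits.

(** * The Banach algebra of bounded operators *)

Section Bop.
Context {R : realType} (V : banType R).

Definition is_bop (f : V -> V) :=
  (forall (a : R[i]) x y, f (a *: x + y) = a *: f x + f y) /\
  exists C : R, forall x, nm (f x) <= C * nm x.

Record bop := Bop { bfun :> V -> V; bopP : is_bop bfun }.

Lemma bop_ext (f g : bop) : f =1 g -> f = g.
Proof.
case: f g => [f hf] [g hg] /= /funext fg; subst g.
by rewrite (Prop_irrelevance hf hg).
Qed.

HB.instance Definition _ := gen_eqMixin bop.
HB.instance Definition _ := gen_choiceMixin bop.

Implicit Types (f g h : bop) (x y : V) (a : R[i]).

Lemma bop_lin f a x y : f (a *: x + y) = a *: f x + f y.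
Proof. exact: (bopP f).1. Qed.
Lemma bop0 f : f 0 = 0.
Proof. by have := bop_lin f (-1) 0 0; rewrite scaleN1r addNr scaleN1r addNr. Qed.
Lemma bopZ f a x : f (a *: x) = a *: f x.
Proof. by rewrite -[a *: x]addr0 bop_lin bop0 addr0. Qed.
Lemma bopD f x y : f (x + y) = f x + f y.
Proof. by rewrite -{1}[x]scale1r bop_lin scale1r. Qed.
Lemma bopN f x : f (- x) = - f x.
Proof. by rewrite -scaleN1r bopZ scaleN1r. Qed.
Lemma bopB f x y : f (x - y) = f x - f y.
Proof. by rewrite bopD bopN. Qed.
Lemma bop_sum f (I : Type) (s : seq I) (P : pred I) (F : I -> V) :
  f (\sum_(i <- s | P i) F i) = \sum_(i <- s | P i) f (F i).
Proof. by elim/big_rec2: _ => [|i x y _ <-]; rewrite ?bop0 ?bopD. Qed.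

Lemma bop_nneg f : exists2 C : R, 0 <= C & forall x, nm (f x) <= C * nm x.
Proof.
have [C hC] := (bopP f).2; exists `|C| => // x; apply: le_trans (hC x) _.
by rewrite ler_wpM2r ?nm_ge0 ?ler_norm.
Qed.

Fact add_bopP f g : is_bop (fun x => f x + g x).
Proof.
split=> [a x y|]; first by rewrite !bop_lin scalerDr addrACA.
have [C _ hC] := bop_nneg f; have [D _ hD] := bop_nneg g; exists (C + D) => x.
by rewrite mulrDl; apply: le_trans (nmD _ _) (lerD _ _).
Qed.
Fact opp_bopP f : is_bop (fun x => - f x).
Proof.
split=> [a x y|]; first by rewrite bop_lin opprD scalerN.
by have [C _ hC] := bop_nneg f; exists C => x; rewrite nmN.
Qed.
Fact scale_bopP a f : is_bop (fun x => a *: f x).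
Proof.
split=> [b x y|]; first by rewrite bop_lin scalerDr !scalerA mulrC.
have [C _ hC] := bop_nneg f; exists (cabs a * C) => x.
by rewrite nmZ -mulrA ler_wpM2l ?cabs_ge0.
Qed.
Fact zero_bopP : is_bop (fun=> 0).
Proof.
split=> [b x y|]; first by rewrite scaler0 addr0.
by exists 0 => x; rewrite nm0 mul0r.
Qed.
Fact one_bopP : is_bop id.
Proof. by split=> //; exists 1 => x; rewrite mul1r. Qed.
Fact mul_bopP f g : is_bop (fun x => f (g x)).
Proof.
split=> [b x y|]; first by rewrite !bop_lin.
have [C C0 hC] := bop_nneg f; have [D _ hD] := bop_nneg g; exists (C * D) => x.
by apply: le_trans (hC _) _; rewrite -mulrA ler_wpM2l.
Qed.

Definition add_bop f g := Bop (add_bopP f g).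
Definition opp_bop f := Bop (opp_bopP f).
Definition scale_bop a f := Bop (scale_bopP a f).
Definition zero_bop := Bop zero_bopP.
Definition one_bop := Bop one_bopP.
Definition mul_bop f g := Bop (mul_bopP f g).

Fact add_bopA : associative add_bop.
Proof. by move=> f g h; apply: bop_ext => x /=; rewrite addrA. Qed.
Fact add_bopC : commutative add_bop.
Proof. by move=> f g; apply: bop_ext => x /=; rewrite addrC. Qed.
Fact add0_bop : left_id zero_bop add_bop.
Proof. by move=> f; apply: bop_ext => x /=; rewrite add0r. Qed.
Fact addN_bop : left_inverse zero_bop opp_bop add_bop.
Proof. by move=> f; apply: bop_ext => x /=; rewrite addNr. Qed.
HB.instance Definition _ := GRing.isZmodule.Build bop add_bopA add_bopC add0_bop addN_bop.

Fact mul_bopA : associative mul_bop. Proof. by move=> f g h; apply: bop_ext. Qed.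
Fact mul1_bop : left_id one_bop mul_bop. Proof. by move=> f; apply: bop_ext. Qed.
Fact mul_bop1 : right_id one_bop mul_bop. Proof. by move=> f; apply: bop_ext. Qed.
Fact mul_bopDl : left_distributive mul_bop +%R. Proof. by move=> f g h; apply: bop_ext. Qed.
Fact mul_bopDr : right_distributive mul_bop +%R.
Proof. by move=> f g h; apply: bop_ext => x /=; rewrite bopD. Qed.
HB.instance Definition _ := GRing.Zmodule_isPzRing.Build bop
  mul_bopA mul1_bop mul_bop1 mul_bopDl mul_bopDr.

Fact scale_bopA a b f : scale_bop a (scale_bop b f) = scale_bop (a * b) f.
Proof. by apply: bop_ext => x /=; rewrite scalerA. Qed.
Fact scale1_bop : left_id 1 scale_bop.
Proof. by move=> f; apply: bop_ext => x /=; rewrite scale1r. Qed.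
Fact scale_bopDr : right_distributive scale_bop +%R.
Proof. by move=> a f g; apply: bop_ext => x /=; rewrite scalerDr. Qed.
Fact scale_bopDl f : {morph scale_bop^~ f : a b / a + b}.
Proof. by move=> a b; apply: bop_ext => x /=; rewrite scalerDl. Qed.
HB.instance Definition _ := GRing.Zmodule_isLmodule.Build R[i] bop
  scale_bopA scale1_bop scale_bopDr scale_bopDl.

Lemma bop_addE f g x : (f + g) x = f x + g x. Proof. by []. Qed.

Lemma bop_subE f g x : (f - g) x = f x - g x. Proof. by []. Qed.
Lemma bop_scaleE a f x : (a *: f) x = a *: f x. Proof. by []. Qed.
Lemma bop_mulE f g x : (f * g) x = f (g x). Proof. by []. Qed.
Lemma bop_1E x : (1 : bop) x = x. Proof. by []. Qed.
Lemma bop_0E x : (0 : bop) x = 0. Proof. by []. Qed.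
Lemma bop_sumE (I : Type) (s : seq I) (P : pred I) (F : I -> bop) x :
  (\sum_(i <- s | P i) F i) x = \sum_(i <- s | P i) F i x.
Proof. by elim/big_rec2: _ => [//|i u f _ <-]. Qed.
Lemma bscalAl a f g : (a *: f) * g = a *: (f * g). Proof. exact: bop_ext. Qed.
Lemma bscalAr a f g : f * (a *: g) = a *: (f * g).
Proof. by apply: bop_ext => x; rewrite /= bopZ. Qed.

Definition opn f : R := inf [set C : R | 0 <= C /\ forall x, nm (f x) <= C * nm x].

Let opn_inf f : has_inf [set C : R | 0 <= C /\ forall x, nm (f x) <= C * nm x].
Proof.
split; first by have [C C0 hC] := bop_nneg f; exists C.
by exists 0 => C [].
Qed.

Lemma opn_ge0 f : 0 <= opn f.
Proof. by apply: lb_le_inf; [exact: (opn_inf f).1 | move=> C []]. Qed.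

Lemma opn_le f (C : R) : 0 <= C -> (forall x, nm (f x) <= C * nm x) -> opn f <= C.
Proof. by move=> C0 hC; apply: ge_inf => //; exact: (opn_inf f).2. Qed.

Lemma opnP f x : nm (f x) <= opn f * nm x.
Proof.
have [->|x0] := eqVneq x 0; first by rewrite bop0 nm0 mulr0.
rewrite -ler_pdivrMr ?nm_gt0 //; apply: lb_le_inf; first exact: (opn_inf f).1.
by move=> C [C0 hC]; rewrite ler_pdivrMr ?nm_gt0.
Qed.

Lemma opn_eq0 f : opn f = 0 -> f = 0.
Proof.
move=> f0; apply: bop_ext => x; apply: nm_eq0; apply/eqP.
by rewrite eq_le nm_ge0 andbT; apply: le_trans (opnP f x) _; rewrite f0 mul0r.
Qed.

Lemma opnD f g : opn (f + g) <= opn f + opn g.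
Proof.
apply: opn_le => [|x]; first by rewrite addr_ge0 ?opn_ge0.
by rewrite mulrDl; apply: le_trans (nmD _ _) (lerD _ _); apply: opnP.
Qed.

Lemma opnZ_le a f : opn (a *: f) <= cabs a * opn f.
Proof.
apply: opn_le => [|x]; first by rewrite mulr_ge0 ?opn_ge0 ?cabs_ge0.
by rewrite /= nmZ -mulrA ler_wpM2l ?cabs_ge0 // opnP.
Qed.

Lemma opnZ a f : opn (a *: f) = cabs a * opn f.
Proof.
apply/eqP; rewrite eq_le opnZ_le /=.
have [->|a0] := eqVneq a 0; first by rewrite cabs0 mul0r opn_ge0.
have := opnZ_le a^-1 (a *: f); rewrite scalerA mulVf // scale1r cabsV.
by rewrite mulrC ler_pdivlMr ?cabs_gt0 // mulrC.
Qed.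

Fact bop_complete (u : nat -> bop) :
  (forall e, 0 < e -> exists N, forall m n, (N <= m)%N -> (N <= n)%N ->
       opn (u m - u n) < e) ->
  exists l, forall e, 0 < e -> exists N, forall n, (N <= n)%N -> opn (u n - l) < e.
Proof.
move=> hu.
have hx x : exists l, tends (fun n => u n x) l.
  apply: cauchys_tends => e e0.
  have x1 : 0 < nm x + 1 by rewrite ltr_wpDl ?nm_ge0.
  have [N hN] := hu _ (divr_gt0 e0 x1); exists N => m n hm hn.
  apply: le_lt_trans (opnP (u m - u n) x) _.
  have := hN _ _ hm hn; rewrite ltr_pdivlMr // mulrDr mulr1; apply: le_lt_trans.
  by rewrite lerDl opn_ge0.
pose l x := sval (cid (hx x)).
have lP x : tends (fun n => u n x) (l x) by rewrite /l; case: cid.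
have [N1 hN1] := hu 1 ltr01.
have lb : is_bop l.
  split=> [a x y|].
    apply: tends_uniq (lP _) _; apply: tends_eq (tendsD (tendsZ a (lP x)) (lP y)) => n.
    by rewrite bop_lin.
  exists (opn (u N1) + 1) => x; apply: (tends_nm_le (N := N1) (lP x)) => n hn.
  apply: le_trans (opnP _ _) _; rewrite ler_wpM2r ?nm_ge0 //.
  have := hN1 _ _ hn (leqnn N1); have := opnD (u n - u N1) (u N1); rewrite subrK; lra.
exists (Bop lb) => e e0; have [N hN] := hu _ (half_gt0 e0).
exists N => n hn; apply: (@le_lt_trans _ _ (e / 2)); last lra.
apply: opn_le => [|x]; first lra.
rewrite bop_subE /= nmC; apply: (tends_nm_leB (N := N) (lP x)) => m hm.
rewrite -bop_subE; apply: le_trans (opnP _ _) _; rewrite ler_wpM2r ?nm_ge0 //.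
by apply: ltW; apply: hN.
Qed.

HB.instance Definition _ := isBanach.Build R bop opn_eq0 opnD opnZ bop_complete.

Lemma nm_bopP f x : nm (f x) <= nm f * nm x. Proof. exact: opnP. Qed.

Lemma nm_bop_le f (C : R) : 0 <= C -> (forall x, nm (f x) <= C * nm x) -> nm f <= C.
Proof. exact: opn_le. Qed.

Lemma nmM f g : nm (f * g) <= nm f * nm g.
Proof.
apply: nm_bop_le => [|x]; first by rewrite mulr_ge0 ?nm_ge0.
apply: le_trans (nm_bopP f (g x)) _; rewrite -mulrA ler_wpM2l ?nm_ge0 //.
exact: nm_bopP.
Qed.

(** Only an inequality: on the zero space the identity has norm 0. *)
Lemma nm1_le : nm (1 : bop) <= 1.
Proof. by apply: nm_bop_le => // x; rewrite mul1r. Qed.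

Lemma nmX f n : nm (f ^+ n) <= nm f ^+ n.
Proof.
elim: n => [|n IH]; first by rewrite !expr0 nm1_le.
by rewrite !exprS; apply: le_trans (nmM _ _) _; rewrite ler_wpM2l ?nm_ge0.
Qed.

Lemma bop_tends f u l : tends u l -> tends (fun n => f (u n)) (f l).
Proof.
move=> h e e0; have c1 : 0 < nm f + 1 by rewrite ltr_wpDl ?nm_ge0.
have [N hN] := h _ (divr_gt0 e0 c1); exists N => n /hN.
rewrite -bopB ltr_pdivlMr // mulrDr mulr1 mulrC => h1.
by apply: le_lt_trans (nm_bopP _ _) _; have := nm_ge0 (u n - l); lra.
Qed.

Lemma tends_bopE (u : nat -> bop) l x : tends u l -> tends (fun n => u n x) (l x).
Proof.
move=> h e e0; have c1 : 0 < nm x + 1 by rewrite ltr_wpDl ?nm_ge0.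
have [N hN] := h _ (divr_gt0 e0 c1); exists N => n /hN.
rewrite -bop_subE ltr_pdivlMr // mulrDr mulr1 => h1.
by apply: le_lt_trans (nm_bopP _ _) _; have := nm_ge0 (u n - l); lra.
Qed.

End Bop.

(** * Inverses, Neumann series and perturbation *)

Section Inverses.
Context {R : realType} {V : banType R}.
Implicit Types (f g h T S : bop V) (z : R[i]).

Lemma tendsMl f (u : nat -> bop V) l : tends u l -> tends (fun n => f * u n) (f * l).
Proof.
move=> h e e0; have c1 : 0 < nm f + 1 by rewrite ltr_wpDl ?nm_ge0.
have [N hN] := h _ (divr_gt0 e0 c1); exists N => n /hN.
rewrite -mulrBr ltr_pdivlMr // mulrDr mulr1 mulrC => h1.
by apply: le_lt_trans (nmM f (u n - l)) _; have := nm_ge0 (u n - l); lra.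
Qed.

Lemma tendsMr f (u : nat -> bop V) l : tends u l -> tends (fun n => u n * f) (l * f).
Proof.
move=> h e e0; have c1 : 0 < nm f + 1 by rewrite ltr_wpDl ?nm_ge0.
have [N hN] := h _ (divr_gt0 e0 c1); exists N => n /hN.
rewrite -mulrBl ltr_pdivlMr // mulrDr mulr1 => h1.
by apply: le_lt_trans (nmM (u n - l) f) _; have := nm_ge0 (u n - l); lra.
Qed.

Lemma tendsM (u v : nat -> bop V) l l' : tends u l -> tends v l' ->
  tends (fun n => u n * v n) (l * l').
Proof.
move=> hu hv e e0.
have [N1 hN1] := hu 1 ltr01.
have hb n : (N1 <= n)%N -> nm (u n) <= nm l + 1.
  by move=> /hN1 /ltW; have := nmBD (u n) l; lra.
have c1 : 0 < nm l + 1 by rewrite ltr_wpDl ?nm_ge0.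
have [N2 hN2] := hv _ (divr_gt0 (half_gt0 e0) c1).
have [N3 hN3] := @tendsMr l' _ _ hu _ (half_gt0 e0).
exists (maxn N1 (maxn N2 N3)) => n; rewrite !geq_max => /and3P[h1 h2 h3].
apply: le_lt_trans (nm_tri (u n * l') _ _) _; rewrite -mulrBr.
have := hN3 _ h3; have := nmM (u n) (v n - l'); have := hN2 _ h2.
rewrite ltr_pdivlMr // mulrC => h4.
have : nm (u n) * nm (v n - l') <= (nm l + 1) * nm (v n - l').
  by rewrite ler_wpM2r ?nm_ge0 // hb.
lra.
Qed.

Definition inv_of f g := f * g = 1 /\ g * f = 1.
Definition invb f := exists g, inv_of f g.

Lemma inv_of_uniq f g h : inv_of f g -> inv_of f h -> g = h.
Proof. by move=> [fg gf] [fh hf]; rewrite -[g]mulr1 -fh mulrA gf mul1r. Qed.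

Lemma inv_of_comm f g h : inv_of f g -> GRing.comm h f -> GRing.comm h g.
Proof.
move=> [fg gf] hf; rewrite /GRing.comm -[LHS]mul1r -gf -mulrA (mulrA f) -hf.
by rewrite -(mulrA h) fg mulr1.
Qed.

Lemma inv_ofM f g f' g' : inv_of f g -> inv_of f' g' -> inv_of (f * f') (g' * g).
Proof.
move=> [fg gf] [fg' gf']; split; first by rewrite mulrA -(mulrA f) fg' mulr1.
by rewrite mulrA -(mulrA g') gf mulr1.
Qed.

Lemma inv_ofZ f g z : z != 0 -> inv_of f g -> inv_of (z *: f) (z^-1 *: g).
Proof.
by move=> z0 [fg gf]; split; rewrite bscalAl bscalAr scalerA ?mulfV ?mulVf // scale1r.
Qed.

Lemma comm_1subX T n : (1 - T) * (\sum_(i < n) T ^+ i) = 1 - T ^+ n.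
Proof. by rewrite -[1 - T]opprB mulNr -subrX1 opprB. Qed.

Lemma comm_sumX T n : GRing.comm T (\sum_(i < n) T ^+ i).
Proof. by apply: commr_sum => i _; apply: commrX. Qed.

(** The powers are bounded and not the norm of [T], so that the series also applies when only the
    spectral radius is below 1. *)
Lemma neumann T (C t : R) : 0 <= t -> t < 1 ->
  (forall n, nm (T ^+ n) <= C * t ^+ n) ->
  exists2 S, inv_of (1 - T) S & nm S <= C / (1 - t).
Proof.
move=> t0 t1 hT.
have [|S hS hS'] := @geo_tends _ _ (fun n => \sum_(i < n) T ^+ i) C t t0 t1.
  by move=> n; rewrite big_ord_recr /= addrAC subrr add0r.
have hT0 : tends (fun n => 1 - T ^+ n) (1 : bop V).
  apply: (@tends_squeeze _ _ (fun n => C * t ^+ n)) => [e e0|n]; first exact: geo_small.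
  by rewrite addrAC subrr add0r nmN.
exists S; last by have := hS' 0%N; rewrite big_ord0 sub0r nmN expr0 mulr1.
split; apply: (tends_uniq _ hT0).
  by apply: tends_eq (tendsMl _ hS) => n; rewrite comm_1subX.
apply: tends_eq (tendsMr _ hS) => n; rewrite -comm_1subX.
by rewrite mulrBr mulrBl mulr1 mul1r comm_sumX.
Qed.

Lemma neumann1 T (t : R) : t < 1 -> nm T <= t ->
  exists2 S, inv_of (1 - T) S & nm S <= (1 - t)^-1.
Proof.
move=> t1 hT; have t0 := le_trans (nm_ge0 T) hT.
have [|S] := @neumann T 1 t t0 t1; last by rewrite mul1r; exists S.
by move=> n; rewrite mul1r; apply: le_trans (nmX _ _) _; rewrite lerXn2r ?nnegrE ?nm_ge0.
Qed.

(** [f' = f (1 - g (f - f'))], and a Neumann series of ratio one half inverts the second factor. *)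
Lemma inv_pert f g f' (C : R) : inv_of f g -> nm g <= C -> C * nm (f' - f) <= 2^-1 ->
  exists g', [/\ inv_of f' g', nm g' <= 2 * C & nm (g' - g) <= 2 * C * C * nm (f' - f)].
Proof.
move=> fg gC h; have C0 := le_trans (nm_ge0 g) gC.
have [|S [S1 S2] hS] := @neumann1 (g * (f - f')) 2^-1 ltac:(lra).
  apply: le_trans (nmM _ _) _; apply: le_trans h; rewrite nmC.
  by rewrite ler_wpM2r ?nm_ge0.
have hS2 : nm S <= 2 by move: hS; rewrite (_ : 1 - 2^-1 = 2^-1) ?invrK //; lra.
have ef : f' = f * (1 - g * (f - f')).
  by rewrite mulrBr mulr1 mulrA fg.1 mul1r opprB addrCA subrr addr0.
have g'P : inv_of f' (S * g) by rewrite ef; apply: inv_ofM.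
have ng' : nm (S * g) <= 2 * C.
  by apply: le_trans (nmM _ _) _; rewrite ler_pM ?nm_ge0.
exists (S * g); split => //.
have -> : S * g - g = S * g * (f - f') * g.
  by rewrite mulrBr g'P.2 mulrBl mul1r -!mulrA fg.1 mulr1.
apply: le_trans (nmM _ _) _; rewrite [leRHS]mulrAC ler_pM ?nm_ge0 //.
by apply: le_trans (nmM _ _) _; rewrite nmC ler_wpM2r ?nm_ge0.
Qed.

(** The lower bound for [f] bounds the inverse of a nearby [u N] by [2 / c], so [f] lies in the ball
    of perturbations of [u N] that remain invertible. *)
Lemma inv_lim (u : nat -> bop V) f (c : R) : 0 < c -> (forall x, c * nm x <= nm (f x)) ->
  tends u f -> (forall n, invb (u n)) -> invb f.
Proof.
move=> c0 hc hu iu.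
have [N hN] := hu (c / 4) ltac:(lra).
have [g ug] := iu N; have hN' := hN N (leqnn N).
have ng : nm g <= 2 / c.
  apply: nm_bop_le => [|x]; first by rewrite divr_ge0 // ltW.
  have h1 := hc (g x); have h2 := nm_bopP (u N - f) (g x).
  have h3 : u N (g x) = x by rewrite -bop_mulE ug.1.
  have h4 : nm (f (g x)) <= nm x + c / 4 * nm (g x).
    have -> : f (g x) = x - (u N - f) (g x) by rewrite bop_subE h3 opprB addrC subrK.
    apply: le_trans (nmB _ _) _; rewrite lerD2l; apply: le_trans h2 _.
    by rewrite ler_wpM2r ?nm_ge0 // ltW.
  rewrite -(ler_pM2l c0) [leRHS](_ : _ = 2 * nm x); last by field; rewrite gt_eqF.
  by have := nm_ge0 (g x); have := nm_ge0 x; nra.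
have [|g' [fg' _ _]] := @inv_pert _ _ f _ ug ng; last by exists g'.
rewrite nmC mulrAC ler_pdivrMr //; lra.
Qed.

End Inverses.

(** * Growth rates of powers and quasinilpotence *)

Section Growth.
Context {R : realType} {V : banType R}.
Implicit Types (f g h T S : bop V) (z : R[i]) (r : R).

Definition grow T r := exists2 C : R, 0 <= C & forall n, nm (T ^+ n) <= C * r ^+ n.
(* Spectral radius zero, see [qn_spec]. *)
Definition qn T := forall r, 0 < r -> grow T r.

Lemma grow_nm T : grow T (nm T).
Proof. by exists 1 => // n; rewrite mul1r nmX. Qed.

Lemma grow_le T r r' : 0 <= r -> r <= r' -> grow T r -> grow T r'.
Proof.
move=> r0 rr [C C0 hC]; exists C => // n; apply: le_trans (hC n) _.
by rewrite ler_wpM2l // lerXn2r ?nnegrE // (le_trans r0).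
Qed.

Lemma bexprZ z T n : (z *: T) ^+ n = z ^+ n *: T ^+ n.
Proof.
elim: n => [|n IH]; first by rewrite !expr0 scale1r.
by rewrite !exprS IH bscalAl bscalAr scalerA.
Qed.

Lemma growZ z T r : grow T r -> grow (z *: T) (cabs z * r).
Proof.
move=> [C C0 hC]; exists C => // n; rewrite bexprZ nmZ cabsX exprMn mulrCA.
by rewrite ler_wpM2l ?exprn_ge0 ?cabs_ge0.
Qed.

Lemma grow_invb T r z : 0 <= r -> grow T r -> r < cabs z -> invb (z *: (1 : bop V) - T).
Proof.
move=> r0 hT rz; have z0 : z != 0 by rewrite -cabs_gt0 (le_lt_trans r0).
have [C C0 hC] := growZ z^-1 hT.
have [||S hS _] := @neumann _ _ (z^-1 *: T) C (cabs z^-1 * r) _ _ hC.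
- by rewrite mulr_ge0 ?cabs_ge0.
- by rewrite cabsV mulrC ltr_pdivrMr ?cabs_gt0 // mul1r.
exists (z^-1 *: S); have -> : z *: (1 : bop V) - T = z *: (1 - z^-1 *: T).
  by rewrite scalerBr scalerA mulfV // scale1r.
exact: inv_ofZ.
Qed.

Lemma qn_invb T z : qn T -> z != 0 -> invb (z *: (1 : bop V) - T).
Proof.
rewrite -cabs_gt0 => hT z0; apply: (@grow_invb _ (cabs z / 2)); [lra| |lra].
by apply: hT; lra.
Qed.

Lemma qn_eig T x z : qn T -> z != 0 -> T x = z *: x -> x = 0.
Proof.
move=> hT z0 Tx; have [S [_ hS]] := qn_invb hT z0.
by rewrite -[x]bop_1E -hS bop_mulE bop_subE bop_scaleE bop_1E Tx subrr bop0.
Qed.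

Lemma qnZ T z : qn T -> qn (z *: T).
Proof.
move=> hT r r0; have c1 : 0 < cabs z + 1 by rewrite ltr_wpDl ?cabs_ge0.
have := growZ z (hT _ (divr_gt0 r0 c1)); apply: grow_le.
  by rewrite mulr_ge0 ?cabs_ge0 // ltW // divr_gt0.
by rewrite mulrA ler_pdivrMr // mulrC ler_pM2l // lerDl ler01.
Qed.

(** Binomial expansion compared with [(1 + (r - 1)) ^+ n], using the growth bound of [T] at the rate
    [r - 1]. *)
Lemma qn_grow1D T r : qn T -> 1 < r -> grow (1 + T) r.
Proof.
move=> hT r1; have [C C0 hC] := hT (r - 1) ltac:(lra).
exists C => // n; rewrite addrC exprD1n; apply: le_trans (nm_sum _ _ _) _.
rewrite -[r](subrK 1) exprD1n mulr_sumr; apply: ler_sum => i _.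
rewrite -scaler_nat nmZ cabs_nat -[in leRHS]mulr_natl mulrCA.
by rewrite ler_wpM2l // hC.
Qed.

End Growth.

(** * Totally bounded sets *)

Section TotallyBounded.
Context {R : realType}.
Implicit Types V W : banType R.

Definition tbdd V (A : set V) := forall e : R, 0 < e ->
  exists s : seq V, forall x, A x -> exists2 y, y \in s & nm (x - y) < e.

Lemma tbdd_sub V (A B : set V) : A `<=` B -> tbdd B -> tbdd A.
Proof. by move=> AB h e e0; have [s hs] := h e e0; exists s => x /AB /hs. Qed.

(** A centre whose ball meets [A] is replaced by a point of [A] in that ball, which doubles the
    radius; the other centres are dropped. *)
Lemma tbdd_net V (A : set V) e : tbdd A -> 0 < e ->
  exists s : seq V, (forall y, y \in s -> A y) /\
    forall x, A x -> exists2 y, y \in s & nm (x - y) < e.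
Proof.
move=> h e0; have [s hs] := h _ (half_gt0 e0).
suff [s' [As' hs']] : exists s' : seq V, (forall y, y \in s' -> A y) /\
    forall x, A x -> (exists2 y, y \in s & nm (x - y) < e / 2) ->
      exists2 y, y \in s' & nm (x - y) < e.
  by exists s'; split => // x Ax; apply: hs' => //; apply: hs.
elim: s {hs} => [|y s [s' [As' hs']]]; first by exists [::]; split=> // x _ [].
have [[z [Az zy]]|no] := pselect (exists z, A z /\ nm (z - y) < e / 2).
  exists (z :: s'); split=> [t|x Ax [t]]; first by rewrite inE => /predU1P[->|/As'].
  rewrite inE => /predU1P[->|ts] xt.
    by exists z; rewrite ?mem_head //; have := nm_tri y x z; rewrite (nmC y z); lra.
  by have [t' ? ?] := hs' x Ax (ex_intro2 _ _ t ts xt); exists t'; rewrite // inE orbC; apply/orP; left.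
exists s'; split=> // x Ax [t]; rewrite inE => /predU1P[->|ts] xt.
  by case: no; exists x.
by apply: hs' => //; exists t.
Qed.

Lemma tbdd_bounded V (A : set V) : tbdd A -> exists2 M : R, 0 <= M & forall x, A x -> nm x <= M.
Proof.
move=> h; have [s hs] := h 1 ltr01.
exists (1 + \sum_(y <- s) nm y); first by rewrite addr_ge0 ?sumr_ge0 // => *; exact: nm_ge0.
move=> x /hs[y ys xy]; rewrite (big_rem y ys) /=.
have h0 : 0 <= \sum_(z <- rem y s) nm z by rewrite sumr_ge0 // => *; exact: nm_ge0.
by have := nmD (x - y) y; rewrite subrK; lra.
Qed.

Lemma tbdd_approx V (A : set V) : (forall e : R, 0 < e -> exists B : set V, tbdd B /\
    forall x, A x -> exists2 y, B y & nm (x - y) < e) -> tbdd A.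
Proof.
move=> h e e0; have [B [tB hB]] := h _ (half_gt0 e0).
have [s hs] := tB _ (half_gt0 e0); exists s => x /hB[y /hs[z zs yz] xy].
by exists z => //; have := nm_tri y x z; lra.
Qed.

Lemma tbdd_img V W (f : V -> W) (A : set V) (M : R) :
  (forall x y, nm (f x - f y) <= M * nm (x - y)) -> tbdd A -> tbdd (f @` A).
Proof.
move=> hf tA e e0.
have M1 : 0 < `|M| + 1 by rewrite ltr_wpDl.
have [s hs] := tA _ (divr_gt0 e0 M1).
exists (map f s) => _ [x Ax <-]; have [y ys xy] := hs x Ax.
exists (f y); first exact: map_f.
apply: le_lt_trans (hf _ _) _; move: xy; rewrite ltr_pdivlMr // => xy.
have := ler_norm M; have := nm_ge0 (x - y); nra.
Qed.

Lemma tbddD V (A B : set V) : tbdd A -> tbdd B ->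
  tbdd [set z | exists x y, [/\ A x, B y & z = x + y]].
Proof.
move=> tA tB e e0; have [s hs] := tA _ (half_gt0 e0); have [t ht] := tB _ (half_gt0 e0).
exists [seq x + y | x <- s, y <- t] => _ [x [y [/hs[x' x's xx] /ht[y' y't yy] ->]]].
exists (x' + y'); first exact: allpairs_f.
by rewrite opprD addrACA; apply: le_lt_trans (nmD _ _) _; lra.
Qed.

Lemma tbddU V (A B : set V) : tbdd A -> tbdd B -> tbdd (A `|` B).
Proof.
move=> tA tB e e0; have [s hs] := tA _ e0; have [t ht] := tB _ e0.
exists (s ++ t) => x [/hs|/ht] [y ys xy]; exists y => //.
  by rewrite mem_cat ys.
by rewrite mem_cat ys orbT.
Qed.

Lemma tbdd_seq V (s : seq V) : tbdd [set x | x \in s].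
Proof. by move=> e e0; exists s => x /= xs; exists x; rewrite // subrr nm0. Qed.

Lemma tbdd_bigU V (I : eqType) (s : seq I) (A : I -> set V) :
  (forall i, i \in s -> tbdd (A i)) -> tbdd [set x | exists2 i, i \in s & A i x].
Proof.
elim: s => [_|i s IH h]; first by move=> e _; exists [::] => x [].
apply: tbdd_sub (tbddU (h i (mem_head _ _)) (IH _)) => [x [j]|j js].
  by rewrite inE => /predU1P[->|js] Ax; [left | right; exists j].
by apply: h; rewrite inE js orbT.
Qed.

Definition infn (P : nat -> Prop) := forall N, exists2 n, (N <= n)%N & P n.

Lemma infn_pigeon (T : eqType) (s : seq T) (P : nat -> Prop) (Q : T -> nat -> Prop) :
  infn P -> (forall n, P n -> exists2 y, y \in s & Q y n) ->
  exists2 y, y \in s & infn (fun n => P n /\ Q y n).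
Proof.
elim: s P => [|y s IH] P iP h; first by have [n _ /h[]] := iP 0%N.
have [iy|niy] := pselect (infn (fun n => P n /\ Q y n)).
  by exists y; rewrite ?mem_head.
move/existsNP: niy => [N hN].
have hN' n : (N <= n)%N -> P n -> ~ Q y n by move=> Nn Pn Qn; apply: hN; exists n.
have [||z zs iz] := IH (fun n => P n /\ (N <= n)%N).
- move=> M; have [n] := iP (maxn M N); rewrite geq_max => /andP[Mn Nn] Pn.
  by exists n.
- move=> n [Pn Nn]; have [z] := h n Pn; rewrite inE => /predU1P[->|zs] Qz.
    by case: (hN' n Nn Pn).
  by exists z.
exists z; first by rewrite inE zs orbT.
by move=> M; have [n Mn [[Pn _] Qn]] := iz M; exists n.
Qed.

(** Diagonal argument: the infinite index sets [F k] decrease, on [F k.+1] the sequence stays in a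
    ball of radius [2^-1 ^+ k], and [p k] is picked in [F k.+1] beyond the earlier choices. *)
Lemma tbdd_subseq V (u : nat -> V) : tbdd (range u) ->
  exists2 p : nat -> nat, (forall n, (p n < p n.+1)%N) & cauchys (fun n => u (p n)).
Proof.
move=> tu.
have step (k : nat) (P : {P : nat -> Prop | infn P}) :
    exists P' : {P : nat -> Prop | infn P}, (forall n, sval P' n -> sval P n) /\
      exists y, forall n, sval P' n -> nm (u n - y) < 2^-1 ^+ k.
  case: P => P iP /=.
  have [s hs] := tu (2^-1 ^+ k) ltac:(by rewrite exprn_gt0 // invr_gt0).
  have [|y ys iy] := @infn_pigeon _ s P (fun y n => nm (u n - y) < 2^-1 ^+ k) iP.
    by move=> n _; apply: hs; exists n.
  by exists (exist _ _ iy) => /=; split=> [n []//|]; exists y => n [].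
have inf0 : infn (fun=> True) by move=> N; exists N.
pose F := fix F k := if k is k'.+1 then sval (cid (step k' (F k')))
  else exist _ _ inf0 : {P : nat -> Prop | infn P}.
have FP k : (forall n, sval (F k.+1) n -> sval (F k) n) /\
   exists y, forall n, sval (F k.+1) n -> nm (u n - y) < 2^-1 ^+ k.
  by rewrite /=; case: (cid (step k (F k))).
have pick k N : exists n, (N <= n)%N /\ sval (F k) n.
  by have [n Nn Fn] := svalP (F k) N; exists n.
pose p := fix p k := sval (cid (pick k.+1 (if k is k'.+1 then (p k').+1 else 0%N))).
have pP k : ((if k is k'.+1 then (p k').+1 else 0%N) <= p k)%N /\ sval (F k.+1) (p k).
  by case: k => [|k]; [exact: svalP (cid (pick 1%N 0%N)) | exact: svalP (cid (pick k.+2 (p k).+1))].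
have pF k : sval (F k.+1) (p k) by have [] := pP k.
have pS k : (p k < p k.+1)%N by have [] := pP k.+1.
exists p => // e e0.
have [N hN] := @geo_small R 1 2^-1 _ ltac:(lra) ltac:(lra) (half_gt0 e0).
have Fm k m : (k <= m)%N -> forall n, sval (F m) n -> sval (F k) n.
  elim: m => [|m IH]; first by rewrite leqn0 => /eqP->.
  rewrite leq_eqVlt => /predU1P[-> //|km] n /(FP m).1; exact: IH.
have [_ [y hy]] := FP N; exists N => m n Nm Nn.
have h1 := hy _ (Fm N.+1 m.+1 Nm _ (pF m)).
have h2 := hy _ (Fm N.+1 n.+1 Nn _ (pF n)).
have := hN N (leqnn N); rewrite mul1r => h3.
by have := nm_tri y (u (p m)) (u (p n)); rewrite (nmC y (u (p n))); lra.
Qed.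

Lemma incr_geq (p : nat -> nat) : (forall n, (p n < p n.+1)%N) -> forall n, (n <= p n)%N.
Proof. by move=> hp; elim=> // n IH; apply: leq_ltn_trans IH (hp n). Qed.

Lemma tbdd_cvg V (u : nat -> V) : tbdd (range u) ->
  exists2 p : nat -> nat, (forall n, (n <= p n)%N) & exists l, tends (fun n => u (p n)) l.
Proof.
move=> /tbdd_subseq[p hp /cauchys_tends hl]; exists p => //; exact: incr_geq.
Qed.

End TotallyBounded.

(** * The complex numbers as a Banach space, and dyadic roots of unity *)

Section ComplexBanach.
Context {R : realType}.

Fact complex_complete (u : nat -> R[i]) :
  (forall e, 0 < e -> exists N, forall m n, (N <= m)%N -> (N <= n)%N ->
     cabs (u m - u n) < e) ->
  exists l, forall e, 0 < e -> exists N, forall n, (N <= n)%N -> cabs (u n - l) < e.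
Proof.
move=> hu.
have real_complete (v : nat -> R) :
    (forall e, 0 < e -> exists N, forall m n, (N <= m)%N -> (N <= n)%N -> `|v m - v n| < e) ->
    exists l, forall e, 0 < e -> exists N, forall n, (N <= n)%N -> `|v n - l| < e.
  move=> hv.
  have /cauchy_cvg /cvg_ex [l /cvgrPdist_lt hl] : cauchy (v @ \oo).
    apply/cauchy_exP => e e0; have [N hN] := hv e e0.
    by exists (v N); exists N => // n Nn; apply: hN.
  exists l => e e0; have [N _ hN] := hl e e0.
  by exists N => n Nn; rewrite distrC; apply: hN.
have [|x hx] := real_complete (fun n => complex.Re (u n)).
  move=> e /hu[N hN]; exists N => m n Nm Nn; apply: le_lt_trans (hN m n Nm Nn).
  by rewrite -raddfB cabs_Re.
have [|y hy] := real_complete (fun n => complex.Im (u n)).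
  move=> e /hu[N hN]; exists N => m n Nm Nn; apply: le_lt_trans (hN m n Nm Nn).
  by rewrite -raddfB -ler_sqr ?nnegrE ?cabs_ge0 // cabs_sqr real_normK ?num_real // lerDr sqr_ge0.
exists (x +i* y)%C => e e0.
have [N hN] := hx _ (half_gt0 e0); have [M hM] := hy _ (half_gt0 e0).
exists (maxn N M) => n; rewrite geq_max => /andP[/hN h1 /hM h2].
by apply: le_lt_trans (cabs_le_ReIm _) _; rewrite !raddfB /=; lra.
Qed.

Fact complex_nm_eq0 (z : R[i]^o) : cabs z = 0 -> z = 0.
Proof. by move/eqP; rewrite cabs_eq0 => /eqP. Qed.

HB.instance Definition _ := isBanach.Build R R[i]^o complex_nm_eq0 (@cabsD R)
  (@cabsM R) complex_complete.

Lemma nm_complexE (z : R[i]^o) : nm z = cabs z. Proof. by []. Qed.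

Lemma tbdd_disc (M : R) : tbdd [set z : R[i]^o | cabs z <= M].
Proof.
move=> e e0; pose d := e / 4; have d0 : 0 < d by rewrite /d; lra.
pose K := Num.truncn (`|M| / d + 2).
pose g (i : nat) : R := (i%:R - (K.+1)%:R) * d.
have grid (x : R) : `|x| <= `|M| -> exists2 i, (i < (K.+1).*2)%N & `|x - g i| <= d.
  move=> xM; pose y := x / d + (K.+1)%:R.
  have K1 : `|M| / d + 2 < (K.+1)%:R by exact: truncnS_gt.
  have xd : `|x / d| <= `|M| / d by rewrite normrM [`|d^-1|]gtr0_norm ?invr_gt0 // ler_pM2r ?invr_gt0.
  have y0 : 0 <= y by rewrite /y; have := ler_norm (- (x / d)); rewrite normrN; lra.
  have /andP[h1 h2] := truncn_itv y0.
  exists (Num.truncn y).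
    rewrite -(ltr_nat R); apply: le_lt_trans h1 _.
    rewrite -addnn natrD /y; have := ler_norm (x / d); lra.
  have -> : x - g (Num.truncn y) = (y - (Num.truncn y)%:R) * d.
    by rewrite /g /y; field; rewrite gt_eqF.
  rewrite normrM [`|d|]gtr0_norm // ler_piMl ?(ltW d0) // ger0_norm ?subr_ge0 //.
  by move: h2; rewrite -natr1; lra.
pose ps := [seq (i, j) | i <- iota 0 (K.+1).*2, j <- iota 0 (K.+1).*2].
exists [seq ((g p.1 +i* g p.2)%C : R[i]^o) | p <- ps].
move=> z zM; have {}zM : cabs z <= M := zM.
have zM' := le_trans zM (ler_norm M).
have [i iK hi] := grid _ (le_trans (cabs_Re z) zM').
have Imz : `|complex.Im z| <= cabs z.
  by rewrite -ler_sqr ?nnegrE ?cabs_ge0 // cabs_sqr real_normK ?num_real // lerDr sqr_ge0.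
have [j jK hj] := grid _ (le_trans Imz zM').
exists (g i +i* g j)%C.
  apply/mapP; exists (i, j) => //.
  by apply/allpairsP; exists (i, j); rewrite !mem_iota !add0n.
rewrite nm_complexE; apply: le_lt_trans (cabs_le_ReIm _) _; rewrite !raddfB /=.
by move: hi hj; rewrite /d; lra.
Qed.

(* [rt n] is a primitive [2 ^ n.+1]-th root of unity; choosing square roots of
   nonnegative real part makes [rt n] tend to 1 geometrically. *)
Fact sqrt_Re_ge0 (z : R[i]) : exists w, w ^+ 2 = z /\ 0 <= complex.Re w.
Proof.
have [h|h] := lerP 0 (complex.Re (sqrtC z)).
  by exists (sqrtC z); rewrite sqrtCK.
by exists (- sqrtC z); rewrite sqrrN sqrtCK raddfN oppr_ge0 ltW.
Qed.

Fixpoint rt n : R[i] := if n is n'.+1 then sval (cid (sqrt_Re_ge0 (rt n'))) else -1.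

Lemma rtS n : rt n.+1 ^+ 2 = rt n.
Proof. by rewrite /=; case: cid => w []. Qed.

Lemma rt_Re n : 0 <= complex.Re (rt n.+1).
Proof. by rewrite /=; case: cid => w []. Qed.

Arguments rt : simpl never.

Lemma rtX n : rt n ^+ (2 ^ n) = -1.
Proof. by elim: n => [|n IH]; rewrite ?expr1 // expnS exprM rtS. Qed.

Lemma rt_prim n : (2 ^ n.+1).-primitive_root (rt n).
Proof.
have h : rt n ^+ (2 ^ n.+1) = 1 by rewrite expnSr exprM rtX sqrrN expr1n.
have [m pm] := prim_order_exists (expn_gt0 2 n.+1) h.
case/(dvdn_pfactor _ _ (isT : prime 2)) => k; rewrite leq_eqVlt => /predU1P[->|kn] mE.
  by rewrite -mE.
have : (m %| 2 ^ n)%N by rewrite mE dvdn_exp2l.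
by rewrite (prim_order_dvd pm) rtX eq_sym -subr_eq0 opprK -[1 + 1]/(2%:R) pnatr_eq0.
Qed.

Lemma cabs_rt n : cabs (rt n) = 1.
Proof.
elim: n => [|n IH]; first by rewrite /rt cabsN cabs1.
apply/eqP; rewrite -(@eqrXn2 _ 2) ?cabs_ge0 // -cabsX rtS IH expr1n //.
Qed.

Lemma rt_unit n : rt n ^+ (2 ^ n.+1) = 1.
Proof. exact: prim_expr_order (rt_prim n). Qed.

(** [rt n - 1] factors as [(rt n.+1 - 1) * (rt n.+1 + 1)], and [|w + 1|^2 >= 2 > (4 / 3)^2] for [w]
    of modulus 1 with nonnegative real part. *)
Lemma cabs_rt1 n : cabs (rt n - 1) <= 2 * (3 / 4) ^+ n.
Proof.
elim: n => [|n IH].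
  by rewrite expr0 mulr1 /rt -opprD cabsN -[1 + 1]/(2%:R) cabs_nat.
have h : (rt n.+1 - 1) * (rt n.+1 + 1) = rt n - 1.
  by rewrite -subr_sqr expr1n rtS.
have h2 : 4 / 3 <= cabs (rt n.+1 + 1).
  rewrite -ler_sqr ?nnegrE ?cabs_ge0 //.
  have := cabs_sqr (rt n.+1); rewrite cabs_rt cabs_sqr !raddfD /= addr0 expr1n => e1.
  by have := rt_Re n; move: e1; set x := complex.Re _; set y := complex.Im _; nra.
have := cabs_ge0 (rt n.+1 - 1); move: IH; rewrite -h cabsM exprS.
set a := cabs _; set b := cabs _; set c := _ ^+ n; rewrite -/b in h2 *.
nra.
Qed.

Lemma sum_rt n k : \sum_(j < 2 ^ n.+1) rt n ^+ (j * k) =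
  if (2 ^ n.+1 %| k)%N then (2 ^ n.+1)%:R else 0.
Proof.
case: ifP => [|ndk].
  rewrite (prim_order_dvd (rt_prim n)) => /eqP h.
  under eq_bigr => j _ do rewrite mulnC exprM h expr1n.
  by rewrite big_const_ord iter_addr_0.
under eq_bigr => j _ do rewrite mulnC exprM.
have h1 : rt n ^+ k - 1 != 0 by rewrite subr_eq0 -(prim_order_dvd (rt_prim n)) ndk.
by apply: (mulfI h1); rewrite -subrX1 -exprM mulnC exprM rt_unit expr1n subrr mulr0.
Qed.

End ComplexBanach.

(** * Averages over dyadic roots of unity *)

Section Averages.
Context {R : realType} {V : banType R}.
Implicit Types (F : R[i] -> V).

Definition avg n F : V := (2 ^ n.+1)%:R^-1 *: \sum_(j < 2 ^ n.+1) F (rt n ^+ j).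

Lemma cabs_rtX n j : cabs (rt n ^+ j : R[i]) = 1.
Proof. by rewrite cabsX cabs_rt expr1n. Qed.

Lemma avg_nm n F (C : R) : (forall u, cabs u = 1 -> nm (F u) <= C) -> nm (avg n F) <= C.
Proof.
move=> hF; rewrite nmZ cabsV cabs_nat mulrC ler_pdivrMr ?ltr0n ?expn_gt0 //.
apply: le_trans (nm_sum _ _ _) _; rewrite mulr_natr -[X in _ *+ X]card_ord -sumr_const.
by apply: ler_sum => j _; apply: hF; exact: cabs_rtX.
Qed.

Lemma avgB n F G : avg n F - avg n G = avg n (fun u => F u - G u).
Proof. by rewrite -scalerBr -sumrB. Qed.

Lemma eq_avg n F G : (forall u, cabs u = 1 -> u ^+ (2 ^ n.+1) = 1 -> F u = G u) ->
  avg n F = avg n G.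
Proof.
move=> h; congr (_ *: _); apply: eq_bigr => j _; apply: h; first exact: cabs_rtX.
by rewrite -exprM mulnC exprM rt_unit expr1n.
Qed.

Lemma big_ord_double n (f : nat -> V) :
  \sum_(j < n.*2) f j = \sum_(i < n) (f i.*2 + f i.*2.+1).
Proof.
elim: n => [|n IH]; first by rewrite !big_ord0.
by rewrite doubleS !big_ord_recr /= IH addrA.
Qed.

(** Doubling the number of points keeps the old ones and gives each a new neighbour at distance
    [|rt n.+1 - 1|], so consecutive averages differ by a geometric term. This takes the place of
    integration over the circle. *)
Lemma avg_cvg F (L : R) : 0 <= L ->
  (forall u v, cabs u = 1 -> cabs v = 1 -> nm (F u - F v) <= L * cabs (u - v)) ->
  exists A, tends (fun n => avg n F) A.
Proof.
move=> L0 hF.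
suff h n : nm (avg n.+1 F - avg n F) <= 2 * L * (3 / 4) ^+ n.
  by have [||A hA _] := geo_tends _ _ h; [lra|lra|exists A].
rewrite /avg; set N := (2 ^ n.+1)%N.
have -> : \sum_(j < 2 ^ n.+2) F (rt n.+1 ^+ j) =
    \sum_(i < N) (F (rt n ^+ i) + F (rt n.+1 ^+ i.*2.+1)).
  rewrite expnS mul2n (big_ord_double N (fun j => F (rt n.+1 ^+ j))).
  by apply: eq_bigr => i _; rewrite -mul2n exprM rtS.
have -> : \sum_(j < N) F (rt n ^+ j) =
    2^-1 *: \sum_(i < N) (F (rt n ^+ i) + F (rt n ^+ i)).
  rewrite scaler_sumr; apply: eq_bigr => i _.
  by rewrite -mulr2n -[F _ *+ 2]scaler_nat scalerA mulVf ?scale1r ?pnatr_eq0.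
rewrite scalerA expnS natrM invfM [_^-1 / 2]mulrC -scalerBr -sumrB nmZ.
rewrite -invfM -natrM cabsV cabs_nat mulrC ler_pdivrMr ?ltr0n ?muln_gt0 ?expn_gt0 //.
apply: le_trans (nm_sum _ _ _) _.
apply: (@le_trans _ _ (\sum_(i < N) (2 * L * (3 / 4) ^+ n))).
  apply: ler_sum => i _; rewrite addrAC opprD addrA subrr add0r addrC.
  apply: le_trans (hF _ _ _ _) _; rewrite ?cabs_rtX // exprS -mul2n exprM rtS.
  rewrite -[X in _ - X]mul1r -mulrBl cabsM cabs_rtX mulr1.
  have := cabs_rt1 (R := R) n.+1; rewrite exprS.
  have : 0 <= (3 / 4 : R) ^+ n by rewrite exprn_ge0 //; lra.
  by move: (_ ^+ n) (cabs _) => a b; nra.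
rewrite sumr_const card_ord -[leLHS]mulr_natr natrM -/N; set a := (_ * _ ^+ n).
have a0 : 0 <= a by rewrite !mulr_ge0 ?exprn_ge0 //; lra.
have : 0 <= N%:R :> R by [].
nra.
Qed.

End Averages.

(** * Spectral projections as circle averages *)

Section CircleAverages.
Context {R : realType} {V : banType R}.
Implicit Types (B S T : bop V) (u v z : R[i]) (C L d e : R) (m n : nat).

(** The resolvent. The value 0 outside the resolvent set keeps [comm_res] free of side
    conditions. *)
Definition res B u : bop V :=
  if pselect (invb (u *: (1 : bop V) - B)) is left h then sval (cid h) else 0.

Lemma resP B u : invb (u *: (1 : bop V) - B) -> inv_of (u *: (1 : bop V) - B) (res B u).
Proof. by rewrite /res; case: pselect => // h _; case: cid. Qed.

Lemma comm_scal1 B u : GRing.comm (u *: (1 : bop V)) B.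
Proof. by rewrite /GRing.comm bscalAl bscalAr mulr1 mul1r. Qed.

Lemma comm_res S B u : GRing.comm S B -> GRing.comm S (res B u).
Proof.
move=> cSB; rewrite /res; case: pselect => [h|_]; last exact: commr0.
case: cid => g /= hg; apply: inv_of_comm hg _.
by apply: commrB => //; apply: commr_sym; apply: comm_scal1.
Qed.

Lemma comm_lim S (w : nat -> bop V) l : tends w l -> (forall n, GRing.comm S (w n)) ->
  GRing.comm S l.
Proof.
move=> h c; apply: tends_uniq (tendsMl S h) _; apply: tends_eq (tendsMr S h) => n.
by rewrite -c.
Qed.

Definition circ B := forall u, cabs u = 1 -> invb (u *: (1 : bop V) - B).
Definition cbd B C := circ B /\ forall u, cabs u = 1 -> nm (res B u) <= C.

Lemma res_near u B B' C : inv_of (u *: (1 : bop V) - B) (res B u) -> nm (res B u) <= C ->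
  C * nm (B' - B) <= 2^-1 ->
  invb (u *: (1 : bop V) - B') /\ nm (res B' u) <= 2 * C.
Proof.
move=> h hC hB; have [|g [hg ng _]] := @inv_pert _ _ _ _ (u *: (1 : bop V) - B') _ h hC.
  by rewrite opprB addrC addrA subrK nmC.
have hi : invb (u *: (1 : bop V) - B') by exists g.
by split=> //; rewrite (inv_of_uniq (resP hi) hg).
Qed.

(** Compactness of the circle: points where the resolvent has norm above [n] would accumulate at a
    point near which the resolvent is bounded. *)
Lemma circ_bound B : circ B -> exists C, cbd B C.
Proof.
move=> cB; apply: contrapT => /forallNP no.
have hn n : exists u, cabs u = 1 /\ n%:R < nm (res B u).
  apply: contrapT => /forallNP h; apply: (no n%:R); split=> // u u1.
  by rewrite leNgt; apply/negP => hu; apply: (h u).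
pose w n : R[i]^o := sval (cid (hn n)).
have wP n : cabs (w n) = 1 /\ n%:R < nm (res B (w n)) by rewrite /w; case: cid.
have [|p hp [l hl]] := @tbdd_cvg _ _ w.
  by apply: tbdd_sub (tbdd_disc 1) => _ [n _ <-] /=; rewrite (wP n).1.
have l1 : cabs l = 1.
  apply/eqP; rewrite eq_le; apply/andP; split.
    by apply: (tends_nm_le (N := 0%N) hl) => n _; rewrite nm_complexE (wP _).1.
  rewrite leNgt; apply/negP => hlt; have [N /(_ N (leqnn N))] := hl (1 - cabs l) ltac:(lra).
  by rewrite nm_complexE; have := cabsBD (w (p N)) l; rewrite (wP _).1; lra.
have hr := resP (cB l l1).
pose C := nm (res B l) + 1.
have C0 : 0 < C by rewrite /C ltr_wpDl ?nm_ge0.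
have [N hN] := hl ((2 * C)^-1) ltac:(by rewrite invr_gt0; lra).
pose n := maxn N (Num.truncn (2 * C)).+1.
have Nn : (N <= n)%N by exact: leq_maxl.
have [|g [hg ng _]] := @inv_pert _ _ _ _ (w (p n) *: (1 : bop V) - B) C hr (ltac:(rewrite /C; lra)).
  rewrite opprB addrA subrK -scalerBl nmZ.
  have := hN n Nn; rewrite nm_complexE => h1.
  have h2 := nm1_le V; have h3 := nm_ge0 (1 : bop V).
  have h4 : cabs (w (p n) - l) * nm (1 : bop V) <= (2 * C)^-1.
    by rewrite -[leRHS]mulr1 ler_pM ?cabs_ge0 // ltW.
  apply: le_trans (ler_wpM2l (ltW C0) h4) _.
  by rewrite invfM mulrCA mulfV ?mulr1 // gt_eqF.
have := (wP (p n)).2; rewrite (inv_of_uniq (resP (cB _ (wP (p n)).1)) hg) => h1.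
have h2 : n%:R <= (p n)%:R :> R by rewrite ler_nat.
have h3 : (Num.truncn (2 * C)).+1%:R <= n%:R :> R by rewrite ler_nat leq_maxr.
have := truncnS_gt (2 * C); lra.
Qed.

(** One constant for a whole ball of operators: the Lipschitz estimates for [cav] and [Qc] compare
    two operators under a common bound. *)
Lemma circ_near B : circ B ->
  exists C d, [/\ 0 < C, 0 < d & forall B', nm (B' - B) <= d -> cbd B' C].
Proof.
move=> cB; have [C [_ hC]] := circ_bound cB.
have C0 : 0 <= C by apply: le_trans (nm_ge0 _) (hC 1 (cabs1)).
exists (2 * (C + 1)), (2 * (C + 1))^-1.
split; [lra | by rewrite invr_gt0; lra | move=> B' hB].
have h u : cabs u = 1 -> invb (u *: (1 : bop V) - B') /\ nm (res B' u) <= 2 * (C + 1).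
  move=> u1; apply: (res_near (resP (cB u u1))); first by have := hC u u1; lra.
  rewrite -(@ler_pM2l _ 2) // mulfV // mulrA mulrC -ler_pdivlMr ?div1r //.
  lra.
by split=> u /h[].
Qed.

(** The contour integral of the resolvent over the unit circle is the mean of [u] times the
    resolvent, so the averages of [cker] are Riemann sums of the Riesz projection. *)
Definition cker B u : bop V := u *: res B u.

Lemma cker1D B u : invb (u *: (1 : bop V) - B) -> cker B u = 1 + B * res B u.
Proof.
move=> /resP[h _]; rewrite /cker -[X in X *: res B u]addr0.
by rewrite -h mulrBl bscalAl mul1r subrK addr0.
Qed.

Lemma res_diff B B' u v : invb (u *: (1 : bop V) - B) -> invb (v *: (1 : bop V) - B') ->
  res B u - res B' v = res B u * ((v - u) *: (1 : bop V) + (B - B')) * res B' v.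
Proof.
move=> /resP[_ h] /resP[h' _].
have -> : (v - u) *: (1 : bop V) + (B - B') = (v *: (1 : bop V) - B') - (u *: (1 : bop V) - B).
  by rewrite scalerBl opprB addrACA [RHS]addrACA; congr (_ + _); exact: addrC.
by rewrite mulrBr mulrBl -mulrA h' mulr1 h mul1r.
Qed.

Lemma cker_lip B C : cbd B C -> forall u v, cabs u = 1 -> cabs v = 1 ->
  nm (cker B u - cker B v) <= nm B * C * C * cabs (u - v).
Proof.
move=> [cB hC] u v u1 v1; have C0 : 0 <= C by apply: le_trans (nm_ge0 _) (hC u u1).
rewrite !cker1D; [|exact: cB|exact: cB].
rewrite opprD addrACA subrr add0r -mulrBr res_diff; [|exact: cB|exact: cB].
rewrite subrr addr0 bscalAr mulr1 bscalAl bscalAr nmZ cabsB [leRHS]mulrC.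
rewrite ler_wpM2l ?cabs_ge0 //; apply: le_trans (nmM _ _) _.
rewrite -mulrA ler_wpM2l ?nm_ge0 //; apply: le_trans (nmM _ _) _.
by rewrite ler_pM ?nm_ge0 ?hC.
Qed.

Lemma avgMl S n (F : R[i] -> bop V) : S * avg n F = avg n (fun u => S * F u).
Proof. by rewrite /avg bscalAr mulr_sumr. Qed.

Lemma comm_avg S n (F : R[i] -> bop V) : (forall u, GRing.comm S (F u)) -> GRing.comm S (avg n F).
Proof.
move=> h; rewrite /GRing.comm /avg bscalAr bscalAl; congr (_ *: _).
by rewrite mulr_sumr mulr_suml; apply: eq_bigr => j _; apply: h.
Qed.

Definition cav n B := avg n (cker B).

Lemma comm_cker S B u : GRing.comm S B -> GRing.comm S (cker B u).
Proof. by move=> /comm_res h; rewrite /GRing.comm bscalAl bscalAr h. Qed.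

Lemma comm_cav S n B : GRing.comm S B -> GRing.comm S (cav n B).
Proof. by move=> h; apply: comm_avg => u; apply: comm_cker. Qed.

Lemma scal1X u n : (u *: (1 : bop V)) ^+ n = u ^+ n *: (1 : bop V).
Proof. by rewrite bexprZ expr1n. Qed.

Lemma cker_poly n B u : circ B -> cabs u = 1 -> u ^+ n = 1 ->
  (1 - B ^+ n) * cker B u = \sum_(i < n) u ^+ (n - i) *: B ^+ i.
Proof.
move=> cB u1 un; have [h _] := resP (cB u u1).
have e1 : 1 - B ^+ n = (\sum_(i < n) u ^+ (n.-1 - i) *: B ^+ i) * (u *: (1 : bop V) - B).
  have c : GRing.comm (u *: (1 : bop V)) B by exact: comm_scal1.
  have := subrXX_comm n c; rewrite scal1X un scale1r => ->.
  rewrite (eq_bigr (fun i : 'I_n => u ^+ (n.-1 - i) *: B ^+ i)); last first.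
    by move=> i _; rewrite scal1X bscalAl mul1r.
  apply: commr_sum => i _; rewrite /GRing.comm bscalAr bscalAl; congr (_ *: _).
  apply: commrX; apply: commr_sym; apply: commrB => //.
rewrite /cker bscalAr e1 -mulrA h mulr1 scaler_sumr; apply: eq_bigr => i _.
rewrite scalerA -exprS; congr (_ ^+ _ *: _).
by case: n i {un e1} => [[]//|n] i /=; rewrite subSn // -ltnS.
Qed.

(** For [u ^+ N = 1] the operator [(1 - B ^+ N) * cker B u] is a polynomial in [B], and
    orthogonality of the roots of unity leaves only its term of degree [m]. *)
Lemma cav_mul n B m : circ B -> (m < 2 ^ n.+1)%N ->
  (1 - B ^+ (2 ^ n.+1)) * avg n (fun u => u ^+ m *: cker B u) = B ^+ m.
Proof.
set N := (2 ^ n.+1)%N => cB mN; rewrite avgMl.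
rewrite (@eq_avg _ _ _ _ (fun u => \sum_(i < N) u ^+ (m + (N - i)) *: B ^+ i)); last first.
  move=> u u1 uN; rewrite bscalAr cker_poly // scaler_sumr.
  by apply: eq_bigr => i _; rewrite scalerA -exprD.
rewrite /avg -/N exchange_big /=.
have h (i : 'I_N) : \sum_(j < N) (rt n ^+ j) ^+ (m + (N - i)) *: B ^+ i =
    (if m == i then N%:R else 0) *: B ^+ i.
  rewrite -scaler_suml; congr (_ *: _).
  under eq_bigr => j _ do rewrite -exprM.
  rewrite sum_rt -/N; congr (if _ then _ else _).
  have iN := ltn_ord i; apply/idP/eqP => [|<-]; last by rewrite subnKC // ltnW.
  have [mi|im|//] := ltngtP m i.
    rewrite gtnNdvd //; first by rewrite addn_gt0 subn_gt0 iN orbT.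
    by rewrite -(@ltn_add2r i) -addnA subnK ?(ltnW iN) // addnC ltn_add2l.
  rewrite addnBA ?(ltnW iN) // -addnBAC ?(ltnW im) // dvdn_addl // gtnNdvd ?subn_gt0 //.
  exact: leq_ltn_trans (leq_subr _ _) mN.
under eq_bigr => i _ do rewrite h.
rewrite (bigD1 (Ordinal mN)) //= eqxx big1 => [|i].
  by rewrite addr0 scalerA mulVf ?scale1r // pnatr_eq0 -lt0n expn_gt0.
by rewrite -val_eqE /= eq_sym => /negbTE ->; rewrite scale0r.
Qed.

Lemma cav_inv n B : circ B -> inv_of (1 - B ^+ (2 ^ n.+1)) (cav n B).
Proof.
move=> cB; have h : (1 - B ^+ (2 ^ n.+1)) * cav n B = 1.
  rewrite -[RHS](expr0 B) -(cav_mul cB (expn_gt0 2 n.+1)).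
  by congr (_ * _); apply: eq_avg => u _ _; rewrite expr0 scale1r.
split=> //; rewrite -{}[RHS]h; apply/esym.
have cc : GRing.comm B (cav n B) by apply: comm_cav.
by apply/commr_sym/commrB; [exact: commr1 | apply: commrX; apply: commr_sym].
Qed.

Lemma cav_powE n B m : circ B -> (m < 2 ^ n.+1)%N ->
  B ^+ m * cav n B = avg n (fun u => u ^+ m *: cker B u).
Proof.
move=> cB mN; rewrite -[RHS]mul1r -(cav_inv n cB).2 -mulrA cav_mul //.
by apply/commr_sym; apply: commrX; apply: commr_sym; apply: comm_cav.
Qed.

(** Multiplication by [B ^+ m] only twists the average by the unimodular factor [u ^+ m], so the
    bound does not depend on [m]. *)
Lemma cav_pow_le n B m C : cbd B C -> (m < 2 ^ n.+1)%N -> nm (B ^+ m * cav n B) <= C.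
Proof.
move=> [cB hC] mN; rewrite cav_powE //; apply: avg_nm => u u1.
by rewrite !nmZ cabsX u1 expr1n !mul1r hC.
Qed.

Lemma cav_lip n B B' C : cbd B C -> cbd B' C -> nm (cav n B - cav n B') <= C * C * nm (B - B').
Proof.
move=> [cB hC] [cB' hC']; rewrite /cav avgB; apply: avg_nm => u u1.
have C0 : 0 <= C by apply: le_trans (nm_ge0 _) (hC u u1).
rewrite -scalerBr nmZ u1 mul1r res_diff; [|exact: cB|exact: cB'].
rewrite subrr scale0r add0r; apply: le_trans (nmM _ _) _.
rewrite mulrAC ler_pM ?nm_ge0 ?hC' //.
by apply: le_trans (nmM _ _) _; rewrite ler_wpM2r ?nm_ge0 ?hC.
Qed.

(* When the spectrum of [B] avoids the unit circle, [cav n B = (1 - B ^ 2^(n+1))^-1] tends to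
   the spectral projection of the open unit disc. *)
Definition Qc B : bop V :=
  if pselect (exists Q, tends (fun n => cav n B) Q) is left h then sval (cid h) else 0.

Lemma QcP B : circ B -> tends (fun n => cav n B) (Qc B).
Proof.
move=> cB; rewrite /Qc; case: pselect => [h|[]]; first by case: cid.
have [C hC] := circ_bound cB.
have C0 : 0 <= C by apply: le_trans (nm_ge0 _) (hC.2 1 cabs1).
by apply: (avg_cvg (L := nm B * C * C)); rewrite ?mulr_ge0 ?nm_ge0 //; apply: cker_lip.
Qed.

Lemma comm_Qc S B : GRing.comm S B -> GRing.comm S (Qc B).
Proof.
move=> h; rewrite /Qc; case: pselect => [h'|_]; last exact: commr0.
by case: cid => Q /= hQ; apply: comm_lim hQ _ => n; apply: comm_cav.
Qed.

Lemma Qc_lip B B' C : cbd B C -> cbd B' C -> nm (Qc B - Qc B') <= C * C * nm (B - B').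
Proof.
move=> h h'; have t := tendsB (QcP h.1) (QcP h'.1).
by apply: (tends_nm_le (N := 0%N) t) => n _; apply: cav_lip.
Qed.

Lemma Qc_pow_le B C m : cbd B C -> nm (B ^+ m * Qc B) <= C.
Proof.
move=> h; apply: (tends_nm_le (N := m) (tendsMl (B ^+ m) (QcP h.1))) => n mn.
apply: cav_pow_le => //; apply: leq_ltn_trans mn _; apply: leq_trans (ltn_expl n (ltnSn 1)) _.
by rewrite leq_exp2l.
Qed.

(** Since [1 - cav n B = - (B ^+ N * cav n B)], a factor [B ^+ m] splits off and the rest stays
    bounded. The operator [D] stands in for an inverse of [B ^+ m] on the range of [1 - Qc B]. *)
Lemma Qc_approx B C m e : cbd B C -> 0 < e ->
  exists D, nm D <= C + 1 /\ nm (1 - Qc B - B ^+ m * D) < e.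
Proof.
move=> h e0; have C0 : 0 <= C by apply: le_trans (nm_ge0 _) (h.2 1 cabs1).
case: m => [|m].
  exists (1 - Qc B); rewrite expr0 mul1r subrr nm0; split=> //.
  have := Qc_pow_le 0 h; rewrite expr0 mul1r => h1.
  by apply: le_trans (nmB _ _) _; rewrite addrC lerD // nm1_le.
have [N hN] := QcP h.1 e0; pose n := maxn N m.
have mn : (m < 2 ^ n.+1)%N.
  apply: leq_ltn_trans (leq_maxr N m) _; apply: leq_trans (ltn_expl n (ltnSn 1)) _.
  by rewrite leq_exp2l.
exists (- (B ^+ (2 ^ n.+1 - m.+1) * cav n B)); split.
  rewrite nmN; apply: le_trans (cav_pow_le h _) _; last by rewrite lerDl.
  by rewrite ltn_subrL expn_gt0.
rewrite mulrN mulrA -exprD subnKC // -[X in _ - X]opprK opprK.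
have -> : - (B ^+ (2 ^ n.+1) * cav n B) = 1 - cav n B.
  by rewrite -[X in _ = X - _](cav_inv n h.1).1 mulrBl mul1r addrAC subrr add0r.
by rewrite opprB addrC addrA subrK; apply: hN; apply: leq_maxl.
Qed.

End CircleAverages.

(** * Riesz projections and the spectral radius *)

Section SpectralProjections.
Context {R : realType} {V : banType R}.
Implicit Types (B S T p q : bop V) (u v z : R[i]) (C L d e r t : R) (m n : nat).

Lemma bernoulli_ge t n : 0 <= t -> 1 + n%:R * t <= (1 + t) ^+ n.
Proof.
move=> t0; elim: n => [|n IH]; first by rewrite mul0r addr0 expr0.
rewrite exprS -natr1; have n0 : 0 <= n%:R :> R by [].
have := ler_wpM2l (ltac:(lra) : 0 <= 1 + t) IH; nra.
Qed.

Lemma cabs_sub_real z : cabs (1 - z) >= 1 - cabs z.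
Proof. by have := cabsBD 1 z; rewrite cabs1. Qed.

Lemma nat_small e : 0 < e -> exists N, forall n, (N <= n)%N -> (n.+1)%:R^-1 < e.
Proof.
move=> e0; exists (Num.truncn e^-1) => n hn.
rewrite -[ltRHS]invrK ltf_pV2 ?posrE ?invr_gt0 ?ltr0n //.
by apply: lt_le_trans (truncnS_gt _) _; rewrite ler_nat.
Qed.

(** [B] is compared with [s B], where [s = (1 + 1 / N)^-1] tends to 1 while [s ^+ N] stays at most
    one half. The difference of the two averages is [1 - s ^+ N] times
    [(cav n B - 1) * cav n (s B)]; it tends to 0, hence so does this product, whose limit is
    [(Qc B - 1) * Qc B]. *)
Lemma Qc_idem B : circ B -> Qc B * Qc B = Qc B.
Proof.
move=> cB; have [C [d [C0 d0 hd]]] := circ_near cB.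
have hB : cbd B C by apply: hd; rewrite subrr nm0 ltW.
have M0 := nm_ge0 B.
pose s n : R := (1 + (2 ^ n.+1)%:R^-1)^-1.
pose B' n := (s n)%:C%C *: B.
have N0 n : 0 < (2 ^ n.+1)%:R^-1 :> R by rewrite invr_gt0 ltr0n expn_gt0.
have s1 n : 0 < 1 + (2 ^ n.+1)%:R^-1 :> R by have := N0 n; lra.
have hs n : 0 < s n by rewrite invr_gt0.
have hB' n : nm (B' n - B) <= nm B * (n.+1)%:R^-1.
  have -> : B' n - B = ((s n)%:C%C - 1) *: B by rewrite scalerBl scale1r.
  rewrite nmZ mulrC ler_wpM2l //.
  have -> : (s n)%:C%C - 1 = - (1 - s n)%:C%C by rewrite rmorphB rmorph1 opprB.
  have h1 : 1 - s n <= (2 ^ n.+1)%:R^-1.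
    have := mulVf (lt0r_neq0 (s1 n)); rewrite -/(s n); have := N0 n; have := hs n; nra.
  have h2 : 0 <= 1 - s n.
    have := mulVf (lt0r_neq0 (s1 n)); rewrite -/(s n); have := N0 n; have := hs n; nra.
  rewrite cabsN cabs_nneg //; apply: le_trans h1 _.
  by rewrite lef_pV2 ?posrE ?ltr0n ?expn_gt0 // ler_nat ltnW // ltn_expl.
have small e : 0 < e -> exists N, forall n, (N <= n)%N -> nm B * (n.+1)%:R^-1 < e.
  move=> e0; have M1 : 0 < nm B + 1 by lra.
  have [N hN] := nat_small (divr_gt0 e0 M1); exists N => n /hN.
  rewrite ltr_pdivlMr // => h; apply: le_lt_trans h; rewrite mulrDr mulr1 mulrC lerDl.
  by rewrite invr_ge0.
have [N1 hN1] := small _ d0.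
have hb n : (N1 <= n)%N -> cbd (B' n) C.
  by move=> Nn; apply: hd; apply: le_trans (hB' n) _; apply: ltW; apply: hN1.
have half n : s n ^+ (2 ^ n.+1) <= 2^-1.
  rewrite exprVn lef_pV2 ?posrE ?exprn_gt0 //.
  have := bernoulli_ge (2 ^ n.+1) (ltW (N0 n)); rewrite mulfV ?pnatr_eq0 -?lt0n ?expn_gt0 //.
have key n : (N1 <= n)%N -> nm ((cav n B - 1) * cav n (B' n)) <= 2 * (C * C * (nm B * (n.+1)%:R^-1)).
  move=> Nn; have hn := hb n Nn.
  have [_ i1] := cav_inv n cB; have [i2 _] := cav_inv n hn.1.
  set N := (2 ^ n.+1)%N in i1 i2; set b := (s n)%:C%C ^+ N.
  have b2 : cabs b <= 2^-1 by rewrite cabsX cabs_nneg ?half // ltW.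
  have eq1 : cav n B - cav n (B' n) = (1 - b) *: ((cav n B - 1) * cav n (B' n)).
    have -> : cav n B - 1 = cav n B * B ^+ N.
      by rewrite -[X in _ - X]i1 mulrBr mulr1 opprB addrC subrK.
    have h1 : cav n B = cav n B * (1 - b *: B ^+ N) * cav n (B' n).
      by rewrite -mulrA -bexprZ i2 mulr1.
    have h2 : cav n (B' n) = cav n B * (1 - B ^+ N) * cav n (B' n) by rewrite i1 mul1r.
    rewrite [X in X - _]h1 [X in _ - X]h2 -mulrBl -mulrBr.
    rewrite opprB addrC addrA subrK -[X in X - _]scale1r -scalerBl.
    by rewrite (bscalAr (1 - b)) (bscalAl (1 - b)).
  have h2 := cav_lip n hB hn; rewrite eq1 nmZ in h2.
  have h3 : 2^-1 <= cabs (1 - b) by have := cabs_sub_real b; lra.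
  have h4 := nm_ge0 ((cav n B - 1) * cav n (B' n)).
  have h5 : C * C * nm (B - B' n) <= C * C * (nm B * (n.+1)%:R^-1).
    by rewrite ler_wpM2l ?mulr_ge0 ?(ltW C0) // nmC.
  have h6 := le_trans (ler_wpM2r h4 h3) (le_trans h2 h5).
  by rewrite -(@ler_pM2l _ 2^-1) ?invr_gt0 // [leRHS]mulrA mulVf ?mul1r ?pnatr_eq0.
have t1 : tends (fun n => (cav n B - 1) * cav n (B' n)) ((Qc B - 1) * Qc B).
  apply: tendsM; first by apply: tendsB (QcP cB) (tends_cst _).
  move=> e e0; have CC : 0 < C * C by rewrite mulr_gt0.
  have [M hM] := QcP cB (half_gt0 e0).
  have [M' hM'] := small _ (divr_gt0 (half_gt0 e0) CC).
  exists (maxn N1 (maxn M M')) => n; rewrite !geq_max => /and3P[n1 /hM n2 /hM' n3].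
  apply: le_lt_trans (nm_tri (cav n B) _ _) _.
  have h1 := cav_lip n (hb n n1) hB.
  move: n3; rewrite ltr_pdivlMr // mulrC => n3.
  rewrite [ltRHS]splitr; apply: ltrD n2; apply: le_lt_trans h1 _.
  exact: le_lt_trans (ler_wpM2l (ltW CC) (hB' n)) n3.
have t2 : tends (fun n => (cav n B - 1) * cav n (B' n)) 0.
  move=> e e0; have CC : 0 < 2 * (C * C) by rewrite !mulr_gt0.
  have [M' hM'] := small _ (divr_gt0 e0 CC).
  exists (maxn N1 M') => n; rewrite geq_max => /andP[n1 /hM']; rewrite subr0 ltr_pdivlMr // mulrC => n3.
  by apply: le_lt_trans (key n n1) _; rewrite mulrA.
have := tends_uniq t1 t2; rewrite mulrBl mul1r => /eqP; rewrite subr_eq0 => /eqP.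
by [].
Qed.

Lemma idem_eq p q : p * p = p -> q * q = q -> GRing.comm p q -> nm (p - q) < 1 -> p = q.
Proof.
have key (a b : bop V) : a * a = a -> b * b = b -> GRing.comm a b -> nm (a - b) < 1 -> a = a * b.
  move=> aa bb ab h; suff : a * (1 - b) = 0.
    by rewrite mulrBr mulr1 => /eqP; rewrite subr_eq0 => /eqP.
  have e1 : a * (1 - b) = (a - b) * (a * (1 - b)).
    by rewrite mulrBl !mulrA aa -ab -mulrA [b * _]mulrBr bb mulr1 subrr mulr0 subr0.
  apply/eqP; rewrite -nmE0; apply/eqP.
  have := nmM (a - b) (a * (1 - b)); rewrite -e1; have := nm_ge0 (a * (1 - b)); nra.
move=> pp qq pq h; rewrite [LHS](key p q) // pq; apply/esym/key => //.
by rewrite nmC.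
Qed.

(** For [t] near 1 the projections of [t B] and [B] are commuting idempotents at distance below 1,
    hence equal. The uniform bounds for [(1 + D) B] and [(1 - D) B] thereby become exponential
    bounds for [B]. *)
Lemma Qc_split B : circ B -> exists C t, [/\ 0 <= C, 0 < t, t < 1,
  (forall m, nm (B ^+ m * Qc B) <= C * t ^+ m) &
  forall m e, 0 < e -> exists D, nm D <= C * t ^+ m /\ nm (1 - Qc B - B ^+ m * D) < e].
Proof.
move=> cB; have [C [d [C0 d0 hd]]] := circ_near cB.
have hB : cbd B C by apply: hd; rewrite subrr nm0 ltW.
have M0 := nm_ge0 B.
(* [D] is so small that [D * nm B <= d], as needed for [hd], and [C * C * (D * nm B) < 1], as needed
   for [idem_eq]. *)
pose K := C * C + 1 + d^-1.
have K0 : 0 < K by rewrite /K; have : 0 < d^-1 by [rewrite invr_gt0]; nra.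
pose D := (K * (nm B + 1) * 2)^-1.
have KB : 0 < K * (nm B + 1) * 2 by rewrite !mulr_gt0 //; lra.
have D0 : 0 < D by rewrite invr_gt0.
have D1 : D < 1.
  rewrite invf_lt1 //; have : 1 <= K by rewrite /K; have : 0 < d^-1 by [rewrite invr_gt0]; nra.
  nra.
have DB : D * nm B * K < 1.
  have := mulVf (lt0r_neq0 KB); rewrite -/D; nra.
have near t : `|t - 1| <= D -> cbd (t%:C%C *: B) C /\ Qc (t%:C%C *: B) = Qc B.
  move=> tD.
  have e1 : nm (t%:C%C *: B - B) <= D * nm B.
    rewrite -[X in _ - X]scale1r -scalerBl nmZ ler_wpM2r //.
    by rewrite -(rmorph1 (real_complex R)) -rmorphB cabs_real.
  have DB0 : 0 <= D * nm B by rewrite mulr_ge0 // ltW.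
  have h : cbd (t%:C%C *: B) C.
    apply: hd; apply: le_trans e1 _; rewrite -[leRHS]mul1r -ler_pdivrMr //.
    have : D * nm B / d <= D * nm B * K by rewrite ler_wpM2l // /K; nra.
    lra.
  split=> //; apply: idem_eq; rewrite ?Qc_idem //; first exact: h.1.
    apply/commr_sym; apply: comm_Qc; rewrite /GRing.comm bscalAl bscalAr.
    by congr (_ *: _); apply/commr_sym; apply: comm_Qc.
  apply: le_lt_trans (Qc_lip h hB) _; apply: le_lt_trans DB.
  rewrite [leRHS]mulrC ler_pM ?nm_ge0 ?mulr_ge0 ?(ltW C0) // /K.
  have : 0 < d^-1 by [rewrite invr_gt0]; lra.
have [|h1 q1] := near (1 + D); first by rewrite addrAC subrr add0r gtr0_norm.
have [|h2 q2] := near (1 - D); first by rewrite addrAC subrr add0r normrN gtr0_norm.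
have s1 : 0 < 1 + D by lra.
have s2 : 0 < 1 - D by lra.
exists (C + 1), (1 + D)^-1; split; [lra | by rewrite invr_gt0 | by rewrite invf_lt1 //; lra | |].
  move=> m; have := Qc_pow_le m h1; rewrite q1 bexprZ bscalAl nmZ cabsX cabs_nneg ?(ltW s1) //.
  rewrite exprVn ler_pdivlMr ?exprn_gt0 // mulrC; lra.
move=> m e e0; have [E [E1 E2]] := Qc_approx m h2 e0; rewrite q2 in E2.
exists ((1 - D)%:C%C ^+ m *: E); split; last first.
  by move: E2; rewrite bexprZ bscalAl bscalAr.
rewrite nmZ cabsX cabs_nneg ?(ltW s2) // mulrC.
apply: ler_pM; rewrite ?nm_ge0 ?exprn_ge0 ?(ltW s2) //.
rewrite lerXn2r ?nnegrE ?invr_ge0 ?(ltW s1) ?(ltW s2) //.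
by rewrite -[(1 + D)^-1]mul1r ler_pdivlMr //; nra.
Qed.

(** [1 - Qc B] is close to [B ^+ m * D] with [nm D <= C * t ^+ m]; a growth rate [r] of [B] with
    [t * r < 1] makes this product tend to 0. *)
Lemma Qc_one B : circ B -> (forall r, 1 < r -> grow B r) -> Qc B = 1.
Proof.
move=> cB gB; have [C [t [C0 t0 t1 _ h]]] := Qc_split cB.
pose r := (t^-1 + 1) / 2.
have ti : 1 < t^-1 by rewrite invf_gt1.
have [|C' C'0 hC'] := gB r; first by rewrite /r; lra.
have tr0 : 0 <= t * r by rewrite mulr_ge0 ?(ltW t0) // /r; lra.
have tr1 : t * r < 1 by rewrite /r mulrA mulrDr mulfV ?gt_eqF //; lra.
apply/eqP; rewrite eq_sym -subr_eq0; apply/eqP/nm_small => e e0.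
have [m /(_ m (leqnn m)) hm] := geo_small (C * C') tr0 tr1 (half_gt0 e0).
have [D [D1 D2]] := h m _ (half_gt0 e0).
have h1 : nm (B ^+ m * D) <= C * C' * (t * r) ^+ m.
  apply: le_trans (nmM _ _) _; rewrite mulrC exprMn mulrACA.
  by apply: ler_pM; rewrite ?nm_ge0.
have := nmBD (1 - Qc B) (B ^+ m * D); lra.
Qed.

Lemma circ_grow B : circ B -> Qc B = 1 -> exists t, [/\ 0 < t, t < 1 & grow B t].
Proof.
move=> cB Q1; have [C [t [C0 t0 t1 h _]]] := Qc_split cB.
by exists t; split=> //; exists C => // n; have := h n; rewrite Q1 mulr1.
Qed.

Lemma grow_improve T r : 0 < r -> (forall r', r < r' -> grow T r') ->
  (forall z, cabs z = r -> invb (z *: (1 : bop V) - T)) ->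
  exists r1, [/\ 0 < r1, r1 < r & grow T r1].
Proof.
move=> r0 gT hT; pose s := (r^-1)%:C%C : R[i].
have cs : cabs s = r^-1 by rewrite cabs_nneg // invr_ge0 ltW.
have sE : s * r%:C%C = 1 by rewrite -rmorphM mulVf ?rmorph1 // gt_eqF.
have cB : circ (s *: T).
  move=> u u1; have [|g hg] := hT (r%:C%C * u); first by rewrite cabsM u1 mulr1 cabs_nneg // ltW.
  exists (s^-1 *: g); have -> : u *: (1 : bop V) - s *: T = s *: ((r%:C%C * u) *: (1 : bop V) - T).
    by rewrite scalerBr scalerA mulrA sE mul1r.
  by apply: inv_ofZ; rewrite // -cabs_gt0 cs invr_gt0.
have [|t [t0 t1 gt]] := circ_grow cB.
  apply: Qc_one => // r' r'1; have -> : r' = cabs s * (r * r').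
    by rewrite cs mulrA mulVf ?mul1r // gt_eqF.
  by apply: growZ; apply: gT; rewrite -[X in X < _]mulr1 ltr_pM2l.
exists (r * t); split; [by rewrite mulr_gt0 | by rewrite -[ltRHS]mulr1 ltr_pM2l |].
have := growZ r%:C%C gt; rewrite scalerA mulrC sE scale1r cabs_nneg //; exact: ltW.
Qed.

(** A quasinilpotent operator has projection 1, and [Qc] is Lipschitz near [B], so [Qc B = 1] as
    well. *)
Lemma circ_lim_grow B : circ B -> (forall e, 0 < e -> exists2 T, qn T & nm (T - B) < e) ->
  exists t, [/\ 0 < t, t < 1 & grow B t].
Proof.
move=> cB hB; apply: circ_grow => //.
have [C [d [C0 d0 hd]]] := circ_near cB.
have hB' : cbd B C by apply: hd; rewrite subrr nm0 ltW.
apply/eqP; rewrite -subr_eq0; apply/eqP/nm_small => e e0.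
have CC : 0 < C * C by rewrite mulr_gt0.
have m0 : 0 < Num.min d (e / (C * C)) by rewrite lt_min d0 divr_gt0.
have [T qT] := hB _ m0; rewrite lt_min => /andP[h1 h2].
have hT := hd _ (ltW h1).
have <- : Qc T = 1 by apply: Qc_one hT.1 _ => r r1; apply: qT; lra.
apply: le_trans (Qc_lip hB' hT) _; move: h2; rewrite ltr_pdivlMr // mulrC nmC; exact: ltW.
Qed.

(** If the infimum of the growth rates were positive, [grow_improve] would lower it. This is the
    spectral radius formula for radius zero, obtained without analytic functions. *)
Lemma qn_spec T : (forall z, z != 0 -> invb (z *: (1 : bop V) - T)) -> qn T.
Proof.
move=> hT r0 r00; apply: contrapT => nog.
pose A := [set r | 0 < r /\ grow T r].
have lbA : lbound A r0.
  move=> r [rp gr]; rewrite leNgt; apply/negP => rr; apply: nog.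
  exact: grow_le (ltW rp) (ltW rr) gr.
have hA : has_inf A.
  split; last by exists r0.
  exists (nm T + 1); split; first by rewrite ltr_wpDl ?nm_ge0.
  by apply: grow_le (grow_nm T); rewrite ?nm_ge0 // lerDl.
have rho0 : r0 <= inf A by apply: lb_le_inf hA.1 lbA.
have [||z zr|r1 [r10 r1r gr1]] := @grow_improve T (inf A).
- exact: lt_le_trans rho0.
- move=> r' hr; have [s [s0 gs] sr] := inf_adherent (ltac:(by rewrite subr_gt0) : 0 < r' - inf A) hA.
  by apply: grow_le gs; [exact: ltW | rewrite addrC subrK in sr; exact: ltW].
- by apply: hT; rewrite -cabs_gt0 zr (lt_le_trans r00).
- have := ge_inf hA.2 (conj r10 gr1 : A r1); lra.
Qed.

Lemma idem_invb p z : p * p = p -> z != 0 -> z != 1 -> invb (z *: (1 : bop V) - p).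
Proof.
move=> pp z0 z1; have z1' : z - 1 != 0 by rewrite subr_eq0.
exists (z^-1 *: (1 - p) + (z - 1)^-1 *: p).
have e1 : (z *: (1 : bop V) - p) * (1 - p) = z *: (1 - p).
  by rewrite mulrBl bscalAl mul1r mulrBr mulr1 pp subrr subr0.
have e2 : (z *: (1 : bop V) - p) * p = (z - 1) *: p.
  by rewrite mulrBl bscalAl mul1r pp scalerBl scale1r.
have c : GRing.comm (z *: (1 : bop V) - p) p.
  by apply/commr_sym/commrB => //; apply/commr_sym/comm_scal1.
have e3 : (z *: (1 : bop V) - p) * (z^-1 *: (1 - p) + (z - 1)^-1 *: p) = 1.
  by rewrite mulrDr !bscalAr e1 e2 !scalerA !mulVf // !scale1r subrK.
split=> //; rewrite -[RHS]e3; apply/commr_sym/commrD.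
  rewrite /GRing.comm bscalAr bscalAl; congr (_ *: _).
  by apply: commrB => //; exact: commr1.
by rewrite /GRing.comm bscalAr bscalAl; congr (_ *: _).
Qed.

(** The spectrum of [2 p] lies in [{0, 2}] and misses the unit circle. If quasinilpotent operators
    accumulated at [p], the powers of [2 p] would decay, but they are [2 ^+ n *: p]. *)
Lemma near_idem_not_qn p : p * p = p -> p != 0 ->
  exists2 e, 0 < e & forall T, nm (T - p) < e -> ~ qn T.
Proof.
move=> pp p0; apply: contrapT => no.
have [|e e0|t [t0 t1 [C C0 hC]]] := @circ_lim_grow ((2 : R[i]) *: p).
- move=> u u1; have [||g hg] := @idem_invb p (u / 2) pp.
  + by rewrite -cabs_gt0 cabsM u1 mul1r cabsV cabs_nat invr_gt0.
  + apply/eqP => h; have := cabs1 (R := R); rewrite -h cabsM u1 mul1r cabsV cabs_nat; lra.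
  exists ((2 : R[i])^-1 *: g).
  have -> : u *: (1 : bop V) - (2 : R[i]) *: p = (2 : R[i]) *: ((u / 2) *: (1 : bop V) - p).
    by rewrite scalerBr scalerA mulrCA mulfV ?mulr1 // pnatr_eq0.
  by apply: inv_ofZ => //; rewrite pnatr_eq0.
- apply: contrapT => noT; apply: no; exists (e / 2) => [|T hT qT]; first exact: half_gt0.
  apply: noT; exists ((2 : R[i]) *: T); first exact: qnZ.
  by rewrite -scalerBr nmZ cabs_nat; lra.
have p1 : 0 < nm p by rewrite nm_gt0.
have [N hN] := geo_small C (ltW t0) t1 p1.
have := hN N.+1 (leqnSn N); have := hC N.+1; rewrite bexprZ nmZ cabsX cabs_nat.
have -> : p ^+ N.+1 = p by elim: (N) => [|k IH]; rewrite ?expr1 // exprS IH.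
have : 1 <= (2 : R) ^+ N.+1 by rewrite exprn_ege1 //; lra.
nra.
Qed.

End SpectralProjections.

(** * Total boundedness by finite labellings *)

Section Labels.
Context {R : realType}.
Implicit Types V W : banType R.

(** Labels, unlike nets, combine by products, which is convenient when finitely many approximations
    must hold at once. *)
Lemma tbdd_label V (A : set V) (e : R) : tbdd A -> 0 < e ->
  exists (T : finType) (f : V -> T), forall x y, A x -> A y -> f x = f y -> nm (x - y) < e.
Proof.
move=> hA e0; have [s hs] := hA _ (half_gt0 e0).
pose near (x y : V) := nm (x - y) < e / 2.
exists 'I_(size s).+1, (fun x => inord (find (near x) s)) => x y Ax Ay fE.
have hs' z : A z -> has (near z) s by move=> /hs[t ts zt]; apply/hasP; exists t.
have hf z : A z -> (find (near z) s < (size s).+1)%N by move=> Az; rewrite ltnS find_size.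
have {}fE : find (near x) s = find (near y) s.
  by rewrite -(inordK (hf _ Ax)) fE inordK // hf.
have h1 := nth_find 0 (hs' _ Ax); have h2 := nth_find 0 (hs' _ Ay); rewrite /near fE in h1 h2.
apply: le_lt_trans (nm_tri _ _ _) _; rewrite [ltRHS]splitr; apply: ltrD h1 _.
by rewrite nmC.
Qed.

Lemma label_tbdd V (A : set V) :
  (forall e : R, 0 < e -> exists (T : finType) (f : V -> T),
     forall x y, A x -> A y -> f x = f y -> nm (x - y) < e) -> tbdd A.
Proof.
move=> h e /h[T [f hf]].
pose rep t : V := if pselect (exists x, A x /\ f x = t) is left h then sval (cid h) else 0.
exists [seq rep t | t <- enum T] => x Ax.
exists (rep (f x)); first by apply: map_f; rewrite mem_enum.
rewrite /rep; case: pselect => [h'|[]]; last by exists x.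
by case: cid => y [] /= Ay fy; apply: hf.
Qed.

End Labels.

(** * Compact operators *)

Section CompactOperators.
Context {R : realType} {V : banType R}.
Implicit Types (k f g : bop V) (x y w : V) (z a : R[i]) (e c r M : R) (W : set V).

Definition kop f := tbdd [set f x | x in [set x | nm x <= 1]].

Lemma kop0 : kop 0.
Proof. by apply: tbdd_sub (tbdd_seq [:: 0]) => _ [x _ <-]; rewrite /= inE. Qed.

Lemma kopD f g : kop f -> kop g -> kop (f + g).
Proof.
move=> hf hg; apply: tbdd_sub (tbddD hf hg) => _ [x x1 <-].
by exists (f x), (g x); split=> //; exists x.
Qed.

Lemma kopMl f k : kop k -> kop (f * k).
Proof.
move=> hk; apply: tbdd_sub (tbdd_img (f := f) (M := nm f) _ hk) => [_ [x x1 <-]|x y].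
  by exists (k x) => //; exists x.
by rewrite -bopB nm_bopP.
Qed.

Lemma kopZ z k : kop k -> kop (z *: k).
Proof.
have -> : z *: k = (z *: (1 : bop V)) * k by rewrite bscalAl mul1r.
exact: kopMl.
Qed.

Lemma kopN k : kop k -> kop (- k).
Proof. by rewrite -scaleN1r; apply: kopZ. Qed.

Lemma kop_ball k M : kop k -> tbdd [set k x | x in [set x | nm x <= M]].
Proof.
move=> hk; have M1 : 0 < `|M| + 1 by rewrite ltr_wpDl.
pose s := (`|M| + 1)%:C%C : R[i]; have cs : cabs s = `|M| + 1 by rewrite cabs_nneg // ltW.
have s0 : s != 0 by rewrite -cabs_gt0 cs.
apply: tbdd_sub (kopZ s hk) => _ [x x1 <-]; exists (s^-1 *: x) => /=.
  rewrite nmZ cabsV cs mulrC ler_pdivrMr // mul1r; apply: le_trans x1 _.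
  by rewrite (le_trans (ler_norm M)) // lerDl.
by rewrite bopZ scalerA mulfV // scale1r.
Qed.

Lemma kopMr f k : kop k -> kop (k * f).
Proof.
move=> hk; apply: tbdd_sub (kop_ball (nm f) hk) => _ [x x1 <-].
exists (f x) => //=; apply: le_trans (nm_bopP f x) _.
by rewrite -[leRHS]mulr1 ler_wpM2l ?nm_ge0.
Qed.

Lemma kop_near f : (forall e, 0 < e -> exists2 k, kop k & nm (k - f) < e) -> kop f.
Proof.
move=> h; apply: tbdd_approx => e e0; have [k hk kf] := h e e0.
exists [set k x | x in [set x | nm x <= 1]]; split=> // _ [x x1 <-].
exists (k x); first by exists x.
rewrite nmC -bop_subE; apply: le_lt_trans (nm_bopP _ _) _; apply: le_lt_trans kf.
by rewrite -[leRHS]mulr1 ler_wpM2l ?nm_ge0.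
Qed.

Lemma kop_lim (u : nat -> bop V) f : (forall n, kop (u n)) -> tends u f -> kop f.
Proof.
move=> hu h; apply: kop_near => e /h[N hN]; exists (u N) => //.
exact: hN.
Qed.

Lemma kop_sum (I : Type) (s : seq I) (P : pred I) (F : I -> bop V) :
  (forall i, P i -> kop (F i)) -> kop (\sum_(i <- s | P i) F i).
Proof. by move=> h; elim/big_rec: _ => [|i x Pi]; [exact: kop0 | apply: kopD; exact: h]. Qed.

Lemma kop_seq k (u : nat -> V) M : kop k -> (forall n, nm (u n) <= M) ->
  exists2 p : nat -> nat, (forall n, (n <= p n)%N) & exists l, tends (fun n => k (u (p n))) l.
Proof.
move=> hk hu; apply: (@tbdd_cvg _ _ (fun n => k (u n))).
by apply: tbdd_sub (kop_ball M hk) => _ [n _ <-]; exists (u n) => //; exact: hu.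
Qed.

(** Vala's theorem. If [ys] is a net for the image of the unit ball under [k'], then [k c k'] is
    determined up to a small error by the vectors [k (c y)] with [y] in [ys], and each of them
    ranges over a totally bounded set. *)
Lemma vala k k' : kop k -> kop k' -> tbdd [set k * c * k' | c in [set c : bop V | nm c <= 1]].
Proof.
move=> hk hk'; suff h : tbdd [set f | exists c : bop V, nm c <= 1 /\ f = k * c * k'].
  by apply: tbdd_sub h => _ [c c1 <-]; exists c.
apply: label_tbdd => e e0.
have M1 : 0 < nm k * 4 + 4 by have := nm_ge0 k; lra.
have d0 : 0 < e / (nm k * 4 + 4) by rewrite divr_gt0.
set d := e / (nm k * 4 + 4) in d0.
have [ys [hys1 hys]] := tbdd_net hk' d0.
have [T [f hf]] : exists (T : finType) (f : bop V -> T), forall c c' : bop V, nm c <= 1 -> nm c' <= 1 ->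
    f c = f c' -> forall y, y \in ys -> nm (k (c y) - k (c' y)) < d.
  elim: ys {hys1 hys} => [|y ys [T [f hf]]]; first by exists unit, (fun=> tt).
  have [T' [f' hf']] := tbdd_label (kop_ball (nm y) hk) d0.
  exists (T * T')%type, (fun c : bop V => (f c, f' (k (c y)))) => c c' c1 c1' [fE f'E] x.
  rewrite inE => /predU1P[->|xys]; last exact: hf.
  have cy (b : bop V) : nm b <= 1 -> nm (b y) <= nm y.
    move=> b1; apply: le_trans (nm_bopP b y) _.
    by rewrite -[leRHS]mul1r ler_wpM2r ?nm_ge0.
  by apply: hf' f'E; [exists (c y) | exists (c' y)]; rewrite //=; apply: cy.
(* Labels have to be functions of the operator, so a middle factor is chosen for each element of the
   family. *)
pose pre (h : bop V) : bop V := if pselect (exists c : bop V, nm c <= 1 /\ h = k * c * k') is left p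
  then sval (cid p) else 0.
exists T, (fun h : bop V => f (pre h)) => h h' Ah Ah' fE.
have preP (h0 : bop V) : (exists c : bop V, nm c <= 1 /\ h0 = k * c * k') -> nm (pre h0) <= 1 /\ h0 = k * pre h0 * k'.
  by rewrite /pre; case: pselect => // p _; case: cid.
have [c1 ->] := preP _ Ah; have [c1' ->] := preP _ Ah'.
set c := pre h in c1 fE *; set c' := pre h' in c1' fE *.
apply: (@le_lt_trans _ _ (e / 2)); last by lra.
have dM : d * (nm k * 4 + 4) = e by rewrite /d divfK // gt_eqF.
have main x : nm x <= 1 -> nm ((k * c * k' - k * c' * k') x) <= e / 2.
  move=> x1; have [y yys xy] : exists2 y, y \in ys & nm (k' x - y) < d by apply: hys; exists x.
  rewrite bop_subE !bop_mulE.
  have kb (b : bop V) : nm b <= 1 -> nm (k (b (k' x)) - k (b y)) <= nm k * d.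
    move=> b1; rewrite -!bopB; apply: le_trans (nm_bopP _ _) _; rewrite ler_wpM2l ?nm_ge0 //.
    apply: le_trans (nm_bopP _ _) _; rewrite -[leRHS]mul1r.
    by apply: ler_pM; rewrite ?nm_ge0 // ltW.
  have h1 := kb c c1; have h2 := kb c' c1'; have h3 := hf c c' c1 c1' fE y yys.
  apply: le_trans (nm_tri (k (c y)) _ _) _.
  have h4 := nm_tri (k (c' y)) (k (c y)) (k (c' (k' x))).
  rewrite [nm (k (c' y) - _)]nmC in h4.
  have h5 : nm k * d + (d + nm k * d) <= e / 2.
    by rewrite -dM; have := nm_ge0 k; nra.
  apply: le_trans h5; apply: lerD h1 _; apply: le_trans h4 _.
  by apply: lerD h2; apply: ltW.
apply: nm_bop_le => [|x]; first lra.
have [->|x0] := eqVneq x 0; first by rewrite bop0 nm0 mulr0.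
have x0' : 0 < nm x by rewrite nm_gt0.
pose s := (nm x)%:C%C : R[i]; have cs : cabs s = nm x by rewrite cabs_nneg // ltW.
have s0 : s != 0 by rewrite -cabs_gt0 cs.
have := main (s^-1 *: x); rewrite nmZ cabsV cs mulVf ?gt_eqF // bopZ nmZ cabsV cs.
by move=> /(_ (lexx _)); rewrite mulrC ler_pdivrMr.
Qed.

Lemma bounded_below f : (forall u : nat -> V, (forall n, nm (u n) = 1) ->
    ~ tends (fun n => f (u n)) 0) -> exists2 c, 0 < c & forall x, c * nm x <= nm (f x).
Proof.
move=> h; apply: contrapT => no.
have hn n : exists x, nm x = 1 /\ nm (f x) <= n.+1%:R^-1.
  apply: contrapT => /forallNP hx; apply: no; exists n.+1%:R^-1; first by rewrite invr_gt0.
  move=> x; have [->|x0] := eqVneq x 0; first by rewrite nm0 mulr0 nm_ge0.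
  have x0' : 0 < nm x by rewrite nm_gt0.
  pose s := (nm x)%:C%C : R[i]; have cs : cabs s = nm x by rewrite cabs_nneg // ltW.
  have x1 : nm (s^-1 *: x) = 1 by rewrite nmZ cabsV cs mulVf // gt_eqF.
  rewrite leNgt; apply/negP => hlt; apply: (hx (s^-1 *: x)); split=> //.
  by rewrite bopZ nmZ cabsV cs mulrC ler_pdivrMr // ltW.
apply: (h (fun n => sval (cid (hn n)))) => [n|e /nat_small[N hN]]; first by case: cid => x [].
exists N => n /hN hne; rewrite subr0; case: cid => x [] /= _ /le_lt_trans; exact.
Qed.

(** Approximate eigenvectors of a compact operator for a nonzero value have a convergent
    subsequence, and its limit is an eigenvector. *)
Lemma kop_eig_or_below k z : kop k -> z != 0 ->
  (exists2 x, x != 0 & k x = z *: x) \/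
  exists2 c, 0 < c & forall x, c * nm x <= nm ((z *: (1 : bop V) - k) x).
Proof.
move=> hk z0; have [h|no] := pselect (exists2 x, x != 0 & k x = z *: x); [by left | right].
apply: bounded_below => u u1 hu; apply: no.
have [p hp [l hl]] := @kop_seq _ u 1 hk (fun n => ltac:(by rewrite u1)).
have hl' : tends (fun n => z *: u (p n)) l.
  apply: tends_eq (_ : tends (fun n => (z *: (1 : bop V) - k) (u (p n)) + k (u (p n))) l) => [n|].
    by rewrite bop_subE subrK.
  by rewrite -[l]add0r; apply: tendsD hl; exact: tends_sub hp hu.
have hx : tends (fun n => u (p n)) (z^-1 *: l).
  by apply: tends_eq (tendsZ z^-1 hl') => n; rewrite scalerA mulVf // scale1r.
exists (z^-1 *: l).
  apply/eqP => e0; rewrite e0 in hx; have [N /(_ N (leqnn N))] := hx 1 ltr01.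
  by rewrite subr0 u1 ltxx.
rewrite scalerA mulfV // scale1r; apply: tends_uniq hl; exact: bop_tends.
Qed.

Lemma ker_csub f : csub [set x | f x = 0].
Proof.
split; first by split=> [|a x y /= fx fy]; rewrite /= ?bop0 // bop_lin fx fy scaler0 addr0.
move=> x /clos_seq[u hu ux]; apply: tends_uniq (bop_tends f ux) _.
by apply: tends_eq (tends_cst 0) => n; rewrite hu.
Qed.

Lemma notin_clos W x : ~ clos W x -> exists2 e, 0 < e & forall w, W w -> e <= nm (x - w).
Proof.
move=> h; apply: contrapT => no; apply: h => e e0; apply: contrapT => no'.
apply: no; exists e => // w Ww; rewrite leNgt; apply/negP => hlt; apply: no'.
by exists w.
Qed.

(** Riesz's lemma with constant 1/2. The form [a *: (x - w)] is recorded because the uses need [y]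
    inside a given subspace that contains [x] and [W]. *)
Lemma riesz W x : csub W -> ~ W x -> exists y a w, [/\ W w, a != 0, y = a *: (x - w), nm y = 1 &
  forall v, W v -> 2^-1 <= nm (y - v)].
Proof.
move=> [sW cW] Wx; have [e e0 he] := notin_clos (fun h => Wx (cW _ h)).
pose A := [set r | exists2 w, W w & r = nm (x - w)].
have hA : has_inf A.
  split; first by exists (nm (x - 0)); exists 0 => //; exact: sW.1.
  by exists e => _ [w Ww ->]; exact: he.
have d0 : 0 < inf A.
  by apply: lt_le_trans e0 _; apply: lb_le_inf hA.1 _ => _ [w Ww ->]; exact: he.
have [_ [w Ww ->] hw] := inf_adherent d0 hA.
have xw0 : 0 < nm (x - w) by apply: lt_le_trans e0 (he _ Ww).
pose s := (nm (x - w))%:C%C : R[i]; have cs : cabs s = nm (x - w) by rewrite cabs_nneg // ltW.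
have s0 : s != 0 by rewrite -cabs_gt0 cs.
exists (s^-1 *: (x - w)), s^-1, w; split=> //; first by rewrite invr_neq0.
  by rewrite nmZ cabsV cs mulVf // gt_eqF.
move=> v Wv; have -> : s^-1 *: (x - w) - v = s^-1 *: (x - (w + s *: v)).
  by rewrite opprD addrA [RHS]scalerBr scalerA mulVf // scale1r.
have h1 : inf A <= nm (x - (w + s *: v)).
  by apply: ge_inf; [exact: hA.2 | exists (w + s *: v) => //; apply: subspD => //; apply: subspZ].
rewrite nmZ cabsV cs [leRHS]mulrC ler_pdivlMr //; lra.
Qed.

(** For distinct eigenvalues of modulus at least [c] the kernels of the products [P n] increase
    strictly. Riesz vectors of consecutive kernels have images under [k] that are [c / 2] apart,
    against compactness. *)
Lemma kop_eig_fin k c : kop k -> 0 < c ->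
  exists s : seq R[i], forall z, c <= cabs z -> (exists2 x, x != 0 & k x = z *: x) -> z \in s.
Proof.
move=> hk c0; apply: contrapT => /forallNP no.
have pick (s : seq R[i]) : exists z, [/\ c <= cabs z, z \notin s & exists x, x != 0 /\ k x = z *: x].
  apply: contrapT => /forallNP h; apply: (no s) => z cz [x x0 kx].
  by apply: contrapT => /negP zs; apply: (h z); split=> //; exists x.
pose g s := sval (cid (pick s)).
have gP s : [/\ c <= cabs (g s), g s \notin s & exists x, x != 0 /\ k x = g s *: x].
  by rewrite /g; case: cid.
pose s := fix s n := if n is n'.+1 then g (s n') :: s n' else [::].
pose l n := g (s n).
have lP n : [/\ c <= cabs (l n), l n \notin s n & exists x, x != 0 /\ k x = l n *: x] by exact: gP.
pose P := fix P n : bop V := if n is n'.+1 then (k - l n' *: (1 : bop V)) * P n' else 1.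
have PS n : P n.+1 = (k - l n *: (1 : bop V)) * P n by [].
have Pk n : GRing.comm k (P n).
  elim: n => [|n IH]; first exact: commr1.
  by rewrite PS; apply: commrM => //; apply: commrB => //; apply/commr_sym/comm_scal1.
have ls m n : (m < n)%N -> l m \in s n.
  elim: n => // n IH; rewrite ltnS leq_eqVlt => /predU1P[->|/IH h]; rewrite /= inE ?eqxx //.
  by rewrite h orbT.
have inj m n : (m < n)%N -> l n - l m != 0.
  move=> /ls h; rewrite subr_eq0; apply/eqP => e; have [_ /negP h' _] := lP n.
  by apply: h'; rewrite e.
have VS n x : P n x = 0 -> P n.+1 x = 0 by rewrite PS bop_mulE => ->; rewrite bop0.
have VS' m n x : (m <= n)%N -> P m x = 0 -> P n x = 0.
  by move=> mn; rewrite -(subnKC mn); elim: (n - m)%N => [|j IH] h; rewrite ?addn0 ?addnS //; apply/VS/IH.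
have Vk n x : P n x = 0 -> P n (k x) = 0.
  by move=> h; rewrite -bop_mulE -Pk bop_mulE h bop0.
have ex n : exists y, [/\ nm y = 1, P n (k y - l n *: y) = 0, P n.+1 y = 0 &
     forall v, P n v = 0 -> 2^-1 <= nm (y - v)].
  have [_ _ [x [x0 kx]]] := lP n.
  have Px m : (m <= n)%N -> exists2 a, a != 0 & P m x = a *: x.
    elim: m => [_|m IH mn]; first by exists 1; rewrite ?oner_neq0 // scale1r.
    have [a a0 ha] := IH (ltnW mn); exists (a * (l n - l m)); first by rewrite mulf_neq0 // inj.
    by rewrite PS bop_mulE ha bopZ bop_subE bop_scaleE kx -scalerBl scalerA.
  have nPx : ~ P n x = 0.
    have [a a0 ->] := Px n (leqnn n) => /eqP; rewrite -nmE0 nmZ mulf_eq0 cabs_eq0 nmE0.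
    by rewrite (negbTE a0) (negbTE x0).
  have PSx : P n.+1 x = 0.
    have [a a0 ha] := Px n (leqnn n).
    by rewrite PS bop_mulE ha bopZ bop_subE bop_scaleE kx bop_1E subrr scaler0.
  have [y [a [w [Ww a0 yE y1 hy]]]] := riesz (ker_csub (P n)) nPx.
  have PSy : P n.+1 y = 0.
    by rewrite yE bopZ bopB PSx (VS _ _ Ww) subrr scaler0.
  exists y; split=> //.
  have -> : k y - l n *: y = (k - l n *: (1 : bop V)) y by [].
  rewrite -bop_mulE -PSy PS; congr (fun f : bop V => f y).
  by apply: commrB; [apply/commr_sym; exact: Pk | apply/commr_sym/comm_scal1].
pose y n := sval (cid (ex n)).
have yP n : [/\ nm (y n) = 1, P n (k (y n) - l n *: y n) = 0, P n.+1 (y n) = 0 &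
     forall v, P n v = 0 -> 2^-1 <= nm (y n - v)] by rewrite /y; case: cid.
have sep m n : (m < n)%N -> c / 2 <= nm (k (y n) - k (y m)).
  move=> mn; have [_ h1 _ h2] := yP n; have [_ _ h3 _] := yP m.
  have l0 : l n != 0 by rewrite -cabs_gt0; have [? _ _] := lP n; apply: lt_le_trans c0 _.
  have := h2 (- (l n)^-1 *: ((k (y n) - l n *: y n) - k (y m))).
  rewrite bopZ bopB h1 (VS' m.+1 n) ?Vk // subrr scaler0 => /(_ erefl).
  rewrite scaleNr opprK -[in X in nm (X + _)](scale1r (y n)) -(mulVf l0) -scalerA -scalerDr.
  rewrite addrC -addrA [- k (y m) + _]addrC addrA subrK nmZ cabsV mulrC ler_pdivlMr ?cabs_gt0 //.
  have [? _ _] := lP n; lra.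
have [p hp [v hv]] := @kop_seq k y 1 hk (fun n => ltac:(by have [-> _ _ _] := yP n)).
have [N hN] := tends_cauchys hv (half_gt0 c0).
have := sep (p N) (p (p N).+1) (hp _); have := hN _ _ (leq_trans (hp N) (leqnSn _)) (leqnn N).
lra.
Qed.

End CompactOperators.

(** * The spectrum of a compact operator *)

Section CompactSpectrum.
Context {R : realType} {V : banType R}.
Implicit Types (k f g T : bop V) (x y w : V) (z a : R[i]) (e c r M t : R) (W : set V).

(** Continuity method: the supremum of the parameters up to which all operators are invertible is
    attained by [inv_lim], thanks to the lower bounds, and can be passed by [inv_pert] unless it is
    1. *)
Lemma seg_invb (F : R -> bop V) (L : R) :
  (forall s t, nm (F s - F t) <= L * `|s - t|) -> invb (F 0) ->
  (forall t, 0 <= t <= 1 -> exists2 c, 0 < c & forall x, c * nm x <= nm (F t x)) ->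
  invb (F 1).
Proof.
move=> hL i0 hb.
have L1 : 0 < `|L| + 1 by rewrite ltr_wpDl.
have hL' s t e : 0 < e -> `|s - t| < e / (`|L| + 1) -> nm (F s - F t) < e.
  move=> e0; rewrite ltr_pdivlMr // => h; apply: le_lt_trans (hL s t) _; apply: le_lt_trans h.
  by rewrite mulrC ler_wpM2l // (le_trans (ler_norm L)) // lerDl.
pose A := [set t | 0 <= t <= 1 /\ forall s, 0 <= s <= t -> invb (F s)].
have A0 : A 0.
  by split=> [|s /andP[s0 s0']]; [rewrite lexx ler01 | rewrite (_ : s = 0) //; apply: le_anti; rewrite s0'].
have hA : has_sup A by split; [exists 0 | exists 1 => t [/andP[]]].
pose t := sup A.
have t0 : 0 <= t by apply: ub_le_sup A0; exact: hA.2.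
have t1 : t <= 1 by apply: ge_sup; [exists 0 | move=> s [/andP[]]].
have below s : 0 <= s -> s < t -> invb (F s).
  move=> s0 st; have [u [_ hu] su] := sup_adherent (ltac:(by rewrite subr_gt0) : 0 < t - s) hA.
  by apply: hu; rewrite s0 /=; move: su; rewrite -/t => su; rewrite ltW //; lra.
have it : invb (F t).
  have [c c0 hc] := hb t (ltac:(by rewrite t0 t1)).
  have [t00|tpos] := leP t 0.
    by rewrite (_ : t = 0) //; apply: le_anti; rewrite t00.
  apply: (inv_lim (u := fun n => F (t - t * n.+1%:R^-1)) c0 hc) => [|n].
    move=> e e0; have d0 : 0 < e / (`|L| + 1) / (t + 1) by rewrite !divr_gt0 //; lra.
    have [N hN] := nat_small d0; exists N => n /hN; rewrite ltr_pdivlMr => [h|]; last lra.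
    apply: hL' => //; rewrite addrAC subrr add0r normrN ger0_norm; last by rewrite mulr_ge0.
    by apply: le_lt_trans h; rewrite mulrC ler_wpM2l // lerDl.
  apply: below; first by rewrite subr_ge0 ler_piMr // invf_le1 // ler1n.
  by rewrite ltrBlDr ltrDl mulr_gt0.
have [t1'|tlt] := leP 1 t.
  by rewrite (_ : 1 = t) //; apply: le_anti; rewrite t1'.
have [g hg] := it; pose C := nm g + 1.
have C0 : 0 < C by rewrite /C ltr_wpDl ?nm_ge0.
have e0 : 0 < (2 * C)^-1 by rewrite invr_gt0 mulr_gt0.
pose d := (2 * C)^-1 / (`|L| + 1).
have d0 : 0 < d by rewrite divr_gt0.
have near s : `|s - t| < d -> invb (F s).
  move=> h; have [|g' [hg' _ _]] := @inv_pert _ _ _ _ (F s) C hg (ltac:(rewrite /C; lra)).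
    have /ltW := hL' _ _ _ e0 h; move=> /(ler_wpM2l (ltW C0)) h'; apply: le_trans h' _.
    by rewrite invfM mulrCA mulfV ?mulr1 // gt_eqF.
  by exists g'.
pose s := Num.min 1 (t + d / 2).
have ts : t < s by rewrite lt_min tlt ltrDl half_gt0.
have As : A s.
  split; first by rewrite (le_trans t0 (ltW ts)) ge_min lexx.
  move=> u /andP[u0 us]; have [ut|tu] := ltP u t; first exact: below.
  apply: near; rewrite ger0_norm ?subr_ge0 //.
  have : u <= t + d / 2 by apply: le_trans us _; rewrite ge_min lexx orbT.
  lra.
by have := ub_le_sup hA.2 As; rewrite -/t; lra.
Qed.

Lemma grow_eig T r z x : 0 <= r -> grow T r -> x != 0 -> T x = z *: x -> cabs z <= r.
Proof.
move=> r0 hT x0 Tx; rewrite leNgt; apply/negP => rz; have [g [_ hg]] := grow_invb r0 hT rz.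
apply/negP: x0; rewrite negbK -[x]bop_1E -hg bop_mulE bop_subE bop_scaleE bop_1E Tx subrr.
by rewrite bop0.
Qed.

(** Fredholm alternative: [seg_invb] applies along a ray to [z] from a far point, where a Neumann
    series inverts, provided that the ray meets no eigenvalue. *)
Lemma kop_invb k z : kop k -> z != 0 -> ~ (exists2 x, x != 0 & k x = z *: x) ->
  invb (z *: (1 : bop V) - k).
Proof.
move=> hk z0 nz; have cz : 0 < cabs z by rewrite cabs_gt0.
have [s hs] := kop_eig_fin hk cz.
(* The ray is [z (1 + t w)]. Its slope [j] exceeds those of the finitely many eigenvalues of modulus
   at least [|z|], and since [w] has real part 1 the modulus on the ray is at least [|z|]. *)
pose slope (l : R[i]) : R := complex.Im (l / z - 1) / complex.Re (l / z - 1).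
pose j : nat := (Num.truncn (\sum_(l <- s) `|slope l|)).+1.
pose w : R[i] := (1 +i* j%:R)%C.
have jP l : l \in s -> slope l != j%:R.
  move=> ls; apply/eqP => e.
  have h1 : `|slope l| <= \sum_(l <- s) `|slope l| by rewrite (big_rem l ls) /= lerDl sumr_ge0.
  have h2 := truncnS_gt (\sum_(l <- s) `|slope l|); rewrite -/j -e in h2.
  by have := ler_norm (slope l); lra.
pose p (t : R) : R[i] := z * (1 + t%:C%C * w).
have cp t : 0 <= t -> cabs z * (1 + t) <= cabs (p t).
  move=> t0; rewrite cabsM ler_wpM2l ?cabs_ge0 //.
  apply: le_trans (cabs_Re _); apply: le_trans (ler_norm _).
  by rewrite /= mul0r subr0 mulr1.
have pne t : 0 <= t -> ~ (exists2 x, x != 0 & k x = p t *: x).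
  move=> t0 ex; have [t00|tpos] := leP t 0.
    have te : t = 0 by apply: le_anti; rewrite t00.
    by apply: nz; move: ex; rewrite /p te mul0r addr0 mulr1.
  have ps : p t \in s.
    by apply: hs => //; apply: le_trans (cp t t0); rewrite ler_peMr ?cabs_ge0 // lerDl.
  have := jP _ ps; rewrite /slope /p mulrAC mulfV // mul1r addrAC subrr add0r /=.
  by rewrite !mul0r subr0 addr0 mulr1 mulrAC mulfV ?mul1r ?eqxx // gt_eqF.
pose M := nm k / cabs z + 1.
have M0 : 0 <= M by rewrite /M addr_ge0 // divr_ge0 ?nm_ge0 ?cabs_ge0.
pose F (t : R) : bop V := p (M * (1 - t)) *: (1 : bop V) - k.
have FE t t' : F t - F t' = (p (M * (1 - t)) - p (M * (1 - t'))) *: (1 : bop V).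
  by rewrite /F opprB addrA subrK scalerBl.
have F1 : F 1 = z *: (1 : bop V) - k by rewrite /F subrr mulr0 /p mul0r addr0 mulr1.
rewrite -F1; apply: (@seg_invb F (cabs z * cabs w * M)) => [t t'||t /andP[t0 t1]].
- rewrite FE nmZ; apply: le_trans (_ : cabs (p (M * (1 - t)) - p (M * (1 - t'))) * 1 <= _).
    by rewrite ler_wpM2l ?cabs_ge0 // nm1_le.
  have pB (a b : R) : p a - p b = z * ((a - b)%:C%C * w) by rewrite /p rmorphB; ring.
  rewrite mulr1 pB !cabsM cabs_real (_ : _ - _ = M * (t' - t)); last by ring.
  by rewrite normrM (ger0_norm M0) distrC le_eqVlt; apply/orP; left; apply/eqP; ring.
- have Mp : 0 <= M * (1 - 0) by rewrite subr0 mulr1.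
  apply: (grow_invb (nm_ge0 _) (grow_nm k)); apply: lt_le_trans (cp _ Mp).
  by rewrite subr0 mulr1 mulrC -ltr_pdivrMr // /M; lra.
have tp : 0 <= M * (1 - t) by rewrite mulr_ge0 // subr_ge0.
have p0 : p (M * (1 - t)) != 0.
  by rewrite -cabs_gt0; apply: lt_le_trans (cp _ tp); rewrite mulr_gt0 //; lra.
by have [/(pne _ tp)//|] := kop_eig_or_below hk p0.
Qed.

Lemma kop_circle k r1 r2 : kop k -> 0 < r1 -> r1 < r2 ->
  exists r, [/\ r1 < r, r < r2 & forall z, cabs z = r -> invb (z *: (1 : bop V) - k)].
Proof.
move=> hk r10 r12; have [s hs] := kop_eig_fin hk r10.
have [a [b [ra ab br hab]]] : exists a b : R, [/\ r1 <= a, a < b, b <= r2 &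
    forall z, z \in s -> a < cabs z -> cabs z < b -> False].
  elim: s {hs} => [|z s [a [b [ra ab br hab]]]]; first by exists r1, r2; split=> //.
  have [az|za] := ltP a (cabs z); last first.
    exists a, b; split=> // u; rewrite inE => /predU1P[->|/hab//]; lra.
  have [zb|bz] := ltP (cabs z) b; last first.
    exists a, b; split=> // u; rewrite inE => /predU1P[->|/hab//]; lra.
  exists a, (cabs z); split=> //; first lra.
  move=> u; rewrite inE => /predU1P[->|us] h1 h2; first lra.
  by apply: (hab u us h1); lra.
exists ((a + b) / 2); split; [lra|lra|move=> z zr].
have z0 : z != 0 by rewrite -cabs_gt0 zr; lra.
by apply: kop_invb => // ex; apply: (hab z); [apply: hs => //|..]; lra.
Qed.

Lemma kop_qn k : kop k -> (forall z x, z != 0 -> k x = z *: x -> x = 0) -> qn k.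
Proof.
move=> hk h; apply: qn_spec => z z0; apply: kop_invb => // -[x /negP x0 kx]; apply: x0.
by rewrite (h z x).
Qed.

Lemma kop_nqn_eig k : kop k -> ~ qn k -> exists z x, [/\ z != 0, x != 0 & k x = z *: x].
Proof.
move=> hk nq; apply: contrapT => no; apply: nq; apply: kop_qn => // z x z0 kx.
by apply/eqP/negPn/negP => x0; apply: no; exists z, x.
Qed.

Lemma circ_scale T r : 0 < r -> (forall z, cabs z = r -> invb (z *: (1 : bop V) - T)) ->
  circ ((r^-1)%:C%C *: T).
Proof.
move=> r0 hT u u1; pose s := (r^-1)%:C%C : R[i].
have cs : cabs s = r^-1 by rewrite cabs_nneg // invr_ge0 ltW.
have sE : s * r%:C%C = 1 by rewrite -rmorphM mulVf ?rmorph1 // gt_eqF.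
have [|g hg] := hT (r%:C%C * u); first by rewrite cabsM u1 mulr1 cabs_nneg // ltW.
exists (s^-1 *: g); have -> : u *: (1 : bop V) - s *: T = s *: ((r%:C%C * u) *: (1 : bop V) - T).
  by rewrite scalerBr scalerA mulrA sE mul1r.
by apply: inv_ofZ; rewrite // -cabs_gt0 cs invr_gt0.
Qed.

(** If [k] had a nonzero eigenvalue, some circle of smaller radius would be free of spectrum, and
    [circ_lim_grow] would confine all eigenvalues to its inside. *)
Lemma kop_lim_qn k : kop k -> (forall e, 0 < e -> exists2 T, qn T & nm (T - k) < e) -> qn k.
Proof.
move=> hk hT; apply: kop_qn => // z x z0 kx; apply/eqP/negPn/negP => x0.
have cz : 0 < cabs z by rewrite cabs_gt0.
have [r [r1 r2 hr]] := @kop_circle k (cabs z / 2) (cabs z) hk (half_gt0 cz) ltac:(lra).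
have r0 : 0 < r by lra.
pose s := (r^-1)%:C%C : R[i].
have cs : cabs s = r^-1 by rewrite cabs_nneg // invr_ge0 ltW.
have [e e0|t [t0 t1 gt]] := circ_lim_grow (circ_scale r0 hr).
  have [T qT Tk] := hT _ (mulr_gt0 e0 r0); exists (s *: T); first exact: qnZ.
  by rewrite -scalerBr nmZ cs mulrC ltr_pdivrMr.
have := grow_eig (ltW t0) gt x0 (_ : _ = (s * z) *: x); rewrite bop_scaleE kx scalerA => /(_ erefl).
by rewrite cabsM cs mulrC ler_pdivrMr //; nra.
Qed.

End CompactSpectrum.

(** * Finite-rank operators and traces *)

Section MatrixTrace.
Context {R : realType}.

Lemma trig_pow n (T : 'M[R[i]]_n) m : is_trig_mx T ->
  is_trig_mx (T ^+ m) /\ forall i, (T ^+ m) i i = T i i ^+ m.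
Proof.
move=> /is_trig_mxP hT; elim: m => [|m [/is_trig_mxP h1 h2]].
  by split=> [|i]; rewrite expr0; [apply/is_trig_mxP => i j ij; rewrite !mxE -val_eqE /= (ltn_eqF ij) | rewrite !mxE eqxx].
rewrite exprS; split=> [|i].
  apply/is_trig_mxP => i j ij; rewrite mxE big1 // => k _.
  have [ik|ki] := ltnP i k; first by rewrite hT ?mul0r.
  by rewrite h1 ?mulr0 // (leq_ltn_trans ki).
rewrite mxE (bigD1 i) //= big1 ?addr0 ?h2 ?exprS // => k ki.
have [ik|ki'] := ltnP i k; first by rewrite hT ?mul0r.
by rewrite h1 ?mulr0 // ltn_neqAle ki' andbT.
Qed.

(** The [l i] are the diagonal entries of a Schur triangular form, that is, the eigenvalues with
    multiplicity. *)
Lemma mxtrace_pow n (A : 'M[R[i]]_n) : exists l : 'I_n -> R[i],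
  [/\ forall m, \tr (A ^+ m) = \sum_i l i ^+ m,
      forall i, eigenvalue A (l i) & forall a, eigenvalue A a -> exists i, a = l i].
Proof.
case: n A => [|n] A.
  exists (fun=> 0); split=> [m|[]//|a /eigenvalueP[v _]]; first by rewrite /mxtrace !big_ord0.
  by rewrite (_ : v = 0) ?eqxx //; apply/rowP => -[].
have [P uP sP] := Schur A isT.
have uP' := unitarymx_unit uP.
set T := conjmx P A; have tT : is_trig_mx T by [].
have TE : T = P *m A *m invmx P by rewrite /T conjumx.
have simT : similar P A T by rewrite /similar_to /= eqxx.
have eT a : eigenvalue A a = eigenvalue T a.
  by rewrite !eigenvalue_root_min (similar_mxminpoly uP' simT).
have rT a : eigenvalue T a = [exists i, a == T i i].
  rewrite eigenvalue_root_char char_poly_trig // /root horner_prod.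
  apply/prodf_eq0/existsP => [[i _]|[i hi]]; first by rewrite !hornerE subr_eq0; exists i.
  by exists i; rewrite // !hornerE subr_eq0.
exists (fun i => T i i); split=> [m|i|a].
- have TX : T ^+ m = P *m (A ^+ m) *m invmx P.
    elim: m => [|m IH]; first by rewrite !expr0 mulmx1 mulmxV.
    by rewrite !exprS IH {1}TE -[LHS]/(_ *m _) !mulmxA mulmxKV.
  have -> : \tr (A ^+ m) = \tr (T ^+ m) by rewrite TX mxtrace_mulC mulmxA mulVmx // mul1mx.
  by apply: eq_bigr => i _; rewrite (trig_pow m tT).2.
- by rewrite eT rT; apply/existsP; exists i.
- by rewrite eT rT => /existsP[i /eqP]; exists i.
Qed.

(* Newton-free recovery of the [l i]: test against a polynomial vanishing at 0
   and at all values but one. *)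
Lemma power_sums0 (n : nat) (l : 'I_n -> R[i]) :
  (forall m, \sum_i l i ^+ m.+1 = 0) -> forall i, l i = 0.
Proof.
move=> h i0; apply/eqP/negPn/negP => li0.
have hp (p : {poly R[i]}) : \sum_i (p * 'X).[l i] = 0.
  transitivity (\sum_i \sum_(j < size p) p`_j * l i ^+ j.+1).
    apply: eq_bigr => i _; rewrite hornerMX horner_coef mulr_suml.
    by apply: eq_bigr => j _; rewrite exprSr mulrA.
  rewrite exchange_big big1 //= => j _; rewrite -mulr_sumr h mulr0 //.
pose p := \prod_(i | l i != l i0) ('X - (l i)%:P).
have pE i : (p * 'X).[l i] = if l i == l i0 then (p * 'X).[l i0] else 0.
  case: eqP => [->//|/eqP hi]; rewrite hornerM /p horner_prod (bigD1 i) //=.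
  by rewrite !hornerE subrr !mul0r.
have := hp p; under eq_bigr => i _ do rewrite pE.
rewrite -big_mkcond /= sumr_const => /eqP; rewrite mulrn_eq0 hornerMX mulf_eq0 (negbTE li0) orbF.
have -> : (#|[pred i | l i == l i0]| == 0%N) = false.
  by apply/negP => /eqP /card0_eq /(_ i0); rewrite !inE eqxx.
rewrite /= /p horner_prod => /prodf_eq0[i hi]; rewrite !hornerE subr_eq0 eq_sym.
by rewrite (negbTE hi).
Qed.

End MatrixTrace.

(** * Finite-rank operators and their trace *)

Section FiniteRank.
Context {R : realType} {V : banType R}.
Implicit Types (f g y : bop V) (x w : V) (a z : R[i]).

Definition is_fun (phi : V -> R[i]) := (forall a (x y : V), phi (a *: x + y) = a * phi x + phi y) /\
  exists C : R, forall x, cabs (phi x) <= C * nm x.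

(** The vectors [e i] may be dependent, so that sums and products of representations are again
    representations; [ftrE] shows that the trace does not depend on the choice. *)
Definition frep n (e : 'I_n -> V) (phi : 'I_n -> V -> R[i]) f :=
  (forall i, is_fun (phi i)) /\ forall x, f x = \sum_i phi i x *: e i.

Definition fr f := exists n e phi, @frep n e phi f.

Lemma is_fun0 phi : is_fun phi -> phi 0 = 0.
Proof. by move=> [h _]; have := h (-1) 0 0; rewrite scaler0 addr0 mulN1r addNr. Qed.

Lemma is_funD phi (x y : V) : is_fun phi -> phi (x + y) = phi x + phi y.
Proof. by move=> [h _]; have := h 1 x y; rewrite scale1r mul1r. Qed.

Lemma is_funZ phi a x : is_fun phi -> phi (a *: x) = a * phi x.
Proof. by move=> h; rewrite -[a *: x]addr0 h.1 is_fun0 // addr0. Qed.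

Lemma is_fun_sum phi (I : Type) (s : seq I) (P : pred I) (F : I -> V) : is_fun phi ->
  phi (\sum_(i <- s | P i) F i) = \sum_(i <- s | P i) phi (F i).
Proof.
by move=> h; elim/big_rec2: _ => [|i x y _ <-]; rewrite ?is_fun0 ?is_funD.
Qed.

Lemma is_fun_comp phi f : is_fun phi -> is_fun (fun x => phi (f x)).
Proof.
move=> [h [C hC]]; split=> [a x y|]; first by rewrite bop_lin h.
exists (`|C| * nm f) => x; apply: le_trans (hC _) _.
apply: le_trans (_ : `|C| * nm (f x) <= _); first by rewrite ler_wpM2r ?nm_ge0 ?ler_norm.
by rewrite -mulrA ler_wpM2l // nm_bopP.
Qed.

Lemma is_funM phi a : is_fun phi -> is_fun (fun x => a * phi x).
Proof.
move=> [h [C hC]]; split=> [b x y|]; first by rewrite h mulrDr !mulrA (mulrC a b).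
by exists (cabs a * C) => x; rewrite cabsM -mulrA ler_wpM2l ?cabs_ge0.
Qed.

Lemma is_fun_add phi psi : is_fun phi -> is_fun psi -> is_fun (fun x => phi x + psi x).
Proof.
move=> [h [C hC]] [h' [C' hC']]; split=> [b x y|]; first by rewrite h h' mulrDr addrACA.
by exists (C + C') => x; rewrite mulrDl; apply: le_trans (cabsD _ _) (lerD _ _).
Qed.

Lemma is_fun_zero : is_fun (fun=> 0).
Proof.
by split=> [a x y|]; [rewrite mulr0 addr0 | exists 0 => x; rewrite cabs0 mul0r].
Qed.

Lemma is_fun_bigsum (I : finType) (F : I -> V -> R[i]) : (forall i, is_fun (F i)) ->
  is_fun (fun x => \sum_i F i x).
Proof.
move=> h; rewrite /index_enum; elim: (Finite.enum _) => [|i s IH].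
  rewrite (_ : (fun=> _) = fun=> 0); first exact: is_fun_zero.
  by apply/funext => x; rewrite big_nil.
rewrite (_ : (fun=> _) = fun x => F i x + \sum_(j <- s) F j x); first exact: is_fun_add.
by apply/funext => x; rewrite big_cons.
Qed.

Lemma frepD m n e phi e' phi' f g : @frep m e phi f -> @frep n e' phi' g ->
  @frep (m + n) (fun i => match fintype.split i with inl j => e j | inr k => e' k end)
    (fun i => match fintype.split i with inl j => phi j | inr k => phi' k end) (f + g).
Proof.
move=> [h1 h2] [h1' h2']; split=> [i|x]; first by case: fintype.split.
rewrite bop_addE h2 h2' big_split_ord; congr (_ + _); apply: eq_bigr => i _.
  by rewrite (unsplitK (inl i : 'I_m + 'I_n)).
by rewrite (unsplitK (inr i : 'I_m + 'I_n)).
Qed.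

Lemma frepMr n e phi f y : @frep n e phi f -> frep e (fun i x => phi i (y x)) (f * y).
Proof. by move=> [h1 h2]; split=> [i|x]; [exact: is_fun_comp | rewrite bop_mulE h2]. Qed.

Lemma frepMl n e phi f y : @frep n e phi f -> frep (fun i => y (e i)) phi (y * f).
Proof.
move=> [h1 h2]; split=> // x; rewrite bop_mulE h2 bop_sum.
by apply: eq_bigr => i _; rewrite bopZ.
Qed.

Lemma frepZ n e phi f a : @frep n e phi f -> frep (fun i => a *: e i) phi (a *: f).
Proof.
move=> [h1 h2]; split=> // x; rewrite bop_scaleE h2 scaler_sumr.
by apply: eq_bigr => i _; rewrite !scalerA mulrC.
Qed.

(** The matrix by which [f] acts on rows of coordinates, see [frep_row]. *)
Definition frmx n (e : 'I_n -> V) (phi : 'I_n -> V -> R[i]) : 'M[R[i]]_n :=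
  \matrix_(i, j) phi j (e i).

Lemma frep_row n e phi f x : @frep n e phi f ->
  \row_i phi i (f x) = (\row_i phi i x) *m frmx e phi.
Proof.
move=> [h1 h2]; apply/rowP => j; rewrite !mxE h2 is_fun_sum //.
by apply: eq_bigr => i _; rewrite !mxE is_funZ.
Qed.

Lemma frep_pow n e phi f m : @frep n e phi f ->
  frep e (fun i x => ((\row_i phi i x) *m frmx e phi ^+ m) 0 i) (f ^+ m.+1).
Proof.
move=> h; split=> [i|x].
  rewrite (_ : (fun=> _) = fun x => \sum_j (frmx e phi ^+ m) j i * phi j x).
    by apply: is_fun_bigsum => j; apply: is_funM; apply: h.1.
  by apply/funext => x; rewrite mxE; apply: eq_bigr => j _; rewrite mxE mulrC.
elim: m x => [|m IH] x.
  by rewrite expr1 h.2; apply: eq_bigr => i _; rewrite expr0 mulmx1 mxE.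
rewrite exprSr bop_mulE IH; apply: eq_bigr => i _.
by rewrite (frep_row x h) -mulmxA exprS.
Qed.

Lemma frep_tr_pow n e phi f m : @frep n e phi f ->
  \sum_i ((\row_j phi j (e i)) *m frmx e phi ^+ m) 0 i = \tr (frmx e phi ^+ m.+1).
Proof.
move=> h; rewrite exprS; apply: eq_bigr => i _; rewrite !mxE.
by apply: eq_bigr => j _; rewrite !mxE.
Qed.

(* If [f = 0] then the matrix of any representation squares to zero. *)
Lemma frep0_tr n e phi : @frep n e phi 0 -> \sum_i phi i (e i) = 0.
Proof.
move=> h; set A := frmx e phi.
have A2 : A *m A = 0.
  apply/row_matrixP => i; rewrite row_mul row0.
  have -> : row i A = \row_j phi j (e i) by apply/rowP => j; rewrite !mxE.
  rewrite -(frep_row (e i) h); apply/rowP => j; rewrite !mxE bop_0E.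
  by rewrite is_fun0 //; apply: h.1.
have [l [hl eigl _]] := mxtrace_pow A.
have l0 i : l i = 0.
  have /eigenvalueP[v hv v0] := eigl i.
  have : v *m (A *m A) = l i ^+ 2 *: v.
    by rewrite mulmxA hv -scalemxAl hv scalerA.
  rewrite A2 mulmx0 => /esym/eqP; rewrite scaler_eq0 (negbTE v0) orbF expf_eq0 /=.
  by move/eqP.
have := hl 1%N; rewrite expr1 big1 => [h1|i _]; last by rewrite l0 expr1.
by rewrite -[RHS]h1; apply: eq_bigr => i _; rewrite mxE.
Qed.

Definition ftr f : R[i] := if pselect (exists a n e phi, @frep n e phi f /\ a = \sum_i phi i (e i))
  is left h then sval (cid h) else 0.

Lemma ftrE n e phi f : @frep n e phi f -> ftr f = \sum_i phi i (e i).
Proof.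
move=> h; rewrite /ftr; case: pselect => [p|[]]; last by exists (\sum_i phi i (e i)), n, e, phi.
case: cid => a /= [m [e' [phi' [h' ->]]]].
have h0 := frepD h' (frepZ (-1) h); rewrite scaleN1r subrr in h0.
have := frep0_tr h0; rewrite big_split_ord /= => /eqP; rewrite addr_eq0 => /eqP.
have -> : \sum_i match fintype.split (lshift n i) with inl j => phi' j | inr k => phi k end
    match fintype.split (lshift n i) with inl j => e' j | inr k => -1 *: e k end = \sum_i phi' i (e' i).
  by apply: eq_bigr => i _; rewrite (unsplitK (inl i : 'I_m + 'I_n)).
move=> ->; rewrite -sumrN; apply: eq_bigr => i _; rewrite (unsplitK (inr i : 'I_m + 'I_n)).
by rewrite is_funZ ?mulN1r ?opprK //; apply: h.1.
Qed.

Lemma fr0 : fr 0.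
Proof. by exists 0%N, (fun=> 0), (fun=> fun=> 0); split=> [[]//|x]; rewrite big_ord0. Qed.

Lemma frD f g : fr f -> fr g -> fr (f + g).
Proof. by move=> [m [e [phi h]]] [n [e' [phi' h']]]; have := frepD h h'; do 3 eexists; eassumption. Qed.

Lemma frZ a f : fr f -> fr (a *: f).
Proof. by move=> [m [e [phi h]]]; have := frepZ a h; do 3 eexists; eassumption. Qed.

Lemma frN f : fr f -> fr (- f).
Proof. by rewrite -scaleN1r; apply: frZ. Qed.

Lemma frB f g : fr f -> fr g -> fr (f - g).
Proof. by move=> hf hg; apply: frD => //; apply: frN. Qed.

Lemma frMl y f : fr f -> fr (y * f).
Proof. by move=> [m [e [phi h]]]; have := frepMl y h; do 3 eexists; eassumption. Qed.

Lemma frMr f y : fr f -> fr (f * y).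
Proof. by move=> [m [e [phi h]]]; have := frepMr y h; do 3 eexists; eassumption. Qed.

Lemma ftrD f g : fr f -> fr g -> ftr (f + g) = ftr f + ftr g.
Proof.
move=> [m [e [phi h]]] [n [e' [phi' h']]]; rewrite (ftrE h) (ftrE h') (ftrE (frepD h h')).
rewrite big_split_ord; congr (_ + _); apply: eq_bigr => i _.
  by rewrite (unsplitK (inl i : 'I_m + 'I_n)).
by rewrite (unsplitK (inr i : 'I_m + 'I_n)).
Qed.

Lemma ftrZ a f : fr f -> ftr (a *: f) = a * ftr f.
Proof.
move=> [m [e [phi h]]]; rewrite (ftrE h) (ftrE (frepZ a h)) mulr_sumr.
by apply: eq_bigr => i _; rewrite is_funZ //; apply: h.1.
Qed.

Lemma ftrN f : fr f -> ftr (- f) = - ftr f.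
Proof. by move=> h; rewrite -scaleN1r ftrZ // mulN1r. Qed.

Lemma ftrB f g : fr f -> fr g -> ftr (f - g) = ftr f - ftr g.
Proof. by move=> hf hg; rewrite ftrD ?ftrN //; apply: frN. Qed.

Lemma ftr0 : ftr 0 = 0.
Proof. by rewrite -(scale0r (0 : bop V)) ftrZ ?mul0r //; exact: fr0. Qed.

Lemma ftrC f y : fr f -> ftr (f * y) = ftr (y * f).
Proof. by move=> [m [e [phi h]]]; rewrite (ftrE (frepMl y h)) (ftrE (frepMr y h)). Qed.

Lemma ftr_lip f : fr f -> exists2 C : R, 0 <= C & forall y, cabs (ftr (f * y)) <= C * nm y.
Proof.
move=> [m [e [phi h]]].
have hc i : exists C : R, forall y, cabs (phi i (y (e i))) <= C * nm y.
  have [_ [C hC]] := h.1 i; exists (`|C| * nm (e i)) => y; apply: le_trans (hC _) _.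
  apply: le_trans (_ : `|C| * nm (y (e i)) <= _); first by rewrite ler_wpM2r ?nm_ge0 ?ler_norm.
  by rewrite -mulrA ler_wpM2l // mulrC nm_bopP.
pose C i := sval (cid (hc i)); have hC i y : cabs (phi i (y (e i))) <= C i * nm y by rewrite /C; case: cid.
exists (\sum_i `|C i|); first by apply: sumr_ge0.
move=> y; rewrite (ftrE (frepMr y h)) mulr_suml; apply: le_trans (cabs_sum _ _ _) _.
apply: ler_sum => i _; apply: le_trans (hC _ _) _; by rewrite ler_wpM2r ?nm_ge0 ?ler_norm.
Qed.

(** The nonzero eigenvalues of [f] and of its matrix agree: a row eigenvector gives a combination of
    the [e k], and an eigenvector of [f] gives the row of its coordinates. *)
Lemma ftr_pow f : fr f -> exists n (l : 'I_n -> R[i]),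
  [/\ forall m, ftr (f ^+ m.+1) = \sum_i l i ^+ m.+1,
      forall i, l i != 0 -> exists2 x, x != 0 & f x = l i *: x &
      forall a x, a != 0 -> x != 0 -> f x = a *: x -> exists i, a = l i].
Proof.
move=> [n [e [phi h]]]; have [l [h1 h2 h3]] := mxtrace_pow (frmx e phi).
exists n, l; split=> [m|i li0|a x a0 x0 fx].
- by rewrite (ftrE (frep_pow m h)) (frep_tr_pow m h) h1.
- have /eigenvalueP[v hv v0] := h2 i.
  have phv : \row_j phi j (\sum_k v 0 k *: e k) = l i *: v.
    apply/rowP => j; rewrite -hv !mxE is_fun_sum; last exact: h.1.
    by apply: eq_bigr => k _; rewrite !mxE is_funZ //; apply: h.1.
  exists (\sum_k v 0 k *: e k).
    apply/eqP => e0; move/eqP: phv; rewrite e0 eq_sym => /eqP/rowP phv.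
    case/eqP: v0; apply/rowP => j; have := phv j; rewrite !mxE is_fun0; last exact: h.1.
    by move=> /eqP; rewrite mulf_eq0 (negbTE li0) /= => /eqP.
  rewrite h.2 scaler_sumr; apply: eq_bigr => j _; have /rowP/(_ j) := phv.
  by rewrite !mxE => ->; rewrite scalerA.
- apply: h3; apply/eigenvalueP; exists (\row_i phi i x).
    by rewrite -(frep_row x h) fx; apply/rowP => i; rewrite !mxE is_funZ //; apply: h.1.
  apply/eqP => /rowP p0; case/eqP: x0; have := h.2 x; rewrite fx big1 => [/eqP|i _].
    by rewrite scaler_eq0 (negbTE a0) => /eqP.
  by have := p0 i; rewrite !mxE => ->; rewrite scale0r.
Qed.

Lemma fr_tr_qn f : fr f -> (forall a x, a != 0 -> f x = a *: x -> x = 0) -> ftr f = 0.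
Proof.
move=> /ftr_pow[n [l [h1 h2 _]]] h; have := h1 0%N; rewrite !expr1 => ->; apply: big1 => i _.
by apply/eqP/negPn/negP => li; have [x x0 fx] := h2 i li; case/eqP: x0; exact: h li fx.
Qed.

Lemma fr_tr0_eig f : fr f -> (forall m, ftr (f ^+ m.+1) = 0) ->
  forall a x, a != 0 -> f x = a *: x -> x = 0.
Proof.
move=> /ftr_pow[n [l [h1 _ h3]]] h a x a0 fx; apply/eqP/negPn/negP => x0.
have [i ai] := h3 a x a0 x0 fx; case/eqP: a0; rewrite ai; apply: power_sums0 => m.
by rewrite -h1 h.
Qed.

End FiniteRank.

(** * Compact idempotents have finite rank; traces along a pencil *)

Section CompactIdempotents.
Context {R : realType} {V : banType R}.
Implicit Types (f g k p b : bop V) (x y w : V) (a z : R[i]) (W : set V).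

(** The coordinates are linear and bounded on [W] only, so no functional has to be extended;
    composition with the idempotent makes them global in [kop_idem_fr]. *)
Definition fdim W := csub W /\ exists n (e : 'I_n -> V) (phi : 'I_n -> V -> R[i]),
  [/\ forall i a x y, W x -> W y -> phi i (a *: x + y) = a * phi i x + phi i y,
      forall i, exists C : R, forall x, W x -> cabs (phi i x) <= C * nm x &
      forall x, W x -> x = \sum_i phi i x *: e i].

Definition add_line W y := [set x | exists a, W (x - a *: y)].

Lemma fdim_add_line W y : fdim W -> ~ W y -> fdim (add_line W y).
Proof.
move=> [[sW cW] [n [e [phi [h1 h2 h3]]]]] Wy.
have [d d0 hd] := notin_clos (fun h => Wy (cW _ h)).
have hd' a w : W w -> cabs a * d <= nm (w + a *: y).
  move=> Ww; have [->|a0] := eqVneq a 0; first by rewrite cabs0 mul0r nm_ge0.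
  have -> : w + a *: y = a *: (y - (- a^-1) *: w).
    by rewrite scalerBr scalerA mulrN mulfV // scaleN1r opprK addrC.
  by rewrite nmZ ler_wpM2l ?cabs_ge0 // hd //; apply: subspZ.
(* The coefficient along [y] modulo [W]. It is unique and bounded because [y] has positive distance
   [d] from [W]. *)
pose al x : R[i] := if pselect (exists a, W (x - a *: y)) is left h then sval (cid h) else 0.
have alP x : add_line W y x -> W (x - al x *: y) by rewrite /al; case: pselect => // h _; case: cid.
have uniq x a a' : W (x - a *: y) -> W (x - a' *: y) -> a = a'.
  move=> h h'; apply/eqP; rewrite -subr_eq0 -cabs_eq0 eq_le cabs_ge0 andbT.
  have := subspB sW h' h; rewrite opprB addrC addrA subrK => hw.
  have := hd' (a' - a) _ hw; rewrite scalerBl addrA subrK subrr nm0 => h4.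
  rewrite -cabsN opprB; nra.
have sWy : subsp (add_line W y).
  split=> [|a x x' [b hb] [b' hb']]; first by exists 0; rewrite scale0r subr0; exact: sW.1.
  exists (a * b + b'); have := sW.2 a _ _ hb hb'.
  by rewrite scalerBr scalerA addrACA -opprD -scalerDl.
have all a x x' : add_line W y x -> add_line W y x' -> al (a *: x + x') = a * al x + al x'.
  move=> hx hx'; apply: (uniq (a *: x + x')); first by apply/alP/sWy.2.
  have := sW.2 a _ _ (alP _ hx) (alP _ hx').
  by rewrite scalerBr scalerA addrACA -opprD -scalerDl.
have alb x : add_line W y x -> cabs (al x) <= d^-1 * nm x.
  move=> hx; have := hd' (al x) _ (alP _ hx); rewrite subrK => h.
  by rewrite mulrC ler_pdivlMr.
split; first split=> // x /clos_seq[u hu ux].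
  have [a ha] : exists a : R[i]^o, tends (fun n => al (u n) : R[i]^o) a.
    apply: cauchys_tends => r r0; have [N hN] := tends_cauchys ux (mulr_gt0 r0 d0).
    exists N => i j Ni Nj; rewrite nm_complexE.
    have -> : al (u i) - al (u j) = al (u i - u j).
      have := all (-1) (u j) (u i) (hu j) (hu i).
      by rewrite scaleN1r mulN1r addrC => ->; rewrite addrC.
    have := alb (u i - u j) (subspB sWy (hu i) (hu j)); rewrite mulrC ler_pdivlMr // => h.
    by rewrite -(ltr_pM2r d0); exact: le_lt_trans h (hN _ _ Ni Nj).
  exists a; apply: cW; apply: (@seq_clos _ _ _ (fun n => u n - al (u n) *: y)) => [m|]; first exact: alP.
  apply: tendsB ux _ => r r0; have y1 : 0 < nm y + 1 by rewrite ltr_wpDl ?nm_ge0.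
  have [N hN] := ha _ (divr_gt0 r0 y1); exists N => m /hN; rewrite nm_complexE ltr_pdivlMr // => h.
  rewrite -scalerBl nmZ; apply: le_lt_trans h; rewrite ler_wpM2l ?cabs_ge0 //.
  by rewrite lerDl.
exists n.+1, (fun i => if unlift ord0 i is Some j then e j else y),
  (fun i x => if unlift ord0 i is Some j then phi j (x - al x *: y) else al x); split.
- move=> i a x x' hx hx'; case: unliftP => [j _|_]; last exact: all.
  rewrite -h1; [|exact: alP|exact: alP]; congr (phi j _).
  by rewrite all // scalerBr scalerA addrACA -opprD -scalerDl.
- move=> i; case: unliftP => [j _|_]; last by exists d^-1; exact: alb.
  have [C hC] := h2 j; exists (`|C| * (1 + d^-1 * nm y)) => x hx.
  apply: le_trans (hC _ (alP _ hx)) _.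
  apply: le_trans (_ : `|C| * nm (x - al x *: y) <= _); first by rewrite ler_wpM2r ?nm_ge0 ?ler_norm.
  rewrite -mulrA ler_wpM2l //; apply: le_trans (nmB _ _) _; rewrite mulrDl mul1r lerD2l.
  by rewrite nmZ mulrAC ler_wpM2r ?nm_ge0 ?alb.
- move=> x hx; rewrite big_ord_recl unlift_none.
  rewrite (eq_bigr (fun j => phi j (x - al x *: y) *: e j)) => [|j _]; last by rewrite liftK.
  by rewrite -(h3 _ (alP _ hx)) addrC subrK.
Qed.

Lemma fdim0 : fdim [set 0].
Proof.
split; first exact: csub0.
by exists 0%N, (fun=> 0), (fun=> fun=> 0); split=> [[]//|[]//|x ->]; rewrite big_ord0.
Qed.

(** Otherwise Riesz vectors can be added forever inside the range; they are fixed by [p] and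
    pairwise 1/2 apart, against compactness. *)
Lemma kop_idem_fdim p : kop p -> p * p = p -> fdim [set x | p x = x].
Proof.
move=> hp pp; apply: contrapT => no.
have sp : subsp [set x | p x = x].
  by split=> [|a x y /= px py]; rewrite /= ?bop0 // bop_lin px py.
pose st := {W : set V | fdim W /\ W `<=` [set x | p x = x]}.
have step (W : st) : exists y, [/\ p y = y, nm y = 1 & forall v, sval W v -> 2^-1 <= nm (y - v)].
  case: W => W [fW Wp] /=.
  have [x [px Wx]] : exists x, p x = x /\ ~ W x.
    apply: contrapT => /forallNP h; apply: no; suff <- : W = [set x | p x = x] by [].
    by apply/seteqP; split=> // x px; apply: contrapT => Wx; apply: (h x).
  have [y [a [w [Ww a0 yE y1 hy]]]] := riesz fW.1 Wx.
  by exists y; split=> //; rewrite yE bopZ bopB px (Wp _ Ww).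
pose f (W : st) := sval (cid (step W)).
have fP (W : st) : [/\ p (f W) = f W, nm (f W) = 1 & forall v, sval W v -> 2^-1 <= nm (f W - v)].
  by rewrite /f; case: cid.
have nxt (W : st) : fdim (add_line (sval W) (f W)) /\
    add_line (sval W) (f W) `<=` [set x | p x = x].
  have [py y1 hy] := fP W; split.
    apply: fdim_add_line; first exact: (svalP W).1.
    by move=> /hy; rewrite subrr nm0 leNgt invr_gt0 ltr0n.
  move=> x [a /(svalP W).2 /= h]; rewrite -[x](subrK (a *: f W)) bopD h bopZ py //.
have W0 : fdim [set (0 : V)] /\ [set 0] `<=` [set x | p x = x].
  by split=> [|x ->]; [exact: fdim0 | exact: bop0].
pose F := fix F n : st := if n is n'.+1 then exist _ _ (nxt (F n')) else exist _ _ W0.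
pose u n := f (F n).
have uS n : sval (F n.+1) (u n).
  by exists 1; rewrite scale1r subrr; have [[[? _] _] _] := (svalP (F n)).1.
have up m n x : (m <= n)%N -> sval (F m) x -> sval (F n) x.
  move=> mn; rewrite -(subnKC mn); elim: (n - m)%N => [|j IH] h; rewrite ?addn0 ?addnS //.
  by exists 0; rewrite scale0r subr0; exact: IH.
have sep m n : (m < n)%N -> 2^-1 <= nm (u n - u m).
  by move=> mn; have [_ _ h] := fP (F n); apply: h; exact: (up m.+1 n _ mn (uS m)).
have [q hq [l hl]] := @kop_seq _ _ p u 1 hp (fun n => ltac:(by have [_ -> _] := fP (F n))).
have [N hN] := tends_cauchys hl (ltac:(lra) : 0 < 2^-1 :> R).
have := hN _ _ (leq_trans (hq N) (leqnSn _)) (leqnn N).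
have pu n : p (u n) = u n by have [-> _ _] := fP (F n).
by rewrite !pu ltNge sep // hq.
Qed.

Lemma kop_idem_fr p : kop p -> p * p = p -> fr p.
Proof.
move=> hp pp; have [_ [n [e [phi [h1 h2 h3]]]]] := kop_idem_fdim hp pp.
have ppx x : p (p x) = p x by rewrite -bop_mulE pp.
exists n, e, (fun i x => phi i (p x)); split=> [i|x]; last by rewrite -h3.
split=> [a x y|]; first by rewrite bop_lin h1.
have [C hC] := h2 i; exists (`|C| * nm p) => x; apply: le_trans (hC _ (ppx x)) _.
apply: le_trans (_ : `|C| * nm (p x) <= _); first by rewrite ler_wpM2r ?nm_ge0 ?ler_norm.
by rewrite -mulrA ler_wpM2l // nm_bopP.
Qed.

(* The trace of [f (1 - s b)^-1] vanishes for all [s]; compare first-order terms. *)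
Lemma ftr_pencil f b : fr f -> (forall s t, invb (1 - s *: b - t *: f)) ->
  ftr (f * b) = 0.
Proof.
move=> ff hi.
(* [1 - s b - t f = (1 - t f g) (1 - s b)], so invertibility for all [t] excludes nonzero
   eigenvalues of [f g]. *)
have tr_s s g : inv_of (1 - s *: b) g -> ftr (f * g) = 0.
  move=> hg; apply: fr_tr_qn; first exact: frMr.
  move=> a x a0 hx; have [h [h1 h2]] := hi s a^-1.
  have e1 : 1 - s *: b - a^-1 *: f = (1 - a^-1 *: (f * g)) * (1 - s *: b).
    by rewrite mulrBl mul1r bscalAl -mulrA hg.2 mulr1.
  have e2 : (1 - s *: b) * h * (1 - a^-1 *: (f * g)) = 1.
    have i1 : inv_of (1 - s *: b - a^-1 *: f) h by [].
    have [g1 g2] := hg.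
    have -> : (1 - a^-1 *: (f * g)) = (1 - s *: b - a^-1 *: f) * g.
      by rewrite e1 -mulrA g1 mulr1.
    by rewrite -mulrA (mulrA h) h2 mul1r g1.
  by rewrite -[x]bop_1E -e2 bop_mulE bop_subE bop_scaleE bop_1E hx scalerA mulVf // scale1r subrr bop0.
have f0 : ftr f = 0.
  by rewrite -[f]mulr1; apply: (tr_s 0); rewrite scale0r subr0; split; rewrite mulr1.
have [C C0 hC] := ftr_lip ff.
apply/eqP; rewrite -cabs_eq0; apply/eqP/le_anti; rewrite cabs_ge0 andbT.
set M := nm b; have M0 : 0 <= M by exact: nm_ge0.
pose K := C * (2 * (M * M)).
have K0 : 0 <= K by rewrite !mulr_ge0.
have bnd (r : R) : 0 < r -> r * M <= 2^-1 -> cabs (ftr (f * b)) <= r * K.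
  move=> r0 rM; pose s := r%:C%C : R[i].
  have cs : cabs s = r by rewrite cabs_nneg // ltW.
  have [||g hg ng] := @neumann1 _ _ (s *: b) 2^-1; [by rewrite invf_lt1 ?ltr1n | by rewrite nmZ cs |].
  have gE : g = 1 + s *: b + s *: (s *: (b * b * g)).
    have e1 : g = 1 + (s *: b) * g.
      by have := hg.1; rewrite mulrBl mul1r => /eqP; rewrite subr_eq => /eqP.
    by rewrite {1}e1 {1}e1 mulrDr mulr1 addrA bscalAl bscalAl bscalAr mulrA.
  have := tr_s s g hg; rewrite {1}gE !mulrDr mulr1 !bscalAr ftrD; last 2 first.
  - by apply: frD => //; apply: frZ; apply: frMr.
  - by apply: frZ; apply: frZ; apply: frMr.
  rewrite ftrD //; last by apply: frZ; apply: frMr.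
  rewrite f0 add0r ftrZ; last exact: frMr.
  rewrite ftrZ; last by apply: frZ; apply: frMr.
  rewrite -mulrDr => /eqP; rewrite mulf_eq0 -cabs_eq0 cs gt_eqF //= ftrZ; last exact: frMr.
  rewrite addr_eq0 => /eqP ->; rewrite cabsN cabsM cs ler_wpM2l ?(ltW r0) //.
  apply: le_trans (hC _) _; rewrite ler_wpM2l //.
  apply: le_trans (nmM _ _) _; rewrite mulrC ler_pM ?nm_ge0 ?nmM //.
  by apply: le_trans ng _; rewrite -[leRHS]invrK lef_pV2 ?posrE ?invr_gt0 ?subr_gt0 ?invf_lt1 ?ltr1n //; lra.
apply/ler_addgt0Pl => r r0; rewrite addr0.
pose d := Num.min (r / (K + 1)) (2^-1 / (M + 1)).
have d0 : 0 < d by rewrite lt_min !divr_gt0 // ltr_wpDl.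
have d1 : d <= r / (K + 1) by rewrite /d ge_min lexx.
have d2 : d <= 2^-1 / (M + 1) by rewrite /d ge_min lexx orbT.
move: d1 d2; rewrite !ler_pdivlMr ?ltr_wpDl // => d1 d2.
apply: le_trans (bnd d d0 _) _; first by apply: le_trans d2; rewrite ler_pM2l // lerDl.
by apply: le_trans d1; rewrite ler_pM2l // lerDl.
Qed.

End CompactIdempotents.

(** * Gaps of closed subspaces *)

Section Gap.
Context {R : realType} {V : banType R}.

Record gapdata := GapData { gtop : set V; gbot : set V;
  gtopP : csub gtop; gbotP : csub gbot; gsub : gbot `<=` gtop }.

Variable G : gapdata.
Local Notation Z := (gtop G).
Local Notation W := (gbot G).
Implicit Types (x y w : V) (a z : R[i]).

Let sZ : subsp Z. Proof. exact: (gtopP G).1. Qed.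
Let sW : subsp W. Proof. exact: (gbotP G).1. Qed.

(* Classes are encoded by chosen representatives. *)
Definition gcanon x : V := xget 0 [set y | Z y /\ W (x - y)].

Definition gap := {x : V | Z x /\ gcanon x = x}.

HB.instance Definition _ := gen_eqMixin gap.
HB.instance Definition _ := gen_choiceMixin gap.

Lemma gcanonP x : Z x -> Z (gcanon x) /\ W (x - gcanon x).
Proof.
move=> Zx; rewrite /gcanon; case: xgetP => [y _ //|no].
by case: (no x); split=> //; rewrite subrr; exact: sW.1.
Qed.

Lemma gcanon_eq x y : W (x - y) -> gcanon x = gcanon y.
Proof.
move=> Wxy; congr (xget 0 _); apply/seteqP; split=> t /= [Zt Wt]; split=> //.
  by have := subspB sW Wt Wxy; rewrite opprB addrC addrA subrK.
by have := subspD sW Wt Wxy; rewrite addrC addrA subrK.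
Qed.

Lemma gcanonK x : Z x -> Z (gcanon x) /\ gcanon (gcanon x) = gcanon x.
Proof.
by move=> Zx; have [h1 h2] := gcanonP Zx; split=> //; apply/esym/gcanon_eq.
Qed.

(** Vectors outside the top space go to the class of 0, which keeps the map total. *)
Definition cls x : gap :=
  if pselect (Z x) is left Zx then exist _ _ (gcanonK Zx) else exist _ _ (gcanonK sZ.1).

Definition grep (p : gap) : V := sval p.

Lemma grepP p : Z (grep p). Proof. exact: (svalP p).1. Qed.

Lemma gap_eq (p q : gap) : grep p = grep q -> p = q.
Proof. by case: p q => [x hx] [y hy] /= xy; subst y; rewrite (Prop_irrelevance hx hy). Qed.

Lemma grep_cls x : Z x -> grep (cls x) = gcanon x.
Proof. by move=> Zx; rewrite /cls; case: pselect. Qed.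

Lemma clsP x : Z x -> W (x - grep (cls x)).
Proof. by move=> Zx; rewrite grep_cls //; exact: (gcanonP Zx).2. Qed.

Lemma cls_eq x y : Z x -> Z y -> W (x - y) -> cls x = cls y.
Proof. by move=> Zx Zy h; apply: gap_eq; rewrite !grep_cls //; apply: gcanon_eq. Qed.

Lemma cls_eqE x y : Z x -> Z y -> cls x = cls y -> W (x - y).
Proof.
move=> Zx Zy h; have := subspB sW (clsP Zx) (clsP Zy); rewrite h.
by rewrite opprB addrA subrK.
Qed.

Lemma clsK p : cls (grep p) = p.
Proof. by apply: gap_eq; have [Zp hp] := svalP p; rewrite grep_cls. Qed.

Lemma gapP p : exists2 x, Z x & p = cls x.
Proof. by exists (grep p); rewrite ?clsK //; exact: grepP. Qed.

Definition gap_add p q := cls (grep p + grep q).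
Definition gap_opp p := cls (- grep p).
Definition gap_scale a p := cls (a *: grep p).

Fact gap_addE x y : Z x -> Z y -> gap_add (cls x) (cls y) = cls (x + y).
Proof.
move=> Zx Zy; apply: cls_eq; [by apply: subspD; rewrite //; exact: grepP | exact: subspD |].
have := subspN sW (subspD sW (clsP Zx) (clsP Zy)).
by rewrite opprD !opprB addrACA opprD.
Qed.
Fact gap_oppE x : Z x -> gap_opp (cls x) = cls (- x).
Proof.
move=> Zx; apply: cls_eq; [by apply: subspN; rewrite //; exact: grepP | exact: subspN |].
by have := clsP Zx; rewrite opprK addrC.
Qed.
Fact gap_scaleE a x : Z x -> gap_scale a (cls x) = cls (a *: x).
Proof.
move=> Zx; apply: cls_eq; [by apply: subspZ; rewrite //; exact: grepP | exact: subspZ |].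
by rewrite -scalerBr; apply: subspZ => //; have := subspN sW (clsP Zx); rewrite opprB.
Qed.

Fact gap_addA : associative gap_add.
Proof.
move=> p q r; have [x Zx ->] := gapP p; have [y Zy ->] := gapP q; have [z Zz ->] := gapP r.
by rewrite !gap_addE ?addrA //; apply: subspD.
Qed.
Fact gap_addC : commutative gap_add.
Proof. by move=> p q; rewrite /gap_add addrC. Qed.
Fact gap_add0 : left_id (cls 0) gap_add.
Proof.
move=> p; have [x Zx ->] := gapP p; rewrite gap_addE ?add0r //; exact: sZ.1.
Qed.
Fact gap_addN : left_inverse (cls 0) gap_opp gap_add.
Proof.
move=> p; have [x Zx ->] := gapP p; rewrite gap_oppE // gap_addE ?addNr //; exact: subspN.
Qed.
HB.instance Definition _ := GRing.isZmodule.Build gap gap_addA gap_addC gap_add0 gap_addN.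

Fact gap_scaleA a b p : gap_scale a (gap_scale b p) = gap_scale (a * b) p.
Proof.
have [x Zx ->] := gapP p; rewrite !gap_scaleE // ?scalerA //; exact: subspZ.
Qed.
Fact gap_scale1 : left_id 1 gap_scale.
Proof. by move=> p; rewrite /gap_scale scale1r clsK. Qed.
Fact gap_scaleDr : right_distributive gap_scale +%R.
Proof.
move=> a p q; have [x Zx ->] := gapP p; have [y Zy ->] := gapP q.
change (gap_scale a (gap_add (cls x) (cls y)) = gap_add (gap_scale a (cls x)) (gap_scale a (cls y))).
by rewrite gap_addE // !gap_scaleE ?gap_addE ?scalerDr //; try exact: subspZ; exact: subspD.
Qed.
Fact gap_scaleDl p : {morph gap_scale^~ p : a b / a + b}.
Proof.
move=> a b; have [x Zx ->] := gapP p.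
change (gap_scale (a + b) (cls x) = gap_add (gap_scale a (cls x)) (gap_scale b (cls x))).
by rewrite !gap_scaleE // gap_addE ?scalerDl //; exact: subspZ.
Qed.
HB.instance Definition _ := GRing.Zmodule_isLmodule.Build R[i] gap
  gap_scaleA gap_scale1 gap_scaleDr gap_scaleDl.

Lemma clsD x y : Z x -> Z y -> cls (x + y) = cls x + cls y.
Proof. by move=> Zx Zy; rewrite -gap_addE. Qed.
Lemma clsN x : Z x -> cls (- x) = - cls x.
Proof. by move=> Zx; rewrite -gap_oppE. Qed.
Lemma clsZ a x : Z x -> cls (a *: x) = a *: cls x.
Proof. by move=> Zx; rewrite -gap_scaleE. Qed.
Lemma clsB x y : Z x -> Z y -> cls (x - y) = cls x - cls y.
Proof. by move=> Zx Zy; rewrite clsD ?clsN //; exact: subspN. Qed.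
Lemma cls0 : cls 0 = 0. Proof. by []. Qed.
Lemma cls_eq0 x : Z x -> cls x = 0 <-> W x.
Proof.
move=> Zx; rewrite -cls0; split=> [/(cls_eqE Zx sZ.1)|h]; first by rewrite subr0.
by apply: cls_eq; rewrite ?subr0 //; exact: sZ.1.
Qed.

Definition gnm p : R := inf [set r | exists2 x, Z x /\ cls x = p & r = nm x].

Let hasg p : has_inf [set r | exists2 x, Z x /\ cls x = p & r = nm x].
Proof.
split; last by exists 0 => _ [x _ ->]; exact: nm_ge0.
by exists (nm (grep p)); exists (grep p) => //; split; [exact: grepP | exact: clsK].
Qed.

Lemma gnm_le x : Z x -> gnm (cls x) <= nm x.
Proof. by move=> Zx; apply: ge_inf; [exact: (hasg _).2 | exists x]. Qed.

Lemma gnm_lift p (e : R) : 0 < e -> exists x, [/\ Z x, cls x = p & nm x < gnm p + e].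
Proof. by move=> e0; have [_ [x [Zx xp] ->] h] := inf_adherent e0 (hasg p); exists x. Qed.

Lemma gnm_ge0 p : 0 <= gnm p.
Proof. by apply: lb_le_inf; [exact: (hasg p).1 | move=> _ [x _ ->]; exact: nm_ge0]. Qed.

Fact gnm_eq0 p : gnm p = 0 -> p = 0.
Proof.
move=> p0; have Zp := grepP p; rewrite -(clsK p); apply/cls_eq0 => //.
apply: (gbotP G).2 => e e0; have [x [Zx xp hx]] := gnm_lift p e0.
exists (grep p - x); last by rewrite opprB addrC subrK; move: hx; rewrite p0 add0r.
by apply: cls_eqE => //; rewrite clsK.
Qed.
Fact gnmD p q : gnm (p + q) <= gnm p + gnm q.
Proof.
apply/ler_addgt0Pl => e e0; have [x [Zx xp hx]] := gnm_lift p (half_gt0 e0).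
have [y [Zy yq hy]] := gnm_lift q (half_gt0 e0).
rewrite -xp -yq -clsD //; apply: le_trans (gnm_le (subspD sZ Zx Zy)) _.
by apply: le_trans (nmD _ _) _; rewrite xp yq; lra.
Qed.
Fact gnmZ_le a p : gnm (a *: p) <= cabs a * gnm p.
Proof.
have a1 : 0 < cabs a + 1 by rewrite ltr_wpDl ?cabs_ge0.
apply/ler_addgt0Pl => e e0; have [x [Zx xp hx]] := gnm_lift p (divr_gt0 e0 a1).
rewrite -{1}xp -clsZ //; apply: le_trans (gnm_le (subspZ _ sZ Zx)) _; rewrite nmZ.
have h1 : (gnm p + e / (cabs a + 1)) * (cabs a + 1) = gnm p * (cabs a + 1) + e.
  by rewrite mulrDl divfK // gt_eqF.
have h2 : nm x <= gnm p + e / (cabs a + 1) by exact: ltW.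
have h3 : 0 <= e / (cabs a + 1) by rewrite divr_ge0 // ltW.
have := cabs_ge0 a; nra.
Qed.
Fact gnmZ a p : gnm (a *: p) = cabs a * gnm p.
Proof.
apply/eqP; rewrite eq_le gnmZ_le /=; have [->|a0] := eqVneq a 0.
  by rewrite cabs0 mul0r gnm_ge0.
have := gnmZ_le a^-1 (a *: p); rewrite scalerA mulVf // scale1r cabsV.
by rewrite mulrC ler_pdivlMr ?cabs_gt0 // mulrC.
Qed.
(** Along a subsequence with increments below [2^-1 ^+ k] the increments are lifted one by one, and
    the lifts form an absolutely convergent series in [V]. *)
Fact gnm_complete (u : nat -> gap) :
  (forall e, 0 < e -> exists N, forall m n, (N <= m)%N -> (N <= n)%N -> gnm (u m - u n) < e) ->
  exists l, forall e, 0 < e -> exists N, forall n, (N <= n)%N -> gnm (u n - l) < e.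
Proof.
move=> hu; have h2 k : 0 < 2^-1 ^+ k :> R by rewrite exprn_gt0 // invr_gt0.
pose Nk k := sval (cid (hu _ (h2 k))).
have NkP k m n : (Nk k <= m)%N -> (Nk k <= n)%N -> gnm (u m - u n) < 2^-1 ^+ k.
  by rewrite /Nk; case: cid => N hN /= *; apply: hN.
pose p k := (\sum_(j < k.+1) Nk j)%N.
have pN j k : (j <= k)%N -> (Nk j <= p k)%N.
  by rewrite -ltnS => jk; rewrite /p (bigD1 (Ordinal jk)) //= leq_addr.
have lift k : exists y, [/\ Z y, cls y = u (p k.+1) - u (p k) & nm y <= 2 * 2^-1 ^+ k].
  have [y [Zy yE hy]] := gnm_lift (u (p k.+1) - u (p k)) (h2 k).
  exists y; split=> //; have := NkP k _ _ (pN k k.+1 (leqnSn k)) (pN k k (leqnn k)).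
  lra.
pose y k := sval (cid (lift k)).
have yP k : [/\ Z (y k), cls (y k) = u (p k.+1) - u (p k) & nm (y k) <= 2 * 2^-1 ^+ k].
  by rewrite /y; case: cid.
pose x k := grep (u (p 0%N)) + \sum_(j < k) y j.
have Zs k : Z (\sum_(j < k) y j) by apply: subsp_sum => // j _; have [] := yP j.
have Zx k : Z (x k) by apply: subspD => //; exact: grepP.
have xE k : cls (x k) = u (p k).
  rewrite clsD ?clsK //; last exact: grepP.
  elim: k => [|k IH]; first by rewrite big_ord0 cls0 addr0.
  rewrite big_ord_recr /=; have [Zy yE _] := yP k.
  by rewrite (clsD (Zs k) Zy) yE addrA IH addrC subrK.
have [|l hl _] := @geo_tends _ _ x 2 2^-1 ltac:(lra) ltac:(lra).
  by move=> k; rewrite /x big_ord_recr /= opprD addrACA subrr add0r addrAC subrr add0r; have [] := yP k.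
have Zl : Z l by apply: csub_tends (gtopP G) Zx hl.
exists (cls l) => e e0.
have [N1 hN1] := hl _ (half_gt0 e0); have [N2 hN2] := hu _ (half_gt0 e0).
have [N3 hN3] := @geo_small R 1 2^-1 _ ltac:(lra) ltac:(lra) (half_gt0 e0).
pose k := maxn N1 N3; exists (Nk k) => n hn.
have -> : u n - cls l = (u n - u (p k)) + cls (x k - l) by rewrite clsB // xE addrA subrK.
apply: le_lt_trans (gnmD _ _) _; rewrite [ltRHS]splitr; apply: ltrD.
  apply: lt_le_trans (NkP k _ _ hn (pN k k (leqnn k))) _.
  by have := hN3 k (leq_maxr _ _); rewrite mul1r => /ltW.
by apply: le_lt_trans (gnm_le (subspB sZ (Zx k) Zl)) (hN1 _ (leq_maxl _ _)).
Qed.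
HB.instance Definition _ := isBanach.Build R gap gnm_eq0 gnmD gnmZ gnm_complete.

Lemma nm_cls x : Z x -> nm (cls x) <= nm x. Proof. exact: gnm_le. Qed.

Lemma nm_lift p (e : R) : 0 < e -> exists x, [/\ Z x, cls x = p & nm x < nm p + e].
Proof. exact: gnm_lift. Qed.

Lemma cls_tends (u : nat -> V) l : (forall n, Z (u n)) -> tends u l -> tends (fun n => cls (u n)) (cls l).
Proof.
move=> hu ul e /ul[N hN]; exists N => n /hN; apply: le_lt_trans.
have Zl : Z l by apply: csub_tends (gtopP G) hu ul.
by rewrite -clsB //; apply: nm_cls; apply: subspB.
Qed.

Definition gstab (f : bop V) := (forall x, Z x -> Z (f x)) /\ (forall x, W x -> W (f x)).

Fact gind_subproof f : gstab f -> is_bop (fun p => cls (f (grep p))).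
Proof.
move=> [fZ fW]; have fE x : Z x -> cls (f (grep (cls x))) = cls (f x).
  move=> Zx; apply: cls_eq; try exact: fZ; first by apply/fZ/grepP.
  by rewrite -bopB; apply: fW; have := subspN sW (clsP Zx); rewrite opprB.
split=> [a p q|].
  have [x Zx ->] := gapP p; have [y Zy ->] := gapP q.
  rewrite -clsZ // -clsD //; last exact: subspZ.
  rewrite !fE //; last by apply: subspD => //; apply: subspZ.
  by rewrite bop_lin clsD ?clsZ //; try exact: fZ; apply: subspZ => //; exact: fZ.
exists (nm f) => p; apply/ler_addgt0Pl => e e0; have f1 : 0 < nm f + 1 by rewrite ltr_wpDl ?nm_ge0.
have [x [Zx <- hx]] := nm_lift p (divr_gt0 e0 f1).
rewrite fE //; apply: le_trans (nm_cls (fZ _ Zx)) _; apply: le_trans (nm_bopP f x) _.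
have h1 : (nm (cls x) + e / (nm f + 1)) * (nm f + 1) = nm (cls x) * (nm f + 1) + e.
  by rewrite mulrDl divfK // gt_eqF.
have h3 : 0 <= e / (nm f + 1) by rewrite divr_ge0 // ltW.
have := nm_ge0 f; nra.
Qed.

Definition gind f : bop gap := if pselect (gstab f) is left h then Bop (gind_subproof h) else 0.

Lemma gindE f x : gstab f -> Z x -> gind f (cls x) = cls (f x).
Proof.
move=> h Zx; rewrite /gind; case: pselect => // -[fZ fW] /=.
apply: cls_eq; try exact: fZ; first by apply/fZ/grepP.
by rewrite -bopB; apply: fW; have := subspN sW (clsP Zx); rewrite opprB.
Qed.

Lemma gind_ext f (g : bop gap) : gstab f -> (forall x, Z x -> g (cls x) = cls (f x)) -> g = gind f.
Proof.
move=> h hg; apply: bop_ext => p; have [x Zx ->] := gapP p.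
by rewrite gindE ?hg.
Qed.

Lemma nm_gind f : gstab f -> nm (gind f) <= nm f.
Proof.
move=> h; apply: nm_bop_le => [|p]; first exact: nm_ge0.
have f1 : 0 < nm f + 1 by rewrite ltr_wpDl ?nm_ge0.
apply/ler_addgt0Pl => e e0; have [x [Zx <- hx]] := nm_lift p (divr_gt0 e0 f1).
rewrite gindE //; apply: le_trans (nm_cls (h.1 _ Zx)) _; apply: le_trans (nm_bopP f x) _.
have h1 : (nm (cls x) + e / (nm f + 1)) * (nm f + 1) = nm (cls x) * (nm f + 1) + e.
  by rewrite mulrDl divfK // gt_eqF.
have h3 : 0 <= e / (nm f + 1) by rewrite divr_ge0 // ltW.
have := nm_ge0 f; nra.
Qed.

Lemma gstab1 : gstab 1. Proof. by []. Qed.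
Lemma gstab_lin a f g : gstab f -> gstab g -> gstab (a *: f + g).
Proof. by move=> [h1 h2] [h1' h2']; split=> x hx; [apply: sZ.2 | apply: sW.2]; auto. Qed.
Lemma gstabM f g : gstab f -> gstab g -> gstab (f * g).
Proof. by move=> [h1 h2] [h1' h2']; split=> x hx; rewrite bop_mulE; auto. Qed.
Lemma gstabX f n : gstab f -> gstab (f ^+ n).
Proof. by move=> h; elim: n => [|n IH]; [exact: gstab1 | rewrite exprS; exact: gstabM]. Qed.

Lemma gind1 : gind 1 = 1. Proof. by apply/esym/gind_ext. Qed.
Lemma gind_lin a f g : gstab f -> gstab g -> gind (a *: f + g) = a *: gind f + gind g.
Proof.
move=> hf hg; apply/esym/gind_ext => [|x Zx]; first exact: gstab_lin.
rewrite bop_addE bop_scaleE !gindE // -clsZ; last exact: hf.1.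
by rewrite -clsD //; [apply: subspZ => //; exact: hf.1 | exact: hg.1].
Qed.
Lemma gindM f g : gstab f -> gstab g -> gind (f * g) = gind f * gind g.
Proof.
move=> hf hg; apply/esym/gind_ext => [|x Zx]; first exact: gstabM.
by rewrite bop_mulE !gindE //; exact: hg.1.
Qed.
Lemma gindX f n : gstab f -> gind (f ^+ n) = gind f ^+ n.
Proof.
move=> h; elim: n => [|n IH]; first by rewrite !expr0 gind1.
by rewrite !exprS gindM ?IH //; exact: gstabX.
Qed.

Lemma gind_qn f : gstab f -> qn f -> qn (gind f).
Proof.
move=> h hf r r0; have [C C0 hC] := hf r r0; exists C => // n; apply: le_trans (hC n).
by rewrite -gindX //; apply: nm_gind; exact: gstabX.
Qed.

Lemma gind_kop f : gstab f -> kop f -> kop (gind f).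
Proof.
move=> h hf e e0.
(* Classes of norm at most 1 lift to vectors of norm below 2, hence the radius. *)
have tA : tbdd [set f x | x in [set x | Z x /\ nm x <= 2]].
  by apply: tbdd_sub (kop_ball 2 hf) => _ [x [_ x2] <-]; exists x.
have [s [hs1 hs]] := tbdd_net tA e0.
exists [seq cls y | y <- s] => _ [p p1 <-]; have {}p1 : nm p <= 1 := p1.
have [x [Zx xp hx]] := nm_lift p (ltr01 : 0 < 1 :> R).
rewrite -xp; have [|y ys xy] := hs (f x).
  by exists x => //=; split=> //; lra.
exists (cls y); first exact: map_f.
have [t [Zt _] ty] := hs1 _ ys; rewrite -ty in xy *.
have Zx' := h.1 _ Zx; have Zt' := h.1 _ Zt.
by rewrite gindE // -clsB //; apply: le_lt_trans (nm_cls (subspB sZ Zx' Zt')) xy.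
Qed.

End Gap.

(** * Exponentials *)

Section PowerSeries.
Context {R : realType} {V : banType R}.
Implicit Types (a b f g x y : bop V) (u v : nat -> bop V) (z c : R[i]) (r C : R) (l : seq (bop V)).

(* Coefficient sequences of entire functions. *)
Definition ent u := forall r, 0 < r -> exists2 C, 0 <= C & forall n, nm (u n) <= C * r ^+ n.

Definition psum z u : bop V :=
  if pselect (exists S, tends (fun n => \sum_(i < n) z ^+ i *: u i) S) is left h
  then sval (cid h) else 0.

(** The estimate is uniform on a disc, as needed for averages over circles and for the total
    boundedness of [exp (z a)] on a disc. *)
Lemma psum_tail z u : ent u -> exists2 C, 0 <= C &
  forall z' n, cabs z' <= cabs z -> nm (psum z' u - \sum_(i < n) z' ^+ i *: u i) <= C * 2^-1 ^+ n.
Proof.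
move=> hu; have c1 : 0 < (2 * (cabs z + 1))^-1 by rewrite invr_gt0 mulr_gt0 // ltr_wpDl ?cabs_ge0.
have [C C0 hC] := hu _ c1; exists (C * 2) => [|z' n zz]; first exact: mulr_ge0.
have h n' : nm (z' ^+ n' *: u n') <= C * 2^-1 ^+ n'.
  rewrite nmZ cabsX; apply: le_trans (_ : (cabs z + 1) ^+ n' * (C * (2 * (cabs z + 1))^-1 ^+ n') <= _).
    rewrite ler_pM ?nm_ge0 ?exprn_ge0 ?cabs_ge0 //.
    by rewrite lerXn2r ?nnegrE ?cabs_ge0 ?addr_ge0 ?cabs_ge0 //; lra.
  rewrite mulrCA -exprMn invfM mulrCA mulfV ?mulr1 //.
  by rewrite gt_eqF // ltr_wpDl ?cabs_ge0.
have [|S hS hS'] := @geo_tends _ _ (fun n => \sum_(i < n) z' ^+ i *: u i) C 2^-1 ltac:(lra) ltac:(lra).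
  by move=> m; rewrite big_ord_recr /= addrAC subrr add0r.
rewrite /psum; case: pselect => [hp|[]]; last by exists S.
case: cid => S' /= hS''; rewrite (tends_uniq hS'' hS) nmC; apply: le_trans (hS' n) _.
rewrite (_ : 1 - 2^-1 = 2^-1 :> R); last by lra.
by rewrite invrK mulrAC.
Qed.

Lemma psumP z u : ent u -> tends (fun n => \sum_(i < n) z ^+ i *: u i) (psum z u).
Proof.
move=> /(psum_tail z)[C C0 hC]; apply: (@tends_squeeze _ _ (fun n => C * 2^-1 ^+ n)) => [e e0|n].
  by apply: geo_small => //; lra.
by rewrite nmC; apply: hC.
Qed.

Lemma psum_uniq z u S : ent u -> tends (fun n => \sum_(i < n) z ^+ i *: u i) S -> psum z u = S.
Proof. by move=> hu; apply: tends_uniq; apply: psumP. Qed.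

Lemma entMl f u : ent u -> ent (fun n => f * u n).
Proof.
move=> hu r r0; have [C C0 hC] := hu r r0; exists (nm f * C) => [|n]; first by rewrite mulr_ge0 ?nm_ge0.
by apply: le_trans (nmM _ _) _; rewrite -mulrA ler_wpM2l ?nm_ge0.
Qed.

Lemma entMr f u : ent u -> ent (fun n => u n * f).
Proof.
move=> hu r r0; have [C C0 hC] := hu r r0; exists (nm f * C) => [|n]; first by rewrite mulr_ge0 ?nm_ge0.
by apply: le_trans (nmM _ _) _; rewrite mulrC -mulrA ler_wpM2l ?nm_ge0.
Qed.

Lemma psumMl z f u : ent u -> psum z (fun n => f * u n) = f * psum z u.
Proof.
move=> hu; apply: psum_uniq; first exact: entMl.
apply: tends_eq (tendsMl f (psumP z hu)) => n; rewrite mulr_sumr.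
by apply: eq_bigr => i _; rewrite bscalAr.
Qed.

Lemma psumMr z f u : ent u -> psum z (fun n => u n * f) = psum z u * f.
Proof.
move=> hu; apply: psum_uniq; first exact: entMr.
apply: tends_eq (tendsMr f (psumP z hu)) => n; rewrite mulr_suml.
by apply: eq_bigr => i _; rewrite bscalAl.
Qed.

Definition conv u v m : bop V := \sum_(i < m.+1) u i * v (m - i)%N.

Lemma ent_conv u v : ent u -> ent v -> ent (conv u v).
Proof.
move=> hu hv r r0; have [C C0 hC] := hu _ (half_gt0 r0); have [D D0 hD] := hv _ (half_gt0 r0).
exists (C * D) => [|m]; first exact: mulr_ge0.
apply: le_trans (nm_sum _ _ _) _.
apply: le_trans (_ : \sum_(i < m.+1) C * D * (r / 2) ^+ m <= _).
  apply: ler_sum => i _; apply: le_trans (nmM _ _) _.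
  have -> : (r / 2) ^+ m = (r / 2) ^+ i * (r / 2) ^+ (m - i) by rewrite -exprD subnKC // -ltnS.
  by rewrite mulrACA ler_pM ?nm_ge0.
rewrite sumr_const card_ord -mulrnAr ler_wpM2l ?mulr_ge0 // exprMn -mulrnAr.
rewrite -[leRHS]mulr1 ler_wpM2l ?exprn_ge0 ?(ltW r0) // exprVn -[leLHS]mulr_natl ler_pdivrMr ?exprn_gt0 //.
by rewrite mul1r -natrX ler_nat ltn_expl.
Qed.

Lemma tri_sum (F : nat -> nat -> bop V) n :
  \sum_(m < n) \sum_(i < m.+1) F i (m - i)%N = \sum_(i < n) \sum_(j < n - i) F i j.
Proof.
elim: n => [|n IH]; first by rewrite !big_ord0.
rewrite big_ord_recr /= IH [RHS]big_ord_recr /= subSnn big_ord1.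
rewrite [X in _ + X]big_ord_recr /= subnn addrA; congr (_ + _).
rewrite -big_split; apply: eq_bigr => i _ /=.
by rewrite subSn ?(ltnW (ltn_ord i)) // big_ord_recr.
Qed.

(** Cauchy product. The product of the partial sums differs from the partial sum of [conv u v] by
    terms with [i + j >= n]; there are at most [n * n] of them, each at most [C * D * 4^-1 ^+ n],
    and [n * n <= 4 * 2 ^+ n] leaves a geometric rate of one half. *)
Lemma psum_conv z u v : ent u -> ent v -> psum z (conv u v) = psum z u * psum z v.
Proof.
move=> hu hv; apply: psum_uniq; first exact: ent_conv.
have c1 : 0 < (4 * (cabs z + 1))^-1 by rewrite invr_gt0 mulr_gt0 // ltr_wpDl ?cabs_ge0.
have [C C0 hC] := hu _ c1; have [D D0 hD] := hv _ c1.
have key (w : nat -> bop V) (E : R) n : 0 <= E ->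
    (forall n, nm (w n) <= E * (4 * (cabs z + 1))^-1 ^+ n) -> nm (z ^+ n *: w n) <= E * 4^-1 ^+ n.
  move=> E0 hw; rewrite nmZ cabsX.
  apply: le_trans (_ : (cabs z + 1) ^+ n * (E * (4 * (cabs z + 1))^-1 ^+ n) <= _).
    rewrite ler_pM ?nm_ge0 ?exprn_ge0 ?cabs_ge0 //.
    by rewrite lerXn2r ?nnegrE ?cabs_ge0 ?addr_ge0 ?cabs_ge0 //; lra.
  rewrite mulrCA -exprMn invfM mulrCA mulfV ?mulr1 //.
  by rewrite gt_eqF // ltr_wpDl ?cabs_ge0.
have hd : tends (fun n => (\sum_(i < n) z ^+ i *: u i) * (\sum_(i < n) z ^+ i *: v i) -
    \sum_(i < n) z ^+ i *: conv u v i) 0.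
  apply: (@tends_squeeze _ _ (fun n => (C * D * 4) * 2^-1 ^+ n)) => [e e0|n].
    by apply: geo_small => //; lra.
  rewrite subr0.
  have -> : \sum_(i < n) z ^+ i *: conv u v i =
      \sum_(i < n) \sum_(j < n - i) (z ^+ i *: u i) * (z ^+ j *: v j).
    rewrite -(tri_sum (fun i j => (z ^+ i *: u i) * (z ^+ j *: v j))).
    apply: eq_bigr => m _; rewrite scaler_sumr; apply: eq_bigr => i _.
    by rewrite bscalAl bscalAr scalerA -exprD subnKC // -ltnS.
  rewrite mulr_suml -sumrB.
  apply: le_trans (nm_sum _ _ _) _.
  apply: le_trans (_ : \sum_(i < n) n%:R * (C * D * 4^-1 ^+ n) <= _).
    apply: ler_sum => i _; rewrite mulr_sumr.
    have -> : \sum_(j < n) (z ^+ i *: u i) * (z ^+ j *: v j) -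
        \sum_(j < n - i) (z ^+ i *: u i) * (z ^+ j *: v j) =
        \sum_(n - i <= j < n) (z ^+ i *: u i) * (z ^+ j *: v j).
      rewrite -(big_mkord xpredT (fun j => (z ^+ i *: u i) * (z ^+ j *: v j))).
      rewrite -(big_mkord xpredT (fun j => (z ^+ i *: u i) * (z ^+ j *: v j))).
      by rewrite (big_cat_nat (leq0n (n - i)) (leq_subr i n)) /= addrAC subrr add0r.
    apply: le_trans (nm_sum _ _ _) _.
    apply: le_trans (_ : \sum_(n - i <= j < n) (C * D * 4^-1 ^+ n) <= _).
      rewrite !big_seq; apply: ler_sum => j; rewrite mem_index_iota => /andP[ij jn].
      apply: le_trans (nmM _ _) _; apply: le_trans (ler_pM (nm_ge0 _) (nm_ge0 _) (key _ _ _ C0 hC) (key _ _ _ D0 hD)) _.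
      rewrite mulrACA ler_wpM2l ?mulr_ge0 // -exprD ler_wiXn2l //; try lra.
      by rewrite -leq_subLR.
    rewrite sumr_const_nat -[leLHS]mulr_natl ler_wpM2r ?mulr_ge0 ?exprn_ge0 //; try lra.
    by rewrite ler_nat leq_subr.
  rewrite sumr_const card_ord -[leLHS]mulr_natl mulrA.
  have n2 : n%:R * n%:R <= 4 * 2 ^+ n :> R.
    rewrite -natrM -natrX -natrM ler_nat; elim: n => // n IH.
    have h1 : (n < 2 ^ n)%N by exact: ltn_expl.
    rewrite expnS; case: n IH h1 => [|[|n]] IH h1 //.
    nia.
  have -> : C * D * 4 * 2^-1 ^+ n = 4 * 2 ^+ n * (C * D * 4^-1 ^+ n).
    have -> : (4^-1 : R) ^+ n = 2^-1 ^+ n * 2^-1 ^+ n by rewrite -exprMn; congr (_ ^+ _); lra.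
    rewrite [RHS]mulrA [4 * 2 ^+ n * _]mulrC -!mulrA; congr (C * (D * (4 * _))).
    by rewrite mulrA -exprMn mulfV ?expr1n ?mul1r // pnatr_eq0.
  by rewrite ler_wpM2r ?mulr_ge0 ?exprn_ge0 //; lra.
have := tendsB (tendsM (psumP z hu) (psumP z hv)) hd; rewrite subr0.
by apply: tends_eq => n; rewrite opprB addrC subrK.
Qed.

Definition shift u n := u n.+1.

Lemma ent_shift u : ent u -> ent (shift u).
Proof.
move=> hu r r0; have [C C0 hC] := hu r r0; exists (C * r) => [|n]; first by rewrite mulr_ge0 // ltW.
by apply: le_trans (hC n.+1) _; rewrite exprS mulrA.
Qed.

Lemma psum_shift z u : ent u -> psum z u = u 0%N + z *: psum z (shift u).
Proof.
move=> hu; apply: psum_uniq => // e e0.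
have [N hN] := tendsD (tends_cst (u 0%N)) (tendsZ z (psumP z (ent_shift hu))) e0.
exists N.+1 => -[//|n] hn.
have -> : \sum_(i < n.+1) z ^+ i *: u i = u 0%N + z *: \sum_(i < n) z ^+ i *: shift u i.
  rewrite big_ord_recl /= expr0 scale1r scaler_sumr; congr (_ + _).
  by apply: eq_bigr => i _; rewrite scalerA -exprS.
exact: hN.
Qed.

(** Identity theorem at 0: the constant term is the limit of the values along the zeros [w k], and
    after its removal the shifted series has the same zeros. *)
Lemma psum_zero u (w : nat -> R[i]) : ent u -> (forall k, w k != 0 /\ cabs (w k) <= 1) ->
  (forall e : R, 0 < e -> exists k, cabs (w k) < e) -> (forall k, psum (w k) u = 0) ->
  forall n, u n = 0.
Proof.
move=> hu hw0 hw hz n; elim: n u hu hz => [|n IH] u hu hz.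
all: have u0 : u 0%N = 0.
- have [C C0 hC] := psum_tail 1 hu.
  apply/eqP; rewrite -nmE0 eq_le nm_ge0 andbT; apply/ler_addgt0Pl => e e0; rewrite addr0.
  have [D D0 hD] := psum_tail 1 (ent_shift hu).
  have D1 : 0 < D + 1 by lra.
  have [k hk] := hw _ (divr_gt0 e0 D1); have [_ wk1] := hw0 k.
  have := hz k; rewrite psum_shift // => /eqP; rewrite addr_eq0 => /eqP ->; rewrite nmN nmZ.
  have := hD (w k) 0%N; rewrite cabs1 big_ord0 subr0 expr0 mulr1 => /(_ wk1) h.
  move: hk; rewrite ltr_pdivlMr // => hk; apply: le_trans (ltW hk).
  by rewrite ler_wpM2l ?cabs_ge0 //; lra.
- exact: u0.
- have [D D0 hD] := psum_tail 1 (ent_shift hu).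
  have D1 : 0 < D + 1 by lra.
  apply/eqP; rewrite -nmE0 eq_le nm_ge0 andbT; apply/ler_addgt0Pl => e e0; rewrite addr0.
  have [k hk] := hw _ (divr_gt0 e0 D1); have [_ wk1] := hw0 k.
  have := hz k; rewrite psum_shift // => /eqP; rewrite addr_eq0 => /eqP ->; rewrite nmN nmZ.
  have := hD (w k) 0%N; rewrite cabs1 big_ord0 subr0 expr0 mulr1 => /(_ wk1) h.
  move: hk; rewrite ltr_pdivlMr // => hk; apply: le_trans (ltW hk).
  by rewrite ler_wpM2l ?cabs_ge0 //; lra.
apply: (IH (shift u)); first exact: ent_shift.
move=> k; have := hz k; rewrite psum_shift // u0 add0r => /eqP.
by rewrite scaler_eq0 (negbTE (hw0 k).1) => /eqP.
Qed.

(** The coefficients of the exponential series, so that [bx z a] is [exp (z a)]. *)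
Definition ec a n : bop V := (n`!%:R)^-1 *: a ^+ n.

Lemma ent_ec a : ent (ec a).
Proof.
move=> r r0; have M0 : 0 <= nm a / r by rewrite divr_ge0 ?nm_ge0 ?ltW.
have [C C0 hC] := pow_fact_le M0; exists C => // n.
rewrite nmZ cabsV cabs_nat; have h := hC n.
have rn : 0 < r ^+ n by rewrite exprn_gt0.
have h2 : C * 2^-1 ^+ n <= C by rewrite ler_piMr // exprn_ile1 //; lra.
have := le_trans h h2; rewrite expr_div_n mulrAC ler_pdivrMr // => h3.
by apply: le_trans h3; rewrite mulrC ler_wpM2r ?invr_ge0 // nmX.
Qed.

Definition bx z a : bop V := psum z (ec a).

Lemma ecZ c a n : ec (c *: a) n = c ^+ n *: ec a n.
Proof. by rewrite /ec bexprZ !scalerA mulrC. Qed.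

Lemma bxZ z c a : bx z (c *: a) = bx (z * c) a.
Proof.
apply: psum_uniq; first exact: ent_ec.
apply: tends_eq (psumP (z * c) (ent_ec a)) => n; apply: eq_bigr => i _.
by rewrite ecZ scalerA exprMn.
Qed.

Definition delta n : bop V := if n == 0%N then 1 else 0.

Lemma ent_delta : ent delta.
Proof.
move=> r r0; exists 1 => // -[|n]; rewrite /delta /= mul1r; first by rewrite expr0 nm1_le.
by rewrite nm0 exprn_ge0 // ltW.
Qed.

Lemma psum_delta z : psum z delta = 1.
Proof.
apply: psum_uniq; first exact: ent_delta.
move=> e e0; exists 1%N => -[//|n] _; rewrite big_ord_recl big1 => [|i _]; last by rewrite scaler0.
by rewrite addr0 expr0 scale1r subrr nm0.
Qed.

Lemma conv_ecN a m : conv (ec a) (ec (- a)) m = delta m.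
Proof.
have c : GRing.comm a (- a) by rewrite /GRing.comm mulrN mulNr.
have -> : conv (ec a) (ec (- a)) m = (m`!%:R)^-1 *: (- a + a) ^+ m.
  rewrite exprDn_comm; last exact: commr_sym.
  rewrite scaler_sumr; apply: eq_bigr => i _; have im : (i <= m)%N by rewrite -ltnS.
  rewrite /ec bscalAl bscalAr scalerA -[_ *+ 'C(m, i)]scaler_nat scalerA.
  congr (_ *: _); last by apply: commrX; apply/commr_sym; apply: commrX; exact: commr_sym.
  rewrite -(bin_fact im).
  rewrite !natrM !invfM mulrAC mulVf ?mul1r // pnatr_eq0 -lt0n bin_gt0 //.
rewrite addNr /delta; case: m => [|m]; last by rewrite expr0n scaler0.
by rewrite expr0 fact0 invr1 scale1r.
Qed.

Lemma bx_inv z a : bx z a * bx (- z) a = 1.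
Proof.
have -> : bx (- z) a = bx z (- a) by rewrite -[- a]scaleN1r bxZ mulrN1.
rewrite /bx -psum_conv; try exact: ent_ec.
rewrite -(psum_delta z); congr psum; apply/funext => m; exact: conv_ecN.
Qed.

(** [gx z l] is the product of the [exp (z a)] for [a] in [l], and [el l] is its coefficient
    sequence in [z]. Products are kept as lists because inversion and scaling act on the list. *)
Fixpoint gx z l : bop V := if l is a :: l' then bx z a * gx z l' else 1.
Fixpoint el l : nat -> bop V := if l is a :: l' then conv (ec a) (el l') else delta.

Lemma gx_cat z l l' : gx z (l ++ l') = gx z l * gx z l'.
Proof. by elim: l => [|a l IH] /=; rewrite ?mul1r // IH mulrA. Qed.

Lemma bx_invs z a : inv_of (bx z a) (bx (- z) a).
Proof. by have := bx_inv (- z) a; rewrite opprK => h; split; [exact: bx_inv | exact: h]. Qed.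

Lemma gx_inv z l : inv_of (gx z l) (gx (- z) (rev l)).
Proof.
elim: l => [|a l IH]; first by split; apply: mulr1.
have -> : gx (- z) (rev (a :: l)) = gx (- z) (rev l) * bx (- z) a.
  by rewrite rev_cons -cats1 gx_cat; congr (_ * _); apply: mulr1.
exact: inv_ofM (bx_invs z a) IH.
Qed.

Lemma ent_el l : ent (el l).
Proof. by elim: l => [|a l IH]; [exact: ent_delta | apply: ent_conv => //; exact: ent_ec]. Qed.

Lemma psum_el z l : psum z (el l) = gx z l.
Proof.
elim: l => [|a l IH] /=; first exact: psum_delta.
by rewrite psum_conv ?IH //; [exact: ent_ec | exact: ent_el].
Qed.

Lemma convA u v (w : nat -> bop V) m : conv (conv u v) w m = conv u (conv v w) m.
Proof.
transitivity (\sum_(k < m.+1) \sum_(i < k.+1) u i * v (k - i)%N * w (m - i - (k - i))%N).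
  apply: eq_bigr => k _; rewrite mulr_suml; apply: eq_bigr => i _.
  by rewrite -subnDA subnKC // -ltnS.
rewrite (tri_sum (fun i j => u i * v j * w (m - i - j)%N)); apply: eq_bigr => i _.
have im : (i <= m)%N by rewrite -ltnS.
by rewrite subSn // mulr_sumr; apply: eq_bigr => j _; rewrite mulrA.
Qed.

Lemma el_cat l l' m : el (l ++ l') m = conv (el l) (el l') m.
Proof.
elim: l m => [|a l IH] m /=.
  by rewrite /conv big_ord_recl big1 ?subn0 ?addr0 ?mul1r // => i _; rewrite mul0r.
by rewrite convA; apply: eq_bigr => i _; rewrite IH.
Qed.

Lemma el_scale c l m : el [seq c *: a | a <- l] m = c ^+ m *: el l m.
Proof.
elim: l m => [|a l IH] m /=.
  by rewrite /delta; case: m => [|m] /=; rewrite ?expr0 ?scale1r ?scaler0.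
rewrite /conv scaler_sumr; apply: eq_bigr => i _; rewrite ecZ IH bscalAl bscalAr scalerA.
by rewrite -exprD subnKC // -ltnS.
Qed.

Lemma el0 l : el l 0%N = 1.
Proof. by elim: l => [|a l IH] //=; rewrite /conv big_ord1 IH /ec expr0 fact0 invr1 scale1r mulr1. Qed.

(* The conjugate of [x] by [exp y] is the sum of a series whose coefficients
   obey [(m+1) c_(m+1) = [c_m, y]]. *)
Lemma bx_conj (L : set (bop V)) y z : csub L -> (forall x, L x -> L (x * y - y * x)) ->
  forall x, L x -> L (bx (- z) y * x * bx z y).
Proof.
move=> cL hL x Lx; pose c := conv (ec (- y)) (fun n => x * ec y n).
have ecS b n : n.+1%:R *: ec b n.+1 = b * ec b n :> bop V.
  rewrite /ec exprS scalerA bscalAr factS natrM invfM mulrA mulfV ?mul1r //.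
have ecS' b n : n.+1%:R *: ec b n.+1 = ec b n * b :> bop V.
  rewrite ecS /ec bscalAr bscalAl; congr (_ *: _); exact: commrX.
have cS m : m.+1%:R *: c m.+1 = c m * y - y * c m.
  transitivity (\sum_(i < m.+2) (i%:R *: ec (- y) i) * (x * ec y (m.+1 - i)%N) +
    \sum_(i < m.+2) ec (- y) i * (x * ((m.+1 - i)%:R *: ec y (m.+1 - i)%N))).
    rewrite -big_split scaler_sumr; apply: eq_bigr => i _ /=.
    by rewrite (bscalAl i%:R) !(bscalAr (m.+1 - i)%:R) -scalerDl -natrD subnKC // -ltnS.
  rewrite addrC; congr (_ + _).
    rewrite big_ord_recr /= subnn scale0r !mulr0 addr0 mulr_suml; apply: eq_bigr => i _.
    have e : (m.+1 - i)%N = (m - i).+1 by rewrite subSn // -ltnS.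
    by rewrite e (ecS' y (m - i)%N) !mulrA.
  rewrite big_ord_recl; have -> : (nat_of_ord (@ord0 m.+1))%:R = 0 :> R[i] by [].
  rewrite (scale0r (ec (- y) _)) mul0r add0r -mulNr mulr_sumr.
  by apply: eq_bigr => i _; rewrite lift0 (ecS (- y) i) subSS -mulrA.
have Lc m : L (c m).
  elim: m => [|m IH].
    by rewrite /c /conv big_ord1 /ec !expr0 fact0 invr1 !scale1r mul1r mulr1.
  have -> : c m.+1 = (m.+1%:R)^-1 *: (c m * y - y * c m).
    by rewrite -cS scalerA mulVf ?scale1r // pnatr_eq0.
  by apply: (subspZ _ cL.1); apply: hL.
have entx : ent (fun n => x * ec y n) by apply: entMl; exact: ent_ec.
have -> : bx (- z) y * x * bx z y = psum z c.
  rewrite psum_conv //; last exact: ent_ec.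
  rewrite psumMl; last exact: ent_ec.
  by rewrite mulrA -/(bx z (- y)) -[- y]scaleN1r bxZ mulrN1.
have hs n : L (\sum_(i < n) z ^+ i *: c i).
  elim: n => [|n IH]; first by rewrite big_ord0; exact: cL.1.1.
  by rewrite big_ord_recr /= addrC; apply: cL.1.2.
exact: csub_tends cL hs (psumP z (ent_conv (ent_ec _) entx)).
Qed.

(** The factor [a] shows that the exponential of a compact operator is the identity plus a compact
    operator. *)
Lemma bx_1D z a : bx z a = 1 + z *: (a * psum z (fun n => (n.+1%:R)^-1 *: ec a n)).
Proof.
have hu : ent (fun n => (n.+1%:R)^-1 *: ec a n).
  move=> r r0; have [C C0 hC] := ent_ec a r0; exists C => // n.
  rewrite nmZ cabsV cabs_nat; apply: le_trans (hC n).
  by rewrite ler_piMl ?nm_ge0 // invf_le1 ?ler1n ?ltr0n.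
rewrite -psumMl // /bx psum_shift; last exact: ent_ec.
rewrite {1}/ec expr0 fact0 invr1 scale1r; congr (_ + _ *: psum _ _).
apply/funext => n; rewrite /shift /ec exprS factS natrM invfM bscalAr bscalAr scalerA.
by [].
Qed.

(* Averaging over roots of unity recovers [a] up to aliasing terms of order 2^n. *)
Lemma bx_avg t a : t != 0 ->
  tends (fun n => avg n (fun w => (t * w)^-1 *: bx (t * w) a)) a.
Proof.
move=> t0; have [C C0 hC] := psum_tail t (ent_ec a).
have ct : 0 < cabs t by rewrite cabs_gt0.
have hN n : nm (avg n (fun w => (t * w)^-1 *: bx (t * w) a) - a) <= (cabs t)^-1 * C * 2^-1 ^+ n.
  have [N NE] : exists N, N = (2 ^ n.+1)%N by exists (2 ^ n.+1)%N.
  have N1 : (1 < N)%N by rewrite NE expnS; have := expn_gt0 2 n; lia.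
  have N0 := ltnW N1; have rtN : rt n ^+ N = 1 :> R[i] by rewrite NE rt_unit.
  have rtsum k : \sum_(j < N) rt n ^+ (j * k) = if (N %| k)%N then N%:R else 0 :> R[i].
    by rewrite NE; exact: sum_rt.
  have aE : a = avg n (fun w => (t * w)^-1 *: \sum_(i < N) (t * w) ^+ i *: ec a i).
    rewrite /avg -NE.
    have -> : \sum_(j < N) (t * rt n ^+ j)^-1 *: (\sum_(i < N) (t * rt n ^+ j) ^+ i *: ec a i) =
       \sum_(i < N) (t ^-1 * t ^+ i * \sum_(j < N) rt n ^+ (j * (i + N.-1))) *: ec a i.
      under eq_bigr => j _ do rewrite scaler_sumr.
      rewrite exchange_big; apply: eq_bigr => i _; rewrite mulr_sumr scaler_suml.
      apply: eq_bigr => j _; rewrite scalerA; congr (_ *: _).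
      have -> : (t * rt n ^+ j)^-1 = t^-1 * rt n ^+ (j * N.-1).
        rewrite invfM; congr (_ * _); apply: (mulfI (_ : rt n ^+ j != 0)).
          by rewrite -cabs_gt0 cabs_rtX.
        rewrite mulfV -?cabs_gt0 ?cabs_rtX // -exprD -mulnS prednK  //.
        by rewrite mulnC exprM rtN expr1n.
      by rewrite exprMn -exprM mulnDr exprD mulrACA; congr (_ * _); exact: mulrC.
    rewrite (bigD1 (Ordinal N1)) //= [X in _ + X]big1 => [|i].
      rewrite addr0 rtsum add1n prednK ?dvdnn  // expr1 mulVf // mul1r.
      by rewrite scalerA mulVf ?pnatr_eq0 -?lt0n // /ec expr1 (_ : (1`!)%:R = 1 :> R[i]) // invr1 !scale1r.
    rewrite -val_eqE /= => i1; rewrite rtsum; case: ifP => [dv|_]; last by rewrite mulr0 scale0r.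
    have iN := ltn_ord i; exfalso; move/dvdnP: dv => [k hk].
    by move/eqP: i1; case: k hk => [|[|k]] hk; nia.
  rewrite [X in _ - X]aE avgB; apply: avg_nm => w w1.
  rewrite -scalerBr nmZ cabsV cabsM w1 mulr1 -mulrA ler_wpM2l ?invr_ge0 ?cabs_ge0 //.
  have tw : cabs (t * w) <= cabs t by rewrite cabsM w1 mulr1.
  have h := hC _ N tw; rewrite -/(bx (t * w) a) in h; apply: (le_trans h).
  rewrite ler_wpM2l // ler_wiXn2l //; try lra.
  by rewrite NE; apply/ltnW/ltnW; exact: ltn_expl n.+1 (ltnSn 1).
apply: (tends_squeeze _ hN) => e e0; apply: geo_small => //; lra.
Qed.

End PowerSeries.

(** * Accumulation points of words *)

Section Words.
Context {R : realType} {V : banType R}.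
Implicit Types (f g T B c : bop V) (s u v : seq (bop V)) (e r C eta : R) (m n k : nat).

Definition wpr s : bop V := foldr *%R 1 s.

Lemma wpr_cat s s' : wpr (s ++ s') = wpr s * wpr s'.
Proof. by elim: s => [|a s IH] /=; rewrite ?mul1r // IH mulrA. Qed.

Lemma tbdd_tail (W : banType R) (a : nat -> W) : (forall eta : R, 0 < eta ->
    exists N (L : seq W), forall k, (N <= k)%N -> exists2 y, y \in L & nm (a k - y) < eta) ->
  tbdd (range a).
Proof.
move=> h e e0; have [N [L hL]] := h e e0; exists (L ++ [seq a k | k <- iota 0 N]) => _ [k _ <-].
have [Nk|kN] := leqP N k.
  by have [y yL ky] := hL k Nk; exists y; rewrite // mem_cat yL.
exists (a k); last by rewrite subrr nm0.
by rewrite mem_cat; apply/orP; right; apply: map_f; rewrite mem_iota add0n.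
Qed.

Variable E : set (bop V).

Definition isw s := forall x, x \in s -> E x.

Lemma isw_cat s s' : isw (s ++ s') <-> isw s /\ isw s'.
Proof.
split=> [h|[h h'] x]; last by rewrite mem_cat => /orP[/h|/h'].
by split=> x xs; apply: h; rewrite mem_cat xs ?orbT.
Qed.

(** The infimum of the positive [r] with this property is the joint spectral radius of [E]. *)
Definition wgrow r := exists2 C, 0 <= C & forall s, isw s -> nm (wpr s) <= C * r ^+ size s.

(** A substitute for compactness of the letters: an arbitrary contraction between two long words
    lands near a finite set. It also holds for suitably scaled exponentials, which are not
    compact. *)
Definition acompact := forall eta, 0 < eta -> exists m (L : seq (bop V)),
  forall u v c, isw u -> isw v -> size u = m -> size v = m -> nm c <= 1 ->
    exists2 y, y \in L & nm (wpr u * c * wpr v - y) < eta.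

Definition limw T := forall e n, 0 < e -> exists s, [/\ isw s, (n <= size s)%N & nm (wpr s - T) < e].

Lemma acompactM C : acompact -> 0 < C -> forall eta, 0 < eta -> exists m (L : seq (bop V)),
  forall u v c, isw u -> isw v -> size u = m -> size v = m -> nm c <= C ->
    exists2 y, y \in L & nm (wpr u * c * wpr v - y) < eta.
Proof.
move=> hE C0 eta eta0; have [m [L hL]] := hE _ (divr_gt0 eta0 C0).
pose a : R[i] := C%:C%C; have ca : cabs a = C by rewrite cabs_nneg // ltW.
have a0 : a != 0 by rewrite -cabs_gt0 ca.
exists m, [seq a *: y | y <- L] => u v c wu wv um vm cC.
have [|y yL hy] := hL u v (a^-1 *: c) wu wv um vm.
  by rewrite nmZ cabsV ca mulrC ler_pdivrMr // mul1r.
exists (a *: y); first exact: map_f.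
have -> : wpr u * c * wpr v = a *: (wpr u * (a^-1 *: c) * wpr v).
  by rewrite (bscalAr a^-1) (bscalAl a^-1) scalerA mulfV // scale1r.
by rewrite -scalerBr nmZ ca mulrC -ltr_pdivlMr.
Qed.

Lemma isw_split3 s m : isw s -> (m.*2 <= size s)%N -> exists u s' v,
  [/\ isw u, isw s', isw v & [/\ size u = m, size v = m, s = u ++ s' ++ v & (size s = size s' + m.*2)%N]].
Proof.
move=> ws ms; exists (take m s), (take (size s - m.*2) (drop m s)), (drop (size s - m) s).
have e1 : drop (size s - m) s = drop (size s - m.*2) (drop m s).
  by rewrite drop_drop; congr drop; lia.
have e2 : s = take m s ++ take (size s - m.*2) (drop m s) ++ drop (size s - m) s.
  by rewrite e1 cat_take_drop cat_take_drop.
have [h1 h2] : isw (take m s) /\ isw (take (size s - m.*2) (drop m s) ++ drop (size s - m) s).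
  by apply/isw_cat; rewrite -e2.
have [h3 h4] := (isw_cat _ _).1 h2.
split=> //; split=> //.
- by rewrite size_takel //; lia.
- by rewrite size_drop; lia.
- by rewrite size_takel ?size_drop; lia.
Qed.

Lemma limw_mul C T T' : (forall s, isw s -> nm (wpr s) <= C) -> limw T -> limw T' -> limw (T * T').
Proof.
move=> hC hT hT' e n e0.
have C0 : 0 <= C by apply: le_trans (nm_ge0 _) (hC [::] (fun x h => ltac:(by []))).
have M0 : 0 < C + nm T' + 1 by have := nm_ge0 T'; lra.
have d0 : 0 < e / (C + nm T' + 1) / 2 by rewrite !divr_gt0.
have [s [ws ns sT]] := hT _ n d0; have [s' [ws' _ sT']] := hT' _ 0%N d0.
exists (s ++ s'); split; first by apply/isw_cat.
  by rewrite size_cat (leq_trans ns) // leq_addr.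
rewrite wpr_cat; apply: le_lt_trans (nm_tri (wpr s * T') _ _) _.
rewrite -mulrBr -mulrBl.
have h1 := le_trans (nmM (wpr s) (wpr s' - T')) (ler_pM (nm_ge0 _) (nm_ge0 _) (hC s ws) (ltW sT')).
have h2 := le_trans (nmM (wpr s - T) T') (ler_pM (nm_ge0 _) (nm_ge0 _) (ltW sT) (lexx _)).
apply: le_lt_trans (lerD h1 h2) _.
have -> : e = (C + nm T' + 1) * (e / (C + nm T' + 1)) by rewrite mulrCA mulfV ?mulr1 // gt_eqF.
rewrite [(C + nm T' + 1) * _ / (C + nm T' + 1)]mulrAC mulfV ?mul1r ?gt_eqF //.
move: d0; move: (e / (C + nm T' + 1)) => d d0; have := nm_ge0 T'; nra.
Qed.

Lemma limw_tends (a : nat -> bop V) T : (forall n, limw (a n)) -> tends a T -> limw T.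
Proof.
move=> ha hT e n e0; have [N /(_ N (leqnn N)) hN] := hT _ (half_gt0 e0).
have [s [ws ns hs]] := ha N _ n (half_gt0 e0).
exists s; split=> //; apply: le_lt_trans (nm_tri (a N) _ _) _; lra.
Qed.

Section Bounded.
Variable C : R.
Hypothesis hC : forall s, isw s -> nm (wpr s) <= C.
Hypothesis hE : acompact.

Let C1 : 0 < `|C| + 1. Proof. by rewrite ltr_wpDl. Qed.

Lemma words_net eta : 0 < eta -> exists m (L : seq (bop V)),
  forall s, isw s -> (m <= size s)%N -> exists2 y, y \in L & nm (wpr s - y) < eta.
Proof.
move=> eta0; have [m [L hL]] := acompactM hE C1 eta0.
exists m.*2, L => s ws ms; have [u [s' [v [wu ws' wv [um vm -> _]]]]] := isw_split3 ws ms.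
rewrite !wpr_cat mulrA; apply: hL => //; apply: le_trans (hC ws') _.
by rewrite (le_trans (ler_norm C)) // lerDl.
Qed.

Lemma limw_tbdd : tbdd [set T | limw T].
Proof.
move=> e e0; have [m [L hL]] := words_net (half_gt0 e0).
exists L => T /(_ _ m (half_gt0 e0))[s [ws ms sT]]; have [y yL sy] := hL s ws ms.
by exists y => //; apply: le_lt_trans (nm_tri (wpr s) _ _) _; rewrite nmC in sT; lra.
Qed.

Lemma words_label eta : 0 < eta -> exists m (X : finType) (f : bop V -> X),
  forall s s', isw s -> isw s' -> (m <= size s)%N -> (m <= size s')%N ->
    f (wpr s) = f (wpr s') -> nm (wpr s - wpr s') < eta.
Proof.
move=> eta0; have [m [L hL]] := words_net (half_gt0 eta0).
pose near (x y : bop V) := nm (x - y) < eta / 2.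
exists m, 'I_(size L).+1, (fun x => inord (find (near x) L)) => s s' ws ws' ms ms' fE.
have hs t : isw t -> (m <= size t)%N -> has (near (wpr t)) L.
  by move=> wt mt; have [y yL h] := hL t wt mt; apply/hasP; exists y.
have hf t : (find (near (wpr t)) L < (size L).+1)%N by rewrite ltnS find_size.
have {}fE : find (near (wpr s)) L = find (near (wpr s')) L.
  by rewrite -(inordK (hf s)) fE inordK.
have h1 := nth_find 0 (hs _ ws ms); have h2 := nth_find 0 (hs _ ws' ms').
rewrite fE in h1; apply: le_lt_trans (nm_tri _ _ _) _; rewrite [ltRHS]splitr.
by apply: ltrD h1 _; rewrite nmC.
Qed.

Hypothesis hlow : forall n, exists s, [/\ isw s, size s = n & 2^-1 <= nm (wpr s)].

(** Among the prefixes of a long word of norm at least 1/2 two carry the same label; [s] is the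
    shorter one and [q] the segment between them. Prefixes are not small because the remaining
    suffix has norm at most [C]. *)
Lemma almost_fixed k eta : 0 < eta -> exists s q, [/\ isw s, isw q & [/\ (k <= size s)%N, (k <= size q)%N,
  2^-1 / (`|C| + 1) <= nm (wpr s) & nm (wpr s - wpr s * wpr q) < eta]].
Proof.
move=> /words_label[m [X [f hf]]].
(* Prefixes of length [m + k + k i]: at least [m] for the labels, at least [k] for [s], in steps of
   [k] for [q]. *)
pose N := (m + k + k * (#|X|.+1))%N.
have [s [ws sN ns]] := hlow N.
pose j (i : 'I_(#|X|.+1)) := (m + k + k * i)%N.
have jN i : (j i <= N)%N by rewrite /j /N leq_add2l leq_mul2l ltnW ?orbT.
have [i1 [i2 [i12 fE]]] : exists i1 i2 : 'I_(#|X|.+1), (i1 < i2)%N /\ f (wpr (take (j i1) s)) = f (wpr (take (j i2) s)).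
  have /injectivePn [a [b ab E']] : ~~ injectiveb (fun i : 'I_(#|X|.+1) => f (wpr (take (j i) s))).
    apply/negP => /injectiveP inj; have := leq_card _ inj; rewrite card_ord ltnn //.
  by have [h|h|/val_inj h] := ltngtP a b; [exists a, b | exists b, a | rewrite h eqxx in ab].
have wt i : isw (take i s) by move=> x /mem_take; exact: ws.
have jj : (j i1 + k <= j i2)%N by rewrite /j -addnA leq_add2l addnC -mulnS leq_mul2l i12 orbT.
have e1 : take (j i2) s = take (j i1) s ++ drop (j i1) (take (j i2) s).
  by rewrite -{1}(cat_take_drop (j i1) (take (j i2) s)) take_takel // (leq_trans _ jj) // leq_addr.
have size_j i : size (take (j i) s) = j i by rewrite size_takel // sN.
exists (take (j i1) s), (drop (j i1) (take (j i2) s)); split; first exact: wt.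
  by move=> x /mem_drop; apply: wt.
split.
- by rewrite size_j /j -addnA addnCA leq_addr.
- by rewrite size_drop size_j; lia.
- rewrite ler_pdivrMr //; apply: le_trans ns _.
  rewrite -{1}(cat_take_drop (j i1) s) wpr_cat; apply: le_trans (nmM _ _) _.
  rewrite ler_wpM2l ?nm_ge0 //; apply: le_trans (hC _) _; first by move=> x /mem_drop; exact: ws.
  by rewrite (le_trans (ler_norm C)) // lerDl.
rewrite -wpr_cat -e1; apply: hf => //; try exact: wt.
  by rewrite size_j /j -addnA leq_addr.
by rewrite size_j /j -addnA leq_addr.
Qed.

(** Limits of the almost fixed words give [T = T Q] with [T] nonzero. The powers of [Q] are
    relatively compact and have an idempotent cluster point; it is nonzero because it still fixes
    [T]. *)
Lemma words_idem : exists B, [/\ B * B = B, B != 0 & limw B].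
Proof.
have step k : exists p : seq (bop V) * seq (bop V), [/\ isw p.1, isw p.2 & [/\ (k <= size p.1)%N, (k <= size p.2)%N,
    2^-1 / (`|C| + 1) <= nm (wpr p.1) & nm (wpr p.1 - wpr p.1 * wpr p.2) < k.+1%:R^-1]].
  have [|s [q h]] := almost_fixed k (eta := k.+1%:R^-1); first by rewrite invr_gt0.
  by exists (s, q).
pose P k := (sval (cid (step k))).1; pose q k := (sval (cid (step k))).2.
have hPq k : [/\ isw (P k), isw (q k) & [/\ (k <= size (P k))%N, (k <= size (q k))%N,
    2^-1 / (`|C| + 1) <= nm (wpr (P k)) & nm (wpr (P k) - wpr (P k) * wpr (q k)) < k.+1%:R^-1]].
  by rewrite /P /q; case: cid.
have tw (a : nat -> seq (bop V)) : (forall k, isw (a k)) -> (forall k, (k <= size (a k))%N) ->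
    tbdd (range (fun k => wpr (a k))).
  move=> wa sa; apply: tbdd_tail => eta /words_net[m [L hL]]; exists m, L => k mk.
  by apply: hL => //; apply: leq_trans mk (sa k).
have [|p1 hp1 [T hT]] := @tbdd_cvg _ _ (fun k => wpr (P k)).
  by apply: tw => k; have [h1 h2 [h3 _ _ _]] := hPq k.
have [|p2 hp2 [Q hQ]] := @tbdd_cvg _ _ (fun k => wpr (q (p1 k))).
  by apply: (tw (fun k => q (p1 k))) => k; have [h1 h2 [_ h3 _ _]] := hPq (p1 k) => //; exact: leq_trans (hp1 k) h3.
pose p k := p1 (p2 k); have hp k : (k <= p k)%N by apply: leq_trans (hp2 k) (hp1 _).
have {}hT : tends (fun k => wpr (P (p k))) T by exact: tends_sub hp2 hT.
have TQ : T * Q = T.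
  apply: tends_uniq (tendsM hT hQ) _ => e e0.
  have [N1 hN1] := hT _ (half_gt0 e0); have [N2 hN2] := nat_small (half_gt0 e0).
  exists (maxn N1 N2) => n; rewrite geq_max => /andP[/hN1 h1 h2].
  have [_ _ [_ _ _ h3]] := hPq (p n).
  have h4 := hN2 (p n) (leq_trans h2 (hp n)).
  apply: le_lt_trans (nm_tri (wpr (P (p n))) _ _) _; rewrite [nm (_ - wpr (P (p n)))]nmC.
  by rewrite [ltRHS]splitr; apply: ltrD h1; apply: lt_trans h3 h4.
have T0 : T != 0.
  rewrite -nm_gt0; apply: lt_le_trans (_ : 2^-1 / (`|C| + 1) <= _).
    by rewrite divr_gt0 // invr_gt0.
  rewrite leNgt; apply/negP => hlt.
  have [N /(_ N (leqnn N))] := hT (2^-1 / (`|C| + 1) - nm T) ltac:(by rewrite subr_gt0).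
  have [_ _ [_ _ h _]] := hPq (p N); have := nmBD (wpr (P (p N))) T; lra.
have lQ : limw Q.
  move=> e n e0; have [N hN] := hQ e e0; exists (q (p (maxn N n))).
  have [_ h [_ h' _ _]] := hPq (p (maxn N n)); split=> //; last exact/hN/leq_maxl.
  by apply: leq_trans (leq_maxr N n) _; apply: leq_trans (hp _) h'.
have lQn n : limw (Q ^+ n.+1).
  by elim: n => [|n IH]; rewrite ?expr1 // exprS; exact: limw_mul hC lQ IH.
have TQn n : T * Q ^+ n = T by elim: n => [|n IH]; rewrite ?expr0 ?mulr1 // exprS mulrA TQ.
have tl (a : nat -> nat) : tbdd (range (fun k => Q ^+ (a k).+1)).
  by apply: tbdd_sub limw_tbdd => _ [k _ <-]; exact: lQn.
have [p3 hp3 /cauchys_tends[A hA]] := tbdd_subseq (tl id).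
have hp3' := incr_geq hp3.
pose a k := (p3 k).+1.
have ak k : (k < a k)%N by rewrite ltnS.
(* The gaps make [a (j k) - a k] and [a (j k) - 2 a k] positive. The limits [A], [B], [D] of the
   powers with exponents [a k] and these two satisfy [A B = A] and [B = D A], whence
   [B B = D A B = B]. *)
pose j k := ((a k).*2 + 2)%N.
have kj k : (k <= j k)%N by have := ak k; rewrite /j; lia.
have aj k : ((a k).*2 + 2 < a (j k))%N by exact: ak.
have hAj : tends (fun k => Q ^+ a (j k)) A by exact: tends_sub kj hA.
have [|p4 hp4 [B hB]] := @tbdd_cvg _ _ (fun k => Q ^+ (a (j k) - a k).-1.+1); first exact: tl.
have [|p5 hp5 [D hD]] := @tbdd_cvg _ _ (fun k => Q ^+ (a (j (p4 k)) - (a (p4 k)).*2).-1.+1); first exact: tl.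
have BA : A * B = A.
  apply: tends_uniq (tendsM (tends_sub hp4 hA) hB) _.
  apply: tends_eq (tends_sub hp4 hAj) => k; rewrite -/(a _) -exprD; congr (_ ^+ _).
  by have := aj (p4 k); lia.
have BDA : B = D * A.
  have hA' : tends (fun k => Q ^+ a (p4 (p5 k))) A.
    exact: (tends_sub (p := fun k => p4 (p5 k)) (fun k => leq_trans (hp5 k) (hp4 _)) hA).
  apply: tends_uniq (tends_sub hp5 hB) _; apply: tends_eq (tendsM hD hA') => k.
  rewrite -exprD; congr (_ ^+ _); have := aj (p4 (p5 k)); lia.
exists B; split; last by apply: limw_tends hB => n; exact: lQn.
  by rewrite {1}BDA -mulrA BA -BDA.
have TB : T * B = T.
  by apply: tends_uniq (tendsMl T hB) _; apply: tends_eq (tends_cst T) => k; rewrite TQn.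
by apply/eqP => B0; case/eqP: T0; rewrite -TB B0 mulr0.
Qed.

End Bounded.

Section Unbounded.
Hypothesis hE : acompact.
Hypothesis hup : forall r, 1 < r -> wgrow r.
Hypothesis hunb : forall C, exists s, isw s /\ C < nm (wpr s).

(** Damping by [t ^+ size s] makes the supremum finite, because the growth rate is at most 1; with
    [t] close to 1 it remains large, because the words are unbounded. *)
Lemma near_max k : exists (t S : R) s, [/\ 2^-1 <= t, t < 1, k%:R + 1 <= S & [/\ isw s, (k <= size s)%N,
  forall s', isw s' -> t ^+ size s' * nm (wpr s') <= S & S <= 2 * (t ^+ size s * nm (wpr s))]].
Proof.
have [D D0 hD] := hup (r := 2) ltac:(lra).
(* [K / 2] exceeds [k + 1] plus twice the bound [D * 2 ^+ k] for words shorter than [k], so a near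
   maximiser has length at least [k]. *)
pose K := 2 * (k%:R + 1) + 4 * (D * 2 ^+ k) + 1.
have [s0 [ws0 hs0]] := hunb K.
have n1 : 1 <= (size s0).+1%:R :> R by rewrite ler1n.
have [d [d0 d1 dE]] : exists d : R, [/\ 0 < d, d <= 2^-1 & d * (2 * (size s0).+1%:R) = 1].
  exists (2 * (size s0).+1%:R)^-1; split; first by rewrite invr_gt0; lra.
    by rewrite lef_pV2 ?posrE //; lra.
  by rewrite mulVf // gt_eqF //; lra.
pose t := 1 - d.
have t0 : 0 < t by rewrite /t; lra.
have bern n : 1 - n%:R * d <= t ^+ n.
  elim: n => [|n IH]; first by rewrite mul0r subr0 expr0.
  rewrite exprS -natr1; have n0 : 0 <= n%:R :> R by [].
  by have := ler_wpM2l (ltW t0) IH; rewrite /t; nra.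
have ts0 : 2^-1 <= t ^+ size s0.
  by apply: le_trans (bern _); have nE : (size s0).+1%:R = (size s0)%:R + 1 :> R by [rewrite natr1]; rewrite nE in dE; lra.
have ti : 1 < t^-1 by rewrite invf_gt1 // /t; lra.
have [C C0 hC] := hup ti.
pose A := [set x | exists2 s, isw s & x = t ^+ size s * nm (wpr s)].
have hA : has_sup A.
  split; first by exists (t ^+ size s0 * nm (wpr s0)); exists s0.
  exists C => _ [s ws ->]; have := hC s ws; rewrite exprVn ler_pdivlMr ?exprn_gt0 //.
  by rewrite mulrC.
have S0 : K / 2 <= sup A.
  apply: le_trans (_ : t ^+ size s0 * nm (wpr s0) <= _).
    by have := nm_ge0 (wpr s0); nra.
  by apply: ub_le_sup; [exact: hA.2 | exists s0].
have D2 : 0 <= D * 2 ^+ k by rewrite mulr_ge0 ?exprn_ge0.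
have k0 : 0 <= k%:R :> R by [].
have Spos : 0 < sup A / 2 by rewrite /K in S0; lra.
have [_ [s ws ->] hs] := sup_adherent Spos hA.
have hs' : sup A <= 2 * (t ^+ size s * nm (wpr s)) by lra.
exists t, (sup A), s; split; [by rewrite /t; lra | by rewrite /t; lra | by rewrite /K in S0; lra |].
split=> // [|s' ws']; last by apply: ub_le_sup; [exact: hA.2 | exists s'].
rewrite leqNgt; apply/negP => sk; have h1 := hD s ws.
have h2 : D * 2 ^+ size s <= D * 2 ^+ k.
  by apply: ler_wpM2l => //; apply: ler_weXn2l; [rewrite ler1n | exact: ltnW].
have h3 : t ^+ size s * nm (wpr s) <= nm (wpr s).
  have t1 : t <= 1 by rewrite /t; lra.
  by apply: ler_piMl; [exact: nm_ge0 | apply: exprn_ile1 => //; exact: ltW].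
rewrite /K in S0; lra.
Qed.

(** Let [w = u s v] be a near maximiser and [Tk] the middle [s] divided by the norm of [w]. The word
    [s s' s] obeys the same maximum [S], so [Tk s' Tk] has norm of order [1 / S] and tends to 0,
    while the outer letters [u] and [v] witness that [Tk] does not. *)
Lemma words_nilp : exists T (Tk uk vk : nat -> bop V), [/\ T != 0, tends Tk T,
  forall k, [/\ E (uk k), E (vk k) & nm (uk k * Tk k * vk k) = 1] &
  forall s, isw s -> T * wpr s * T = 0].
Proof.
have [D D0 hD] := hup (r := 2) ltac:(lra).
have hu (b : bop V) : E b -> nm b <= D * 2.
  move=> Eu; have := hD [:: b]; rewrite /= mulr1 expr1; apply.
  by move=> x; rewrite inE => /eqP->.
have step k : exists (T u v : bop V), [/\ [/\ E u, E v & nm (u * T * v) = 1],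
    forall m, (m.*2 <= k)%N -> exists (a : seq (bop V)) (c : bop V) (b : seq (bop V)), [/\ isw a, isw b, size a = m, size b = m &
      nm c <= 2 /\ T = wpr a * c * wpr b] &
    forall s, isw s -> nm (T * wpr s * T) <= 4 * 2 ^+ size s * k.+1%:R^-1].
  (* One letter is split off at each end, hence [k.+2]: the middle keeps length at least [k]. *)
  have [t [S [s [t2 t1 kS [ws ks hS Ss]]]]] := near_max k.+2.
  have k0 : 0 <= k%:R :> R by [].
  have kS' : k%:R + 3 <= S by rewrite -addn2 natrD in kS; lra.
  case: s ws ks Ss => [|u s] // ws ks Ss; case/lastP: s ws ks Ss => [|s v] // ws ks Ss.
  have t0 : 0 < t by lra.
  set w := wpr _ in Ss; set N := size _ in ks Ss.
  have NE : N = (size s).+2 by rewrite /N /= size_rcons.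
  have wE : w = u * wpr s * v by rewrite /w /= -cats1 wpr_cat /= mulr1 mulrA.
  have tN : 0 < t ^+ N by rewrite exprn_gt0.
  have w0 : 0 < nm w by rewrite -(pmulr_rgt0 _ tN); lra.
  have ws1 : isw s by move=> x xs; apply: ws; rewrite inE mem_rcons inE xs !orbT.
  pose c0 : R[i] := (nm w)%:C%C; have cc : cabs c0 = nm w by rewrite cabs_nneg // ltW.
  have c00 : c0 != 0 by rewrite -cabs_gt0 cc.
  have sub s' : isw s' -> (size s' <= N)%N -> nm (wpr s') <= 2 * nm w.
    move=> ws' sN; have h := le_trans (hS s' ws') Ss.
    have e : t ^+ N = t ^+ size s' * t ^+ (N - size s') by rewrite -exprD subnKC.
    have tp : 0 < t ^+ size s' by rewrite exprn_gt0.
    have tq : t ^+ (N - size s') <= 1 by apply: exprn_ile1; exact: ltW.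
    rewrite e -mulrA mulrCA ler_pM2l // in h; apply: (le_trans h).
    by rewrite ler_pM2l // ler_piMl ?nm_ge0.
  exists (c0^-1 *: wpr s), u, v; split.
  - split; [by apply: ws; rewrite inE eqxx | by apply: ws; rewrite inE mem_rcons inE eqxx orbT |].
    by rewrite (bscalAr c0^-1) (bscalAl c0^-1) -wE nmZ cabsV cc mulVf // gt_eqF.
  - move=> m mk; have ms : (m.*2 <= size s)%N by clear -mk ks NE; lia.
    have [a [s' [b [wa ws' wb [am bm sE sz]]]]] := isw_split3 ws1 ms.
    exists a, (c0^-1 *: wpr s'), b; split=> //; split.
      rewrite nmZ cabsV cc mulrC ler_pdivrMr //; apply: sub => //; clear -sz NE; lia.
    by rewrite sE !wpr_cat (bscalAr c0^-1) (bscalAl c0^-1) mulrA.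
  - move=> s' ws'; have h := hS (s ++ s' ++ s) _.
    rewrite (bscalAl c0^-1) (bscalAr c0^-1) (bscalAl c0^-1) scalerA nmZ cabsM cabsV cc.
    have -> : wpr s * wpr s' * wpr s = wpr (s ++ s' ++ s) by rewrite !wpr_cat mulrA.
    have {}h : t ^+ size (s ++ s' ++ s) * nm (wpr (s ++ s' ++ s)) <= S.
      by apply: h; apply/isw_cat; split=> //; apply/isw_cat.
    set x := nm (wpr _) in h *; have x0 : 0 <= x by exact: nm_ge0.
    rewrite -invfM mulrC ler_pdivrMr ?mulr_gt0 //.
    have tj : 0 < t ^+ size s' by rewrite exprn_gt0.
    have tp : t ^+ size (s ++ s' ++ s) = t ^+ size s' * (t ^+ size s * t ^+ size s).
      by rewrite -!exprD; congr (_ ^+ _); rewrite !size_cat; clear; lia.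
    have tNs : t ^+ N <= t ^+ size s.
      by apply: ler_wiXn2l; [exact: ltW | exact: ltW | rewrite NE -addn2 leq_addr].
    have tj2 : 2^-1 ^+ size s' <= t ^+ size s' by rewrite lerXn2r ?nnegrE //; lra.
    rewrite tp in h; move: h tNs tN Ss; move: (t ^+ N) (t ^+ size s) => A A' h AA A0 Ss.
    clear -h AA A0 Ss x0 tj tj2 w0 kS' k0.
    have h1 : t ^+ size s' * (A * A) * x <= S.
      apply: le_trans h; rewrite ler_wpM2r // ler_wpM2l ?(ltW tj) // ler_pM //; exact: ltW.
    have h2 : S * S <= 4 * (A * A * (nm w * nm w)).
      have S0 : 0 <= S by lra.
      by apply: le_trans (ler_pM S0 S0 Ss Ss) _; rewrite le_eqVlt; apply/orP; left; apply/eqP; ring.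
    have h3 : S * (t ^+ size s' * x) <= 4 * (nm w * nm w).
      have S0 : 0 < S by lra.
      have AA0 : 0 < A * A by exact: mulr_gt0.
      rewrite -(ler_pM2l AA0); have : S * (t ^+ size s' * (A * A) * x) <= S * S by rewrite ler_pM2l.
      lra.
    have h4 : x <= 2 ^+ size s' * (t ^+ size s' * x).
      rewrite mulrA ler_peMl // -(ler_pM2l (_ : 0 < 2^-1 ^+ size s')) ?exprn_gt0 ?invr_gt0 //.
      by rewrite mulrA -exprMn mulVf ?expr1n ?mul1r ?mulr1 // pnatr_eq0.
    have h5 : S * x <= 2 ^+ size s' * (4 * (nm w * nm w)).
      apply: le_trans (_ : S * (2 ^+ size s' * (t ^+ size s' * x)) <= _); first by rewrite ler_wpM2l //; lra.
      by rewrite mulrCA ler_wpM2l // exprn_ge0.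
    have kp : 0 < k.+1%:R :> R by rewrite ltr0n.
    rewrite mulrAC ler_pdivlMr //; apply: le_trans (_ : S * x <= _); last by rewrite -mulrA mulrCA.
    by rewrite mulrC ler_wpM2r // -addn1 natrD; lra.
pose Tk k := sval (cid (step k)).
have hT1 k : exists (u v : bop V), [/\ [/\ E u, E v & nm (u * Tk k * v) = 1],
    forall m, (m.*2 <= k)%N -> exists (a : seq (bop V)) (c : bop V) (b : seq (bop V)), [/\ isw a, isw b, size a = m, size b = m &
      nm c <= 2 /\ Tk k = wpr a * c * wpr b] &
    forall s, isw s -> nm (Tk k * wpr s * Tk k) <= 4 * 2 ^+ size s * k.+1%:R^-1].
  by rewrite /Tk; case: cid.
pose uk k := sval (cid (hT1 k)).
have hT2 k : exists (v : bop V), [/\ [/\ E (uk k), E v & nm (uk k * Tk k * v) = 1],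
    forall m, (m.*2 <= k)%N -> exists (a : seq (bop V)) (c : bop V) (b : seq (bop V)), [/\ isw a, isw b, size a = m, size b = m &
      nm c <= 2 /\ Tk k = wpr a * c * wpr b] &
    forall s, isw s -> nm (Tk k * wpr s * Tk k) <= 4 * 2 ^+ size s * k.+1%:R^-1].
  by rewrite /uk; case: cid.
pose vk k := sval (cid (hT2 k)).
have hT k : [/\ [/\ E (uk k), E (vk k) & nm (uk k * Tk k * vk k) = 1],
    forall m, (m.*2 <= k)%N -> exists (a : seq (bop V)) (c : bop V) (b : seq (bop V)), [/\ isw a, isw b, size a = m, size b = m &
      nm c <= 2 /\ Tk k = wpr a * c * wpr b] &
    forall s, isw s -> nm (Tk k * wpr s * Tk k) <= 4 * 2 ^+ size s * k.+1%:R^-1].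
  by rewrite /vk; case: cid.
have [|p hp [T TkT]] := @tbdd_cvg _ _ Tk.
  apply: tbdd_tail => eta eta0; have [m [L hL]] := acompactM hE (ltr0Sn R 1) eta0.
  exists m.*2, L => k mk; have [_ h _] := hT k; have [a [c [b [wa wb am bm [c2 ->]]]]] := h m mk.
  exact: hL.
exists T, (fun k => Tk (p k)), (fun k => uk (p k)), (fun k => vk (p k)); split=> // [|k|s ws].
- have D2 : 0 < D * 2 + 1 by lra.
  rewrite -nm_gt0 ltNge; apply/negP => T0.
  have d0 : 0 < ((D * 2 + 1) * (D * 2 + 1))^-1 by rewrite invr_gt0 mulr_gt0.
  have [N /(_ N (leqnn N)) hN] := TkT _ d0.
  have [[Eu Ev h1] _ _] := hT (p N).
  have h2 : nm (Tk (p N)) < ((D * 2 + 1) * (D * 2 + 1))^-1.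
    by apply: le_lt_trans hN; have := nmBD (Tk (p N)) T; lra.
  have h3 : 1 <= nm (uk (p N)) * nm (Tk (p N)) * nm (vk (p N)).
    by rewrite -h1; apply: le_trans (nmM _ _) _; rewrite ler_wpM2r ?nm_ge0 ?nmM.
  move: h2; rewrite -[ltRHS]mul1r ltr_pdivlMr ?mulr_gt0 // => h2.
  have h4 := hu _ Eu; have h5 := hu _ Ev; have h6 := nm_ge0 (Tk (p N)).
  have : nm (uk (p N)) * nm (Tk (p N)) * nm (vk (p N)) <= (D * 2 + 1) * nm (Tk (p N)) * (D * 2 + 1).
    by rewrite ler_pM ?mulr_ge0 ?nm_ge0 ?ler_wpM2r //; lra.
  lra.
- by have [? _ _] := hT (p k).
apply: tends_uniq (tendsM (tendsMr (wpr s) TkT) TkT) _.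
apply: (@tends_squeeze _ _ (fun k => 4 * 2 ^+ size s * k.+1%:R^-1)) => [e e0|k].
  have c0 : 0 < 4 * 2 ^+ size s :> R by rewrite mulr_gt0 ?exprn_gt0.
  have [N hN] := nat_small (divr_gt0 e0 c0); exists N => n /hN.
  by rewrite ltr_pdivlMr // mulrC.
rewrite subr0; have [_ _ h] := hT (p k); apply: le_trans (h s ws) _.
by rewrite ler_wpM2l ?mulr_ge0 ?exprn_ge0 // lef_pV2 ?posrE // ler_nat ltnS.
Qed.

End Unbounded.

End Words.

(** * Irreducible families *)

Section Irreducible.
Context {R : realType} {V : banType R}.
Implicit Types (f g T B c a k : bop V) (s : seq (bop V)) (x y : V) (W : set V) (E A : set (bop V)).

Definition invs E W := forall f, E f -> forall x, W x -> W (f x).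

Definition irred E := forall W, csub W -> invs E W -> (forall x, W x -> x = 0) \/ (forall x, W x).

Definition spn (X : set V) : set V := [set x | forall W, subsp W -> X `<=` W -> W x].

Lemma spn_subsp X : subsp (spn X).
Proof.
split=> [W sW _|a x y hx hy W sW XW]; first exact: sW.1.
by apply: sW.2; [exact: hx | exact: hy].
Qed.

Lemma sub_spn X : X `<=` spn X. Proof. by move=> x Xx W _; apply. Qed.

Lemma clos_spn_min X W : csub W -> X `<=` W -> clos (spn X) `<=` W.
Proof. by move=> [sW cW] XW x hx; apply: cW; apply: clos_sub hx => y; apply. Qed.

Lemma csub_pre f W : csub W -> csub [set x | W (f x)].
Proof.
move=> cW; split; first split=> [|a x y hx hy]; rewrite /= ?bop0 ?bop_lin; first exact: cW.1.1.
  exact: cW.1.2.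
by move=> x /clos_seq[u hu ux]; apply: (csub_tends cW hu); exact: bop_tends.
Qed.

Definition orb E x := clos (spn [set wpr s x | s in [set s | isw E s]]).

Lemma orb_csub E x : csub (orb E x).
Proof. by apply: clos_csub; exact: spn_subsp. Qed.

Lemma orb_word E s x : isw E s -> orb E x (wpr s x).
Proof. by move=> ws; apply: sub_clos; apply: sub_spn; exists s. Qed.

Lemma orb_self E x : orb E x x.
Proof. by apply: (@orb_word E [::] x). Qed.

Lemma orb_inv E x : invs E (orb E x).
Proof.
move=> f Ef; apply: clos_spn_min; first exact/csub_pre/orb_csub.
move=> _ [s ws <-]; apply: (@orb_word E (f :: s) x) => g.
by rewrite inE => /predU1P[->|/ws].
Qed.

(** The kernel of [T] contains the closed span of the orbit of [x], which is the whole space. *)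
Lemma irred_sep E T x : irred E -> x != 0 -> (forall s, isw E s -> T (wpr s x) = 0) -> T = 0.
Proof.
move=> iE x0 hT; have [h|h] := iE _ (orb_csub E x) (@orb_inv E x).
  by case/eqP: x0; apply: h; exact: orb_self.
apply: bop_ext => y; apply: (clos_spn_min (ker_csub T) _ (h y)) => _ [s ws <-]; exact: hT.
Qed.

Lemma irred_sub E E' : E `<=` E' -> irred E -> irred E'.
Proof. by move=> EE iE W cW iW; apply: iE => // f /EE; apply: iW. Qed.

Definition scales (z : R[i]) E : set (bop V) := [set z *: f | f in E].

Lemma scales_word z E s : z != 0 -> isw (scales z E) s ->
  exists s', [/\ isw E s', size s' = size s & wpr s = z ^+ size s *: wpr s'].
Proof.
move=> z0; elim: s => [|f s IH] ws; first by exists [::]; rewrite expr0 scale1r.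
have [|s' [ws' ss sE]] := IH; first by move=> g gs; apply: ws; rewrite inE gs orbT.
have [g Eg gf] := ws f (mem_head _ _); exists (g :: s'); split; last 2 first.
- by rewrite /= ss.
- by rewrite /= sE -gf (bscalAl z) (bscalAr (z ^+ size s)) scalerA exprS.
by move=> h; rewrite inE => /predU1P[->|/ws'].
Qed.

Lemma word_scales z E s : isw E s -> exists s', [/\ isw (scales z E) s', size s' = size s &
  wpr s' = z ^+ size s *: wpr s].
Proof.
elim: s => [|f s IH] ws; first by exists [::]; rewrite expr0 scale1r.
have [|s' [ws' ss sE]] := IH; first by move=> g gs; apply: ws; rewrite inE gs orbT.
exists (z *: f :: s'); split; last 2 first.
- by rewrite /= ss.
- by rewrite /= sE (bscalAl z) (bscalAr (z ^+ size s)) scalerA exprS.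
by move=> h; rewrite inE => /predU1P[->|/ws'//]; exists f => //; apply: ws; exact: mem_head.
Qed.

Lemma wgrow_scales z E r : z != 0 -> wgrow (scales z E) r <-> wgrow E (r / cabs z).
Proof.
move=> z0; have cz : 0 < cabs z by rewrite cabs_gt0.
split=> -[C C0 hC]; exists C => // s ws.
  have [s' [ws' ss sE]] := word_scales z ws; have := hC s' ws'.
  rewrite sE nmZ cabsX ss exprMn exprVn mulrA ler_pdivlMr ?exprn_gt0 //.
  by rewrite mulrC.
have [s' [ws' ss ->]] := scales_word z0 ws; have := hC s' ws'.
by rewrite nmZ cabsX ss exprMn exprVn mulrA ler_pdivlMr ?exprn_gt0 // mulrC.
Qed.

Lemma wgrow_le E r r' : 0 <= r -> r <= r' -> wgrow E r -> wgrow E r'.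
Proof.
move=> r0 rr [C C0 hC]; exists C => // s ws; apply: le_trans (hC s ws) _.
by rewrite ler_wpM2l // lerXn2r ?nnegrE // (le_trans r0).
Qed.

(** If all words of length [n] had norm at most 1/2, cutting words into blocks of this length would
    give a growth rate below 1. *)
Lemma wgrow_low E n : (forall r, 1 < r -> wgrow E r) -> (forall r, 0 < r -> r < 1 -> ~ wgrow E r) ->
  exists s, [/\ isw E s, size s = n & 2^-1 <= nm (wpr s)].
Proof.
move=> hup hlo; apply: contrapT => no.
have hn s : isw E s -> size s = n -> nm (wpr s) <= 2^-1.
  by move=> ws sn; rewrite leNgt; apply/negP => h; apply: no; exists s; split=> //; exact: ltW.
have [D D0 hD] := hup 2 ltac:(lra).
case: n hn {no} => [|n] hn.
  (* The only word of length 0 is the identity; norm at most 1/2 forces every operator to be 0. *)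
  have h1 := hn [::] (fun (f : bop V) h => ltac:(by [])) erefl.
  have f0 f : nm f = 0.
    have := nmM f 1; rewrite mulr1; have := nm_ge0 f; move: h1 => /=; nra.
  by apply: (hlo 2^-1); [lra | lra | exists 0 => // s _; rewrite f0 mul0r].
have n1 : 1 <= n.+1%:R :> R by rewrite ler1n.
(* By Bernoulli's inequality this [d] gives [(1 - d) ^+ n.+1 >= 2^-1]. *)
have [d [d0 d1 dE]] : exists d : R, [/\ 0 < d, d <= 2^-1 & d * (2 * n.+1%:R) = 1].
  exists (2 * n.+1%:R)^-1; split; first by rewrite invr_gt0; lra.
    by rewrite lef_pV2 ?posrE //; lra.
  by rewrite mulVf // gt_eqF //; lra.
pose t := 1 - d; have t0 : 0 < t by rewrite /t; lra.
have bern m : 1 - m%:R * d <= t ^+ m.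
  elim: m => [|m IH]; first by rewrite mul0r subr0 expr0.
  rewrite exprS -addn1 natrD; have m0 : 0 <= m%:R :> R by [].
  by have := ler_wpM2l (ltW t0) IH; rewrite /t; nra.
have tn : 2^-1 <= t ^+ n.+1 by apply: le_trans (bern _) ; lra.
apply: (hlo t t0); first by rewrite /t; lra.
pose K := D * 2 ^+ n.+1 / t ^+ n.+1.
have K0 : 0 <= K by rewrite divr_ge0 ?mulr_ge0 ?exprn_ge0 // ltW.
exists K => // s; have [m] := ubnP (size s); elim: m s => // m IH s sm ws.
have [sn|ns] := ltnP (size s) n.+1.
  apply: le_trans (hD s ws) _; rewrite /K -!mulrA; apply: ler_wpM2l => //.
  apply: le_trans (_ : 2 ^+ n.+1 * 1 <= _).
    by rewrite mulr1; apply: ler_weXn2l; [rewrite ler1n | exact: ltnW].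
  apply: ler_wpM2l; first exact: exprn_ge0.
  rewrite mulrC ler_pdivlMr ?exprn_gt0 // mul1r.
  by apply: ler_wiXn2l; [exact: ltW | rewrite /t; lra | exact: ltnW].
rewrite -{1}(cat_take_drop n.+1 s) wpr_cat; apply: le_trans (nmM _ _) _.
have w1 : isw E (take n.+1 s) by move=> f /mem_take; exact: ws.
have w2 : isw E (drop n.+1 s) by move=> f /mem_drop; exact: ws.
have h1 := hn _ w1 (size_takel ns).
have h2 := IH (drop n.+1 s) ltac:(rewrite size_drop; clear -ns sm; lia) w2.
apply: le_trans (ler_pM (nm_ge0 _) (nm_ge0 _) h1 h2) _.
rewrite size_drop mulrCA ler_wpM2l // -{2}(subnKC ns) exprD ler_wpM2r ?exprn_ge0 //.
exact: ltW.
Qed.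

(** [rho] is the joint spectral radius; division by it brings the critical growth rate to 1, so that
    [wgrow_low] applies. *)
Lemma wgrow_normalize E r0 r1 : 0 < r0 -> wgrow E r0 -> 0 < r1 -> ~ wgrow E r1 ->
  exists rho, [/\ r1 <= rho, 0 < rho, forall r, 1 < r -> wgrow (scales (rho^-1)%:C%C E) r &
    forall n, exists s, [/\ isw (scales (rho^-1)%:C%C E) s, size s = n & 2^-1 <= nm (wpr s)]].
Proof.
move=> r00 g0 r10 n1; pose X := [set r | 0 < r /\ wgrow E r].
have lb : lbound X r1.
  move=> r [rp gr]; rewrite leNgt; apply/negP => rr; apply: n1.
  exact: wgrow_le (ltW rp) (ltW rr) gr.
have hX : has_inf X by split; [exists r0 | exists r1].
have rho1 : r1 <= inf X by apply: lb_le_inf hX.1 lb.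
have rho0 : 0 < inf X by lra.
set z := ((inf X)^-1)%:C%C : R[i].
have cz : cabs z = (inf X)^-1 by rewrite cabs_nneg // invr_ge0 ltW.
have z0 : z != 0 by rewrite -cabs_gt0 cz invr_gt0.
have hup r : 1 < r -> wgrow (scales z E) r.
  move=> r1'; apply/wgrow_scales => //; rewrite cz invrK.
  have h : 0 < r * inf X - inf X by rewrite subr_gt0 ltr_pMl.
  have [s [s0 gs] hs] := inf_adherent h hX.
  by apply: wgrow_le (ltW s0) _ gs; apply: ltW; move: hs; rewrite addrC subrK.
exists (inf X); split=> // n; apply: wgrow_low => // r r0' r1' /wgrow_scales => /(_ z0).
rewrite cz invrK => h; have := ge_inf hX.2 (conj (mulr_gt0 r0' rho0) h : X _).
by rewrite leNgt gtr_pMl // r1'.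
Qed.

Section CompactAlgebra.
Variable A : set (bop V).
Hypothesis sA : subsp A.
Hypothesis mA : forall a b, A a -> A b -> A (a * b).
Hypothesis kA : forall a, A a -> kop a.
Hypothesis iA : irred A.
Hypothesis nzA : exists2 a, A a & a != 0.

Lemma line_csub x : csub [set y | exists z : R[i], y = z *: x].
Proof.
have [->|x0] := eqVneq x 0.
  have -> : [set y : V | exists z : R[i], y = z *: 0] = [set 0].
    by apply/seteqP; split=> [y [z ->]|y ->] /=; [rewrite scaler0 | exists 0; rewrite scaler0].
  exact: csub0.
have := (fdim_add_line fdim0 (fun h => negP x0 (introT eqP h))).1.
rewrite (_ : add_line _ _ = [set y | exists z : R[i], y = z *: x]) //.
apply/seteqP; split=> y [z /= h]; exists z; first by apply/eqP; rewrite -subr_eq0 h.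
by rewrite h subrr.
Qed.

Lemma alg_move x : x != 0 -> exists2 a, A a & a x != 0.
Proof.
move=> x0; apply: contrapT => no.
have ax a : A a -> a x = 0 by move=> Aa; apply/eqP/negPn/negP => h; apply: no; exists a.
have [|h|h] := iA (line_csub x).
- by move=> a Aa y [z ->]; exists 0; rewrite bopZ ax // scaler0 scale0r.
- by case/eqP: x0; apply: h; exists 1; rewrite scale1r.
have [a Aa /eqP[]] := nzA; apply: bop_ext => y; have [z ->] := h y.
by rewrite bopZ ax // scaler0.
Qed.

Lemma alg_dense x y (e : R) : x != 0 -> 0 < e -> exists2 a, A a & nm (a x - y) < e.
Proof.
move=> x0 e0; pose W := clos [set a x | a in A].
have sW : subsp [set a x | a in A].
  split=> [|z _ _ [a Aa <-] [b Ab <-]]; first by exists 0 => //; exact: sA.1.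
  by exists (z *: a + b) => //; exact: sA.2.
have [|h|h] := iA (clos_csub sW).
- move=> a Aa u /clos_seq[v hv vu]; apply: (@seq_clos _ _ _ (fun n => a (v n))) => [n|]; last exact: bop_tends.
  by have [b Ab <-] := hv n; exists (a * b) => //; exact: mA.
- have [a Aa /eqP[]] := alg_move x0; apply: h; apply: sub_clos; by exists a.
have [_ [a Aa <-] h'] := h y _ e0; by exists a; rewrite // nmC.
Qed.

(** The family is supplied by Lomonosov's construction: words in [K1 c K2], with [c] in the unit
    ball of the algebra, return to a fixed ball [S] after scaling and so cannot decay too fast. A
    word near a nonzero idempotent is compact and not quasinilpotent; if the normalised words are
    unbounded, the operator of [words_nilp] contradicts the density of orbits. *)
Lemma compact_algebra_eig : exists w z x, [/\ A w, z != 0, x != 0 & w x = z *: x].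
Proof.
have [K1 AK1 K10] := nzA.
have [x1 hx1] : exists x, K1 x != 0.
  apply: contrapT => /forallNP h; case/eqP: K10; apply: bop_ext => x.
  by apply/eqP/negPn/negP/h.
have [K2 AK2 hC] := alg_move hx1.
pose C := K2 * K1; have kC : kop C by apply: kopMl; exact: kA.
have Cx0 : 0 < nm (C x1) by rewrite nm_gt0.
have x10 : 0 < nm x1 by rewrite nm_gt0; apply/eqP => e; move: hx1; rewrite e bop0 eqxx.
have C10 : 0 < nm C + 1 by have := nm_ge0 C; lra.
pose r := Num.min (nm x1 / 2) (nm (C x1) / 2 / (nm C + 1)).
have r0 : 0 < r by rewrite lt_min !divr_gt0.
have rx : r <= nm x1 / 2 by rewrite ge_min lexx.
have rC : r * (nm C + 1) <= nm (C x1) / 2 by rewrite -ler_pdivlMr // ge_min lexx orbT.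
pose S := [set x | nm (x - x1) <= r].
have Sx x : S x -> nm x <= 2 * nm x1 by move=> h; have {}h : nm (x - x1) <= r := h; have := nmBD x x1; lra.
have CS x : S x -> nm (C x1) / 2 <= nm (C x).
  move=> h; have {}h : nm (x - x1) <= r := h.
  have h1 := nm_bopP C (x1 - x); have h2 := nmBD (C x1) (C x); rewrite -bopB in h2.
  rewrite nmC in h; have : nm C * nm (x1 - x) <= (nm C + 1) * r by rewrite ler_pM ?nm_ge0 //; lra.
  lra.
(* One bound for all of [S]: otherwise the images [C (u n)] have a cluster point [y], nonzero
   because [C] is bounded below on [S], and a single element of the algebra moves [y] and the images
   near it back into [S]. *)
have [M hM] : exists M : nat, forall x, S x -> exists2 c, A c & nm c <= M%:R /\ S (c (C x)).
  apply: contrapT => /forallNP no.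
  have hn n : exists x, S x /\ forall c, A c -> nm c <= n%:R -> ~ S (c (C x)).
    apply: contrapT => /forallNP h; apply: (no n) => x Sx'; apply: contrapT => h'.
    by apply: (h x); split=> // c Ac cn Sc; apply: h'; exists c.
  pose u n := sval (cid (hn n)).
  have uP n : S (u n) /\ forall c, A c -> nm c <= n%:R -> ~ S (c (C (u n))) by rewrite /u; case: cid.
  have [p hp [y hy]] := @kop_seq _ _ C u (2 * nm x1) kC (fun n => Sx _ (uP n).1).
  have y0 : y != 0.
    rewrite -nm_gt0; apply: lt_le_trans (half_gt0 Cx0) _.
    rewrite leNgt; apply/negP => hlt.
    have [N /(_ N (leqnn N))] := hy (nm (C x1) / 2 - nm y) ltac:(by rewrite subr_gt0).
    by have := CS _ (uP (p N)).1; have := nmBD (C (u (p N))) y; lra.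
  have [c Ac hc] := alg_dense x1 y0 (half_gt0 r0).
  have [N hN] := bop_tends c hy (half_gt0 r0).
  pose n := maxn N (Num.truncn (nm c)).+1.
  have [_ /(_ c Ac)] := uP (p n); case.
    apply: le_trans (ltW (truncnS_gt (nm c))) _; rewrite ler_nat.
    by apply: leq_trans (hp n); exact: leq_maxr.
  have := hN n (leq_maxl _ _); have := nm_tri (c y) (c (C (u (p n)))) x1.
  rewrite /S /=; lra.
pose U := [set c | A c /\ nm c <= 1].
pose E := [set f | exists2 c, U c & f = K1 * c * K2].
have AE f : E f -> A f by move=> [c [Ac _] ->]; apply: mA => //; exact: mA.
have Aw s f : E f -> isw E s -> A (wpr (f :: s)).
  elim: s f => [|g s IH] f Ef ws; first by rewrite /= mulr1; exact: AE.
  apply: mA; first exact: AE.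
  by apply: IH => [|h hs]; apply: ws; rewrite inE ?eqxx ?hs ?orbT.
pose m : R := M%:R + 1; have m0 : 0 < m by rewrite ltr_wpDl.
pose mc : R[i] := m%:C%C; have cm : cabs mc = m by rewrite cabs_nneg // ltW.
have mc0 : mc != 0 by rewrite -cabs_gt0 cm.
have hM' x : S x -> exists2 c, U c & S (mc *: c (C x)).
  move=> /hM[c Ac [cM Sc]]; exists (mc^-1 *: c).
    split; first exact: subspZ.
    by rewrite nmZ cabsV cm mulrC ler_pdivrMr // mul1r /m; lra.
  by rewrite bop_scaleE scalerA mulfV // scale1r.
(* After [n] returns to [S] there is a word of length [n] of norm at least [kap / m ^+ n]. *)
have chain n : exists s c, [/\ isw E s, size s = n, U c &
    S (mc ^+ n.+1 *: (c * K2 * wpr s * K1) x1)].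
  elim: n => [|n [s [c [ws sn Uc Sc]]]].
    have [|c Uc Sc] := hM' x1; first by rewrite /S /= subrr nm0 ltW.
    by exists [::], c; split=> //; rewrite /= mulr1 expr1 -mulrA.
  have [c' Uc' Sc'] := hM' _ Sc; exists (K1 * c * K2 :: s), c'; split=> //.
  - by move=> f; rewrite inE => /predU1P[->|/ws//]; exists c.
  - by rewrite /= sn.
  - have e : c' * (K2 * K1) * (c * K2 * wpr s * K1) = c' * K2 * wpr (K1 * c * K2 :: s) * K1.
      by rewrite /= !mulrA.
    by move: Sc'; rewrite (bopZ C) (bopZ c') scalerA -exprS -e.
pose kap := nm x1 / 2 / (m * ((nm K2 + 1) * (nm K1 + 1) * nm x1)).
have kap0 : 0 < kap.
  by rewrite !divr_gt0 // !mulr_gt0 //; [have := nm_ge0 K2 | have := nm_ge0 K1]; lra.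
have low n : exists s, [/\ isw E s, size s = n & kap <= m ^+ n * nm (wpr s)].
  have [s [c [ws sn [_ c1] Sc]]] := chain n; exists s; split=> //.
  have h1 : nm x1 / 2 <= nm (mc ^+ n.+1 *: (c * K2 * wpr s * K1) x1).
    have {}Sc : nm (mc ^+ n.+1 *: (c * K2 * wpr s * K1) x1 - x1) <= r := Sc.
    by rewrite nmC in Sc; have := nmBD x1 (mc ^+ n.+1 *: (c * K2 * wpr s * K1) x1); lra.
  rewrite nmZ cabsX cm in h1.
  have h2 : nm ((c * K2 * wpr s * K1) x1) <= (nm K2 + 1) * nm (wpr s) * (nm K1 + 1) * nm x1.
    apply: le_trans (nm_bopP _ _) _; rewrite ler_wpM2r ?nm_ge0 //.
    apply: le_trans (nmM _ _) _; rewrite ler_pM ?nm_ge0 //; last by lra.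
    apply: le_trans (nmM _ _) _; rewrite ler_wpM2r ?nm_ge0 //.
    by apply: le_trans (nmM _ _) _; have := nm_ge0 K2; have := nm_ge0 c; nra.
  have h3 := le_trans h1 (ler_wpM2l (exprn_ge0 n.+1 (ltW m0)) h2).
  rewrite /kap ler_pdivrMr; last by rewrite !mulr_gt0 //; [have := nm_ge0 K2 | have := nm_ge0 K1]; lra.
  apply: le_trans h3 _; rewrite exprS le_eqVlt; apply/orP; left; apply/eqP; ring.
have nogrow : ~ wgrow E (m^-1 / 2).
  move=> [D D0 hD]; have [N hN] := geo_small D (ltac:(lra) : 0 <= 2^-1) (ltac:(lra) : 2^-1 < 1) kap0.
  have [s [ws sn h]] := low N; have := hD s ws; rewrite sn => h'.
  have := hN N (leqnn N); have mN : 0 < m ^+ N by rewrite exprn_gt0.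
  have := ler_wpM2l (ltW mN) h'; rewrite mulrCA -exprMn mulrA mulfV ?gt_eqF // mul1r; lra.
have Enm f : E f -> nm f <= nm K1 * nm K2.
  move=> [c [_ c1] ->]; apply: le_trans (nmM _ _) _; rewrite ler_wpM2r ?nm_ge0 //.
  by apply: le_trans (nmM _ _) _; rewrite -[leRHS]mulr1 ler_wpM2l ?nm_ge0.
pose r2 := nm K1 * nm K2 + 1; have K12 : 0 <= nm K1 * nm K2 by rewrite mulr_ge0 ?nm_ge0.
have up : wgrow E r2.
  exists 1 => // s; rewrite mul1r; elim: s => [|f s IH] ws; first by rewrite expr0 nm1_le.
  apply: le_trans (nmM _ _) _; rewrite exprS ler_pM ?nm_ge0 //.
    by apply: le_trans (Enm f (ws f (mem_head _ _))) _; rewrite lerDl.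
  by apply: IH => g gs; apply: ws; rewrite inE gs orbT.
have r2p : 0 < r2 by rewrite /r2; lra.
have mi : 0 < m^-1 / 2 by rewrite divr_gt0 // invr_gt0.
have [rho [_ rho0 hup hlow]] := wgrow_normalize r2p up mi nogrow.
set z := (rho^-1)%:C%C : R[i] in hup hlow; set E' := scales z E in hup hlow.
have cz : cabs z = rho^-1 by rewrite cabs_nneg // invr_ge0 ltW.
have z0 : z != 0 by rewrite -cabs_gt0 cz invr_gt0.
have E'P f : E' f -> exists2 c, U c & f = z *: (K1 * c * K2) by move=> [_ [c Uc ->] <-]; exists c.
have hE : acompact E'.
  move=> eta eta0; pose b := rho^-1 * rho^-1 * (nm K2 * nm K1 + 1).
  have K21 : 0 <= nm K2 * nm K1 by rewrite mulr_ge0 ?nm_ge0.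
  have b0 : 0 < b by rewrite !mulr_gt0 ?invr_gt0 //; lra.
  pose bc : R[i] := b%:C%C; have cb : cabs bc = b by rewrite cabs_nneg // ltW.
  have bc0 : bc != 0 by rewrite -cabs_gt0 cb.
  have [L hL] := vala (kA AK1) (kA AK2) (divr_gt0 eta0 b0).
  exists 1%N, [seq bc *: f | f <- L] => -[//|u []//] [//|v []//] c wu wv _ _ c1.
  have [c1' [_ h1] ->] := E'P u (wu u (mem_head _ _)).
  have [c2' [_ h2] ->] := E'P v (wv v (mem_head _ _)).
  pose d := bc^-1 *: (z *: (z *: (c1' * K2 * c * K1 * c2'))).
  have d1 : nm d <= 1.
    rewrite !nmZ cabsV cb cz mulrC ler_pdivrMr // mul1r mulrA ler_wpM2l ?mulr_ge0 ?invr_ge0 ?(ltW rho0) //.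
    have h : nm (c1' * K2 * c * K1 * c2') <= 1 * nm K2 * 1 * nm K1 * 1.
      apply: le_trans (nmM _ _) _; rewrite ler_pM ?nm_ge0 //.
      apply: le_trans (nmM _ _) _; rewrite ler_pM ?nm_ge0 //.
      apply: le_trans (nmM _ _) _; rewrite ler_pM ?nm_ge0 //.
      by apply: le_trans (nmM _ _) _; rewrite ler_pM ?nm_ge0.
    by apply: le_trans h _; rewrite mul1r !mulr1 lerDl.
  have [|y yL hy] := hL (K1 * d * K2); first by exists d.
  exists (bc *: y); first exact: map_f.
  have -> : wpr [:: z *: (K1 * c1' * K2)] * c * wpr [:: z *: (K1 * c2' * K2)] = bc *: (K1 * d * K2).
    rewrite /= !mulr1 /d (bscalAr bc^-1) (bscalAl bc^-1) scalerA mulfV // scale1r.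
    rewrite (bscalAr z) !(bscalAl z) (bscalAr z) (bscalAl z) (bscalAr z) (bscalAl z).
    by congr (z *: (z *: _)); rewrite !mulrA.
  by rewrite -scalerBr nmZ cb mulrC -ltr_pdivlMr.
have [[D hD]|unb] := pselect (exists D, forall s, isw E' s -> nm (wpr s) <= D).
  have [B [BB B0 lB]] := words_idem hD hE hlow.
  have [e e0 he] := near_idem_not_qn BB B0.
  have [s [ws s1 sB]] := lB e 1%N e0; case: s ws s1 sB => [//|f s] ws _ sB.
  have [s' [ws' ss sE]] := scales_word z0 ws; case: s' ws' ss sE => [//|g s'] ws' _ sE.
  have AwF : A (wpr (f :: s)).
    rewrite sE; apply: subspZ => //; apply: Aw; first by apply: ws'; exact: mem_head.
    by move=> h hs; apply: ws'; rewrite inE hs orbT.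
  have [l [x [l0 x0 wx]]] := kop_nqn_eig (kA AwF) (he _ sB).
  by exists (wpr (f :: s)), l, x.
have hunb D : exists s, isw E' s /\ D < nm (wpr s).
  apply: contrapT => /forallNP h; apply: unb; exists D => s ws.
  by rewrite leNgt; apply/negP => hl; apply: (h s).
have [T [Tk [uk [vk [T0 TkT huv hT]]]]] := words_nilp hE hup hunb.
(* The left outer letter ends in [K2] and the right one begins with [K1], so the normalisation of
   [uk * Tk * vk] bounds [K2 * Tk * K1] from below. *)
have T1 : K2 * T * K1 != 0.
  apply/eqP => e0; have t := tendsMr K1 (tendsMl K2 TkT); rewrite e0 in t.
  pose b := rho^-1 * rho^-1 * (nm K1 * nm K2) + 1.
  have b0 : 0 < b by rewrite ltr_wpDl // !mulr_ge0 ?nm_ge0 ?invr_ge0 // ltW.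
  have [N /(_ N (leqnn N))] := t b^-1 ltac:(by rewrite invr_gt0); rewrite subr0 => h.
  have [/E'P[c1' [_ h1] uE] /E'P[c2' [_ h2] vE] h3] := huv N.
  have h4 : 1 <= rho^-1 * rho^-1 * (nm K1 * nm (K2 * Tk N * K1) * nm K2).
    rewrite -h3 uE vE (bscalAl z) (bscalAr z) (bscalAl z) scalerA nmZ cabsM cz.
    rewrite ler_wpM2l ?mulr_ge0 ?invr_ge0 ?(ltW rho0) //.
    have -> : K1 * c1' * K2 * Tk N * (K1 * c2' * K2) = K1 * c1' * (K2 * Tk N * K1) * (c2' * K2).
      by rewrite !mulrA.
    apply: le_trans (nmM _ _) _; rewrite ler_pM ?nm_ge0 //.
      apply: le_trans (nmM _ _) _; rewrite ler_wpM2r ?nm_ge0 //.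
      by apply: le_trans (nmM _ _) _; rewrite -[leRHS]mulr1 ler_wpM2l ?nm_ge0.
    by apply: le_trans (nmM _ _) _; rewrite -[leRHS]mul1r ler_wpM2r ?nm_ge0.
  move: h; rewrite -[ltRHS]mul1r ltr_pdivlMr // /b mulrDr mulr1 => h.
  have h5 := nm_ge0 (K2 * Tk N * K1); lra.
have [x hx] : exists x, (K2 * T * K1) x != 0.
  apply: contrapT => /forallNP h; case/eqP: T1; apply: bop_ext => x.
  by apply/eqP/negPn/negP/h.
have TA a : A a -> T * (K1 * a * K2) * T = 0.
  move=> Aa; pose q : R[i] := (nm a + 1)%:C%C.
  have q1 : 0 < nm a + 1 by have := nm_ge0 a; lra.
  have cq : cabs q = nm a + 1 by rewrite cabs_nneg // ltW.
  have q0 : q != 0 by rewrite -cabs_gt0 cq.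
  have := hT [:: z *: (K1 * (q^-1 *: a) * K2)] _; rewrite /= mulr1.
  rewrite (bscalAr q^-1) (bscalAl q^-1) !(bscalAr z) (bscalAl z) (bscalAr q^-1) (bscalAl q^-1).
  move=> /(_ _)/eqP; rewrite !scaler_eq0 (negbTE z0) invr_eq0 (negbTE q0) /= => h; apply/eqP/h.
  move=> f; rewrite inE => /eqP->; exists (K1 * (q^-1 *: a) * K2).
    exists (q^-1 *: a) => //; split; first exact: subspZ.
    by rewrite nmZ cabsV cq mulrC ler_pdivrMr // mul1r lerDl.
  by rewrite (bscalAr q^-1) (bscalAl q^-1).
have y0 : K2 (T (K1 x)) != 0 by exact: hx.
(* By density the vectors [a (K2 (T (K1 x)))] approach every [v], and [T * K1] annihilates all of
   them. *)
have TK1 : T * K1 = 0.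
  apply: bop_ext => v; apply: nm_small => e e0.
  have d1 : 0 < nm (T * K1) + 1 by have := nm_ge0 (T * K1); lra.
  have [a Aa ha] := alg_dense v y0 (divr_gt0 e0 d1).
  have h0 : (T * K1) (a (K2 (T (K1 x)))) = 0.
    by change ((T * (K1 * a * K2) * T) (K1 x) = 0); rewrite TA.
  have -> : (T * K1) v = - (T * K1) (a (K2 (T (K1 x))) - v) by rewrite bopB h0 sub0r opprK.
  rewrite nmN; apply: le_trans (nm_bopP _ _) _.
  move: ha; rewrite ltr_pdivlMr // => ha; have := nm_ge0 (a (K2 (T (K1 x))) - v); lra.
by move: T1; rewrite -mulrA TK1 mulr0 eqxx.
Qed.

End CompactAlgebra.
End Irreducible.

(** * The algebra generated by a family, and Lie triple systems *)

Section GeneratedAlgebra.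
Context {R : realType} {V : banType R}.
Implicit Types (f g a b c : bop V) (s : seq (bop V)) (x y : V) (W : set V) (E A M : set (bop V)).
Implicit Types (L : seq (R[i] * seq (bop V))).

(** Only nonempty words: no identity is adjoined, so the algebra generated by compact operators
    stays compact. *)
Definition alg E f := exists L, (forall p, p \in L -> isw E p.2 /\ p.2 != [::]) /\
  f = \sum_(p <- L) p.1 *: wpr p.2.

Lemma alg_sub E : E `<=` alg E.
Proof.
move=> f Ef; exists [:: (1, [:: f])]; split=> [p|]; last by rewrite big_seq1 scale1r /= mulr1.
by rewrite inE => /eqP-> /=; split=> // g; rewrite inE => /eqP->.
Qed.

Lemma alg_subsp E : subsp (alg E).
Proof.
split=> [|z _ _ [L [hL ->]] [L' [hL' ->]]]; first by exists [::]; split=> //; rewrite big_nil.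
exists ([seq (z * p.1, p.2) | p <- L] ++ L'); split=> [p|].
  by rewrite mem_cat => /orP[/mapP[q qL ->]|/hL'] //=; apply: hL.
rewrite big_cat big_map scaler_sumr; congr (_ + _).
by apply: eq_bigr => p _; rewrite scalerA.
Qed.

Lemma alg_mul E f g : alg E f -> alg E g -> alg E (f * g).
Proof.
move=> [L [hL ->]] [L' [hL' ->]].
exists [seq (p.1 * q.1, p.2 ++ q.2) | p <- L, q <- L']; split=> [p /allpairsP[[u v] [/= uL vL ->]] /=|].
  have [h1 h2] := hL _ uL; have [h3 _] := hL' _ vL; split; first by apply/isw_cat.
  by case: u.2 h2.
rewrite big_allpairs_dep mulr_suml; apply: eq_bigr => p _; rewrite mulr_sumr.
by apply: eq_bigr => q _; rewrite (bscalAl p.1) (bscalAr q.1) scalerA wpr_cat.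
Qed.

Lemma alg_kop E f : (forall a, E a -> kop a) -> alg E f -> kop f.
Proof.
move=> hE [L [hL ->]]; rewrite big_seq; apply: kop_sum => p /hL[ws]; case: p.2 ws => // a s ws _.
by apply: kopZ; apply: kopMr; apply: hE; apply: ws; exact: mem_head.
Qed.

(** The induction bounds [wpr s * f ^+ m] for all prefixes [s] at once. Each factor [f] contributes
    at most [b], the coefficient sum plus 1, and at least one letter; as [t <= 1], longer words are
    estimated by one letter. *)
Lemma alg_qn E f : (forall r, 0 < r -> wgrow E r) -> alg E f -> qn f.
Proof.
move=> hE [L [hL fE]] r r0; pose b := \sum_(p <- L) cabs p.1 + 1.
have b0 : 0 < b by rewrite ltr_wpDl // sumr_ge0 // => p _; exact: cabs_ge0.
pose t := Num.min (r / b) 1; have t0 : 0 < t by rewrite lt_min divr_gt0 //= ltr01.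
have t1 : t <= 1 by rewrite ge_min lexx orbT.
have tb : b * t <= r by rewrite mulrC -ler_pdivlMr // ge_min lexx.
have [C C0 hC] := hE t t0.
have key m s : isw E s -> nm (wpr s * f ^+ m) <= C * t ^+ size s * (b * t) ^+ m.
  elim: m s => [|m IH] s ws; first by rewrite expr0 !mulr1; exact: hC.
  rewrite exprS mulrA {1}fE mulr_sumr mulr_suml; apply: le_trans (nm_sum _ _ _) _.
  apply: le_trans (_ : \sum_(p <- L) cabs p.1 * (C * t ^+ size s * t * (b * t) ^+ m) <= _).
    rewrite !big_seq; apply: ler_sum => p /hL[wp p0].
    rewrite (bscalAr p.1) (bscalAl p.1) nmZ ler_wpM2l ?cabs_ge0 // -wpr_cat.
    apply: le_trans (IH _ _) _; first by apply/isw_cat.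
    apply: ler_wpM2r; first by rewrite exprn_ge0 // mulr_ge0 // ltW.
    rewrite -mulrA; apply: ler_wpM2l => //; rewrite size_cat exprD.
    apply: ler_wpM2l; first by rewrite exprn_ge0 // ltW.
    by case: p.2 p0 => // a s' _; rewrite exprS ler_piMr ?(ltW t0) // exprn_ile1 // ltW.
  rewrite -mulr_suml exprS; set S := \sum_(p <- L) _; set X := (b * t) ^+ m.
  have X0 : 0 <= C * t ^+ size s * X.
    by rewrite !mulr_ge0 ?exprn_ge0 // ?mulr_ge0 // ltW.
  have -> : S * (C * t ^+ size s * t * X) = C * t ^+ size s * X * (S * t) by ring.
  have -> : C * t ^+ size s * (b * t * X) = C * t ^+ size s * X * (b * t) by ring.
  by rewrite ler_wpM2l // ler_pM2r // /b lerDl.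
exists C => // n; have := key n [::] (fun f h => ltac:(by [])); rewrite mul1r expr0 mulr1 => h.
apply: le_trans h _; apply: ler_wpM2l => //; apply: lerXn2r => //; rewrite nnegrE.
  by rewrite mulr_ge0 // ltW.
exact: ltW.
Qed.

Lemma irred_alg E : irred E -> irred (alg E).
Proof. exact/irred_sub/alg_sub. Qed.

Definition lts M := subsp M /\
  forall a b c, M a -> M b -> M c -> M (a * (b * c - c * b) - (b * c - c * b) * a).

Definition volt M := forall a, M a -> kop a /\ qn a.

End GeneratedAlgebra.

(** * Descent of triple systems to a gap *)

Section GapTriples.
Context {R : realType} {V : banType R}.
Implicit Types (f g a b c : bop V).
Variable G : gapdata (V := V).

Lemma gapdata_pull (U : set (gap G)) : csub U -> csub [set x | gtop G x /\ U (cls G x)].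
Proof.
have cZ := gtopP G => cU; split.
  split=> [|a x y [Zx Ux] [Zy Uy]]; first by split; [exact: cZ.1.1 | rewrite cls0; exact: cU.1.1].
  split; first exact: cZ.1.2.
  rewrite clsD ?clsZ //; first exact: cU.1.2.
  by apply: (subspZ _ cZ.1).
move=> x /clos_seq[u hu ux]; have Zu n : gtop G (u n) by have [] := hu n.
split; first exact: (csub_tends cZ Zu ux).
by apply: (csub_tends cU _ (cls_tends (G := G) Zu ux)) => n; have [] := hu n.
Qed.

Lemma gind_volterra (M : set (bop V)) : lts M -> volt M -> (forall f, M f -> gstab G f) ->
  lts [set gind G f | f in M] /\ volt [set gind G f | f in M].
Proof.
move=> lM vM st; have gB f g : gstab G f -> gstab G g -> gind G (f - g) = gind G f - gind G g.
  move=> hf hg; have := gind_lin (-1) hg hf; rewrite !scaleN1r addrC => ->.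
  by rewrite addrC.
have sB f g : gstab G f -> gstab G g -> gstab G (f - g).
  by move=> hf hg; rewrite addrC -scaleN1r; exact: gstab_lin.
split; last first.
  move=> _ [f Mf <-]; have [kf qf] := vM f Mf.
  by split; [apply: gind_kop => //; exact: st | apply: gind_qn => //; exact: st].
split.
  split=> [|z _ _ [f hf <-] [g hg <-]].
    exists 0; first exact: lM.1.1.
    apply/esym/gind_ext => [|x Zx]; first by apply: st; exact: lM.1.1.
    by rewrite !bop_0E cls0.
  by exists (z *: f + g); [exact: lM.1.2 | apply: gind_lin; exact: st].
move=> _ _ _ [a ha <-] [b hb <-] [c hc <-].
exists (a * (b * c - c * b) - (b * c - c * b) * a); first exact: lM.2.
have [sa sb sc] := (@And3 _ _ _) (st _ ha) (st _ hb) (st _ hc).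
have sbc : gstab G (b * c - c * b) by apply: sB; exact: gstabM.
rewrite gB; [|exact: gstabM|exact: gstabM].
rewrite !gindM // gB; [|exact: gstabM|exact: gstabM].
by rewrite !gindM.
Qed.

End GapTriples.

(** * A gap on which finitely many elements act irreducibly *)

Section IrreducibleGap.
Context {R : realType} {V : banType R}.
Implicit Types (f g a b c : bop V) (s : seq (bop V)) (x y : V) (W U : set V).
Variables (M : set (bop V)) (N : seq (bop V)) (w : bop V) (v : V) (l : R[i]).
Hypotheses (lM : lts M) (vM : volt M) (NM : forall a, a \in N -> M a).
Hypotheses (wN : alg [set a | a \in N] w) (v0 : v != 0) (l0 : l != 0) (wv : w v = l *: v).

Let E : set (bop V) := [set a | a \in N].

Let kw : kop w. Proof. by apply: alg_kop wN => a /= /NM /vM[]. Qed.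

Lemma alg_inv W f : csub W -> invs E W -> alg E f -> forall x, W x -> W (f x).
Proof.
move=> cW iW [L [hL ->]] x Wx; rewrite bop_sumE big_seq; apply: (subsp_sum _ cW.1) => p /hL[ws _].
rewrite bop_scaleE; apply: (subspZ _ cW.1); elim: p.2 ws => [//|a s IH] ws.
rewrite /=; apply: iW; first by apply: ws; exact: mem_head.
by apply: IH => b bs; apply: ws; rewrite inE bs orbT.
Qed.

Let T := {W : set V | [/\ csub W, invs E W & ~ W v]}.

(** Zorn's lemma; what needs an argument is that the closure of the union of a chain still avoids
    [v]. *)
Lemma max_avoiding : exists W, [/\ csub W, invs E W, ~ W v &
  forall U, csub U -> invs E U -> ~ U v -> W `<=` U -> U `<=` W].
Proof.
pose mkT W (h : [/\ csub W, invs E W & ~ W v]) : T :=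
  exist (fun W => [/\ csub W, invs E W & ~ W v]) W h.
have [|||C tC|[W [cW iW Wv]] hW] := @Zorn T (fun W U : T => `[< sval W `<=` sval U >]).
- by move=> W; apply/asboolP.
- by move=> W U X /asboolP h /asboolP h'; apply/asboolP => x /h /h'.
- move=> [W hW] [U hU] /asboolP /= h /asboolP /= h'; have WU : W = U by apply/seteqP.
  by subst U; rewrite (Prop_irrelevance hW hU).
- pose X := [set x | exists2 W : T, C W & sval W x].
  have [[W0 CW0]|nC] := pselect (exists W : T, C W); last first.
    have P0 : [/\ csub [set (0 : V)], invs E [set 0] & ~ [set 0] v].
      split; [exact: csub0 | by move=> f _ x ->; exact: bop0 | by move=> h; case/eqP: v0].
    by exists (mkT _ P0) => W CW; case: nC; exists W.
  have sX : subsp X.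
    split=> [|a x y [W1 C1 h1] [W2 C2 h2]].
      by exists W0 => //; have [[[? _] _] _ _] := svalP W0.
    have [W3 [C3 h13 h23]] : exists W3 : T, [/\ C W3, sval W3 x & sval W3 y].
      by have [/asboolP h|/asboolP h] := tC _ _ C1 C2; [exists W2; split=> //; exact: h | exists W1; split=> //; exact: h].
    by exists W3 => //; have [[[_ h] _] _ _] := svalP W3; apply: h.
  have fin (s : seq V) : (forall x, x \in s -> X x) -> exists2 W : T, C W & forall x, x \in s -> sval W x.
    elim: s => [_|x s IH hs]; first by exists W0.
    have [|W1 C1 h1] := IH; first by move=> y ys; apply: hs; rewrite inE ys orbT.
    have [W2 C2 h2] := hs x (mem_head _ _).
    have [/asboolP h|/asboolP h] := tC _ _ C1 C2.
      by exists W2 => // y; rewrite inE => /predU1P[->//|/h1 /h].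
    by exists W1 => // y; rewrite inE => /predU1P[->|/h1//]; apply: h.
  have P : [/\ csub (clos X), invs E (clos X) & ~ clos X v].
    split; first exact: clos_csub.
      move=> f Ef x /clos_seq[u hu ux]; apply: (@seq_clos _ _ _ (fun n => f (u n))); last exact: bop_tends.
      by move=> n; have [W CW h] := hu n; exists W => //; have [_ iW _] := svalP W; apply: iW.
    (* Suppose [v] is in the closure. By compactness the image under [w] of its unit ball is close
       to finitely many vectors of the union, hence to one member [W]. For a Riesz vector [x] of [v]
       modulo [W], however, [w x] equals [l x] modulo [W] and has distance at least [|l| / 2] from
       [W]. *)
    move=> hv; have cl : 0 < cabs l / 4 by rewrite divr_gt0 // cabs_gt0.
    have iX := clos_csub sX.
    have wX x : clos X x -> clos X (w x).
      apply: alg_inv wN x => // f Ef x /clos_seq[u hu ux].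
      apply: (@seq_clos _ _ _ (fun n => f (u n))); last exact: bop_tends.
      by move=> n; have [W CW h] := hu n; exists W => //; have [_ iW _] := svalP W; apply: iW.
    have tA : tbdd [set w x | x in [set x | clos X x /\ nm x <= 1]].
      by apply: tbdd_sub kw => _ [x [_ x1] <-]; exists x.
    have [s [hs1 hs2]] := tbdd_net tA cl.
    have [s' [hs1' hs2']] : exists s' : seq V, (forall y, y \in s' -> X y) /\
        forall y, y \in s -> exists2 z, z \in s' & nm (y - z) < cabs l / 4.
      have : forall y, y \in s -> clos X y by move=> y /hs1[x [Xx _] <-]; exact: wX.
      elim: s {hs1 hs2} => [_|y s IH hs]; first by exists [::].
      have [|s' [h1 h2]] := IH; first by move=> z zs; apply: hs; rewrite inE zs orbT.
      have [z Xz yz] := hs y (mem_head _ _) _ cl.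
      exists (z :: s'); split=> [t|t]; rewrite inE => /predU1P[->|] //.
      - exact: h1.
      - by exists z; rewrite ?mem_head.
      - by move=> /h2[t' ts' h]; exists t'; rewrite // inE ts' orbT.
    have [W CW hW] := fin s' hs1'; have [cW iW Wv] := svalP W.
    have [x [a [u [Wu a0 xE x1 hx]]]] := riesz cW Wv.
    have Xx : clos X x.
      rewrite xE; apply: (subspZ _ iX.1); apply: (subspB iX.1 hv).
      by apply: sub_clos; exists W.
    have [|y ys wxy] := hs2 (w x); first by exists x => //=; rewrite x1.
    have [z zs' yz] := hs2' y ys; have Wz := hW z zs'.
    have wu : sval W (w u) by exact: (alg_inv cW iW wN).
    have e1 : w x - z = l *: (x - l^-1 *: (z + a *: w u - l *: (a *: u))).
      have gen (P Q S t : V) : P - Q - t = P - S - (t + Q - S).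
        by rewrite opprB addrA subrK opprD addrA [LHS]addrAC.
      rewrite scalerBr [l *: (l^-1 *: _)]scalerA mulfV // scale1r xE bopZ bopB wv.
      by rewrite !scalerBr !scalerA (mulrC a l); exact: gen.
    have h1 : nm (w x - z) < cabs l / 2 by have := nm_tri y (w x) z; lra.
    rewrite e1 nmZ in h1.
    have : 2^-1 <= nm (x - l^-1 *: (z + a *: w u - l *: (a *: u))).
      apply: hx; apply: (subspZ _ cW.1); apply: (subspB cW.1); last by do 2 apply: (subspZ _ cW.1).
      by apply: (subspD cW.1) => //; apply: (subspZ _ cW.1).
    have := cabs_ge0 l; nra.
  by exists (mkT _ P) => W CW; apply/asboolP => x Wx; apply: sub_clos; exists W.
exists W; split=> // U cU iU Uv WU.
have hU : [/\ csub U, invs E U & ~ U v] by [].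
have hU' : `[< W `<=` U >] by apply/asboolP.
by have := hW (mkT _ hU) hU'; move=> /(congr1 sval) /= ->.
Qed.

(** [W] is a maximal closed invariant subspace without [v], and [Z] the smallest one containing [W]
    and [v]. An invariant subspace between them is [Z] if it contains [v], and [W] if it does
    not. *)
Lemma irreducible_gap : exists (V' : banType R) (M' : set (bop V')) (N' : seq (bop V')) (w' : bop V') (v' : V'),
  [/\ lts M', volt M', forall a : bop V', a \in N' -> M' a, irred [set` N'] &
   [/\ alg [set` N'] w', v' != 0 & w' v' = l *: v']].
Proof.
have [W [cW iW Wv mW]] := max_avoiding.
pose F := [set U | [/\ csub U, invs E U, W `<=` U & U v]].
pose Z := [set x | forall U, F U -> U x].
have cZ : csub Z by apply: csubI => U [].
have WZ : W `<=` Z by move=> x Wx U [_ _ WU _]; exact: WU.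
have Zv : Z v by move=> U [].
have iZ : invs E Z by move=> f Ef x hx U FU; have [_ iU _ _] := FU; apply: iU => //; exact: hx.
pose G := GapData cZ cW WZ.
(* [M] itself need not preserve [W] and [Z]. Its elements that preserve every closed subspace
   invariant under [N] form a Lie triple system containing [N]. *)
pose MN := [set f | M f /\ forall U, csub U -> invs E U -> forall x, U x -> U (f x)].
have MNN a : a \in N -> MN a by move=> aN; split; [exact: NM | move=> U _ iU; exact: iU].
have st f : MN f -> gstab G f by move=> [_ h]; split=> x; apply: h.
have MNlin z f g : MN f -> MN g -> MN (z *: f + g).
  move=> [Mf hf] [Mg hg]; split; first exact: lM.1.2.
  by move=> U cU iU x Ux; apply: cU.1.2; [exact: hf | exact: hg].
have MN0 : MN 0 by split=> [|U cU _ x _]; [exact: lM.1.1 | exact: cU.1.1].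
pose M' := [set gind G f | f in MN]; pose N' := [seq gind G a | a <- N].
have [L [hL wE]] := wN.
have lE s x : isw E s -> Z x -> (wpr [seq gind G a | a <- s]) (cls G x) = cls G (wpr s x) /\ Z (wpr s x).
  move=> ws Zx; elim: s ws => [//|a s IH] ws /=.
  have [|e1 Zs] := IH; first by move=> b bs; apply: ws; rewrite inE bs orbT.
  have aN : a \in N by apply: (ws a); exact: mem_head.
  by rewrite e1 gindE //; [split=> //; apply: iZ | exact/st/MNN].
have lMN : lts MN.
  split=> [|a b c ha hb hc]; first by split=> [|z f g]; [exact: MN0|exact: MNlin].
  split; first by apply: lM.2; [exact: ha.1 | exact: hb.1 | exact: hc.1].
  move=> U cU iU x Ux; have [ha' hb' hc'] := (@And3 _ _ _) (ha.2 U cU iU) (hb.2 U cU iU) (hc.2 U cU iU).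
  rewrite bop_subE !bop_mulE !bop_subE !bop_mulE.
  by apply: (subspB cU.1); [apply: ha'; apply: (subspB cU.1) | apply: (subspB cU.1)];
    rewrite ?bop_mulE; auto.
have [lM' vM'] := gind_volterra lMN (fun f (hf : MN f) => vM hf.1) st.
exists (gap G), M', N', (\sum_(p <- L) p.1 *: wpr [seq gind G a | a <- p.2]), (cls G v); split=> //.
- by move=> _ /mapP[a aN ->]; exists a => //; exact: MNN.
- move=> U' cU' iU'; pose U := [set x | Z x /\ U' (cls G x)].
  have cU : csub U by exact: (gapdata_pull (G := G) cU').
  have iU : invs E U.
    move=> a Ea x [Zx Ux]; have aN : a \in N by []; split; first exact: iZ.
    rewrite -gindE //; last exact/st/MNN.
    by apply: iU' => //=; apply: map_f.
  have WU : W `<=` U.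
    move=> x Wx; split; first exact: (WZ _ Wx).
    by rewrite ((cls_eq0 (G := G) (WZ _ Wx)).2 Wx); exact: cU'.1.1.
  have [Uv|Uv] := pselect (U v).
    right=> p; have [x Zx ->] := gapP p.
    by have [] : U x by apply: Zx.
  left=> p U'p; have [x Zx pE] := gapP p; rewrite pE; apply/cls_eq0 => //.
  by apply: (mW U cU iU Uv WU); split=> //; rewrite -pE.
split.
- exists [seq (p.1, [seq gind G a | a <- p.2]) | p <- L]; split; last by rewrite big_map.
  move=> _ /mapP[p pL ->] /=; have [ws p0] := hL p pL; split; last by case: p.2 p0.
  by move=> _ /mapP[a ap ->]; apply: map_f; exact: ws.
- by apply/eqP => /cls_eq0 -/(_ Zv).
rewrite -clsZ // -wv wE !bop_sumE.
have := hL; elim: (L) => [|p L' IH] hL'; first by rewrite !big_nil cls0.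
rewrite !big_cons !bop_scaleE; have [ws _] := hL' p (mem_head _ _); have [e1 Zp] := lE _ _ ws Zv.
rewrite clsD; last 2 first.
- by apply: (subspZ _ cZ.1).
- rewrite big_seq; apply: (subsp_sum _ cZ.1) => q qL; rewrite bop_scaleE; apply: (subspZ _ cZ.1).
  have [|ws' _] := hL' q; first by rewrite inE qL orbT.
  by have [] := lE _ _ ws' Zv.
rewrite clsZ // e1 IH // => q qL; by apply: hL'; rewrite inE qL orbT.
Qed.

End IrreducibleGap.

(** * Totally bounded families, and projections near an idempotent *)

Section CompactFamilies.
Context {R : realType} {V : banType R}.
Implicit Types (f g a b c k B T : bop V) (s : seq (bop V)) (z : R[i]) (e r t : R).

Lemma tbddM (X Y : set (bop V)) : tbdd X -> tbdd Y ->
  tbdd [set f | exists a b, [/\ X a, Y b & f = a * b]].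
Proof.
move=> tX tY e e0; have [M M0 hM] := tbdd_bounded tX; have [K K0 hK] := tbdd_bounded tY.
have d0 : 0 < e / (M + K + 1) / 2 by rewrite !divr_gt0 //; lra.
have [L hL] := tX _ d0; have [L' [hL1 hL2]] := tbdd_net tY d0.
exists [seq a * b | a <- L, b <- L'] => _ [a [b [Xa Yb ->]]].
have [a' aL haa] := hL a Xa; have [b' bL hbb] := hL2 b Yb.
exists (a' * b'); first exact: allpairs_f.
apply: le_lt_trans (nm_tri (a * b') _ _) _; rewrite -mulrBr -mulrBl.
have h1 := le_trans (nmM a (b - b')) (ler_pM (nm_ge0 _) (nm_ge0 _) (hM a Xa) (ltW hbb)).
have h2 := le_trans (nmM (a - a') b') (ler_pM (nm_ge0 _) (nm_ge0 _) (ltW haa) (hK b' (hL1 b' bL))).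
apply: le_lt_trans (lerD h1 h2) _.
have -> : e = (M + K + 1) * (e / (M + K + 1)) by rewrite mulrCA mulfV ?mulr1 // gt_eqF //; lra.
rewrite [(M + K + 1) * _ / (M + K + 1)]mulrAC mulfV ?mul1r ?gt_eqF //; try lra.
clear -d0 M0 K0; move: d0; move: (e / (M + K + 1)) => d d0; nra.
Qed.

Lemma vala2 (X Y : set (bop V)) : tbdd X -> tbdd Y -> (forall a, X a -> kop a) ->
  (forall a, Y a -> kop a) ->
  tbdd [set f | exists a b c, [/\ X a, Y b, nm c <= 1 & f = a * c * b]].
Proof.
move=> tX tY kX kY; apply: tbdd_approx => e e0.
have [M M0 hM] := tbdd_bounded tX; have [K K0 hK] := tbdd_bounded tY.
have d0 : 0 < e / (M + K + 1) by rewrite divr_gt0 //; lra.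
have [L [hL1 hL2]] := tbdd_net tX d0; have [L' [hL1' hL2']] := tbdd_net tY d0.
exists [set f | exists2 p, p \in [seq (a, b) | a <- L, b <- L'] &
  [set p.1 * c * p.2 | c in [set c : bop V | nm c <= 1]] f]; split.
  apply: tbdd_bigU => _ /allpairsP[[a b] [/= aL bL ->]] /=.
  by apply: vala; [exact/kX/hL1 | exact/kY/hL1'].
move=> _ [a [b [c [Xa Yb c1 ->]]]].
have [a' aL haa] := hL2 a Xa; have [b' bL hbb] := hL2' b Yb.
exists (a' * c * b').
  by exists (a', b'); [apply/allpairsP; exists (a', b') | exists c].
apply: le_lt_trans (nm_tri (a' * c * b) _ _) _; rewrite -mulrBr -!mulrBl.
have h1 : nm ((a - a') * c * b) <= e / (M + K + 1) * K.
  apply: le_trans (nmM _ _) _; apply: ler_pM; rewrite ?nm_ge0 ?hK //.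
  apply: le_trans (nmM _ _) _; rewrite -[leRHS]mulr1.
  by apply: ler_pM; rewrite ?nm_ge0 // ltW.
have h2 : nm (a' * c * (b - b')) <= M * (e / (M + K + 1)).
  apply: le_trans (nmM _ _) _; apply: ler_pM; rewrite ?nm_ge0 ?(ltW hbb) //.
  apply: le_trans (nmM _ _) _; rewrite -[leRHS]mulr1.
  by apply: ler_pM; rewrite ?nm_ge0 ?hM //; exact: hL1.
apply: le_lt_trans (lerD h1 h2) _.
have e1 : e = (M + K + 1) * (e / (M + K + 1)) by rewrite mulrCA mulfV ?mulr1 // gt_eqF //; lra.
rewrite [ltRHS]e1; clear -d0 M0 K0; move: (e / (M + K + 1)) d0 => d d0; nra.
Qed.

Lemma bx_disc_tbdd a t : 0 < t -> tbdd [set bx z a | z in [set z : R[i] | cabs z <= t]].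
Proof.
move=> t0; apply: tbdd_approx => e e0.
have ct : cabs (t%:C%C : R[i]) = t by rewrite cabs_nneg // ltW.
have [C C0 hC] := psum_tail (t%:C%C : R[i]) (ent_ec a).
have [n /(_ n (leqnn n)) hn] := geo_small C (ltac:(lra) : 0 <= 2^-1) (ltac:(lra) : 2^-1 < 1) e0.
exists [set f | exists2 z : R[i], cabs z <= t & f = \sum_(i < n) z ^+ i *: ec a i]; split; last first.
  move=> _ [z zt <-]; exists (\sum_(i < n) z ^+ i *: ec a i); first by exists z.
  by apply: le_lt_trans hn; apply: hC; rewrite ct.
elim: n {hn} => [|n IH].
  by apply: tbdd_sub (tbdd_seq [:: 0]) => _ [z _ ->] /=; rewrite big_ord0 inE.
have tn : tbdd [set z *: ec a n | z in [set z : R[i]^o | cabs z <= t ^+ n]].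
  apply: (tbdd_img (M := nm (ec a n))) (tbdd_disc (t ^+ n)) => z z'.
  by rewrite -scalerBl nmZ mulrC.
apply: tbdd_sub (tbddD IH tn) => _ [z zt ->].
exists (\sum_(i < n) z ^+ i *: ec a i), (z ^+ n *: ec a n); split.
- by exists z.
- by exists (z ^+ n) => //=; rewrite cabsX lerXn2r ?nnegrE ?cabs_ge0 // ltW.
by rewrite big_ord_recr.
Qed.

Lemma kop_bx z a : kop a -> kop (bx z a - 1).
Proof. by move=> ka; rewrite bx_1D addrAC subrr add0r; apply: kopZ; apply: kopMr. Qed.

Lemma kop_wpr s : (forall a, a \in s -> kop (a - 1)) -> kop (wpr s - 1).
Proof.
elim: s => [|a s IH] hs; first by rewrite subrr; exact: kop0.
have -> : wpr (a :: s) - 1 = (a - 1) * wpr s + (wpr s - 1).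
  by rewrite mulrBl mul1r addrA subrK.
apply: kopD; first by apply: kopMr; apply: hs; exact: mem_head.
by apply: IH => b bs; apply: hs; rewrite inE bs orbT.
Qed.

Lemma kop_powD (m : R[i]) k n : kop k -> kop ((m *: (1 : bop V) + k) ^+ n - m ^+ n *: (1 : bop V)).
Proof.
move=> hk; elim: n => [|n IH]; first by rewrite !expr0 scale1r subrr; exact: kop0.
have -> : (m *: (1 : bop V) + k) ^+ n.+1 - m ^+ n.+1 *: (1 : bop V) =
   m *: ((m *: (1 : bop V) + k) ^+ n - m ^+ n *: (1 : bop V)) + k * (m *: (1 : bop V) + k) ^+ n.
  rewrite !exprS mulrDl (bscalAl m) mul1r scalerBr scalerA [RHS]addrAC //.
by apply: kopD; [exact: kopZ | exact: kopMr].
Qed.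

(* If [T = m + k] with [|m| < 1] then the circle averages of [T] tend to 1 modulo compacts. *)
Lemma kop_Qc (m : R[i]) k : cabs m < 1 -> kop k -> circ (m *: (1 : bop V) + k) ->
  kop (1 - Qc (m *: (1 : bop V) + k)).
Proof.
move=> m1 hk cT; set T := _ + k in cT *.
pose N n := (2 ^ n.+1)%N; pose al n : R[i] := 1 - m ^+ N n.
have small e : 0 < e -> exists M, forall n, (M <= n)%N -> cabs m ^+ N n < e.
  move=> e0; have [M hM] := geo_small 1 (cabs_ge0 m) m1 e0; exists M => n hn.
  have := hM (N n) _; rewrite mul1r; apply; apply: leq_trans hn _.
  by apply/ltnW/ltnW; exact: ltn_expl n.+1 (ltnSn 1).
pose u n : bop V := al n *: cav n T - 1.
have ku n : kop (u n).
  have [_ i2] := cav_inv n cT.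
  have e1 : 1 - T ^+ N n = al n *: (1 : bop V) - (T ^+ N n - m ^+ N n *: (1 : bop V)).
    by rewrite opprB /al scalerBl scale1r addrA subrK.
  have -> : u n = cav n T * (T ^+ N n - m ^+ N n *: (1 : bop V)).
    have h := i2; rewrite e1 mulrBr (bscalAr (al n)) mulr1 in h.
    by rewrite /u -[X in _ - X = _]h opprB addrC subrK.
  by apply: kopMl; apply: kop_powD.
have tu : tends u (Qc T - 1).
  apply: (tendsB _ (tends_cst (1 : bop V))) => e e0.
  have C1 : 0 < nm (Qc T) + 1 by have := nm_ge0 (Qc T); lra.
  have [N1 hN1] := QcP cT (ltac:(by rewrite divr_gt0 // ltr0n) : 0 < e / 4).
  have [N2 hN2] := QcP cT (ltr01 : 0 < 1 :> R).
  have [N3 hN3] := small _ (divr_gt0 (half_gt0 e0) C1).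
  exists (maxn N1 (maxn N2 N3)) => n; rewrite !geq_max => /and3P[/hN1 h1 /hN2 h2 /hN3 h3].
  have -> : al n *: cav n T - Qc T = (cav n T - Qc T) - m ^+ N n *: cav n T.
    by rewrite /al scalerBl scale1r addrAC.
  apply: le_lt_trans (nmB _ _) _; rewrite nmZ cabsX.
  have h4 : nm (cav n T) <= nm (Qc T) + 1 by have := nmBD (cav n T) (Qc T); lra.
  move: h3; rewrite ltr_pdivlMr // => h3.
  have : cabs m ^+ N n * nm (cav n T) <= cabs m ^+ N n * (nm (Qc T) + 1).
    by rewrite ler_wpM2l ?exprn_ge0 ?cabs_ge0.
  lra.
by rewrite -opprB; apply: kopN; exact: kop_lim ku tu.
Qed.

(** Doubling moves the eigenvalue 1 of [B] off the unit circle. The projection of [2 B] for the disc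
    is not 1, since otherwise the powers [2 ^+ n *: B] would decay, and this persists near [B]. *)
Lemma idem_Qc B : B * B = B -> B != 0 -> exists2 e, 0 < e &
  forall T, nm (T - B) < e -> circ ((2 : R[i]) *: T) /\ Qc ((2 : R[i]) *: T) != 1.
Proof.
move=> BB B0.
have cB : circ ((2 : R[i]) *: B).
  move=> u u1; have [||g hg] := @idem_invb _ _ B (u / 2) BB.
  + by rewrite -cabs_gt0 cabsM u1 mul1r cabsV cabs_nat invr_gt0.
  + apply/eqP => h; have := cabs1 (R := R); rewrite -h cabsM u1 mul1r cabsV cabs_nat; lra.
  exists ((2 : R[i])^-1 *: g).
  have -> : u *: (1 : bop V) - (2 : R[i]) *: B = (2 : R[i]) *: ((u / 2) *: (1 : bop V) - B).
    by rewrite scalerBr scalerA mulrCA mulfV ?mulr1 // pnatr_eq0.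
  by apply: inv_ofZ => //; rewrite pnatr_eq0.
have Q1 : Qc ((2 : R[i]) *: B) != 1.
  apply/eqP => Q1; have [t [t0 t1 [C C0 hC]]] := circ_grow cB Q1.
  have p1 : 0 < nm B by rewrite nm_gt0.
  have [N hN] := geo_small C (ltW t0) t1 p1.
  have := hN N.+1 (leqnSn N); have := hC N.+1; rewrite bexprZ nmZ cabsX cabs_nat.
  have -> : B ^+ N.+1 = B by elim: (N) => [|k IH]; rewrite ?expr1 // exprS IH.
  have : 1 <= (2 : R) ^+ N.+1 by rewrite exprn_ege1 //; lra.
  nra.
have [C [d [C0 d0 hd]]] := circ_near cB.
have hB : cbd ((2 : R[i]) *: B) C by apply: hd; rewrite subrr nm0 ltW.
have q0 : 0 < nm (1 - Qc ((2 : R[i]) *: B)) by rewrite nm_gt0 subr_eq0 eq_sym.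
have CC : 0 < C * C * 2 by rewrite !mulr_gt0.
exists (Num.min (d / 2) (nm (1 - Qc ((2 : R[i]) *: B)) / (C * C * 2))).
  by rewrite lt_min !divr_gt0.
move=> T; rewrite lt_min => /andP[h1 h2].
have e2 : nm ((2 : R[i]) *: T - (2 : R[i]) *: B) = 2 * nm (T - B).
  by rewrite -scalerBr nmZ cabs_nat.
have hT : cbd ((2 : R[i]) *: T) C by apply: hd; rewrite e2; lra.
split; first exact: hT.1.
apply/eqP => Q2; have := Qc_lip hT hB; rewrite e2 Q2.
move: h2; rewrite ltr_pdivlMr // => h2; lra.
Qed.

End CompactFamilies.

(** * A product of exponentials with a spectral gap *)

Section GroupElement.
Context {R : realType} {V : banType R}.
Implicit Types (f g a b c k B T : bop V) (s : seq (bop V)) (z : R[i]) (e r t : R).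
Variables (M : set (bop V)) (N : seq (bop V)) (w : bop V) (v : V) (l : R[i]).
Hypotheses (sM : subsp M) (vM : volt M) (NM : forall a, a \in N -> M a).
Hypotheses (iN : irred [set` N]) (wN : alg [set` N] w) (v0 : v != 0) (l0 : l != 0).
Hypothesis wv : w v = l *: v.

(** The disc contains the circle over which [bx_avg] recovers [a]; the radius stays free because a
    large one forces growth. *)
Let Et t : set (bop V) := [set f | exists a z, [/\ a \in N, cabs z <= t & f = bx z a]].

Let Et_lim t a : 0 < t -> a \in N ->
  tends (fun n => avg n (fun u => (t%:C%C * u)^-1 *: bx (t%:C%C * u) a)) a.
Proof. by move=> t0 aN; apply: bx_avg; rewrite -cabs_gt0 cabs_nneg // ltW. Qed.

(** Each letter [a] of [s] is the limit of averages of [(t z)^-1 exp (t z a)], at the cost of a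
    factor [t^-1]. The prefix [u] collects the exponentials already substituted. *)
Lemma exp_words_bound t C r s u : 0 < t -> 0 <= C -> 0 <= r ->
  (forall s, isw (Et t) s -> nm (wpr s) <= C * r ^+ size s) ->
  isw [set` N] s -> isw (Et t) u -> nm (wpr u * wpr s) <= t^-1 ^+ size s * (C * r ^+ (size u + size s)).
Proof.
move=> t0 C0 r0 hC; elim: s u => [|a s IH] u ws wu.
  by rewrite expr0 mul1r mulr1 addn0; exact: hC.
have aN : a \in N by apply: (ws a); exact: mem_head.
have ws' : isw [set` N] s by move=> b bs; apply: ws; rewrite inE bs orbT.
have tl := tendsMr (wpr s) (tendsMl (wpr u) (Et_lim t0 aN)).
rewrite /= mulrA; apply: (tends_nm_le (N := 0%N) tl) => n _.
have -> : wpr u * avg n (fun w0 => (t%:C%C * w0)^-1 *: bx (t%:C%C * w0) a) * wpr s =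
   avg n (fun w0 => (t%:C%C * w0)^-1 *: (wpr u * bx (t%:C%C * w0) a * wpr s)).
  rewrite avgMl /avg (bscalAl (2 ^ n.+1)%:R^-1) mulr_suml; congr (_ *: _); apply: eq_bigr => j _.
  by rewrite (bscalAr (t%:C%C * _)^-1) (bscalAl (t%:C%C * _)^-1).
apply: avg_nm => z z1; have cz : cabs (t%:C%C * z) = t by rewrite cabsM z1 mulr1 cabs_nneg // ltW.
rewrite nmZ cabsV cz exprS -[leRHS]mulrA; apply: ler_wpM2l; first by rewrite invr_ge0 ltW.
have wu' : isw (Et t) (u ++ [:: bx (t%:C%C * z) a]).
  apply/isw_cat; split=> // f; rewrite inE => /eqP->; exists a, (t%:C%C * z); split=> //.
  by rewrite cz.
have := IH _ ws' wu'; rewrite wpr_cat /= mulr1 size_cat /= addn1 addSnnS.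
by [].
Qed.

(** If all the families [Et t] grew at rate 2 or less, the words in [N] would grow at rate [2 / t]
    for every [t], and [w] would be quasinilpotent. *)
Lemma exp_words_grow : exists t r, [/\ 0 < t, 1 < r & ~ wgrow (Et t) r].
Proof.
apply: contrapT => no.
have hg t : 0 < t -> wgrow (Et t) 2.
  by move=> t0; apply: contrapT => h; apply: no; exists t, 2; split=> //; lra.
have qw : qn w.
  apply: alg_qn wN => r r0; have t0 : 0 < 2 / r by rewrite divr_gt0.
  have [C C0 hC] := hg _ t0; exists C => // s ws.
  have := exp_words_bound t0 C0 (ltac:(lra) : 0 <= 2) hC ws (fun f h => ltac:(by [])) (u := [::]).
  rewrite mul1r add0n mulrCA -exprMn invf_div divfK //.
case/eqP: v0; exact: qn_eig qw l0 wv.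
Qed.

Lemma Et_bound t : 0 < t -> exists2 D, 0 <= D & forall f, Et t f -> nm f <= D.
Proof.
move=> t0; have ct : cabs (t%:C%C : R[i]) = t by rewrite cabs_nneg // ltW.
suff [D D0 hD] : exists2 D : R, 0 <= D & forall a, a \in N -> forall z, cabs z <= t -> nm (bx z a) <= D.
  by exists D => // f [a [z [aN zt ->]]]; exact: hD.
elim: (N) => [|a s [D D0 hD]]; first by exists 0.
have [C C0 hC] := psum_tail (t%:C%C : R[i]) (ent_ec a).
exists (C + D) => [|b]; first exact: addr_ge0.
rewrite inE => /predU1P[->|bs] z zt.
  have := hC z 0%N; rewrite ct big_ord0 subr0 expr0 mulr1 => /(_ zt) h.
  by apply: le_trans h _; rewrite lerDl.
by apply: le_trans (hD b bs z zt) _; rewrite lerDr.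
Qed.

Lemma Et_tbdd t : 0 < t -> tbdd (Et t).
Proof.
move=> t0; have h : tbdd [set f | exists2 a, a \in N &
    [set bx z a | z in [set z : R[i] | cabs z <= t]] f].
  by apply: tbdd_bigU => a aN; exact: bx_disc_tbdd.
by apply: tbdd_sub h => f [a [z [aN zt ->]]]; exists a => //; exists z.
Qed.

Lemma Et_kop t f : Et t f -> kop (f - 1).
Proof. by move=> [a [z [aN _ ->]]]; apply: kop_bx; apply: (vM (NM aN)).1. Qed.

Lemma Et_words_tbdd t m : 0 < t -> tbdd [set wpr s | s in [set s | isw (Et t) s /\ size s = m]].
Proof.
move=> t0; elim: m => [|m IH].
  apply: tbdd_sub (tbdd_seq [:: (1 : bop V)]) => _ [s [_ /size0nil->] <-].
  by rewrite /= inE.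
apply: tbdd_sub (tbddM (Et_tbdd t0) IH) => _ [s [ws sm] <-].
case: s ws sm => [//|f s] ws [sm].
exists f, (wpr s); split=> //; first by apply: ws; exact: mem_head.
by exists s => //; split=> // h hs; apply: ws; rewrite inE hs orbT.
Qed.

(** Every word of exponentials is the identity plus a compact operator. After scaling, the identity
    parts carry a factor [la ^+ m] against a growth [r ^+ m] with [|la| r < 1]; the rest is covered
    by Vala's theorem for totally bounded families. *)
Lemma Et_acompact t (la : R[i]) : 0 < t -> la != 0 -> cabs la < 1 ->
  (forall r, 1 < r -> wgrow (scales la (Et t)) r) -> acompact (scales la (Et t)).
Proof.
move=> t0 la0 la1 hup eta eta0.
have cl : 0 < cabs la by rewrite cabs_gt0.
pose r := (1 + (cabs la)^-1) / 2.
have li : 1 < (cabs la)^-1 by rewrite invf_gt1.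
have r1 : 1 < r by rewrite /r; lra.
have [D D0 hD] := hup r r1.
have lr1 : cabs la * r < 1 by rewrite /r mulrA mulrDr mulr1 mulfV ?gt_eqF //; lra.
have lr0 : 0 <= cabs la * r by rewrite mulr_ge0 ?cabs_ge0 //; lra.
have [m /(_ m (leqnn m)) hm] := geo_small (3 * (D + 1)) lr0 lr1 (half_gt0 eta0).
pose X := [set f | exists2 s, isw (Et t) s /\ size s = m & f = wpr s - 1].
have tX : tbdd X.
  have h := @tbdd_img _ _ _ (fun f : bop V => f - 1) _ 1 _ (Et_words_tbdd m t0).
  apply: tbdd_sub (h _) => [f [s hs ->]|f g]; first by exists (wpr s) => //; exists s.
  by rewrite mul1r opprB addrA subrK.
have kX f : X f -> kop f.
  by move=> [s [ws _] ->]; apply: kop_wpr => a /ws; exact: Et_kop.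
have tY : tbdd [set (la ^+ m * la ^+ m) *: f | f in
    [set f | exists a b c, [/\ X a, X b, nm c <= 1 & f = a * c * b]]].
  apply: (tbdd_img (M := cabs (la ^+ m * la ^+ m))) (vala2 tX tX kX kX) => f g.
  by rewrite -scalerBr nmZ.
have [L hL] := tY _ (half_gt0 eta0); exists m, L => u u' c wu wu' um um' c1.
have [s [ws ss uE]] := scales_word la0 wu; have [s' [ws' ss' uE']] := scales_word la0 wu'.
rewrite um in ss uE; rewrite um' in ss' uE'.
have [y yL hy] := hL ((la ^+ m * la ^+ m) *: ((wpr s - 1) * c * (wpr s' - 1)))
  ltac:(eexists; [eexists _, _, c; split; [exists s; [split; [exact: ws|exact: ss] | reflexivity] |
    exists s'; [split; [exact: ws'|exact: ss'] | reflexivity] | exact: c1 | reflexivity] | reflexivity]).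
exists y => //; apply: le_lt_trans (nm_tri ((la ^+ m * la ^+ m) *: ((wpr s - 1) * c * (wpr s' - 1))) _ _) _.
rewrite [ltRHS]splitr; apply: ltrD hy; apply: le_lt_trans hm.
have hu : nm (wpr u) <= D * r ^+ m by have := hD u wu; rewrite um.
have hu' : nm (wpr u') <= D * r ^+ m by have := hD u' wu'; rewrite um'.
pose q := la ^+ m; have cq : cabs q = cabs la ^+ m by rewrite cabsX.
have eq1 : wpr u * c * wpr u' - (q * q) *: ((wpr s - 1) * c * (wpr s' - 1)) =
    q *: (wpr u * c) + q *: (c * wpr u') - (q * q) *: c.
  have e1 : q *: (wpr s - 1) = wpr u - q *: (1 : bop V) by rewrite scalerBr -uE.
  have e2 : q *: (wpr s' - 1) = wpr u' - q *: (1 : bop V) by rewrite scalerBr -uE'.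
  have -> : (q * q) *: ((wpr s - 1) * c * (wpr s' - 1)) = (q *: (wpr s - 1)) * c * (q *: (wpr s' - 1)).
    by rewrite (bscalAl q) (bscalAl q) (bscalAr q) scalerA.
  have gen (A1 B1 C1 D1 : bop V) : A1 - (A1 - B1 - (C1 - D1)) = C1 + B1 - D1.
    by rewrite opprB addrCA opprB [A1 + _]addrCA subrr addr0 addrAC.
  have f1 : q *: (1 : bop V) * c = q *: c by rewrite (bscalAl q) mul1r.
  have f2 b : b * (q *: (1 : bop V)) = q *: b by rewrite (bscalAr q) mulr1.
  rewrite e1 e2 mulrBr f2 !(mulrBl c) f1 (mulrBl (wpr u')) (bscalAl q c) scalerBr scalerA.
  exact: gen.
rewrite eq1; have q0 : 0 <= cabs q by exact: cabs_ge0.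
have q1 : cabs q <= 1 by rewrite cq exprn_ile1 ?cabs_ge0 // ltW.
have rm : 1 <= r ^+ m by rewrite exprn_ege1 // ltW.
apply: le_trans (nmB _ _) _; apply: le_trans (lerD (nmD _ _) (lexx _)) _.
rewrite !nmZ cabsM.
have h1 : nm (wpr u * c) <= D * r ^+ m.
  apply: le_trans (nmM _ _) _; rewrite -[leRHS]mulr1; apply: ler_pM; rewrite ?nm_ge0 //.
have h2 : nm (c * wpr u') <= D * r ^+ m.
  apply: le_trans (nmM _ _) _; rewrite -[leRHS]mul1r; apply: ler_pM; rewrite ?nm_ge0 //.
have h3 : cabs q * nm (wpr u * c) <= cabs q * (D * r ^+ m) by rewrite ler_wpM2l.
have h4 : cabs q * nm (c * wpr u') <= cabs q * (D * r ^+ m) by rewrite ler_wpM2l.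
have h5 : cabs q * cabs q * nm c <= cabs q * r ^+ m.
  rewrite -mulrA ler_wpM2l //; apply: le_trans (_ : 1 * 1 <= _); last by rewrite mulr1.
  by apply: ler_pM; rewrite ?nm_ge0.
have rm0 : 0 <= r ^+ m by apply: le_trans rm.
rewrite exprMn -cq; have p1 : 0 <= cabs q * r ^+ m by rewrite mulr_ge0.
have p2 : 0 <= cabs q * (D * r ^+ m) by rewrite !mulr_ge0.
have -> : 3 * (D + 1) * (cabs q * r ^+ m) = cabs q * (D * r ^+ m) + cabs q * (D * r ^+ m) + cabs q * r ^+ m
  + (cabs q * (D * r ^+ m) + cabs q * r ^+ m + cabs q * r ^+ m) by ring.
by rewrite -[leLHS]addr0; apply: lerD; [apply: lerD h5; exact: lerD | rewrite !addr_ge0].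
Qed.

Lemma Et_irred t (la : R[i]) : 0 < t -> la != 0 -> irred (scales la (Et t)).
Proof.
move=> t0 la0 W cW iW; apply: iN => // a aN x Wx.
have iE f : Et t f -> W (f x).
  move=> Ef; have := iW (la *: f) _ x Wx; rewrite bop_scaleE => h.
  rewrite -[f x]scale1r -(mulVf la0) -scalerA; apply: (subspZ _ cW.1); apply: h.
  by exists f.
apply: (csub_tends cW _ (tends_bopE x (Et_lim t0 aN))) => n.
rewrite /avg bop_scaleE bop_sumE; apply: (subspZ _ cW.1); apply: (subsp_sum _ cW.1) => j _.
rewrite bop_scaleE; apply: (subspZ _ cW.1); apply: iE; exists a, (t%:C%C * rt n ^+ j); split=> //.
by rewrite cabsM cabs_rtX mulr1 cabs_nneg // ltW.
Qed.

Lemma Et_gx t s : isw (Et t) s -> exists2 m : seq (bop V), (forall b, b \in m -> M b) & wpr s = gx 1 m.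
Proof.
elim: s => [|f s IH] ws; first by exists [::].
have [|m hm mE] := IH; first by move=> g gs; apply: ws; rewrite inE gs orbT.
have [a [z [aN _ fE]]] := ws f (mem_head _ _).
exists (z *: a :: m) => [b|]; last by rewrite /= mE fE bxZ mul1r.
by rewrite inE => /predU1P[->|/hm//]; apply: subspZ => //; exact: NM.
Qed.

(** [P] is a scaled word near the idempotent, [q] the projection of [2 P] for the disc and
    [p = 1 - q]. As [a (2 P)^n = (2 P)^n g^-n a g^n] and [p] is close to [(2 P)^n E], the operator
    [q a p] is close to [q (2 P)^n] times [g^-n a g^n] times [E]; the outer factors decay
    exponentially and the middle one grows subexponentially. *)
Lemma group_element : exists (m : seq (bop V)) (p : bop V),
  [/\ forall b, b \in m -> M b, fr p, p != 0, p * p = p &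
  forall a, (forall r, 1 < r -> exists C, forall n,
     nm (gx (-1) (rev m) ^+ n * a * gx 1 m ^+ n) <= C * r ^+ n) -> (1 - p) * a * p = 0].
Proof.
have [t [r [t0 r1 nog]]] := exp_words_grow.
have [D D0 hD] := Et_bound t0.
have up : wgrow (Et t) (D + 1).
  exists 1 => // s; rewrite mul1r; elim: s => [|f s IH] ws; first by rewrite expr0 nm1_le.
  apply: le_trans (nmM _ _) _; rewrite exprS ler_pM ?nm_ge0 //.
    by apply: le_trans (hD f (ws f (mem_head _ _))) _; rewrite lerDl.
  by apply: IH => g gs; apply: ws; rewrite inE gs orbT.
have D1 : 0 < D + 1 by lra.
have r0 : 0 < r by lra.
have [rho [rr rho0 hup hlow]] := wgrow_normalize D1 up r0 nog.
set la := (rho^-1)%:C%C : R[i] in hup hlow.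
have cl : cabs la = rho^-1 by rewrite cabs_nneg // invr_ge0 ltW.
have la0 : la != 0 by rewrite -cabs_gt0 cl invr_gt0.
have la1 : cabs la < 1 by rewrite cl invf_lt1 //; lra.
have hE := Et_acompact t0 la0 la1 hup.
have iE := Et_irred t0 la0.
(* Unbounded words would give a nonzero [T] with [T s T = 0] for all words [s], which irreducibility
   excludes. *)
have [[C hC]|unb] := pselect (exists C, forall s, isw (scales la (Et t)) s -> nm (wpr s) <= C); last first.
  have hunb C : exists s, isw (scales la (Et t)) s /\ C < nm (wpr s).
    apply: contrapT => /forallNP h; apply: unb; exists C => s ws.
    by rewrite leNgt; apply/negP => hl; apply: (h s).
  have [T [_ [_ [_ [T0 _ _ hT]]]]] := words_nilp hE hup hunb.
  have [x Tx] : exists x, T x != 0.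
    apply: contrapT => /forallNP h; case/eqP: T0; apply: bop_ext => x.
    by apply/eqP/negPn/negP/h.
  case/eqP: T0; apply: (irred_sep iE Tx) => s ws.
  by change ((T * wpr s * T) x = 0); rewrite hT.
have [B [BB B0 lB]] := words_idem hC hE hlow.
have [e e0 he] := idem_Qc BB B0.
(* Words of length at least [n0] have [2 |la| ^+ n < 1], so that [2 P] is a scalar of modulus below
   1 plus a compact operator. *)
have [n0 hn0] := geo_small 2 (cabs_ge0 la) la1 (ltr01 : 0 < 1 :> R).
have [s [ws ns sB]] := lB e n0 e0.
have [cP Q1] := he _ sB.
have [s' [ws' ss sE]] := scales_word la0 ws; have [m hm mE] := Et_gx ws'.
set P := wpr s in cP Q1 sB sE; set q := Qc ((2 : R[i]) *: P) in Q1.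
pose mu : R[i] := 2 * la ^+ size s.
have PE : (2 : R[i]) *: P = mu *: (1 : bop V) + mu *: (wpr s' - 1).
  by rewrite -scalerDr addrCA subrr addr0 sE scalerA.
have kp : kop (1 - q).
  rewrite /q PE; apply: kop_Qc; last by rewrite -PE.
    by rewrite cabsM cabs_nat cabsX; exact: hn0.
  by apply: kopZ; apply: kop_wpr => a /ws'; exact: Et_kop.
have qq : q * q = q by exact: Qc_idem.
exists m, (1 - q); split=> //.
- apply: kop_idem_fr => //; by rewrite mulrBr mulr1 mulrBl mul1r qq subrr subr0.
- by rewrite subr_eq0 eq_sym.
- by rewrite mulrBr mulr1 mulrBl mul1r qq subrr subr0.
move=> a ha; rewrite opprB addrC subrK.
have [C' [th [C'0 th0 th1 h1 h2]]] := Qc_split cP.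
have thi : 1 < th^-1 by rewrite invf_gt1.
have [K hK] := ha _ thi.
have [_ gi] := gx_inv 1 m.
have comm_P n : a * ((2 : R[i]) *: P) ^+ n =
    ((2 : R[i]) *: P) ^+ n * (gx (-1) (rev m) ^+ n * a * gx 1 m ^+ n).
  have -> : (2 : R[i]) *: P = mu *: gx 1 m by rewrite sE scalerA mE.
  rewrite bexprZ (bscalAr (mu ^+ n)) (bscalAl (mu ^+ n)); congr (_ *: _).
  rewrite !mulrA; have -> : gx 1 m ^+ n * gx (-1) (rev m) ^+ n = 1.
    have [g1 _] := gx_inv 1 m.
    elim: n => [|n IH]; first by rewrite !expr0 mulr1.
    by rewrite exprS exprSr mulrA -(mulrA (gx 1 m)) IH mulr1.
  by rewrite mul1r.
have cq n : q * ((2 : R[i]) *: P) ^+ n = ((2 : R[i]) *: P) ^+ n * q.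
  by apply/esym; apply: comm_Qc; apply/commr_sym/commrX.
apply: nm_small => e' e'0.
have d0 : 0 < e' / (nm (q * a) + 1) / 2 by rewrite !divr_gt0 // ltr_wpDl ?nm_ge0.
have [n /(_ n (leqnn n)) hn] := geo_small (C' * `|K| * C') (ltW th0) th1 (half_gt0 e'0).
have [E [E1 E2]] := h2 n _ d0.
have -> : q * a * (1 - q) = q * a * (((2 : R[i]) *: P) ^+ n * E) +
    q * a * (1 - q - ((2 : R[i]) *: P) ^+ n * E) by rewrite -mulrDr [_ + (1 - q - _)]addrC subrK.
apply: le_trans (nmD _ _) _.
have b1 : nm (q * a * (((2 : R[i]) *: P) ^+ n * E)) <= C' * `|K| * C' * th ^+ n.
  have -> : q * a * (((2 : R[i]) *: P) ^+ n * E) =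
      (((2 : R[i]) *: P) ^+ n * q) * (gx (-1) (rev m) ^+ n * a * gx 1 m ^+ n) * E.
    by rewrite mulrA -(mulrA q) comm_P mulrA cq.
  apply: le_trans (nmM _ _) _.
  have -> : C' * `|K| * C' * th ^+ n = (C' * th ^+ n) * (`|K| * th^-1 ^+ n) * (C' * th ^+ n).
    rewrite exprVn; field; by rewrite expf_neq0 // gt_eqF.
  apply: ler_pM; rewrite ?nm_ge0 //; apply: le_trans (nmM _ _) _; apply: ler_pM; rewrite ?nm_ge0 //.
  apply: le_trans (hK n) _; rewrite ler_wpM2r ?ler_norm // exprn_ge0 // ltW //; lra.
have b2 : nm (q * a * (1 - q - ((2 : R[i]) *: P) ^+ n * E)) <= e' / 2.
  apply: le_trans (nmM _ _) _.
  apply: le_trans (_ : (nm (q * a) + 1) * (e' / (nm (q * a) + 1) / 2) <= _).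
    by apply: ler_pM; rewrite ?nm_ge0 ?(ltW E2) // lerDl.
  by rewrite mulrA mulrCA mulfV ?mulr1 // gt_eqF // ltr_wpDl ?nm_ge0.
lra.
Qed.

End GroupElement.

(** * Reflection for identities in abelian groups *)

Inductive zterm := ZVar of nat | ZNull | ZAdd of zterm & zterm | ZOpp of zterm.

Section ZmodReflection.
Variable V : zmodType.
Implicit Types (s : seq V) (t : zterm).

Fixpoint zeval s t : V := match t with
  | ZVar i => s`_i | ZNull => 0 | ZAdd a b => zeval s a + zeval s b | ZOpp a => - zeval s a end.

Fixpoint zcoef t (j : nat) : int := match t with
  | ZVar i => if i == j then 1 else 0
  | ZNull => 0 | ZAdd a b => zcoef a j + zcoef b j | ZOpp a => - zcoef a j end.

Lemma zevalE s t : zeval s t = \sum_(i < size s) s`_i *~ zcoef t i.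
Proof.
elim: t => [i||a IHa b IHb|a IHa] /=.
- have [lt|ge] := ltnP i (size s).
    rewrite (bigD1 (Ordinal lt)) //= eqxx mulr1z big1 ?addr0 // => j.
    by rewrite -val_eqE /= eq_sym => /negPf->; rewrite mulr0z.
  rewrite nth_default // big1 // => j _; case: eqP => [e|_]; last by rewrite mulr0z.
  by have := ltn_ord j; rewrite -e ltnNge ge.
- by rewrite big1 // => j _; rewrite mulr0z.
- by rewrite IHa IHb -big_split; apply: eq_bigr => j _; rewrite mulrzDr.
by rewrite IHa -sumrN; apply: eq_bigr => j _; rewrite mulrNz.
Qed.

Lemma zmod_reflect s n t t' : size s = n -> all (fun j => zcoef t j == zcoef t' j) (iota 0 n) ->
  zeval s t = zeval s t'.
Proof.
move=> sn /allP h; rewrite !zevalE; apply: eq_bigr => i _; congr (_ *~ _).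
by apply/eqP/h; rewrite mem_iota add0n -sn ltn_ord.
Qed.

End ZmodReflection.

Ltac zmod_find a l := match l with
  | ?b :: _ => let _ := match goal with _ => unify a b end in constr:(0%N)
  | _ :: ?l' => let n := zmod_find a l' in constr:(n.+1) end.
Ltac zmod_mem a l := match l with
  | _ => let _ := zmod_find a l in constr:(true) | _ => constr:(false) end.
Ltac zmod_atoms T l e := lazymatch e with
  | (?x + ?y)%R => let l' := zmod_atoms T l x in zmod_atoms T l' y
  | (- ?x)%R => zmod_atoms T l x
  | 0%R => l
  | _ => lazymatch zmod_mem e l with true => l | false => constr:(@cons T e l) end end.
Ltac zmod_reify l e := lazymatch e with
  | (?x + ?y)%R => let a := zmod_reify l x in let b := zmod_reify l y in constr:(ZAdd a b)
  | (- ?x)%R => let a := zmod_reify l x in constr:(ZOpp a)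
  | 0%R => constr:(ZNull)
  | _ => let n := zmod_find e l in constr:(ZVar n) end.
(* Decides identities in abelian groups, up to the equality of atoms. *)
Ltac zmod := lazymatch goal with |- @eq ?T ?x ?y =>
  let l := zmod_atoms T (@nil T) x in let l := zmod_atoms T l y in
  let a := zmod_reify l x in let b := zmod_reify l y in
  exact (@zmod_reflect _ l _ a b erefl (erefl true)) end.

(** * Conjugation by a compact perturbation of the identity *)

Section RaySegment.
Context {R : realType} {V : banType R}.
Implicit Types (T f g : bop V) (z : R[i]) (r t : R).

Definition below T := exists2 c : R, 0 < c & forall x, c * nm x <= nm (T x).

(** The ray argument of [kop_invb] with lower bounds as hypothesis, for operators that are not
    compact. The clause [z' == z] allows the ray to end at a point of [s]. *)
Lemma ray_invb T z (s : seq R[i]) : z != 0 ->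
  (forall z', cabs z <= cabs z' -> (z' \notin s) || (z' == z) -> below (z' *: (1 : bop V) - T)) ->
  invb (z *: (1 : bop V) - T).
Proof.
move=> z0 hb; have cz : 0 < cabs z by rewrite cabs_gt0.
pose slope (l : R[i]) : R := complex.Im (l / z - 1) / complex.Re (l / z - 1).
pose j : nat := (Num.truncn (\sum_(l <- s) `|slope l|)).+1.
pose w : R[i] := (1 +i* j%:R)%C.
have jP l : l \in s -> slope l != j%:R.
  move=> ls; apply/eqP => e.
  have h1 : `|slope l| <= \sum_(l <- s) `|slope l| by rewrite (big_rem l ls) /= lerDl sumr_ge0.
  have h2 := truncnS_gt (\sum_(l <- s) `|slope l|); rewrite -/j -e in h2.
  by have := ler_norm (slope l); lra.
pose p (t : R) : R[i] := z * (1 + t%:C%C * w).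
have cp t : 0 <= t -> cabs z * (1 + t) <= cabs (p t).
  move=> t0; rewrite cabsM ler_wpM2l ?cabs_ge0 //.
  apply: le_trans (cabs_Re _); apply: le_trans (ler_norm _).
  by rewrite /= mul0r subr0 mulr1.
have ps t : 0 <= t -> (p t \notin s) || (p t == z).
  move=> t0; have [t00|tpos] := leP t 0.
    have te : t = 0 by apply: le_anti; rewrite t00.
    by rewrite /p te mul0r addr0 mulr1 eqxx orbT.
  apply/orP; left; apply/negP => /jP; rewrite /slope /p mulrAC mulfV // mul1r addrAC subrr add0r /=.
  by rewrite !mul0r subr0 addr0 mulr1 mulrAC mulfV ?mul1r ?eqxx // gt_eqF.
pose M := nm T / cabs z + 1.
have M0 : 0 <= M by rewrite /M addr_ge0 // divr_ge0 ?nm_ge0 ?cabs_ge0.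
pose F (t : R) : bop V := p (M * (1 - t)) *: (1 : bop V) - T.
have FE t t' : F t - F t' = (p (M * (1 - t)) - p (M * (1 - t'))) *: (1 : bop V).
  by rewrite /F opprB addrA subrK scalerBl.
have F1 : F 1 = z *: (1 : bop V) - T by rewrite /F subrr mulr0 /p mul0r addr0 mulr1.
rewrite -F1; apply: (@seg_invb _ _ F (cabs z * cabs w * M)) => [t t'||t /andP[t0 t1]].
- rewrite FE nmZ; apply: le_trans (_ : cabs (p (M * (1 - t)) - p (M * (1 - t'))) * 1 <= _).
    by rewrite ler_wpM2l ?cabs_ge0 // nm1_le.
  have pB (a b : R) : p a - p b = z * ((a - b)%:C%C * w) by rewrite /p rmorphB; ring.
  rewrite mulr1 pB !cabsM cabs_real (_ : _ - _ = M * (t' - t)); last by ring.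
  by rewrite normrM (ger0_norm M0) distrC le_eqVlt; apply/orP; left; apply/eqP; ring.
- have Mp : 0 <= M * (1 - 0) by rewrite subr0 mulr1.
  apply: (grow_invb (nm_ge0 _) (grow_nm T)); apply: lt_le_trans (cp _ Mp).
  by rewrite subr0 mulr1 mulrC -ltr_pdivrMr // /M; lra.
have tp : 0 <= M * (1 - t) by rewrite mulr_ge0 // subr_ge0.
apply: hb; last exact: ps.
by apply: le_trans (cp _ tp); rewrite ler_peMr ?cabs_ge0 // lerDl.
Qed.

Lemma avoid_radius (s : seq R) (r1 r2 : R) : r1 < r2 -> exists r, [/\ r1 < r, r < r2 & r \notin s].
Proof.
move=> r12.
have [a [b [ra ab br hab]]] : exists a b : R, [/\ r1 <= a, a < b, b <= r2 &
    forall z : R, z \in s -> a < z -> z < b -> False].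
  elim: s => [|z s [a [b [ra ab br hab]]]]; first by exists r1, r2; split=> //.
  have [az|za] := ltP a z; last first.
    exists a, b; split=> // u; rewrite inE => /predU1P[->|/hab//]; lra.
  have [zb|bz] := ltP z b; last first.
    exists a, b; split=> // u; rewrite inE => /predU1P[->|/hab//]; lra.
  exists a, z; split=> //; first lra.
  move=> u; rewrite inE => /predU1P[->|us] h1 h2; first lra.
  by apply: (hab u us h1); lra.
exists ((a + b) / 2); split; [lra|lra|apply/negP => /hab h]; apply: h; lra.
Qed.

Lemma invb_LR T f f' g' : T * f = f' -> f * T = f' -> inv_of f' g' -> invb T.
Proof.
move=> h1 h2 [h3 h4]; exists (f * g'); split; first by rewrite mulrA h1.
have e : g' * f * T = 1 by rewrite -mulrA h2.
have e' : T * (f * g') = 1 by rewrite mulrA h1.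
have -> : f * g' = g' * f by rewrite -[LHS]mul1r -[X in X * _]e -mulrA e' mulr1.
by [].
Qed.

(** [T] times [- (T ^+ N.-1 * cav n T)] is [1 - cav n T], which is invertible once [cav n T] is
    small. *)
Lemma Qc0_invb T : circ T -> Qc T = 0 -> invb T.
Proof.
move=> cT Q0; have [n /(_ n (leqnn n)) hn] := QcP cT (ltac:(lra) : 0 < 2^-1 :> R).
rewrite Q0 subr0 in hn; set N := (2 ^ n.+1)%N.
have [S hS _] := neumann1 (ltac:(lra) : 2^-1 < 1 :> R) (ltW hn).
have [i1 i2] := cav_inv n cT; rewrite -/N in i1 i2.
have cc : GRing.comm T (cav n T) by apply: comm_cav.
have NE : N = (N.-1).+1 by rewrite prednK // expn_gt0.
have e1 : - (T ^+ N * cav n T) = 1 - cav n T.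
  by rewrite -[X in _ = X - _]i1 mulrBl mul1r addrAC subrr add0r.
apply: (@invb_LR T (- (T ^+ N.-1 * cav n T)) (1 - cav n T) S _ _ hS); rewrite -e1.
  by rewrite mulrN mulrA -exprS -NE.
by rewrite mulNr -mulrA -cc mulrA -exprSr -NE.
Qed.

End RaySegment.

(** * Left and right multiplication *)

Section Multiplications.
Context {R : realType} {Y : banType R}.
Implicit Types (a b f y z w q S T : bop Y) (c : R[i]).

Fact lmul_subproof f : is_bop (fun y : bop Y => f * y).
Proof.
split=> [c y z|]; first by rewrite mulrDr (bscalAr c).
by exists (nm f) => y; exact: nmM.
Qed.
Definition lmul f : bop (bop Y) := Bop (lmul_subproof f).

Fact rmul_subproof f : is_bop (fun y : bop Y => y * f).
Proof.
split=> [c y z|]; first by rewrite mulrDl (bscalAl c).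
by exists (nm f) => y; rewrite mulrC nmM.
Qed.
Definition rmul f : bop (bop Y) := Bop (rmul_subproof f).

End Multiplications.

(** * Eigenvectors of a conjugation *)

Section Conjugation.
Context {R : realType} {Y : banType R}.
Implicit Types (a b f y w q S T : bop Y) (z c : R[i]) (r d e t : R).
Variables (g g' k : bop Y).
Hypotheses (gg : inv_of g g') (gE : g = 1 + k) (kk : kop k).

Definition gam : bop (bop Y) := lmul g' * rmul g.

Lemma gamE y : gam y = g' * y * g. Proof. by rewrite /gam /= mulrA. Qed.

Lemma gamX n y : (gam ^+ n) y = g' ^+ n * y * g ^+ n.
Proof.
elim: n y => [|n IH] y; first by rewrite !expr0 mulr1 mul1r.
rewrite exprSr; change ((gam ^+ n) (gam y) = g' ^+ n.+1 * y * g ^+ n.+1).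
by rewrite IH gamE exprSr [g ^+ n.+1]exprS !mulrA.
Qed.

(** The equation [gam y = (1 + z) y] reads [y (1 + k) = (1 + z) (1 + k) y], that is
    [y (z - k) = - (1 + z) k y]; the last term is the defect of an approximate eigenvector. *)
Lemma gam_eq z y : y * (z *: (1 : bop Y) - k) = - ((1 + z) *: (k * y) + g * (gam y - (1 + z) *: y)).
Proof.
have -> : g * (gam y - (1 + z) *: y) = y * g - (1 + z) *: (g * y).
  by rewrite mulrBr gamE !mulrA gg.1 mul1r (bscalAr (1 + z)).
rewrite {1 2}gE mulrBr (bscalAr z) (mulr1 y) mulrDr mulrDl mulr1 mul1r scalerDr [(1 + z) *: y]scalerDl scale1r.
zmod.
Qed.

(** Solving the equation once on the right and once on the left puts a factor [k] on both sides of
    [y], up to the defect. This is the form to which Vala's theorem applies. *)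
Lemma gam_two_sided z y S0 S1 : inv_of (z *: (1 : bop Y) - k) S0 ->
  inv_of (z *: (1 : bop Y) + (1 + z) *: k) S1 ->
  y = - (1 + z) *: ((k * S1) * y * (k * S0)) +
      ((1 + z) *: (k * S1 * g * (gam y - (1 + z) *: y) * S0) - g * (gam y - (1 + z) *: y) * S0).
Proof.
move=> h0 h1; set w := gam y - (1 + z) *: y.
have e0 : y = - ((1 + z) *: (k * y) + g * w) * S0 by rewrite -gam_eq -mulrA h0.1 mulr1.
have e1 : y = S1 * (y * k - g * w).
  have -> : y * k - g * w = (z *: (1 : bop Y) + (1 + z) *: k) * y; last by rewrite mulrA h1.2 mul1r.
  have := gam_eq z y; rewrite -/w mulrBr (bscalAr z) mulr1 mulrDl (bscalAl z) (bscalAl (1 + z)) mul1r => h.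
  have -> : y * k = z *: y - (z *: y - y * k) by zmod.
  rewrite h; zmod.
have e2 : k * y * S0 = k * S1 * y * (k * S0) - k * S1 * g * w * S0.
  by rewrite {1}e1 !mulrBr mulrBl !mulrA.
by rewrite {1}e0 mulNr mulrDl (bscalAl (1 + z)) e2 scalerBr scaleNr; zmod.
Qed.

Lemma gam_approx_eig (L : set (bop Y)) z S0 S1 (u : nat -> bop Y) : csub L ->
  inv_of (z *: (1 : bop Y) - k) S0 -> inv_of (z *: (1 : bop Y) + (1 + z) *: k) S1 ->
  (forall n, L (u n)) -> (forall n, nm (u n) = 1) -> tends (fun n => gam (u n) - (1 + z) *: u n) 0 ->
  exists y, [/\ L y, y != 0 & gam y = (1 + z) *: y].
Proof.
move=> cL h0 h1 Lu u1 hu.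
have hT : tbdd (range (fun n => (k * S1) * u n * (k * S0))).
  apply: tbdd_sub (vala (kopMr S1 kk) (kopMr S0 kk)) => _ [n _ <-].
  by exists (u n) => //=; rewrite u1.
have [p pn [x hx]] := tbdd_cvg hT.
have hup := tends_sub pn hu.
pose l := - (1 + z) *: x + ((1 + z) *: (k * S1 * g * 0 * S0) - g * 0 * S0).
have hl : tends (fun n => u (p n)) l.
  apply: tends_eq (fun n => esym (gam_two_sided (u (p n)) h0 h1)) _.
  apply: tendsD; first exact: tendsZ.
  apply: tendsB; first apply: tendsZ; apply: tendsMr; exact: tendsMl.
exists l; split.
- by apply: csub_tends hl => //.
- apply/eqP => l0; have [N hN] := hl _ (ltac:(lra) : 0 < 2^-1 :> R).
  by have := hN N (leqnn _); rewrite l0 subr0 u1; lra.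
have := tends_uniq hup (tendsB (bop_tends gam hl) (tendsZ (1 + z) hl)).
by move=> /esym/eqP; rewrite subr_eq0 => /eqP.
Qed.

(** [q] is the projection for the part of the spectrum of [k] near 0. On the corner [q y q] high
    powers of [Lam] are small, so [w - Lam w], which is [- z^-1 g] times the defect, controls [w].
    Hence an eigenvector for [1 + z] has zero corner and finite rank. *)
Lemma gam_corner z : z != 0 -> exists q d, [/\ q * q = q, GRing.comm q k, fr (1 - q), 0 < d &
  forall w, q * w * q = w -> nm w <= d * nm (gam w - (1 + z) *: w)].
Proof.
move=> z0; have cz : 0 < cabs z by rewrite cabs_gt0.
pose c := 1 + cabs (1 + z); have c0 : 0 < c by rewrite ltr_pwDl ?cabs_ge0.
(* With this radius each application of [Lam] costs a factor of at most 1/2. *)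
pose r := cabs z / (2 * c); have r0 : 0 < r by rewrite divr_gt0 // mulr_gt0.
have [t [rt tr hcirc]] := kop_circle kk (half_gt0 r0) (ltac:(lra) : r / 2 < r).
have t0 : 0 < t by lra.
pose B : bop Y := (t^-1)%:C%C *: k; have cB : circ B by exact: circ_scale.
have [C hC] := circ_bound cB; pose q := Qc B.
have kB : k = t%:C%C *: B by rewrite /B scalerA -rmorphM mulfV ?gt_eqF // scale1r.
have hq i : nm (k ^+ i * q) <= C * t ^+ i.
  rewrite kB bexprZ (bscalAl (t%:C%C ^+ i)) nmZ cabsX cabs_nneg ?(ltW t0) // mulrC.
  by rewrite ler_wpM2r ?exprn_ge0 ?(ltW t0) //; exact: Qc_pow_le.
have C0 : 0 <= C by have := hq 0%N; rewrite expr0 mulr1; apply: le_trans (nm_ge0 _).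
have qk : GRing.comm q k.
  apply: commr_sym; apply: comm_Qc.
  by rewrite /GRing.comm /B (bscalAr (t^-1)%:C%C) (bscalAl (t^-1)%:C%C).
have qq : q * q = q by exact: Qc_idem.
pose Lam : bop (bop Y) := z^-1 *: (rmul k - (1 + z) *: lmul k).
have LamE v i j : k ^+ i * Lam v * k ^+ j = z^-1 *: (k ^+ i * v * k ^+ j.+1 - (1 + z) *: (k ^+ i.+1 * v * k ^+ j)).
  have -> : Lam v = z^-1 *: (v * k - (1 + z) *: (k * v)) by [].
  rewrite (bscalAr z^-1) (bscalAl z^-1) mulrBr mulrBl (bscalAr (1 + z)) (bscalAl (1 + z)).
  by rewrite [k ^+ i.+1]exprSr [k ^+ j.+1]exprS !mulrA.
(* Powers of [k] are carried on both sides, because [Lam] raises one of the two exponents. *)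
have bnd n i j w : nm (k ^+ i * (Lam ^+ n) (q * w * q) * k ^+ j) <= C * C * nm w * t ^+ (i + j) * 2^-1 ^+ n.
  elim: n i j => [|n IH] i j.
    rewrite !expr0 mulr1; change (nm (k ^+ i * (q * w * q) * k ^+ j) <= C * C * nm w * t ^+ (i + j)).
    have -> : k ^+ i * (q * w * q) * k ^+ j = (k ^+ i * q) * w * (k ^+ j * q).
      by rewrite !mulrA -mulrA (commrX j qk) !mulrA.
    apply: le_trans (nmM _ _) _; rewrite exprD.
    have -> : C * C * nm w * (t ^+ i * t ^+ j) = (C * t ^+ i * nm w) * (C * t ^+ j) by ring.
    apply: ler_pM; rewrite ?nm_ge0 ?hq //; apply: le_trans (nmM _ _) _.
    by rewrite ler_wpM2r ?nm_ge0 // hq.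
  rewrite exprS; change (nm (k ^+ i * Lam ((Lam ^+ n) (q * w * q)) * k ^+ j) <= C * C * nm w * t ^+ (i + j) * 2^-1 ^+ n.+1).
  rewrite LamE nmZ cabsV.
  set K := C * C * nm w * t ^+ (i + j) * 2^-1 ^+ n.
  have K0 : 0 <= K by rewrite !mulr_ge0 ?nm_ge0 ?exprn_ge0 ?(ltW t0) ?invr_ge0.
  have h1 := IH i j.+1; have h2 := IH i.+1 j.
  rewrite addnS [t ^+ _.+1]exprS in h1; rewrite addSn [t ^+ _.+1]exprS in h2.
  have e1 : C * C * nm w * (t * t ^+ (i + j)) * 2^-1 ^+ n = t * K by rewrite /K; ring.
  rewrite e1 in h1 h2.
  apply: le_trans (_ : (cabs z)^-1 * (c * (t * K)) <= _).
    rewrite ler_wpM2l ?invr_ge0 ?cabs_ge0 //; apply: le_trans (nmB _ _) _; rewrite nmZ /c mulrDl mul1r.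
    by rewrite lerD // ler_wpM2l ?cabs_ge0.
  rewrite ler_pdivrMl //.
  have -> : C * C * nm w * t ^+ (i + j) * 2^-1 ^+ n.+1 = K / 2 by rewrite exprSr /K; ring.
  have e2 : c * r = cabs z / 2 by rewrite /r invfM; field; rewrite gt_eqF.
  have : c * t <= cabs z / 2 by rewrite -e2 ler_wpM2l // ltW.
  move=> /(ler_wpM2r K0); rewrite -mulrA => /le_trans; apply.
  by rewrite le_eqVlt; apply/orP; left; apply/eqP; ring.
have [n /(_ n (leqnn n)) hn] := @geo_small _ (C * C) 2^-1 2^-1 (ltac:(lra)) (ltac:(lra)) (ltac:(lra)).
pose S := \sum_(i < n) Lam ^+ i.
pose d := 2 * nm S * (cabs z)^-1 * nm g + 1.
exists q, d; split=> //.
- have -> : 1 - q = 1 - Qc (0 *: (1 : bop Y) + B) by rewrite scale0r add0r.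
  apply: kop_idem_fr; first by apply: kop_Qc; rewrite ?cabs0 ?scale0r ?add0r //; exact: kopZ.
  by rewrite scale0r add0r mulrBl mul1r mulrBr mulr1 qq subrr subr0.
- by rewrite /d ltr_wpDl // !mulr_ge0 ?nm_ge0 ?invr_ge0 ?cabs_ge0.
move=> w qwq; set w' := gam w - (1 + z) *: w.
have e1 : w - Lam w = - (z^-1 *: (g * w')).
  have -> : Lam w = z^-1 *: (w * k - (1 + z) *: (k * w)) by [].
  have h := gam_eq z w; rewrite mulrBr (bscalAr z) mulr1 in h.
  have -> : w * k - (1 + z) *: (k * w) = z *: w + g * w'.
    have -> : w * k = z *: w - (z *: w - w * k) by zmod.
    by rewrite h; zmod.
  by rewrite scalerDr scalerA mulVf // scale1r; zmod.
have e2 : w = S (w - Lam w) + (Lam ^+ n) w.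
  have := comm_1subX Lam n; rewrite -/S => h.
  have hc : S * (1 - Lam) = (1 - Lam) * S.
    by rewrite mulrBl mulrBr mul1r mulr1; congr (_ - _); rewrite comm_sumX.
  have : (S * (1 - Lam)) w = (1 - Lam ^+ n) w by rewrite hc h.
  by move=> h'; change (w = (S * (1 - Lam)) w + (Lam ^+ n) w); rewrite h'; change (w = w - (Lam ^+ n) w + (Lam ^+ n) w); rewrite subrK.
have h1 := bnd n 0%N 0%N w; rewrite !expr0 mulr1 mul1r mulr1 qwq in h1.
have h2 : nm (S (w - Lam w)) <= nm S * ((cabs z)^-1 * (nm g * nm w')).
  apply: le_trans (nm_bopP _ _) _; rewrite ler_wpM2l ?nm_ge0 // e1 nmN nmZ cabsV.
  by rewrite ler_wpM2l ?invr_ge0 ?cabs_ge0 // nmM.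
have h3 : nm w <= nm (S (w - Lam w)) + nm ((Lam ^+ n) w) by rewrite {1}e2 nmD.
have h4 : C * C * nm w * 2^-1 ^+ n <= 2^-1 * nm w.
  by rewrite mulrAC ler_wpM2r ?nm_ge0 // ltW.
have -> : d * nm w' = 2 * (nm S * ((cabs z)^-1 * (nm g * nm w'))) + nm w' by rewrite /d; ring.
have := nm_ge0 w'; lra.
Qed.

End Conjugation.

(** * Growth of a conjugation in the absence of finite-rank elements *)

Section ConjugationGrowth.
Context {R : realType} {Y : banType R}.
Implicit Types (a b f y w q S : bop Y) (z : R[i]) (r d e t c : R).
Variables (g g' k : bop Y).
Hypotheses (gg : inv_of g g') (gE : g = 1 + k) (kk : kop k).

Local Notation Gam := (gam g g').

Lemma bad_values c0 : 0 < c0 -> exists s : seq R[i], forall z, c0 <= cabs z -> z \notin s ->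
  invb (z *: (1 : bop Y) - k) /\ invb (z *: (1 : bop Y) + (1 + z) *: k).
Proof.
move=> c00; have c1 : 0 < c0 / (1 + c0) by rewrite divr_gt0 // ltr_wpDl ?ltW.
have [s1 h1] := kop_eig_fin kk c00; have [s2 h2] := kop_eig_fin kk c1.
exists (s1 ++ [seq - l / (1 + l) | l <- s2]) => z cz; rewrite mem_cat negb_or => /andP[n1 n2].
have z0 : z != 0 by rewrite -cabs_gt0; apply: lt_le_trans cz.
split; first by apply: kop_invb => // /(h1 z cz); exact/negP.
have [zz|z1] := eqVneq (1 + z) 0.
  rewrite zz scale0r addr0; exists (z^-1 *: (1 : bop Y)).
  by split; rewrite bscalAl mul1r scalerA ?mulVf ?mulfV ?scale1r.
pose l := - z / (1 + z).
have l0 : l != 0 by rewrite mulf_neq0 ?oppr_eq0 ?invr_neq0.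
have -> : z *: (1 : bop Y) + (1 + z) *: k = - (1 + z) *: (l *: (1 : bop Y) - k).
  rewrite scalerBr scalerA !scaleNr opprK; congr (_ *: _ + _).
  by rewrite /l mulNr mulrA mulrAC mulfV // mul1r opprK.
have [|S hS] := @kop_invb _ _ k l kk l0; last first.
  by exists ((- (1 + z))^-1 *: S); apply: inv_ofZ => //; rewrite oppr_eq0.
move=> h; have ll : l \in s2.
  apply: h2 h; rewrite cabsM cabsN cabsV.
  have h3 : cabs (1 + z) <= 1 + cabs z by rewrite -[X in _ <= X + _]cabs1 cabsD.
  have h4 : 0 < cabs (1 + z) by rewrite cabs_gt0.
  rewrite ler_pdivrMr; last lra.
  rewrite mulrAC ler_pdivlMr //.
  by apply: le_trans (ler_wpM2l (ltW c00) h3) _; lra.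
case/negP: n2; apply/mapP; exists l => //.
have e : 1 + l = (1 + z)^-1.
  by rewrite /l -{1}(mulfV z1) -mulrDl -addrA subrr addr0 mul1r.
by rewrite e invrK mulNr /l mulfVK // opprK.
Qed.

Lemma corner_fr q y : fr (1 - q) -> q * y * q = 0 -> fr y.
Proof.
move=> fq h; have -> : y = (1 - q) * y + q * y * (1 - q).
  by rewrite mulrBl mulrBr mul1r mulr1 h; zmod.
by apply: frD; [exact: frMr | exact: frMl].
Qed.

Lemma gam_corner_comm q y : GRing.comm q k -> Gam (q * y * q) = q * Gam y * q.
Proof.
move=> qk; have qg : GRing.comm q g by rewrite gE; apply: commrD; first exact: commr1.
have qg' : GRing.comm q g' by exact: inv_of_comm gg qg.
by rewrite !gamE !mulrA -qg' -!mulrA qg.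
Qed.

Lemma gam_lin_corner q y z : GRing.comm q k ->
  Gam (q * y * q) - (1 + z) *: (q * y * q) = q * (Gam y - (1 + z) *: y) * q.
Proof. by move=> qk; rewrite gam_corner_comm // mulrBr mulrBl (bscalAr (1 + z)) (bscalAl (1 + z)). Qed.

Section NoFiniteRank.
Variable L : set (bop Y).
Hypotheses (cL : csub L) (LG : forall y, L y -> L (Gam y)) (noF : forall y, L y -> fr y -> y = 0).

Fact zero_sub : [set (0 : bop Y)] `<=` L.
Proof. by move=> _ ->; exact: cL.1.1. Qed.

(** Dividing [L] by zero turns the closed subspace into a Banach space of its own, so that the
    spectral theory applies to the restricted conjugation. *)
Let G := GapData cL (@csub0 _ (bop Y)) zero_sub.

Lemma nm_cls0 y : L y -> nm (cls G y) = nm y.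
Proof.
move=> Ly; apply/le_anti; rewrite gnm_le //=; apply/ler_addgt0Pr => e e0.
have [x [Lx xy xn]] := nm_lift (cls G y) e0.
have /= h : x - y = 0 := @cls_eqE _ _ G x y Lx Ly xy.
by move/eqP: h; rewrite subr_eq0 => /eqP h; rewrite -[X in nm X <= _]h ltW.
Qed.

Fact stab_gam1 : gstab G (Gam - 1).
Proof.
split=> [y Ly|y ->]; last exact: bop0.
exact: (subspB cL.1 (LG Ly) Ly).
Qed.

Let T := gind G (Gam - 1).

Lemma ind_gamE z y : L y -> (z *: (1 : bop (gap G)) - T) (cls G y) = - cls G (Gam y - (1 + z) *: y).
Proof.
move=> Ly; change (z *: cls G y - T (cls G y) = - cls G (Gam y - (1 + z) *: y)).
have LGy := LG Ly.
rewrite /T gindE //; last exact: stab_gam1.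
change (z *: cls G y - cls G (Gam y - y) = - cls G (Gam y - (1 + z) *: y)).
rewrite -clsZ // -clsB -?clsN; last 3 first.
- exact: (subspB cL.1 LGy (subspZ _ cL.1 Ly)).
- exact: (subspZ _ cL.1 Ly).
- exact: (subspB cL.1 LGy Ly).
by congr (cls G _); rewrite scalerDl scale1r; zmod.
Qed.

(** Approximate eigenvectors would produce an eigenvector in [L]; by [gam_corner] its corner
    vanishes, so it would have finite rank. *)
Lemma ind_gam_below z : z != 0 -> invb (z *: (1 : bop Y) - k) ->
  invb (z *: (1 : bop Y) + (1 + z) *: k) -> below (z *: (1 : bop (gap G)) - T).
Proof.
move=> z0 [S0 h0] [S1 h1].
suff : exists2 c : R, 0 < c & forall x, c * nm x <= nm ((z *: (1 : bop (gap G)) - T) x) by [].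
apply: bounded_below => u u1 hu.
pose v n : bop Y := grep (u n).
have Lv n : L (v n) by exact: (svalP (u n)).1.
have vE n : cls G (v n) = u n by exact: clsK.
have LD y : L y -> L (Gam y - (1 + z) *: y).
  by move=> Ly; exact: (subspB cL.1 (LG Ly) (subspZ _ cL.1 Ly)).
have v1 n : nm (v n) = 1 by rewrite -nm_cls0 // vE.
have [|y [Ly y0 ye]] := @gam_approx_eig _ _ g g' k gg gE kk L z S0 S1 v cL h0 h1 Lv v1.
  move=> e e0; have [N hN] := hu e e0; exists N => n Nn.
  by have := hN n Nn; rewrite !subr0 -vE ind_gamE // nmN nm_cls0 //; exact: LD.
have [q [d [qq qk fq d0 hq]]] := gam_corner gg gE kk z0.
have := hq (q * y * q); rewrite gam_lin_corner // ye subrr mulr0 mul0r nm0 mulr0.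
have e : q * (q * y * q) * q = q * y * q by rewrite !mulrA qq -mulrA qq.
move=> /(_ e) h; have c0 : q * y * q = 0 by apply: nm_eq0; apply: le_anti; rewrite h nm_ge0.
by case/eqP: y0; apply: noF Ly (corner_fr fq c0).
Qed.

Lemma ind_gam_invb c0 : 0 < c0 -> exists s : seq R[i], forall z, c0 <= cabs z -> z \notin s ->
  invb (z *: (1 : bop (gap G)) - T).
Proof.
move=> c00; have [s hs] := bad_values c00; exists s => z cz zs.
have z0 : z != 0 by rewrite -cabs_gt0; apply: lt_le_trans cz.
apply: (@ray_invb _ _ T z s z0) => z' zz' h.
have cz' : c0 <= cabs z' by apply: le_trans zz'.
have zs' : z' \notin s by case/orP: h => // /eqP->.
have [i0 i1] := hs z' cz' zs'; apply: ind_gam_below => //.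
by rewrite -cabs_gt0; apply: lt_le_trans cz'.
Qed.

(** Finitely many values outside a small disc are still open. Around such a [z0] take a small circle
    free of spectrum. A vector [y] in the range of its Riesz projection satisfies
    [|D^n y| <= C r^n], while on the corner [D] is bounded below by [d^-1 > r]; so the corner of [y]
    vanishes and [y] has finite rank. *)
Lemma ind_gam_qn : qn T.
Proof.
apply: qn_spec => z0 z00; have cz : 0 < cabs z0 by rewrite cabs_gt0.
have [s hs] := ind_gam_invb (half_gt0 cz).
have [q [d [qq qk fq d0 hq]]] := gam_corner gg gE kk z00.
(* The circle has to stay at distance [|z0| / 2] from 0, and its radius has to satisfy
   [d r <= 1/2]. *)
pose m := Num.min (cabs z0 / 2) (d^-1 / 2).
have m0 : 0 < m by rewrite /m lt_min !divr_gt0 // invr_gt0.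
have [r [r1 r2 rs]] := avoid_radius [seq cabs (z - z0) | z <- s] (ltac:(lra) : m / 2 < m).
have r0 : 0 < r by lra.
have [rm1 rm2] : r < cabs z0 / 2 /\ r < d^-1 / 2 by apply/andP; rewrite -lt_min.
pose T0 : bop (gap G) := T - z0 *: (1 : bop (gap G)).
have cB : circ ((r^-1)%:C%C *: T0).
  apply: circ_scale => // z zr.
  have -> : z *: (1 : bop (gap G)) - T0 = (z + z0) *: (1 : bop (gap G)) - T.
    by rewrite /T0 scalerDl; zmod.
  apply: hs.
    have h1 : cabs z0 <= cabs (z + z0) + cabs z.
      by rewrite -[cabs z]cabsN; apply: le_trans (cabsD _ _); rewrite addrAC subrr add0r.
    rewrite zr in h1; lra.
  apply/negP => h; case/negP: rs; apply/mapP; exists (z + z0) => //.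
  by rewrite addrK zr.
set B := _ *: T0 in cB.
have TB : T0 = r%:C%C *: B by rewrite /B scalerA -rmorphM mulfV ?gt_eqF // scale1r.
have [Q0|Qn] := eqVneq (Qc B) 0.
  have [S hS] := Qc0_invb cB Q0.
  have := inv_ofZ (_ : - r%:C%C != 0 :> R[i]) hS.
  rewrite oppr_eq0 (_ : (r%:C%C == 0) = false); last first.
    by apply/negP => /eqP h; have := cabs_nneg (ltW r0); rewrite h cabs0 => /eqP; rewrite lt_eqF.
  move=> /(_ isT) hh; exists ((- r%:C%C)^-1 *: S).
  by move: hh; rewrite scaleNr -TB /T0 opprB.
have [p pn] : exists p, Qc B p != 0.
  apply: contrapT => /forallNP h; case/eqP: Qn; apply: bop_ext => p.
  by apply: contrapT => /eqP h'; apply: (h p).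
have [C hC] := circ_bound cB.
have [y Ly yE] := gapP (Qc B p).
have y0 : y != 0.
  by apply/eqP => h; case/eqP: pn; rewrite yE h; apply/cls_eq0 => //; exact: cL.1.1.
pose D : bop (bop Y) := Gam - (1 + z0) *: (1 : bop (bop Y)).
have LD x : L x -> L (D x).
  move=> Lx; change (L (Gam x - (1 + z0) *: x)).
  exact: (subspB cL.1 (LG Lx) (subspZ _ cL.1 Lx)).
have DE x : L x -> T0 (cls G x) = cls G (D x).
  move=> Lx; have := ind_gamE z0 Lx => h.
  have -> : T0 (cls G x) = - ((z0 *: (1 : bop (gap G)) - T) (cls G x)).
    by change (T (cls G x) - z0 *: cls G x = - (z0 *: cls G x - T (cls G x))); rewrite opprB.
  by rewrite h opprK.
have LDn n : L ((D ^+ n) y) by elim: n => [//|n IH]; rewrite exprS; exact: LD.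
have DnE n : (T0 ^+ n) (cls G y) = cls G ((D ^+ n) y).
  elim: n => [//|n IH]; rewrite !exprS; change (T0 ((T0 ^+ n) (cls G y)) = cls G (D ((D ^+ n) y))).
  by rewrite IH DE.
have gr n : nm ((D ^+ n) y) <= r ^+ n * (C * nm p).
  rewrite -nm_cls0 // -DnE -yE TB bexprZ.
  change (nm ((r%:C%C ^+ n) *: ((B ^+ n * Qc B) p)) <= r ^+ n * (C * nm p)).
  rewrite nmZ cabsX cabs_nneg ?(ltW r0) // ler_wpM2l ?exprn_ge0 ?(ltW r0) //.
  apply: le_trans (nm_bopP _ _) _; rewrite ler_wpM2r ?nm_ge0 //; exact: Qc_pow_le.
have qD x : q * D x * q = D (q * x * q).
  by change (q * (Gam x - (1 + z0) *: x) * q = Gam (q * x * q) - (1 + z0) *: (q * x * q)); rewrite gam_lin_corner.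
have qqx x : q * (q * x * q) * q = q * x * q by rewrite !mulrA qq -mulrA qq.
have dn n x : nm (q * x * q) <= d ^+ n * nm (q * (D ^+ n) x * q).
  elim: n x => [|n IH] x; first by rewrite !expr0 mul1r.
  apply: le_trans (hq _ (qqx x)) _.
  rewrite gam_lin_corner // [d ^+ n.+1]exprS -[d * _ * _]mulrA ler_wpM2l ?(ltW d0) // [D ^+ n.+1]exprSr.
  exact: IH.
suff h : q * y * q = 0 by case/eqP: y0; exact: noF (corner_fr fq h).
have C0 : 0 <= nm q * (C * nm p) * nm q.
  have := gr 0%N; rewrite !expr0 mul1r => h.
  have h' := le_trans (nm_ge0 _) h; exact: (mulr_ge0 (mulr_ge0 (nm_ge0 q) h') (nm_ge0 q)).
apply: nm_small => e e0.
have [n /(_ n (leqnn n)) hn] := @geo_small _ (nm q * (C * nm p) * nm q) 2^-1 e (ltac:(lra)) (ltac:(lra)) e0.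
apply: le_trans (ltW hn); apply: le_trans (dn n y) _.
apply: le_trans (_ : d ^+ n * (nm q * (r ^+ n * (C * nm p)) * nm q) <= _).
  rewrite ler_wpM2l ?exprn_ge0 ?(ltW d0) //; apply: le_trans (nmM _ _) _.
  rewrite ler_wpM2r ?nm_ge0 //; apply: le_trans (nmM _ _) _.
  by rewrite ler_wpM2l ?nm_ge0.
have -> : d ^+ n * (nm q * (r ^+ n * (C * nm p)) * nm q) = nm q * (C * nm p) * nm q * (d * r) ^+ n.
  by rewrite exprMn; ring.
have dr : d * r <= 2^-1.
  have : d * r <= d * (d^-1 / 2) by rewrite ler_wpM2l // ltW.
  by rewrite mulrA mulfV ?gt_eqF // mul1r.
have dr0 : 0 <= d * r by rewrite mulr_ge0 ?(ltW d0) ?(ltW r0).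
have h20 : 0 <= 2^-1 :> R by lra.
by rewrite ler_wpM2l // lerXn2r ?nnegrE.
Qed.

Lemma conj_growth y r : L y -> 1 < r -> exists C, forall n, nm (g' ^+ n * y * g ^+ n) <= C * r ^+ n.
Proof.
move=> Ly r1; have [C C0 hC] := qn_grow1D ind_gam_qn r1.
have TE x : L x -> (1 + T) (cls G x) = cls G (Gam x).
  move=> Lx; change (cls G x + T (cls G x) = cls G (Gam x)).
  rewrite /T gindE //; last exact: stab_gam1.
  change (cls G x + cls G (Gam x - x) = cls G (Gam x)).
  rewrite -clsD //; first by rewrite addrC subrK.
  exact: (subspB cL.1 (LG Lx) Lx).
have LGn n : L ((Gam ^+ n) y) by elim: n => [//|n IH]; rewrite exprS; exact: LG.
have TnE n : ((1 + T) ^+ n) (cls G y) = cls G ((Gam ^+ n) y).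
  elim: n => [//|n IH]; rewrite !exprS; change ((1 + T) (((1 + T) ^+ n) (cls G y)) = cls G (Gam ((Gam ^+ n) y))).
  by rewrite IH TE.
exists (C * nm y) => n; rewrite -gamX // -nm_cls0 // -TnE.
apply: le_trans (nm_bopP _ _) _; rewrite nm_cls0 // mulrAC ler_wpM2r ?nm_ge0 //.
Qed.

End NoFiniteRank.

Lemma fr_or_growth (L : set (bop Y)) : csub L -> (forall y, L y -> L (g' * y * g)) ->
  (exists y, [/\ L y, y != 0 & fr y]) \/
  (forall y r, L y -> 1 < r -> exists C, forall n, nm (g' ^+ n * y * g ^+ n) <= C * r ^+ n).
Proof.
move=> cL LG; have [h|h] := pselect (exists y, [/\ L y, y != 0 & fr y]); [by left|right].
move=> y r Ly r1; apply: (@conj_growth L) => // x Lx; first by rewrite gamE; exact: LG.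
by move=> fx; apply: contrapT => /eqP x0; apply: h; exists x.
Qed.

End ConjugationGrowth.

(** * The enveloping Lie algebra *)

Section ProductSpace.
Context {R : realType} {V : banType R}.
Implicit Types (p q : V * V) (f g : bop V).

Definition pnm p : R := nm p.1 + nm p.2.

Fact pnm_eq0 p : pnm p = 0 -> p = 0.
Proof.
case: p => x y /eqP; rewrite /pnm /= paddr_eq0 ?nm_ge0 // !nmE0 => /andP[/eqP-> /eqP->] //.
Qed.

Fact pnmD p q : pnm (p + q) <= pnm p + pnm q.
Proof. by rewrite /pnm /= addrACA lerD ?nmD. Qed.

Fact pnmZ (a : R[i]) p : pnm (a *: p) = cabs a * pnm p.
Proof. by rewrite /pnm /= !nmZ mulrDr. Qed.

Fact pnm_complete (u : nat -> V * V) :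
  (forall e, 0 < e -> exists N, forall m n, (N <= m)%N -> (N <= n)%N -> pnm (u m - u n) < e) ->
  exists l, forall e, 0 < e -> exists N, forall n, (N <= n)%N -> pnm (u n - l) < e.
Proof.
move=> hu.
have [l1 h1] : exists l, tends (fun n => (u n).1) l.
  apply: cauchys_tends => e e0; have [N hN] := hu e e0; exists N => m n Nm Nn.
  by apply: le_lt_trans (hN m n Nm Nn); rewrite /pnm /= lerDl nm_ge0.
have [l2 h2] : exists l, tends (fun n => (u n).2) l.
  apply: cauchys_tends => e e0; have [N hN] := hu e e0; exists N => m n Nm Nn.
  by apply: le_lt_trans (hN m n Nm Nn); rewrite /pnm /= lerDr nm_ge0.
exists (l1, l2) => e e0; have [N1 k1] := h1 _ (half_gt0 e0); have [N2 k2] := h2 _ (half_gt0 e0).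
exists (maxn N1 N2) => n; rewrite geq_max => /andP[n1 n2].
by have := k1 n n1; have := k2 n n2; rewrite /pnm /=; lra.
Qed.

HB.instance Definition _ := isBanach.Build R (V * V)%type pnm_eq0 pnmD pnmZ pnm_complete.

Lemma nm_pairE (p : V * V) : nm p = nm p.1 + nm p.2. Proof. by []. Qed.

Lemma nm_pair1 (p : V * V) : nm p.1 <= nm p. Proof. by rewrite nm_pairE lerDl nm_ge0. Qed.
Lemma nm_pair2 (p : V * V) : nm p.2 <= nm p. Proof. by rewrite nm_pairE lerDr nm_ge0. Qed.

Fact dg_subproof f g : is_bop (fun p : V * V => (f p.1, g p.2)).
Proof.
split=> [a x y|]; first by rewrite /= !bop_lin.
exists (nm f + nm g) => p; rewrite !nm_pairE /=.
have := nm_bopP f p.1; have := nm_bopP g p.2; have := nm_ge0 p.1; have := nm_ge0 p.2.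
have := nm_ge0 f; have := nm_ge0 g; nra.
Qed.
Definition dg f g : bop (V * V)%type := Bop (dg_subproof f g).

Lemma dgE f g p : dg f g p = (f p.1, g p.2). Proof. by []. Qed.

Lemma dgD f g f' g' : dg f g + dg f' g' = dg (f + f') (g + g').
Proof. exact: bop_ext. Qed.

Lemma dgB f g f' g' : dg f g - dg f' g' = dg (f - f') (g - g').
Proof. exact: bop_ext. Qed.
Lemma dgM f g f' g' : dg f g * dg f' g' = dg (f * f') (g * g').
Proof. exact: bop_ext. Qed.
Lemma dgZ (a : R[i]) f g : a *: dg f g = dg (a *: f) (a *: g).
Proof. exact: bop_ext. Qed.
Lemma dg1 : dg 1 1 = 1. Proof. by apply: bop_ext => -[]. Qed.
Lemma dg0 : dg 0 0 = 0. Proof. by apply: bop_ext => -[]. Qed.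

Lemma dgX f g n : dg f g ^+ n = dg (f ^+ n) (g ^+ n).
Proof. by elim: n => [|n IH]; rewrite ?expr0 ?dg1 // !exprS IH dgM. Qed.

Lemma dg_sum (I : Type) (s : seq I) (P : pred I) (F G : I -> bop V) :
  \sum_(i <- s | P i) dg (F i) (G i) = dg (\sum_(i <- s | P i) F i) (\sum_(i <- s | P i) G i).
Proof.
elim: s => [|i s IH]; first by rewrite !big_nil dg0.
by rewrite !big_cons; case: (P i); rewrite IH ?dgD.
Qed.

Lemma dg_inj f g f' g' : dg f g = dg f' g' -> f = f' /\ g = g'.
Proof.
move=> h; have hh x y : (f x, g y) = (f' x, g' y) by rewrite -(dgE f g (x, y)) h.
by split; apply: bop_ext => x; have [] := hh x x.
Qed.

Lemma nm_dg f g : nm (dg f g) <= nm f + nm g.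
Proof.
apply: nm_bop_le => [|p]; first by rewrite addr_ge0 ?nm_ge0.
rewrite !nm_pairE /=; have := nm_bopP f p.1; have := nm_bopP g p.2; have := nm_ge0 p.1.
have := nm_ge0 p.2; have := nm_ge0 f; have := nm_ge0 g; nra.
Qed.

Lemma nm_dg1 f g : nm f <= nm (dg f g).
Proof.
apply: nm_bop_le => [|x]; first exact: nm_ge0.
have := nm_bopP (dg f g) (x, 0); rewrite !nm_pairE /= bop0 nm0 !addr0; exact.
Qed.

Lemma nm_dg2 f g : nm g <= nm (dg f g).
Proof.
apply: nm_bop_le => [|x]; first exact: nm_ge0.
have := nm_bopP (dg f g) (0, x); rewrite !nm_pairE /= bop0 nm0 !add0r; exact.
Qed.

Lemma dg_tends (u v : nat -> bop V) f g : tends u f -> tends v g ->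
  tends (fun n => dg (u n) (v n)) (dg f g).
Proof.
move=> h1 h2 e e0; have [N1 k1] := h1 _ (half_gt0 e0); have [N2 k2] := h2 _ (half_gt0 e0).
exists (maxn N1 N2) => n; rewrite geq_max => /andP[n1 n2].
have := k1 n n1; have := k2 n n2; rewrite dgB => *.
by apply: le_lt_trans (nm_dg _ _) _; lra.
Qed.

Lemma kop_dg f g : kop f -> kop g -> kop (dg f g).
Proof.
move=> kf kg e e0; have [s hs] := kf _ (half_gt0 e0); have [t ht] := kg _ (half_gt0 e0).
exists [seq (x, y) | x <- s, y <- t] => _ [p p1 <-].
have [|x xs hx] := hs (f p.1); first by exists p.1 => //=; apply: le_trans (nm_pair1 p) p1.
have [|y yt hy] := ht (g p.2); first by exists p.2 => //=; apply: le_trans (nm_pair2 p) p1.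
exists (x, y); first by apply/allpairsP; exists (x, y).
by rewrite nm_pairE /=; lra.
Qed.

Lemma bx_dg z f g : bx z (dg f g) = dg (bx z f) (bx z g).
Proof.
apply: psum_uniq; first exact: ent_ec.
apply: tends_eq (dg_tends (psumP z (ent_ec f)) (psumP z (ent_ec g))) => n.
by rewrite -dg_sum; apply: eq_bigr => i _; rewrite /ec dgX !dgZ.
Qed.

Lemma bxN z f : bx z (- f) = bx (- z) f.
Proof. by rewrite -scaleN1r bxZ mulrN1. Qed.

(** The embedding of [M] as odd part: the bracket of two such operators has the form [dg d d]. *)
Definition hat f := dg f (- f).

Lemma gx_hat z (l : seq (bop V)) : gx z (map hat l) = dg (gx z l) (gx (- z) l).
Proof. by elim: l => [|f l IH] /=; rewrite ?dg1 // IH bx_dg bxN dgM. Qed.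

Lemma is_fun_fst (phi : V * V -> R[i]) : is_fun phi -> is_fun (fun x => phi (x, 0)).
Proof.
move=> [h1 [C hC]]; split=> [a x y|].
  rewrite -h1; congr phi.
  by change ((a *: x + y, 0) = (a *: x + y, a *: (0 : V) + 0)); rewrite scaler0 addr0.
by exists C => x; apply: le_trans (hC _) _; rewrite nm_pairE /= nm0 addr0.
Qed.

Lemma is_fun_snd (phi : V * V -> R[i]) : is_fun phi -> is_fun (fun x => phi (0, x)).
Proof.
move=> [h1 [C hC]]; split=> [a x y|].
  rewrite -h1; congr phi.
  by change ((0, a *: x + y) = (a *: (0 : V) + 0, a *: x + y)); rewrite scaler0 addr0.
by exists C => x; apply: le_trans (hC _) _; rewrite nm_pairE /= nm0 add0r.
Qed.

Lemma sum_fst (I : finType) (F : I -> V * V) : (\sum_i F i).1 = \sum_i (F i).1.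
Proof. by elim/big_rec2: _ => // i x y _ <-. Qed.
Lemma sum_snd (I : finType) (F : I -> V * V) : (\sum_i F i).2 = \sum_i (F i).2.
Proof. by elim/big_rec2: _ => // i x y _ <-. Qed.

Lemma fr_dgP f g : fr (dg f g) -> fr f /\ fr g.
Proof.
move=> [n [e [phi [h1 h2]]]]; split.
  exists n, (fun i => (e i).1), (fun i x => phi i (x, 0)); split=> [i|x]; first exact: is_fun_fst.
  by have := congr1 fst (h2 (x, 0)); rewrite sum_fst.
exists n, (fun i => (e i).2), (fun i x => phi i (0, x)); split=> [i|x]; first exact: is_fun_snd.
by have := congr1 snd (h2 (0, x)); rewrite sum_snd.
Qed.

Lemma ftr_dg f g : fr f -> fr g -> fr (dg f g) /\ ftr (dg f g) = ftr f + ftr g.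
Proof.
move=> [m [e [phi hf]]] [n [e' [phi' hg]]].
have h1 : frep (fun i => (e i, 0 : V)) (fun i (p : V * V) => phi i p.1) (dg f 0).
  split=> [i|p]; last first.
    rewrite dgE hf.2 [RHS]surjective_pairing sum_fst sum_snd /=.
    by congr pair; rewrite big1 // => i _; rewrite scaler0.
  have [h [C hC]] := hf.1 i; split=> [a x y|]; first by rewrite -h.
  exists `|C| => x; apply: le_trans (hC _) _.
  apply: le_trans (_ : `|C| * nm x.1 <= _); first by rewrite ler_wpM2r ?nm_ge0 ?ler_norm.
  by rewrite ler_wpM2l // nm_pair1.
have h2 : frep (fun i => (0 : V, e' i)) (fun i (p : V * V) => phi' i p.2) (dg 0 g).
  split=> [i|p]; last first.
    rewrite dgE hg.2 [RHS]surjective_pairing sum_fst sum_snd /=.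
    by congr pair; rewrite big1 // => i _; rewrite scaler0.
  have [h [C hC]] := hg.1 i; split=> [a x y|]; first by rewrite -h.
  exists `|C| => x; apply: le_trans (hC _) _.
  apply: le_trans (_ : `|C| * nm x.2 <= _); first by rewrite ler_wpM2r ?nm_ge0 ?ler_norm.
  by rewrite ler_wpM2l // nm_pair2.
have f1 : fr (dg f 0) by exists m; do 2!eexists; exact: h1.
have f2 : fr (dg 0 g) by exists n; do 2!eexists; exact: h2.
have <- : dg f 0 + dg 0 g = dg f g by rewrite dgD addr0 add0r.
split; first exact: frD.
by rewrite ftrD // (ftrE h1) (ftrE h2) (ftrE hf) (ftrE hg).
Qed.

End ProductSpace.

(** * Brackets, and the trace form on the enveloping Lie algebra *)

Section Brackets.
Context {R : realType} {V : banType R}.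
Implicit Types (a b c d e f g x y : bop V) (z : R[i]) (L M X Y Z : set (bop V)).

Definition br a b := a * b - b * a.

Lemma brDl a b c : br (a + b) c = br a c + br b c.
Proof. by rewrite /br mulrDl mulrDr; zmod. Qed.

Lemma brZl z a b : br (z *: a) b = z *: br a b.
Proof. by rewrite /br (bscalAl z) (bscalAr z) scalerBr. Qed.

Lemma brNr a b : br a (- b) = - br a b.
Proof. by rewrite /br mulNr mulrN; zmod. Qed.
Lemma br0l a : br 0 a = 0.
Proof. by rewrite /br mul0r mulr0 subrr. Qed.

Lemma brC a b : br a b = - br b a.
Proof. by rewrite /br opprB. Qed.
Lemma br_jacobi a b c : br (br a b) c = br (br a c) b + br a (br b c).
Proof. by rewrite /br !mulrBl !mulrBr !mulrA; zmod. Qed.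

Lemma br_clos X Y Z : (forall x y, X x -> Y y -> Z (br x y)) ->
  forall x y, clos X x -> clos Y y -> clos Z (br x y).
Proof.
move=> h x y /clos_seq[u Xu hu] /clos_seq[v Yv hv].
apply: (@seq_clos _ _ _ (fun n => br (u n) (v n))); first by move=> n; exact: h.
by apply: tendsB; exact: tendsM.
Qed.

Definition lie L := subsp L /\ forall a b, L a -> L b -> L (br a b).

Lemma gx_conj L z l : csub L -> lie L -> (forall a, a \in l -> L a) ->
  forall y, L y -> L (gx (- z) (rev l) * y * gx z l).
Proof.
move=> cL [sL bL]; elim: l => [|a l IH] Ll y Ly; first by rewrite /= mulr1 mul1r.
have La : L a by apply: Ll; rewrite mem_head.
have h := bx_conj z cL (fun x Lx => bL x a Lx La) Ly.
have Ll' b : b \in l -> L b by move=> bl; apply: Ll; rewrite inE bl orbT.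
have e1 : gx (- z) (rev (a :: l)) = gx (- z) (rev l) * bx (- z) a.
  by rewrite rev_cons -cats1 gx_cat; congr (_ * _); apply: mulr1.
have e2 : gx z (a :: l) = bx z a * gx z l by [].
by have := IH Ll' _ h; rewrite e1 e2 !mulrA.
Qed.

Lemma gx_conjV L z l : csub L -> lie L -> (forall a, a \in l -> L a) ->
  forall y, L y -> L (gx z l * y * gx (- z) (rev l)).
Proof.
move=> cL lL Ll y Ly; have := @gx_conj L (- z) (rev l) cL lL _ y Ly.
by rewrite opprK revK; apply=> a; rewrite mem_rev; exact: Ll.
Qed.

Definition comms M : set (bop V) := spn [set f | exists a b, [/\ M a, M b & f = br a b]].

Lemma comms_br M a b : M a -> M b -> comms M (br a b).
Proof. by move=> Ma Mb W sW hW; apply: hW; exists a, b. Qed.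

Lemma comms_min M W : subsp W -> (forall a b, M a -> M b -> W (br a b)) -> comms M `<=` W.
Proof. by move=> sW h d; apply=> // _ [a [b [Ma Mb ->]]]; exact: h. Qed.

Variable M : set (bop V).
Hypotheses (lM : lts M) (vM : volt M).

Lemma comms_M d a : comms M d -> M a -> M (br d a).
Proof.
move=> Dd Ma; suff : comms M `<=` [set d | M (br d a)] by apply.
apply: comms_min => [|b c Mb Mc] /=.
  split=> [|z x y /= hx hy]; first by rewrite /= br0l; exact: lM.1.1.
  by rewrite brDl brZl; apply: lM.1.2.
by rewrite brC; apply: subspN lM.1 _; exact: lM.2.
Qed.

Lemma comms_comms d e : comms M d -> comms M e -> comms M (br d e).
Proof.
move=> Dd De; suff : comms M `<=` [set d | comms M (br d e)] by apply.
apply: comms_min => [|b c Mb Mc] /=.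
  split=> [|z x y /= hx hy]; first by rewrite /= br0l; exact: (spn_subsp _).1.
  by rewrite brDl brZl; apply: (spn_subsp _).2.
have h x : M x -> M (br x e) by rewrite brC => Mx; apply: subspN lM.1 _; exact: comms_M.
rewrite br_jacobi; apply: (subspD (spn_subsp _)); apply: comms_br => //; exact: h.
Qed.

Let Mc := clos M.
Let Dc := clos (comms M).

(* [f - g] and [f + g] are twice the odd and the even part of [dg f g]. *)
Definition lhat : set (bop (V * V)%type) :=
  [set T | exists f g, [/\ Mc (f - g), Dc (f + g) & T = dg f g]].

Let sMc : subsp Mc. Proof. exact: clos_subsp lM.1. Qed.
Let sDc : subsp Dc. Proof. exact: clos_subsp (spn_subsp _). Qed.

Lemma lhat_csub : csub lhat.
Proof.
have sL : subsp lhat.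
  split=> [|z _ _ [f [g [h1 h2 ->]]] [f' [g' [h1' h2' ->]]]].
    by exists 0, 0; split; rewrite ?subrr ?addr0 ?dg0 //; [exact: sMc.1|exact: sDc.1].
  exists (z *: f + f'), (z *: g + g'); split; last by rewrite dgZ dgD.
    have -> : z *: f + f' - (z *: g + g') = z *: (f - g) + (f' - g') by rewrite scalerBr; zmod.
    exact: sMc.2.
  have -> : z *: f + f' + (z *: g + g') = z *: (f + g) + (f' + g') by rewrite scalerDr; zmod.
  exact: sDc.2.
split=> // T /clos_seq[u Lu hu].
have [v hv] := choice Lu; have [w hw] := choice hv.
have uE n : u n = dg (v n) (w n) by have [] := hw n.
have cu := tends_cauchys hu.
have [f hf] : exists f, tends v f.
  apply: cauchys_tends => e e0; have [N hN] := cu e e0; exists N => m n Nm Nn.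
  apply: le_lt_trans (hN m n Nm Nn); rewrite !uE dgB; exact: nm_dg1.
have [g hg] : exists g, tends w g.
  apply: cauchys_tends => e e0; have [N hN] := cu e e0; exists N => m n Nm Nn.
  apply: le_lt_trans (hN m n Nm Nn); rewrite !uE dgB; exact: nm_dg2.
exists f, g; split.
- apply: closK; apply: (@seq_clos _ _ _ (fun n => v n - w n)); last exact: tendsB.
  by move=> n; have [] := hw n.
- apply: closK; apply: (@seq_clos _ _ _ (fun n => v n + w n)); last exact: tendsD.
  by move=> n; have [] := hw n.
by apply: tends_uniq hu _; apply: tends_eq (dg_tends hf hg) => n; rewrite uE.
Qed.

Let br_DM d a : Dc d -> Mc a -> Mc (br d a).
Proof. by apply: br_clos => *; exact: comms_M. Qed.
Let br_MM a b : Mc a -> Mc b -> Dc (br a b).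
Proof. by apply: br_clos => *; exact: comms_br. Qed.
Let br_DD a b : Dc a -> Dc b -> Dc (br a b).
Proof. by apply: br_clos => *; exact: comms_comms. Qed.

Lemma half_twice (W : set (bop V)) f : subsp W -> W (f + f) -> W f.
Proof.
move=> sW h; have -> : f = (2^-1 : R[i]) *: (f + f); last exact: (subspZ _ sW).
by rewrite -mulr2n -[f *+ 2](scaler_nat 2 f) scalerA mulVf ?scale1r // pnatr_eq0.
Qed.

Lemma br_dg f g f' g' : dg f g * dg f' g' - dg f' g' * dg f g = dg (br f f') (br g g').
Proof. by rewrite !dgM dgB. Qed.

(** The odd part of a bracket pairs even with odd parts; its even part pairs odd with odd and even
    with even. *)
Lemma lhat_lie : subsp lhat /\ forall S T, lhat S -> lhat T -> lhat (S * T - T * S).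
Proof.
split; first exact: lhat_csub.1.
move=> _ _ [f [g [h1 h2 ->]]] [f' [g' [h1' h2' ->]]]; rewrite br_dg.
exists (br f f'), (br g g'); split=> //.
  apply: (half_twice sMc).
  have -> : br f f' - br g g' + (br f f' - br g g') = br (f + g) (f' - g') - br (f' + g') (f - g).
    by rewrite /br !(mulrDl, mulrDr, mulrBl, mulrBr) ?mulrN ?mulNr; zmod.
  by apply: (subspB sMc); exact: br_DM.
apply: (half_twice sDc).
have -> : br f f' + br g g' + (br f f' + br g g') = br (f - g) (f' - g') + br (f + g) (f' + g').
  by rewrite /br !(mulrDl, mulrDr, mulrBl, mulrBr) ?mulrN ?mulNr; zmod.
by apply: (subspD sDc); [exact: br_MM|exact: br_DD].
Qed.

Lemma lhat_hat a : M a -> lhat (hat a).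
Proof.
move=> Ma; exists a, (- a); split=> //; last by rewrite subrr; exact: sDc.1.
by rewrite opprK; apply: (subspD sMc); exact: sub_clos.
Qed.

Lemma clos_volt a : Mc a -> kop a /\ qn a.
Proof.
move=> ha; have ka : kop a.
  by apply: kop_near => e /ha[y My h]; exists y; [exact: (vM My).1 | rewrite nmC].
split=> //; apply: kop_lim_qn => // e /ha[y My h].
by exists y; [exact: (vM My).2 | rewrite nmC].
Qed.

(** All combinations [s b + t a] are quasinilpotent, so the pencil of [ftr_pencil] is invertible. *)
Lemma ftr_MM a b : Mc a -> fr a -> Mc b -> ftr (a * b) = 0.
Proof.
move=> Ma fa Mb; apply: ftr_pencil => // s t.
have h : Mc (s *: b + t *: a) by apply: sMc.2 => //; exact: (subspZ _ sMc).
have := qn_invb (clos_volt h).2 (oner_neq0 _); rewrite scale1r.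
by have -> : 1 - (s *: b + t *: a) = 1 - s *: b - t *: a by zmod.
Qed.

(** For [e = [b, c]] invariance of the trace gives [tr (d [b, c]) = tr ([d, b] c)], where [[d, b]]
    is a finite-rank element of the closure of [M]; linearity and continuity in [e] do the rest. *)
Lemma ftr_DD d e : Dc d -> fr d -> Dc e -> ftr (d * e) = 0.
Proof.
move=> Dd fd; apply: (@clos_spn_min _ _ _ [set e | ftr (d * e) = 0]).
  have [C C0 hC] := ftr_lip fd.
  split=> [|x hx /=].
    split=> [|z x y /= hx hy]; first by rewrite /= mulr0 ftr0.
    rewrite mulrDr (bscalAr z) ftrD ?ftrZ ?hx ?hy ?mulr0 ?addr0 //; try exact: frMr.
    by apply: frZ; exact: frMr.
  apply/eqP; rewrite -cabs_eq0; apply/eqP/le_anti; rewrite cabs_ge0 andbT.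
  apply/ler_addgt0Pr => r r0; rewrite add0r.
  have [y /= hy xy] := hx (r / (C + 1)) (divr_gt0 r0 (ltr_wpDl C0 ltr01)).
  have -> : d * x = d * y + d * (x - y) by rewrite -mulrDr addrC subrK.
  rewrite ftrD ?hy ?add0r; try exact: frMr.
  apply: le_trans (hC _) _; rewrite ltr_pdivlMr ?ltr_wpDl // in xy.
  by have := nm_ge0 (x - y); lra.
move=> _ [b [c [Mb Mc' ->]]] /=.
have -> : ftr (d * br b c) = ftr (br d b * c).
  rewrite /br mulrBr mulrBl !mulrA ftrB; try (do 2?apply: frMr; exact: fd).
  rewrite ftrB; last first.
  - by apply: frMr; exact: frMl.
  - by do 2!apply: frMr.
  by congr (_ - _); rewrite ftrC; [rewrite mulrA|exact: frMr].
apply: ftr_MM; [apply: br_DM => //; exact: sub_clos| |exact: sub_clos].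
by apply: frB; [exact: frMr|exact: frMl].
Qed.

(** Twice [f f' + g g'] is the sum of the odd-odd and the even-even product; the mixed products
    cancel between the coordinates. *)
Lemma lhat_ftr S T : lhat S -> fr S -> lhat T -> ftr (S * T) = 0.
Proof.
move=> [f [g [h1 h2 ->]]] /fr_dgP[ff fg] [f' [g' [h1' h2' ->]]].
rewrite dgM; have [_ ->] := ftr_dg (frMr f' ff) (frMr g' fg).
have e1 := ftr_MM h1 (frB ff fg) h1'; have e2 := ftr_DD h2 (frD ff fg) h2'.
have : ftr ((f - g) * (f' - g') + (f + g) * (f' + g')) = 0.
  by rewrite ftrD ?e1 ?e2 ?addr0 //; apply: frMr; [exact: frB|exact: frD].
have -> : (f - g) * (f' - g') + (f + g) * (f' + g') = f * f' + g * g' + (f * f' + g * g').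
  by rewrite !(mulrDl, mulrDr, mulrBl, mulrBr) ?mulrN ?mulNr; zmod.
have f1 : fr (f * f' + g * g') by apply: frD; exact: frMr.
rewrite ftrD // ftrD; try exact: frMr.
by move=> /eqP; rewrite -mulr2n mulrn_eq0 /= => /eqP.
Qed.

End Brackets.

(** * Cartan's criterion *)

Section PrimaryDecomposition.
Context {R : realType} {U : banType R}.
Implicit Types (D A B T : bop U) (h f g u : U) (z w : R[i]) (W : set U) (K : nat).

Definition shf D z : bop U := D - z *: (1 : bop U).

Lemma shfE D z h : shf D z h = D h - z *: h. Proof. by []. Qed.

Lemma shf_comm D z w : GRing.comm (shf D z) (shf D w).
Proof.
apply: commrB; last by apply: commr_sym; exact: comm_scal1.
by apply: commr_sym; apply: commrB; [exact: commr_refl | apply: commr_sym; exact: comm_scal1].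
Qed.

Lemma powS_app T K h : (T ^+ K.+1) h = (T ^+ K) (T h).
Proof. by rewrite exprSr. Qed.
Lemma powS_app' T K h : (T ^+ K.+1) h = T ((T ^+ K) h).
Proof. by rewrite exprS. Qed.

Lemma pow_kill T K K' h : (K <= K')%N -> (T ^+ K) h = 0 -> (T ^+ K') h = 0.
Proof.
by move=> /subnK<- hK; rewrite exprD; change ((T ^+ (K' - K)) ((T ^+ K) h) = 0); rewrite hK bop0.
Qed.

(** The generalised eigenspace of [D] for the value [z]. *)
Definition gk D z h := exists K, (shf D z ^+ K) h = 0.

Definition stable D W := subsp W /\ forall h, W h -> W (D h).

Lemma stable_shf D W z h : stable D W -> W h -> W (shf D z h).
Proof. by move=> [sW hW] Wh; apply: (subspB sW); [exact: hW|exact: (subspZ _ sW)]. Qed.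

(** On the generalised eigenspace for [z], the operator [D - w] is the nonzero scalar [z - w] plus a
    nilpotent one. Its inverse is a polynomial in [D], so the solution stays in every stable
    subspace. *)
Lemma gk_solve D z w g : gk D z g -> z != w -> exists u, [/\ shf D w u = g, gk D z u &
  forall W, stable D W -> W g -> W u].
Proof.
move=> [K]; elim: K g => [|K IH] g gK zw.
  exists 0; have -> : g = 0 by [].
  by split; [exact: bop0|exists 0%N; exact: bop0|move=> W [[]]].
rewrite powS_app in gK; have [u' [h1 [K' hK'] h3]] := IH _ gK zw.
have c0 : z - w != 0 by rewrite subr_eq0.
exists ((z - w)^-1 *: (g - u')); split.
- rewrite bopZ bopB h1.
  have -> : shf D w g - shf D z g = (z - w) *: g by rewrite !shfE scalerBl; zmod.
  by rewrite scalerA mulVf // scale1r.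
- exists (maxn K.+1 K'); rewrite bopZ bopB.
  rewrite (pow_kill (leq_maxl K.+1 K')) ?powS_app // (pow_kill (leq_maxr K.+1 K') hK').
  by rewrite subr0 scaler0.
move=> W sW Wg; apply: (subspZ _ sW.1); apply: (subspB sW.1) => //; apply: (h3 W sW).
exact: stable_shf.
Qed.

Lemma gk_disjoint D z w h : gk D z h -> gk D w h -> z != w -> h = 0.
Proof.
move=> hz [K]; elim: K h hz => [|K IH] h hz; first by rewrite expr0.
rewrite powS_app => hK zw.
have [Kz hKz] := hz.
have h0 : shf D w h = 0.
  apply: IH => //; exists Kz.
  have c : GRing.comm (shf D z ^+ Kz) (shf D w) by apply: commr_sym; apply: commrX; exact: shf_comm.
  by change ((shf D z ^+ Kz * shf D w) h = 0); rewrite c; change (shf D w ((shf D z ^+ Kz) h) = 0); rewrite hKz bop0.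
elim: Kz hKz => [//|Kz IHz]; rewrite powS_app => hKz; apply: IHz.
have e : shf D z h = (w - z) *: h.
  have : shf D w h - shf D z h = - ((w - z) *: h) by rewrite !shfE scalerBl; zmod.
  by rewrite h0 add0r => /oppr_inj.
move: hKz; rewrite e bopZ => /eqP; rewrite scaler_eq0 subr_eq0 eq_sym (negPf zw) /= => /eqP //.
Qed.

Definition kl D (s : seq R[i]) : bop U := foldr (fun z T => shf D z * T) 1 s.

Lemma kl_comm D s z : GRing.comm (shf D z) (kl D s).
Proof.
elim: s => [|w s IH] /=; first exact: commr1.
by apply: commrM => //; exact: shf_comm.
Qed.

Lemma primary_decomposition D s f : kl D s f = 0 -> exists l : seq (R[i] * U),
  f = \sum_(p <- l) p.2 /\ forall p, p \in l -> gk D p.1 p.2 /\ forall W, stable D W -> W f -> W p.2.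
Proof.
elim: s f => [|z s IH] f /=; first by move=> f0; exists [::]; rewrite big_nil.
move=> hf0; have hf : kl D s (shf D z f) = 0.
  by rewrite -[RHS]hf0; exact: esym (congr1 (fun T : bop U => T f) (kl_comm D s z)).
have [l [gE hl]] := IH _ hf.
set g := shf D z f in gE hl.
have hu p : exists u, p \in l -> p.1 != z -> [/\ shf D z u = p.2, gk D p.1 u &
    forall W, stable D W -> W p.2 -> W u].
  have [pl|pl] := boolP (p \in l); last by exists 0.
  have [pz|pz] := eqVneq p.1 z; first by exists 0.
  by have [u hu] := gk_solve (hl p pl).1 pz; exists u.
have [u {}hu] := choice hu.
(* Solving for the components with values other than [z] leaves a remainder that [D - z] maps to the
   components for [z]. *)
pose r := f - \sum_(p <- l | p.1 != z) u p.
exists ((z, r) :: [seq (p.1, u p) | p <- l & p.1 != z]); split.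
  by rewrite big_cons big_map big_filter subrK.
have rz : shf D z r = \sum_(p <- l | p.1 == z) p.2.
  rewrite (bopB (shf D z)) -/g (bop_sum (shf D z)) gE (bigID (fun p : R[i] * U => p.1 == z)).
  rewrite -[LHS]addrA -[RHS]addr0; congr (_ + _); apply/eqP; rewrite subr_eq0; apply/eqP.
  rewrite big_seq_cond [RHS]big_seq_cond; apply: eq_bigr => p /andP[pl pz].
  by have [-> _ _] := hu p pl pz.
have us W p : stable D W -> W f -> p \in l -> p.1 != z -> W (u p).
  move=> sW Wf pl pz; have [_ _ h] := hu p pl pz; apply: h => //; apply: (hl p pl).2 => //.
  exact: stable_shf.
move=> p; rewrite inE => /predU1P[->|/mapP[q]]; last first.
  rewrite mem_filter => /andP[qz ql] -> /=; split; first by have [] := hu q ql qz.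
  by move=> W sW Wf; exact: us.
split=> [|W sW Wf] /=; last first.
  rewrite /r big_seq_cond; apply: (subspB sW.1) => //; apply: (subsp_sum _ sW.1) => q /andP[ql qz].
  exact: us.
have [K hK] : exists K, forall p, p \in l -> p.1 == z -> (shf D z ^+ K) p.2 = 0.
  have : forall p, p \in l -> gk D p.1 p.2 by move=> q /hl[].
  elim: (l) => [|q t IHt] ht; first by exists 0%N.
  have [|K hK] := IHt; first by move=> q' h; apply: ht; rewrite inE h orbT.
  have [K' hK'] := ht q (mem_head _ _).
  exists (maxn K K') => q'; rewrite inE => /predU1P[-> /eqP qz|qt qz].
    by apply: (pow_kill (leq_maxr K K')); rewrite -qz.
  by apply: (pow_kill (leq_maxl K K')); exact: hK.
exists K.+1; rewrite powS_app rz (bop_sum (shf D z ^+ K)) big_seq_cond big1 // => q /andP[ql qz]; exact: hK.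
Qed.

(** A power of [D - w] kills the component for [w]; by induction the other components, after that
    power, lie in [W], and [gk_solve] undoes the power inside [W]. *)
Lemma component_sum D W (s : seq R[i]) (h : R[i] -> U) : stable D W -> uniq s ->
  (forall z, gk D z (h z)) -> W (\sum_(z <- s) h z) -> forall z, z \in s -> W (h z).
Proof.
move=> sW; elim: s h => [//|w s IH] h /= /andP[ws us] hh Wh.
have [K hK] := hh w.
have Wh' : W (\sum_(z <- s) (shf D w ^+ K) (h z)).
  have : W ((shf D w ^+ K) (\sum_(z <- w :: s) h z)).
    elim: (K) => [//|k]; rewrite powS_app'; exact: stable_shf.
  by rewrite bop_sum big_cons hK add0r.
have hz z : z \in s -> W (h z).
  move=> zs; have zw : z != w by apply: contraNneq ws => <-.
  have := IH (fun z => (shf D w ^+ K) (h z)) us _ Wh' z zs.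
  have h1 z' : gk D z' ((shf D w ^+ K) (h z')).
    have [k hk] := hh z'; exists k.
    have c : GRing.comm (shf D z' ^+ k) (shf D w ^+ K).
      by apply: commrX; apply: commr_sym; apply: commrX; exact: shf_comm.
    by change ((shf D z' ^+ k * shf D w ^+ K) (h z') = 0); rewrite c; change ((shf D w ^+ K) ((shf D z' ^+ k) (h z')) = 0); rewrite hk bop0.
  move=> /(_ h1); have [k hk] := hh z.
  elim: (K) (h z) (hh z) => [//|K' IHK] y yz; rewrite powS_app => /IHK hy.
  have gy : gk D z (shf D w y).
    have [k' hk'] := yz; exists k'; have c : GRing.comm (shf D z ^+ k') (shf D w).
      by apply: commr_sym; apply: commrX; exact: shf_comm.
    by change ((shf D z ^+ k' * shf D w) y = 0); rewrite c; change (shf D w ((shf D z ^+ k') y) = 0); rewrite hk' bop0.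
  have [u [h2 h3 h4]] := gk_solve gy zw.
  have -> : y = u; last by apply: h4 => //; exact: hy.
  apply/eqP; rewrite -subr_eq0; apply/eqP; apply: (@gk_disjoint D z w) => //.
    have [k1 e1] := yz; have [k2 e2] := h3; exists (maxn k1 k2).
    by rewrite bopB (pow_kill (leq_maxl k1 k2) e1) (pow_kill (leq_maxr k1 k2) e2) subrr.
  by exists 1%N; rewrite expr1 bopB h2 subrr.
move=> z; rewrite inE => /predU1P[->|]; last exact: hz.
have -> : h w = \sum_(z <- w :: s) h z - \sum_(z <- s) h z by rewrite big_cons addrK.
by apply: (subspB sW.1) => //; rewrite big_seq; apply: (subsp_sum _ sW.1).
Qed.

(** Used for [ad x] with [t] complex conjugation. A weight may occur several times in [l], so the
    components are first grouped by weight. *)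
Lemma component_weights D W (l : seq (R[i] * U)) (t : R[i] -> R[i]) : stable D W ->
  (forall p, p \in l -> gk D p.1 p.2) -> W (\sum_(p <- l) p.2) -> W (\sum_(p <- l) t p.1 *: p.2).
Proof.
move=> sW hl Wl; pose s := undup [seq p.1 | p <- l].
pose h z := \sum_(p <- l | p.1 == z) p.2.
have part (F : R[i] * U -> U) : \sum_(p <- l) F p = \sum_(z <- s) \sum_(p <- l | p.1 == z) F p.
  rewrite (exchange_big_dep xpredT) //=; apply: eq_big_seq => p pl; rewrite -big_filter.
  have -> : [seq z <- s | p.1 == z] = [:: p.1]; last by rewrite big_seq1.
  rewrite (eq_filter (a2 := pred1 p.1)); last by move=> z; rewrite /= eq_sym.
  by apply: filter_pred1_uniq; rewrite ?undup_uniq // mem_undup map_f.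
have hh z : gk D z (h z).
  rewrite /h; elim: (l) hl => [|q r IH] hl; first by exists 0%N; rewrite big_nil bop0.
  have [|K hK] := IH; first by move=> p pr; apply: hl; rewrite inE pr orbT.
  rewrite big_cons; have [qz|_] := eqVneq q.1 z; last by exists K.
  have [K' hK'] := hl q (mem_head _ _); rewrite qz in hK'.
  by exists (maxn K K'); rewrite bopD (pow_kill (leq_maxl K K') hK) (pow_kill (leq_maxr K K') hK') addr0.
have Wz z : z \in s -> W (h z).
  by apply: (component_sum sW (undup_uniq _) hh); rewrite -part.
rewrite part big_seq; apply: (subsp_sum _ sW.1) => z zs.
have -> : \sum_(p <- l | p.1 == z) t p.1 *: p.2 = t z *: h z.
  by rewrite /h scaler_sumr; apply: eq_bigr => p /eqP->.
by apply: (subspZ _ sW.1); exact: Wz.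
Qed.

(** In each binomial term of degree [K + K'] one of the two powers is high enough. *)
Lemma gk_sub A B h : GRing.comm A B -> (exists K, (A ^+ K) h = 0) -> (exists K, (B ^+ K) h = 0) ->
  exists K, ((A - B) ^+ K) h = 0.
Proof.
move=> AB [K hK] [K' hK']; exists (K + K')%N.
have cN : GRing.comm A (- B) by apply: commrN.
rewrite exprDn_comm // bop_sumE big1 // => i _.
have e : (A ^+ (K + K' - i) * (- B) ^+ i) h = 0.
  have [Ki|Ki] := leqP K' i.
    change ((A ^+ (K + K' - i)) (((- B) ^+ i) h) = 0).
    rewrite exprNn; have -> : ((-1) ^+ i * B ^+ i) h = 0; last exact: bop0.
    by change (((-1) ^+ i : bop U) ((B ^+ i) h) = 0); rewrite (pow_kill Ki hK') bop0.
  have -> : A ^+ (K + K' - i) * (- B) ^+ i = (- B) ^+ i * A ^+ (K + K' - i).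
    by apply: commrX; apply: commr_sym; apply: commrX; exact: commr_sym.
  have Ki' : (K <= K + K' - i)%N by rewrite -addnBA ?leq_addr // ltnW.
  by change (((- B) ^+ i) ((A ^+ (K + K' - i)) h) = 0); rewrite (pow_kill Ki' hK) bop0.
by rewrite -scaler_nat; change ('C(K + K', i)%:R *: (A ^+ (K + K' - i) * (- B) ^+ i) h = 0); rewrite e scaler0.
Qed.

End PrimaryDecomposition.

(** * Nilpotence of the ideal by the trace form *)

Section CartanCriterion.
Context {R : realType} {V : banType R}.
Implicit Types (f g x y S T : bop V) (v : V) (z w a : R[i]) (L : set (bop V)).

Lemma comm_app f g v : GRing.comm f g -> f (g v) = g (f v).
Proof. by move=> h; change ((f * g) v = (g * f) v); rewrite h. Qed.

Lemma closed_matrix_kill n (A : 'M[R[i]]_n) : exists s : seq R[i],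
  foldr (fun z B => B *m (A - z%:M)) 1%:M s = 0.
Proof.
case: n A => [|n] A; first by exists [::]; exact: flatmx0.
have [s hs] := closed_field_poly_normal (char_poly A).
rewrite (monicP (char_poly_monic A)) scale1r in hs; exists s.
have -> : foldr (fun z B => B *m (A - z%:M)) 1%:M s = horner_mx A (\prod_(z <- s) ('X - z%:P)).
  elim: s {hs} => [|z s IH] /=; first by rewrite big_nil -polyC1 horner_mx_C.
  by rewrite big_cons mulrC rmorphM /= IH rmorphB /= horner_mx_X horner_mx_C.
by rewrite -hs Cayley_Hamilton.
Qed.

(** Cayley-Hamilton for the matrix of [f] kills the coordinates; the additional factor [f], for the
    value 0, turns this into a vanishing operator. *)
Lemma fr_kl f : fr f -> exists s, kl f s = 0.
Proof.
move=> [n [e [phi hf]]]; have [s hs] := closed_matrix_kill (frmx e phi).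
have rowE t v : \row_i phi i (kl f t v) =
    (\row_i phi i v) *m foldr (fun z B => B *m (frmx e phi - z%:M)) 1%:M t.
  elim: t v => [|z t IH] v; first by rewrite /= mulmx1.
  rewrite /= mulmxA -IH mulmxBr -(frep_row (kl f t v) hf) mul_mx_scalar.
  apply/rowP => i; rewrite !mxE.
  have -> : f (kl f t v) - z *: kl f t v = (- z) *: kl f t v + f (kl f t v) by rewrite scaleNr addrC.
  by rewrite (hf.1 i).1; ring.
exists (0 :: s); apply: bop_ext => v.
change (f (kl f s v) - 0 *: kl f s v = 0); rewrite scale0r subr0 hf.2 big1 // => i _.
have := rowE s v; rewrite hs mulmx0 => /rowP/(_ i).
rewrite !mxE => h0.
by rewrite h0 scale0r.
Qed.

Definition adj f : bop (bop V) := lmul f - rmul f.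

(** [ad x] is the difference of the left and right multiplications by [x], which commute; on [g] the
    right one acts as the left one because [x] and [g] commute. *)
Lemma gk_adj x f g z w : gk (lmul x) z f -> gk (lmul x) w g -> GRing.comm x g ->
  forall y, gk (adj x) (z - w) (f * y * g).
Proof.
move=> [K hK] [K' hK'] xg y.
pose A := shf (lmul x) z; pose B := shf (rmul x) w.
have e : shf (adj x) (z - w) = A - B.
  by apply: bop_ext => h; change (x * h - h * x - (z - w) *: h = x * h - z *: h - (h * x - w *: h)); rewrite scalerBl; zmod.
rewrite /gk e; apply: gk_sub.
- apply: bop_ext => h; change (x * (h * x - w *: h) - z *: (h * x - w *: h) = (x * h - z *: h) * x - w *: (x * h - z *: h)).
  rewrite mulrBr mulrBl (bscalAr w) (bscalAl z) !scalerBr !scalerA [w * z]mulrC mulrA; zmod.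
- exists K; have -> : (A ^+ K) (f * y * g) = (A ^+ K) f * y * g; last by rewrite hK !mul0r.
  elim: (K) => [//|k IH]; rewrite !powS_app' IH !shfE /= !mulrA mulrBl mulrBl.
  by rewrite (bscalAl z) (bscalAl z).
exists K'; have hB h k : (B ^+ k) (f * y * h) = f * y * (B ^+ k) h.
  elim: k => [//|k IH]; rewrite !powS_app' IH !shfE /= mulrBr (bscalAr w) !mulrA //.
have hg k : GRing.comm x ((shf (lmul x) w ^+ k) g) /\ (B ^+ k) g = (shf (lmul x) w ^+ k) g.
  elim: k => [//|k [c IH]]; rewrite !powS_app' IH.
  set h := (shf (lmul x) w ^+ k) g in c *.
  have e1 : B h = x * h - w *: h by change (h * x - w *: h = x * h - w *: h); rewrite c.
  have e2 : shf (lmul x) w h = x * h - w *: h by [].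
  rewrite e1 e2; split=> //; apply: commrB; first by apply: commrM => //; exact: commr_refl.
  by rewrite /GRing.comm (bscalAl w) (bscalAr w) c.
by rewrite hB (hg K').2 hK' mulr0.
Qed.

Variable L : set (bop V).
Hypotheses (lL : lie L) (tL : forall f y, L f -> fr f -> L y -> ftr (f * y) = 0).

Definition dideal : set (bop V) :=
  spn [set x | exists f y, [/\ L f, fr f, L y & x = br f y]].

Lemma dideal_min W : subsp W -> (forall f y, L f -> fr f -> L y -> W (br f y)) -> dideal `<=` W.
Proof. by move=> sW h d; apply=> // _ [f [y [Lf ff Ly ->]]]; exact: h. Qed.

Lemma dideal_L x : dideal x -> L x /\ fr x.
Proof.
apply: (dideal_min (W := [set x | L x /\ fr x])) => [|f y Lf ff Ly].
  split=> [|a y y' [h1 h2] [h3 h4]]; first by split; [exact: lL.1.1|exact: fr0].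
  by split; [exact: lL.1.2|apply: frD => //; exact: frZ].
by split; [exact: lL.2|apply: frB; [exact: frMr|exact: frMl]].
Qed.

(* With [1 = sum_p e_p] the primary decomposition of [x] and [S = sum_p conj(p) e_p],
   the trace of [S x] is the sum of the squared moduli of the eigenvalues of [x]. *)
Lemma dideal_no_eig x a v : dideal x -> a != 0 -> x v = a *: v -> v = 0.
Proof.
move=> Jx a0 xv; have [Lx fx] := dideal_L Jx; have [s hs] := fr_kl fx.
(* The vector 1 is decomposed under left multiplication by [x]; this gives components that commute
   with [x]. *)
have hs1 : kl (lmul x) s 1 = 0.
  have -> : kl (lmul x) s 1 = kl x s; last by [].
  elim: (s) => [//|z t IH] /=.
  by change (x * kl (lmul x) t 1 - z *: kl (lmul x) t 1 = (x - z *: (1 : bop V)) * kl x t); rewrite IH mulrBl (bscalAl z) mul1r.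
have [l [l1 hl]] := primary_decomposition hs1.
have ec p : p \in l -> GRing.comm x p.2.
  move=> pl; apply: ((hl p pl).2 [set y | GRing.comm x y]); last exact: commr1.
  split=> [|y /= xy]; last by apply: commrM => //; exact: commr_refl.
  split=> [|b y y' /= h h']; first exact: commr0.
  by apply: commrD => //; rewrite /GRing.comm (bscalAl b) (bscalAr b) h.
have gkv p u : p \in l -> gk x p.1 (p.2 u).
  move=> pl; have [K hK] := (hl p pl).1; exists K.
  have -> : (shf x p.1 ^+ K) (p.2 u) = (shf (lmul x) p.1 ^+ K) p.2 u; last by rewrite hK.
  by elim: (K) => [//|k IH]; rewrite !powS_app' IH.
have gkw p u c : c != p.1 -> p \in l -> x u = c *: u -> p.2 u = 0.
  move=> cp pl xu; apply: (gk_disjoint (gkv p u pl) _ (_ : p.1 != c)); last by rewrite eq_sym.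
  exists 1%N; rewrite expr1 shfE; have -> : x (p.2 u) = p.2 (x u).
    exact: (comm_app u (ec p pl)).
  by rewrite xu bopZ subrr.
pose S : bop V := \sum_(p <- l) Num.conj p.1 *: p.2.
have sumv u : \sum_(p <- l) p.2 u = u.
  by have := congr1 (fun T : bop V => T u) l1; rewrite /= bop_sumE => <-.
have SE u : S u = \sum_(p <- l) Num.conj p.1 *: p.2 u by rewrite bop_sumE.
have Sc c u : x u = c *: u -> S u = Num.conj c *: u.
  move=> xu; rewrite SE -[in RHS](sumv u) scaler_sumr big_seq [RHS]big_seq.
  apply: eq_bigr => p pl; have [->//|cp] := eqVneq c p.1.
  by rewrite (gkw p u c) // !scaler0.
(* Under [ad x] the pieces [e_p f e_q] have weights [p - q], and conjugating the weights yields
   [[S, f]]. So [ad S] preserves [L] although [S] need not belong to it. *)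
have SL f : L f -> L (br S f).
  move=> Lf; pose F : seq (R[i] * bop V) := [seq (p.1 - q.1, p.2 * f * q.2) | p <- l, q <- l].
  have st : stable (adj x) L by split=> [|h Lh]; [exact: lL.1|exact: lL.2].
  have := @component_weights _ _ (adj x) L F Num.conj st.
  have -> : \sum_(p <- F) p.2 = f.
    rewrite /F big_allpairs_dep /=; transitivity ((\sum_(p <- l) p.2) * f * (\sum_(q <- l) q.2)).
      by rewrite mulr_suml mulr_suml; apply: eq_bigr => p _; rewrite mulr_sumr.
    by rewrite -l1 mul1r mulr1.
  have -> : \sum_(p <- F) Num.conj p.1 *: p.2 = br S f.
    rewrite /F big_allpairs_dep /=.
    transitivity (\sum_(p <- l) \sum_(q <- l) (Num.conj p.1 *: p.2 * f * q.2 - p.2 * f * (Num.conj q.1 *: q.2))).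
      apply: eq_bigr => p _; apply: eq_bigr => q _.
      by rewrite rmorphB scalerBl (bscalAr (Num.conj q.1)) !(bscalAl (Num.conj p.1)).
    rewrite (eq_bigr (fun p : R[i] * bop V => Num.conj p.1 *: p.2 * f - p.2 * f * S)); last first.
      by move=> p _; rewrite sumrB -!mulr_sumr -l1 mulr1.
    by rewrite sumrB -!mulr_suml -l1 mul1r.
  apply=> // _ /allpairsP[[p q] /= [pl ql ->]] /=.
  by apply: gk_adj (hl p pl).1 (hl q ql).1 (ec q ql) f.
have fSx : fr (S * x) by exact: frMl.
(* On generators [tr (S [f, y]) = tr ([S, f] y)], which vanishes because [[S, f]] is a finite-rank
   element of [L]. *)
have tr0 : ftr (S * x) = 0.
  have h : dideal `<=` [set y | fr y /\ ftr (S * y) = 0].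
    apply: dideal_min => [|f y Lf ff Ly].
      split=> [|b y y' [h1 h2] [h3 h4]]; first by split; [exact: fr0|rewrite mulr0 ftr0].
      split; first by apply: frD => //; exact: frZ.
      rewrite mulrDr (bscalAr b) ftrD ?ftrZ ?h2 ?h4 ?mulr0 ?addr0 //; try exact: frMl.
      by apply: frZ; exact: frMl.
    split; first by apply: frB; [exact: frMr|exact: frMl].
    have f1 : fr (S * f) by exact: frMl.
    have f2 : fr (f * S) by exact: frMr.
    rewrite /br mulrBr ftrB; last 2 first.
    - by rewrite mulrA; exact: frMr.
    - by do 2!apply: frMl.
    have -> : ftr (S * (y * f)) = ftr (f * S * y) by rewrite mulrA -ftrC // mulrA.
    rewrite mulrA -ftrB; [|exact: frMr|exact: frMr].
    rewrite -mulrBl; apply: tL => //; [exact: SL|exact: frB].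
  by have [] := h x Jx.
have [n [c [c1 c2 c3]]] := ftr_pow fSx.
(* An eigenvector of [S x] has a nonzero component under some [e_p], and there the eigenvalue is [p]
   times its conjugate. *)
have cge i : 0 <= c i.
  have [->//|ci0] := eqVneq (c i) 0.
  have [u u0 hu] := c2 i ci0.
  have [p pl pu] : exists2 p, p \in l & p.2 u != 0.
    apply: contrapT => h; case/eqP: u0; rewrite -(sumv u) big_seq big1 // => p pl.
    by apply: contrapT => /eqP h'; apply: h; exists p.
  pose q := Num.conj p.1.
  have e1 : S (x (p.2 u)) = q *: x (p.2 u).
    rewrite SE /q -[X in _ = _ *: X](sumv (x (p.2 u))) scaler_sumr big_seq [RHS]big_seq; apply: eq_bigr => r rl.
    have [->//|rp] := eqVneq r.1 p.1.
    have -> : r.2 (x (p.2 u)) = 0; last by rewrite !scaler0.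
    apply: (gk_disjoint (gkv r (x (p.2 u)) rl) _ rp).
    have [K hK] := gkv p u pl; exists K.
    have cK : GRing.comm (shf x p.1 ^+ K) x.
      apply: commr_sym; apply: commrX; apply: commrB; first exact: commr_refl.
      by apply: commr_sym; exact: comm_scal1.
    have cR : GRing.comm (shf x p.1 ^+ K) r.2.
      apply: commr_sym; apply: commrX; apply: commrB; first by apply: commr_sym; exact: ec.
      by apply: commr_sym; exact: comm_scal1.
    change ((shf x p.1 ^+ K * (r.2 * x)) (p.2 u) = 0).
    by rewrite mulrA cR -mulrA cK; change (r.2 (x ((shf x p.1 ^+ K) (p.2 u))) = 0); rewrite hK !bop0.
  have cp : GRing.comm S p.2.
    rewrite /S /GRing.comm mulr_suml mulr_sumr; apply: eq_big_seq => r rl.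
    rewrite (bscalAl (Num.conj r.1)) (bscalAr (Num.conj r.1)); congr (_ *: _).
    apply: ((hl r rl).2 [set y | y * p.2 = p.2 * y]); last by rewrite /= mul1r mulr1.
    split=> [|y /= xy]; last by rewrite -mulrA xy !mulrA (ec p pl).
    split=> [|b y y' /= h h']; first by rewrite /= mul0r mulr0.
    by rewrite mulrDl mulrDr (bscalAl b) (bscalAr b) h h'.
  have e2 : S (x (p.2 u)) = c i *: p.2 u.
    have -> : x (p.2 u) = p.2 (x u) by exact: (comm_app u (ec p pl)).
    have -> : S (p.2 (x u)) = p.2 (S (x u)) by exact: (comm_app (x u) cp).
    by have -> : S (x u) = c i *: u by []; rewrite bopZ.
  have q0 : q != 0.
    apply/eqP => q0; move: e2; rewrite e1 q0 scale0r => /esym/eqP.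
    by rewrite scaler_eq0 (negPf ci0) (negPf pu).
  have e3 : x (p.2 u) = (c i / q) *: p.2 u.
    by rewrite mulrC -scalerA -e2 e1 scalerA mulVf // scale1r.
  have e4 : c i / q = p.1.
    apply/eqP; apply: contraT => ne; case/eqP: pu.
    apply: (gk_disjoint (gkv p u pl) _ (_ : p.1 != c i / q)); last by rewrite eq_sym.
    by exists 1%N; rewrite expr1 shfE e3 subrr.
  have -> : c i = p.1 * q by rewrite -e4 mulfVK.
  exact: mul_conjC_ge0.
apply: contrapT => /eqP v0.
have Sv : (S * x) v = (a * Num.conj a) *: v.
  by change (S (x v) = (a * Num.conj a) *: v); rewrite xv bopZ (Sc a) // scalerA.
have [|i ci] := c3 _ v _ v0 Sv; first by rewrite mulf_neq0 // conjC_eq0.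
have := c1 0%N; rewrite expr1 tr0 => /esym/eqP.
rewrite psumr_eq0 => [/allP/(_ i (mem_index_enum _))|j _]; last by rewrite expr1.
by rewrite expr1 -ci mulf_eq0 conjC_eq0 (negPf a0).
Qed.

End CartanCriterion.

(** * Words of nilpotent operators *)

Section NilWords.
Context {R : realType} {V : banType R}.
Implicit Types (f g x y w a b : bop V) (v : V) (z t : R[i]) (s u : seq (bop V)).
Variable L : set (bop V).
Hypotheses (lL : lie L) (tL : forall f y, L f -> fr f -> L y -> ftr (f * y) = 0).

Local Notation J := (dideal L).

Lemma dideal_subsp : subsp J. Proof. exact: spn_subsp. Qed.

Lemma dideal_br x y : J x -> L y -> J (br x y).
Proof.
move=> Jx Ly W sW; apply; have [Lx fx] := dideal_L lL Jx.
by exists x, y.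
Qed.

Lemma fr_word s : isw J s -> s != [::] -> fr (wpr s).
Proof.
case: s => [//|x s] h _; have [_ fx] := dideal_L lL (h x (mem_head _ _)); exact: frMr.
Qed.

Let isJ_cons x s : J x -> isw J s -> isw J (x :: s).
Proof. by move=> Jx Js b; rewrite inE => /predU1P[->|/Js]. Qed.

Section Symmetric.
Variable n : nat.
Hypothesis IHn : forall s, isw J s -> size s = n -> s != [::] -> ftr (wpr s) = 0.

(** Swapping neighbours changes the word by a word with the bracket as a single letter, which has
    length [n]. *)
Lemma trace_swap s a b u : isw J s -> isw J u -> J a -> J b -> (size s + size u).+1 = n ->
  ftr (wpr (s ++ a :: b :: u)) = ftr (wpr (s ++ b :: a :: u)).
Proof.
move=> Js Ju Ja Jb sz; have [La _] := dideal_L lL Ja; have [Lb _] := dideal_L lL Jb.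
have nz c d : s ++ c :: d :: u != [::] by case: (s).
have w1 : isw J (s ++ a :: b :: u) by apply/isw_cat; split=> //; do 2!apply: isJ_cons => //.
have w2 : isw J (s ++ b :: a :: u) by apply/isw_cat; split=> //; do 2!apply: isJ_cons => //.
apply/eqP; rewrite -subr_eq0 -ftrB; [|exact: fr_word|exact: fr_word].
have -> : wpr (s ++ a :: b :: u) - wpr (s ++ b :: a :: u) = wpr (s ++ br a b :: u).
  by rewrite !wpr_cat /= -mulrBr; congr (_ * _); rewrite /br mulrBl !mulrA.
rewrite IHn //; last by case: (s).
  by apply/isw_cat; split=> //; apply: isJ_cons => //; exact: dideal_br.
by rewrite size_cat /= addnS.
Qed.

Lemma trace_move s a u (t : seq (bop V)) : isw J s -> isw J u -> isw J t -> J a ->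
  (size s + size u + size t)%N = n -> ftr (wpr (s ++ a :: u ++ t)) = ftr (wpr (s ++ u ++ a :: t)).
Proof.
move=> + + Jt Ja; elim: u s => [//|b u IH] s Js Ju sz.
have Jb : J b by apply: Ju; rewrite mem_head.
have Ju' : isw J u by move=> c cu; apply: Ju; rewrite inE cu orbT.
rewrite /= trace_swap //; last first.
- by move: sz; rewrite /= size_cat; clear; lia.
- by apply/isw_cat; split.
rewrite -cat_rcons IH //; last by move: sz; rewrite /= size_rcons; clear; lia.
  by rewrite cat_rcons.
by move=> c; rewrite mem_rcons inE => /predU1P[->|/Js].
Qed.

Lemma polarization x y m s : J x -> J y -> isw J s -> (m + size s)%N = n.+1 ->
  exists p : {poly R[i]}, [/\ forall t, ftr (wpr (nseq m (x + t *: y) ++ s)) = p.[t],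
   p`_0 = ftr (wpr (nseq m x ++ s)) & p`_1 = m%:R * ftr (wpr (nseq m.-1 x ++ y :: s))].
Proof.
move=> Jx Jy; have Jxy t : J (x + t *: y).
  by apply: (subspD dideal_subsp) => //; exact: (subspZ _ dideal_subsp).
have Jn k c : J c -> isw J (nseq k c) by move=> Jc d; rewrite mem_nseq => /andP[_ /eqP->].
elim: m s => [|m IH] s Js sz.
  by exists (ftr (wpr s))%:P; split=> [t||]; rewrite ?hornerC ?coefC //= mul0r.
have [|p1 [h1 h2 h3]] := IH (x :: s) (isJ_cons Jx Js); first by rewrite /= -sz addnS.
have [|p2 [k1 k2 k3]] := IH (y :: s) (isJ_cons Jy Js); first by rewrite /= -sz addnS.
have mv c k : J c -> isw J k -> size k = m -> ftr (wpr (c :: k ++ s)) = ftr (wpr (k ++ c :: s)).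
  by move=> Jc Jk sk; apply: (@trace_move [::]) => //; rewrite /= add0n sk; move: sz; clear; lia.
exists (p1 + 'X * p2); split=> [t||].
- rewrite hornerD hornerM hornerX -h1 -k1 -!mv ?size_nseq //; try exact: Jn.
  have fx := (dideal_L lL Jx).2; have fy := (dideal_L lL Jy).2.
  by rewrite /= mulrDl (bscalAl t) ftrD ?ftrZ //; first [exact: frMr|apply: frZ; exact: frMr].
- by rewrite coefD coefXM /= addr0 h2 -mv ?size_nseq //; exact: Jn.
rewrite coefD coefXM /= h3 k2; case: m {IH} sz mv h1 h2 h3 k1 k2 k3 => [|m] sz mv *.
  by rewrite mul0r add0r mul1r.
rewrite trace_swap //=; last first.
- by rewrite size_nseq; move: sz; clear; lia.
- exact: Jn.
have -> : nseq m x ++ x :: y :: s = x :: nseq m x ++ y :: s.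
  by elim: (m) => [//|k IHk] /=; rewrite IHk.
by rewrite -[m.+2%:R]natr1 mulrDl mul1r.
Qed.

End Symmetric.

Lemma poly_zero (p : {poly R[i]}) : (forall t, p.[t] = 0) -> p = 0.
Proof.
move=> h; apply/eqP; apply: contraT => p0.
pose rs : seq R[i] := [seq k%:R | k <- iota 0 (size p)].
have := @max_poly_roots _ p rs p0; rewrite size_map size_iota ltnn; apply.
  by apply/allP => t _; rewrite /root h.
by rewrite map_inj_uniq ?iota_uniq // => i j /eqP; rewrite eqr_nat => /eqP.
Qed.

Lemma trace_power0 x m : J x -> ftr (x ^+ m.+1) = 0.
Proof.
move=> Jx; have [_ fx] := dideal_L lL Jx; have [k [l [h1 h2 _]]] := ftr_pow fx.
rewrite h1 big1 // => i _; have [->|li] := eqVneq (l i) 0; first by rewrite expr0n.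
by have [v v0 /(dideal_no_eig lL tL Jx li)/eqP] := h2 i li; rewrite (negPf v0).
Qed.

Lemma trace_word s : isw J s -> s != [::] -> ftr (wpr s) = 0.
Proof.
move: {2}(size s) (erefl (size s)) => n; elim: n s => [|n IH] s sz Js.
  by rewrite (size0nil sz).
have IHn s' : isw J s' -> size s' = n -> s' != [::] -> ftr (wpr s') = 0 by move=> h1 h2; exact: IH.
(* [k] letters are arbitrary and the others equal [x]. For [k = 0] this is the trace of a power;
   each step compares linear coefficients in [x + t *: y]. At [k = n.+1] no [x] is left, so 0 serves
   as its value. *)
suff h k x u : (k <= n.+1)%N -> J x -> isw J u -> size u = k ->
    ftr (wpr (nseq (n.+1 - k) x ++ u)) = 0.
  move=> _; have := h n.+1 0 s (leqnn _) dideal_subsp.1 Js sz.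
  by rewrite subnn.
elim: k x u => [|k IHk] x u kn Jx Ju su.
  rewrite (size0nil su) cats0 subn0; have -> : wpr (nseq n.+1 x) = x ^+ n.+1; last exact: trace_power0.
  by elim: (n.+1) => [|j IHj]; rewrite ?expr0 // exprS -IHj.
case: u su Ju => [//|y u] [su] Ju.
have Jy : J y by apply: Ju; rewrite mem_head.
have Ju' : isw J u by move=> c cu; apply: Ju; rewrite inE cu orbT.
have [|p [h1 h2 h3]] := @polarization n IHn x y (n.+1 - k) u Jx Jy Ju'; first by rewrite su; move: kn; clear; lia.
have p0 : p = 0.
  apply: poly_zero => t; rewrite -h1; apply: IHk => //; first exact: ltnW.
  by apply: (subspD dideal_subsp) => //; exact: (subspZ _ dideal_subsp).
move/esym/eqP: h3; rewrite p0 coef0 mulf_eq0 pnatr_eq0 => /orP[/eqP h|/eqP].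
  by move: kn h; clear; lia.
by rewrite -subnS.
Qed.

Definition jword w := exists s, [/\ isw J s, s != [::] & w = wpr s].

Lemma jword_mul w w' : jword w -> jword w' -> jword (w * w').
Proof.
move=> [s [Js s0 ->]] [s' [Js' s0' ->]]; exists (s ++ s'); split; last by rewrite wpr_cat.
  by apply/isw_cat.
by case: (s) s0.
Qed.

Lemma jword_trace w m : jword w -> ftr (w ^+ m.+1) = 0.
Proof.
move=> jw; suff [s [Js s0 ->]] : jword (w ^+ m.+1) by exact: trace_word.
by elim: m => [|m IH]; rewrite ?expr1 // exprS; exact: jword_mul.
Qed.

Lemma jword_conj g g' w : inv_of g g' -> (forall y, L y -> L (g * y * g')) -> jword w -> jword (g * w * g').
Proof.
move=> gg Lg [s [Js s0 ->]]; exists [seq g * x * g' | x <- s]; split; last 1 first.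
- elim: (s) => [|x t IH] /=; first by rewrite mulr1 gg.1.
  rewrite -IH; have -> : g * x * g' * (g * wpr t * g') = g * x * (g' * g) * wpr t * g' by rewrite !mulrA.
  by rewrite gg.2 mulr1 !mulrA.
- move=> _ /mapP[x xs ->].
  suff : J `<=` [set x | J (g * x * g')] by apply; exact: Js.
  apply: dideal_min => [|f y Lf ff Ly].
    split=> [|z x1 x2 /= h1 h2]; first by rewrite /= mulr0 mul0r; exact: dideal_subsp.1.
    by rewrite mulrDr mulrDl (bscalAr z) (bscalAl z); exact: dideal_subsp.2.
  change (J (g * br f y * g')).
  have -> : g * br f y * g' = br (g * f * g') (g * y * g').
    have e c d : g * c * g' * (g * d * g') = g * (c * d) * g'.
      have -> : g * c * g' * (g * d * g') = g * c * (g' * g) * d * g' by rewrite !mulrA.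
      by rewrite gg.2 mulr1 !mulrA.
    by rewrite /br !e mulrBr mulrBl.
  move=> W sW; apply; exists (g * f * g'), (g * y * g'); split=> //; try exact: Lg.
  by apply: frMr; exact: frMl.
by case: (s) s0.
Qed.

Section MinimalWord.
Variables (w : bop V) (n : nat) (e : 'I_n -> V) (phi : 'I_n -> V -> R[i]).
Hypotheses (jw : jword w) (w0 : w != 0) (hw : frep e phi w).
Hypothesis wmin : forall w' m e' phi', jword w' -> w' != 0 -> @frep _ _ m e' phi' w' -> (n <= m)%N.

Let A g : 'M[R[i]]_n := \matrix_(i, j) phi j (g (e i)).

(** [w g w] factors through the matrix [A g]. If this is singular, [w (g w g')], a product of two
    words, has a representation of smaller size than [w], so it vanishes by minimality. *)
Lemma singular_sandwich g g' : inv_of g g' -> (forall y, L y -> L (g * y * g')) ->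
  A g \notin unitmx -> w * g * w = 0.
Proof.
move=> gg Lg sA; have ra : (\rank (A g) < n)%N.
  by rewrite ltn_neqAle rank_leq_row andbT; apply: contra sA; rewrite -row_free_unit.
set r := \rank (A g) in ra.
pose C := col_base (A g); pose D := row_base (A g).
have AE : A g = C *m D by rewrite mulmx_base.
have row_w v : \row_i phi i (g (w v)) = (\row_i phi i v) *m A g.
  apply/rowP => j; rewrite !mxE hw.2 bop_sum (is_fun_sum _ _ _ (hw.1 j)).
  by apply: eq_bigr => k _; rewrite bopZ (is_funZ _ _ (hw.1 j)) !mxE.
have fw : frep (fun k : 'I_r => \sum_i D k i *: e i)
    (fun k v => ((\row_i phi i v) *m C) 0 k) (w * g * w).
  split=> [k|v].
    have -> : (fun v : V => ((\row_i phi i v) *m C) 0 k) = fun v => \sum_i C i k * phi i v.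
      by apply/funext => v; rewrite !mxE; apply: eq_bigr => i _; rewrite !mxE mulrC.
    by apply: is_fun_bigsum => i; apply: is_funM; exact: hw.1.
  change (w (g (w v)) = \sum_k ((\row_i phi i v) *m C) 0 k *: (\sum_i D k i *: e i)).
  have h i : phi i (g (w v)) = \sum_k ((\row_i phi i v) *m C) 0 k * D k i.
    have : \row_i phi i (g (w v)) = (\row_i phi i v) *m C *m D by rewrite row_w -mulmxA -AE.
    by move=> /rowP/(_ i); rewrite mxE => ->; rewrite mxE.
  rewrite hw.2 (eq_bigr (fun i => \sum_k ((\row_i phi i v) *m C) 0 k * D k i *: e i)); last first.
    by move=> i _; rewrite h scaler_suml.
  rewrite exchange_big; apply: eq_bigr => k _; rewrite scaler_sumr.
  by apply: eq_bigr => i _; rewrite scalerA.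
have u0 : w * g * w * g' = 0.
  apply: contrapT => /eqP un0.
  suff : (n <= r)%N by rewrite leqNgt ra.
  apply: (@wmin (w * g * w * g') r) => //; last exact: frepMr fw.
  have -> : w * g * w * g' = w * (g * w * g') by rewrite !mulrA.
  by apply: jword_mul => //; exact: jword_conj.
by rewrite -[LHS]mulr1 -gg.2 mulrA u0 mul0r.
Qed.

(** If both matrices were invertible, so would be the matrix [A g' *m A g] of the word [w (g w g')];
    but the traces of its powers vanish, so its eigenvalues are 0. *)
Lemma sandwich_or g g' : inv_of g g' -> (forall y, L y -> L (g * y * g')) ->
  (forall y, L y -> L (g' * y * g)) -> w * g * w = 0 \/ w * g' * w = 0.
Proof.
move=> gg Lg Lg'; have g'g : inv_of g' g by split; [exact: gg.2|exact: gg.1].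
have [sA|sA] := boolP (A g \in unitmx); last by left; exact: singular_sandwich gg Lg sA.
have [sA'|sA'] := boolP (A g' \in unitmx); last by right; exact: singular_sandwich g'g Lg' sA'.
pose u := w * (g * w * g').
have ju : jword u by apply: jword_mul => //; exact: jword_conj.
pose psi i (v : V) := phi i ((g * w * g') v).
have fu : frep e psi u by exact: frepMr (g * w * g') hw.
have BE : frmx e psi = A g' *m A g.
  apply/matrixP => i j; rewrite !mxE /psi.
  change (phi j (g (w (g' (e i)))) = \sum_k A g' i k * A g k j).
  rewrite hw.2 bop_sum (is_fun_sum _ _ _ (hw.1 j)); apply: eq_bigr => k _.
  by rewrite bopZ (is_funZ _ _ (hw.1 j)) !mxE.
have uB : frmx e psi \in unitmx by rewrite BE unitmx_mul sA sA'.
have [l [h1 h2 _]] := mxtrace_pow (frmx e psi).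
have l0 : forall i, l i = 0.
  apply: power_sums0 => m; have h := jword_trace m ju; rewrite (ftrE (frep_pow m fu)) in h.
  by rewrite -h1 -(frep_tr_pow m fu) -[RHS]h; apply: eq_bigr => i _; congr ((_ *m _) 0 i); apply/rowP => j; rewrite !mxE.
have n0 : (0 < n)%N.
  rewrite lt0n; apply/eqP => n0; case/eqP: w0; apply: bop_ext => v.
  by rewrite hw.2 big1 // => i _; have := ltn_ord i; rewrite [X in (_ < X)%N]n0.
have /eigenvalueP[v] := h2 (Ordinal n0); rewrite l0 scale0r => hv v0.
by case/eqP: v0; rewrite -[v]mulmx1 -(mulmxV uB) mulmxA hv mul0mx.
Qed.

Lemma sandwich_exp (l : seq (bop V)) : csub L -> (forall a, a \in l -> L a) ->
  forall z, w * gx z l * w = 0 \/ w * gx (- z) (rev l) * w = 0.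
Proof.
move=> cL hl z; apply: sandwich_or (gx_inv z l) _ _ => y Ly.
  exact: gx_conjV.
exact: gx_conj.
Qed.

End MinimalWord.

End NilWords.

(** * A dichotomy for power series *)

Section Alternative.
Context {R : realType} {V : banType R}.
Implicit Types (u v : nat -> bop V) (z c : R[i]) (w : bop V) (l : seq (bop V)).

(** At the points [1 / k.+1] the first alternative holds infinitely often, or the second holds from
    some point on; in either case zeros of one series accumulate at 0. *)
Lemma psum_alternative u v c : ent u -> ent v -> c != 0 -> cabs c <= 1 ->
  (forall z, psum z u = 0 \/ psum (c * z) v = 0) -> (forall n, u n = 0) \/ (forall n, v n = 0).
Proof.
move=> eu ev c0 c1 h.
pose zk (k : nat) : R[i] := (k.+1%:R^-1)%:C%C.
have cz k : cabs (zk k) = k.+1%:R^-1 by rewrite cabs_nneg // invr_ge0.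
have z0 k : zk k != 0 by rewrite -cabs_gt0 cz invr_gt0.
have z1 k : cabs (zk k) <= 1 by rewrite cz invf_le1 // ler1n.
have [inf|fin] := pselect (forall N, exists k, (N <= k)%N /\ psum (zk k) u = 0).
  left; have [p hp] := choice inf.
  apply: (psum_zero (w := fun k => zk (p k))) => // [e e0|k]; last by have [] := hp k.
  have [N hN] := nat_small e0; exists N; rewrite cz; apply: hN; by have [] := hp N.
right; have [N hN] : exists N, forall k, (N <= k)%N -> psum (zk k) u <> 0.
  by apply: contrapT => /forallNP h'; apply: fin => N; apply: contrapT => /forallNP h2; apply: (h' N) => k Nk e; apply: (h2 k).
apply: (psum_zero (w := fun k => c * zk (N + k)%N)) => // [k|e e0|k].
- by rewrite mulf_neq0 // cabsM mulr_ile1 ?cabs_ge0.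
- have [K hK] := nat_small e0; exists K; rewrite cabsM cz.
  apply: le_lt_trans (hK (N + K)%N (leq_addl _ _)).
  by rewrite ler_piMl // invr_ge0.
by have [/(hN _ (leq_addr _ _))|] := h (zk (N + k)%N).
Qed.

Lemma ent_finite (c : nat -> bop V) m : ent (fun i => if (i <= m)%N then c i else 0).
Proof.
move=> r r0; exists (\sum_(i < m.+1) nm (c i) / r ^+ i) => [|n].
  by apply: sumr_ge0 => i _; rewrite divr_ge0 ?nm_ge0 // exprn_ge0 // ltW.
have S0 : 0 <= \sum_(i < m.+1) nm (c i) / r ^+ i.
  by apply: sumr_ge0 => i _; rewrite divr_ge0 ?nm_ge0 // exprn_ge0 // ltW.
have [nm_|_] := leqP n m; last by rewrite nm0 mulr_ge0 // exprn_ge0 // ltW.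
rewrite -ler_pdivrMr ?exprn_gt0 // (bigD1 (Ordinal (nm_ : (n < m.+1)%N))) //= lerDl.
by apply: sumr_ge0 => i _; rewrite divr_ge0 ?nm_ge0 // exprn_ge0 // ltW.
Qed.

Lemma psum_finite (c : nat -> bop V) m z :
  psum z (fun i => if (i <= m)%N then c i else 0) = \sum_(i < m.+1) z ^+ i *: c i.
Proof.
apply: psum_uniq; first exact: ent_finite.
move=> e e0; exists m.+1 => n mn.
have -> : \sum_(i < n) z ^+ i *: (if (i <= m)%N then c i else 0) = \sum_(i < m.+1) z ^+ i *: c i.
  rewrite (big_ord_widen n (fun i => z ^+ i *: c i) mn) [RHS]big_mkcond.
  by apply: eq_bigr => i _; rewrite ltnS; case: leqP => // _; rewrite scaler0.
by rewrite subrr nm0.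
Qed.

(* The two alternatives are played against each other along the lists [l ++ t *: rev l],
   whose reversals are [t *: l ++ rev l]. *)
Lemma exp_alternative (L : set (bop V)) w : subsp L ->
  (forall l, (forall a, a \in l -> L a) -> forall z,
    w * gx z l * w = 0 \/ w * gx (- z) (rev l) * w = 0) ->
  forall l, (forall a, a \in l -> L a) -> forall z, w * gx z l * w = 0.
Proof.
move=> sL h; pose f l m := w * el l m * w.
have ef l : ent (f l) by apply: entMr; apply: entMl; exact: ent_el.
have fE z l : psum z (f l) = w * gx z l * w.
  rewrite /f psumMr; first by rewrite psumMl ?psum_el //; exact: ent_el.
  by apply: entMl; exact: ent_el.
have alt l : (forall a, a \in l -> L a) -> (forall m, f l m = 0) \/ (forall m, f (rev l) m = 0).
  move=> hl; apply: (@psum_alternative (f l) (f (rev l)) (-1)) => //; rewrite ?oppr_eq0 ?oner_neq0 //.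
    by rewrite cabsN cabs1.
  by move=> z; rewrite !fE mulN1r; exact: h.
move=> l hl; suff f0 m : f l m = 0.
  move=> z; rewrite -fE; apply: psum_uniq => // e e0; exists 0%N => n _.
  by rewrite big1 ?subrr ?nm0 // => i _; rewrite f0 scaler0.
pose c i := w * (el l i * el (rev l) (m - i)) * w.
have cm : c m = f l m by rewrite /c subnn el0 mulr1.
have fc t : f (l ++ [seq t *: b | b <- rev l]) m = \sum_(i < m.+1) t ^+ (m - i) *: c i.
  rewrite /f el_cat /conv mulr_sumr mulr_suml; apply: eq_bigr => i _.
  by rewrite el_scale (bscalAr (t ^+ (m - i))) (bscalAr (t ^+ (m - i))) (bscalAl (t ^+ (m - i))).
have fr t : f (rev (l ++ [seq t *: b | b <- rev l])) m = \sum_(i < m.+1) t ^+ i *: c i.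
  rewrite rev_cat -map_rev revK /f el_cat /conv mulr_sumr mulr_suml; apply: eq_bigr => i _.
  by rewrite el_scale (bscalAl (t ^+ i)) (bscalAr (t ^+ i)) (bscalAl (t ^+ i)).
pose u i := if (i <= m)%N then c (m - i)%N else 0.
pose v i := if (i <= m)%N then c i else 0.
have [||h0|h0] := @psum_alternative u v 1 (ent_finite _ _) (ent_finite _ _) (oner_neq0 _).
- by rewrite cabs1.
- move=> t; rewrite mul1r !psum_finite.
  have ht a : a \in l ++ [seq t *: b | b <- rev l] -> L a.
    rewrite mem_cat => /orP[/hl//|/mapP[b]]; rewrite mem_rev => /hl Lb ->; exact: (subspZ _ sL).
  have [/(_ m)|/(_ m)] := alt _ ht; rewrite ?fc ?fr => e; [left|by right].
  rewrite -[RHS]e [RHS](reindex_inj rev_ord_inj); apply: eq_bigr => i _ /=.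
  by rewrite subSS subKn // -ltnS.
- by have := h0 0%N; rewrite /u subn0 -cm.
by have := h0 m; rewrite /v leqnn -cm.
Qed.

End Alternative.

(** * Absence of finite-rank elements, and the irreducible case *)

Section NoFiniteRank.
Context {R : realType} {V : banType R}.
Implicit Types (v : V) (z t : R[i]) (M : set (bop V)).

(** Schur's lemma: eigenspaces of [f] are closed and invariant, and the product of the [f - z] that
    kills [f] provides an eigenvector. *)
Lemma irred_scalar M (f : bop V) v : irred M -> v != 0 -> fr f -> (forall b, M b -> f * b = b * f) ->
  exists z, f = z *: (1 : bop V).
Proof.
move=> iM v0 ff fM; have [s hs] := fr_kl ff.
have [z [u u0 fu]] : exists z, exists2 u, u != 0 & f u = z *: u.
  have : kl f s v = 0 by rewrite hs.
  elim: s {hs} => [/eqP|z s IH]; first by rewrite (negPf v0).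
  have [/IH//|n0 h] := eqVneq (kl f s v) 0.
  exists z, (kl f s v) => //; apply/eqP; rewrite -subr_eq0; apply/eqP; exact: h.
exists z; have cW := ker_csub (shf f z).
have [|h|h] := iM _ cW.
- move=> b Mb x /= /eqP; rewrite subr_eq0 => /eqP fx.
  apply/eqP; rewrite subr_eq0; apply/eqP.
  have -> : f (b x) = b (f x) by apply: comm_app; exact: fM.
  by rewrite fx; exact: bopZ.
- case/eqP: u0; apply: h; change (f u - z *: u = 0); by rewrite fu subrr.
apply: bop_ext => x; have /= /eqP := h x; rewrite subr_eq0 => /eqP; exact.
Qed.

(** Averages of exponentials recover the letters one after the other, so [w s w = 0] for all words
    [s] in [M]. *)
Lemma irred_sandwich M (w : bop V) : subsp M -> irred M ->
  (forall l, (forall a, a \in l -> M a) -> w * gx 1 l * w = 0) -> w = 0.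
Proof.
move=> sM iM hw.
have key s l : isw M s -> (forall a, a \in l -> M a) -> w * gx 1 l * wpr s * w = 0.
  elim: s l => [|a s IH] l Ms Ml; first by rewrite /= mulr1 hw.
  have Ma : M a by apply: Ms; rewrite mem_head.
  have Ms' : isw M s by move=> b bs; apply: Ms; rewrite inE bs orbT.
  have t0 := @bx_avg _ _ 1 a (oner_neq0 _).
  have := tendsMr (wpr s * w) (tendsMl (w * gx 1 l) t0).
  have -> : w * gx 1 l * a * (wpr s * w) = w * gx 1 l * wpr (a :: s) * w by rewrite /= !mulrA.
  move=> h; apply: tends_uniq h _; apply: tends_eq (tends_cst 0) => n; rewrite /avg.
  set q := _^-1; rewrite (bscalAr q) (bscalAl q) mulr_sumr mulr_suml big1 ?scaler0 // => j _.
  set c := _^-1; rewrite (bscalAr c) (bscalAl c) mul1r.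
  have := IH (l ++ [:: rt n ^+ j *: a]) Ms' _; rewrite gx_cat /= bxZ mul1r mulr1 !mulrA => -> //.
    exact: scaler0.
  by move=> b; rewrite mem_cat inE => /orP[/Ml//|/eqP->]; exact: (subspZ _ sM).
apply: contrapT => /eqP w0.
have [v wv] : exists v, w v != 0.
  by apply: contrapT => /forallNP h; case/eqP: w0; apply: bop_ext => v; apply: contrapT => /eqP; exact: h.
case/eqP: w0; apply: (irred_sep iM wv) => s Ms.
by have := key s [::] Ms (fun a => ltac:(by [])); rewrite /= mulr1 => /(congr1 (fun T : bop V => T v)).
Qed.

Lemma no_finite_rank M v : lts M -> volt M -> irred M -> v != 0 ->
  forall T, lhat M T -> fr T -> T = 0.
Proof.
move=> lM vM iM v0 T LT fT; apply: contrapT => /eqP T0.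
have lL : lie (lhat M) := lhat_lie lM; have cL := @lhat_csub _ _ M lM.
have tL (f y : bop (V * V)%type) := @lhat_ftr _ _ M lM vM f y.
have [hJ|hJ] := pselect (exists2 w, dideal (lhat M) w & w != 0).
  have [n [w [jw w0 [e [phi hw]]] wmin]] : exists n, exists w, [/\ jword (lhat M) w, w != 0,
      exists e phi, @frep _ _ n e phi w &
      forall w' m e' phi', jword (lhat M) w' -> w' != 0 -> @frep _ _ m e' phi' w' -> (n <= m)%N].
    pose P n := exists w, [/\ jword (lhat M) w, w != 0 & exists e phi, @frep _ _ n e phi w].
    have [n [Pn nmin]] : exists n, P n /\ forall m, P m -> (n <= m)%N.
      apply: contrapT => no.
      have noP n : ~ P n.
        elim/ltn_ind: n => n IH Pn; apply: no; exists n; split=> // m Pm.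
        by rewrite leqNgt; apply/negP => /IH.
      have [w Jw w0] := hJ; have [n [e [phi he]]] := (dideal_L lL Jw).2.
      apply: (noP n); exists w; split=> //; last by exists e, phi.
      by exists [:: w]; split=> //; rewrite /= ?mulr1 // => b; rewrite inE => /eqP->.
    have [w [jw w0 h]] := Pn; exists n, w; split=> // w' m e' phi' jw' w0' h'.
    by apply: nmin; exists w'; split=> //; exists e', phi'.
  have [f [g wE]] : exists f g, w = dg f g.
    have [u [Ju _ ->]] := jw; elim: u Ju => [|x u IH] Ju; first by exists 1, 1; rewrite dg1.
    have [|f [g fgE]] := IH; first by move=> b bu; apply: Ju; rewrite inE bu orbT.
    have [[f' [g' [_ _ e']]] _] := dideal_L lL (Ju x (mem_head _ _)).
    by exists (f' * f), (g' * g); rewrite /= fgE e' dgM.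
  (* Irreducibility is available on [V] only, so the vanishing product is read off in each
     coordinate separately. *)
  have kill z l : (forall a, a \in l -> M a) -> dg (f * gx z l * f) (g * gx (- z) l * g) = 0.
    move=> Ml; rewrite -!dgM -gx_hat -wE.
    apply: (exp_alternative lL.1 _ _) => [l' Ll'|_ /mapP[a al ->]]; last exact: lhat_hat (Ml a al).
    exact: (sandwich_exp lL tL jw w0 hw wmin cL Ll').
  case/eqP: w0; rewrite wE -dg0; congr dg; apply: (irred_sandwich lM.1 iM) => l Ml.
    by have := kill 1 l Ml; rewrite -dg0 => /dg_inj[].
  by have := kill (-1) l Ml; rewrite opprK -dg0 => /dg_inj[].
have J0 x : dideal (lhat M) x -> x = 0.
  by move=> Jx; apply: contrapT => /eqP x0; apply: hJ; exists x.
have [f [g [h1 h2 TE]]] := LT; have [ff fg] : fr f /\ fr g by apply: fr_dgP; rewrite -TE.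
have cent b : M b -> br f b = 0 /\ br g b = 0.
  move=> Mb; have : br T (hat b) = 0.
    apply: J0 => W sW; apply; exists T, (hat b); split=> //; exact: lhat_hat.
  rewrite TE /br br_dg -dg0 => /dg_inj[h3 h4]; split=> //.
  by move/eqP: h4; rewrite brNr oppr_eq0 => /eqP.
have [z1 f1] : exists z, f = z *: (1 : bop V).
  by apply: (irred_scalar iM v0 ff) => b /cent[/eqP]; rewrite subr_eq0 => /eqP.
have [z2 g2] : exists z, g = z *: (1 : bop V).
  by apply: (irred_scalar iM v0 fg) => b /cent[_ /eqP]; rewrite subr_eq0 => /eqP.
(* [f - g] is a scalar in the closure of [M], hence a quasinilpotent one. *)
have z12 : z1 = z2.
  apply: contrapT => /eqP; rewrite -subr_eq0 => ne; case/eqP: v0.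
  apply: (qn_eig (clos_volt vM h1).2 ne); rewrite f1 g2 -scalerBl //.
have z10 : z1 != 0.
  by apply/eqP => e; case/eqP: T0; rewrite TE f1 g2 -z12 e !scale0r dg0.
have fd : fr (f + g) by exact: frD.
have dE : f + g = (z1 + z1) *: (1 : bop V) by rewrite f1 g2 -z12 scalerDl.
have c0 : z1 + z1 != 0 by rewrite -mulr2n mulrn_eq0.
have f1' : fr (1 : bop V).
  have -> : (1 : bop V) = (z1 + z1)^-1 *: (f + g) by rewrite dE scalerA mulVf // scale1r.
  exact: frZ.
(* The trace of the square of [f + g] is 0 although this operator is a nonzero multiple of the
   identity, so the identity has trace 0 and cannot have the eigenvalue 1. *)
have := ftr_DD lM vM h2 fd h2; rewrite dE (bscalAl (z1 + z1)) mul1r scalerA ftrZ //.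
move=> /eqP; rewrite !mulf_eq0 (negPf c0) /= => /eqP t1.
case/eqP: v0; apply: (@fr_tr0_eig _ _ 1 f1' _ 1 v (oner_neq0 _)); last by rewrite scale1r.
by move=> m; rewrite expr1n.
Qed.

(* If conjugation by [g] has subexponential growth, the range of [p] is invariant,
   so the identity has finite rank and finite-rank elements exist anyway. *)
Lemma irred_nonzero_eig M (N : seq (bop V)) (w : bop V) v z : lts M -> volt M -> irred [set` N] -> (forall a, a \in N -> M a) ->
  alg [set` N] w -> v != 0 -> z != 0 -> w v = z *: v -> False.
Proof.
move=> lM vM iN NM wN v0 z0 wv.
have iM : irred M by apply: irred_sub iN => a; exact: NM.
have noF := no_finite_rank lM vM iM v0.
have cL := @lhat_csub _ _ M lM; have lL : lie (lhat M) := lhat_lie lM.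
have [a Ma a0] : exists2 a, M a & a != 0.
  apply: contrapT => h; case/eqP: v0.
  have M0 a : M a -> a = 0 by move=> Ma; apply: contrapT => /eqP a0; apply: h; exists a.
  have w0 : w = 0.
    have [l [hl ->]] := wN; rewrite big_seq big1 // => q /hl[].
    case: q.2 => [//|b s] hs _; rewrite /= (M0 b); first by rewrite mul0r scaler0.
    by apply: NM; apply: (hs b); rewrite mem_head.
  by move/eqP: wv; rewrite w0 eq_sym scaler_eq0 (negPf z0) => /eqP.
have hat0 : hat a != 0 by apply/eqP; rewrite -dg0 => /dg_inj[/eqP]; rewrite (negPf a0).
have [m [p [mM fp p0 pp hp]]] := group_element lM.1 vM NM iN wN v0 z0 wv.
have hm b : b \in map hat m -> lhat M b by move=> /mapP[c cm ->]; exact: lhat_hat (mM c cm).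
pose g := gx 1 (map hat m); pose g' := gx (-1) (rev (map hat m)).
have gg : inv_of g g' := gx_inv 1 (map hat m).
have gE : g = 1 + (g - 1) by rewrite addrC subrK.
have kg : kop (g - 1).
  have -> : g = wpr [seq bx 1 b | b <- map hat m] by rewrite /g; elim: (map _ _) => //= b s ->.
  apply: kop_wpr => _ /mapP[b bm ->]; apply: kop_bx; have [c cm ->] := mapP bm.
  have kc := (vM _ (mM c cm)).1; apply: kop_dg => //; exact: kopN.
have [|[T [LT T0 fT]]|gr] := fr_or_growth gg gE kg cL.
- by move=> y Ly; apply: gx_conj.
- by case/eqP: T0; exact: noF LT fT.
have pinv b : M b -> (1 - p) * b * p = 0.
  move=> Mb; apply: hp => r r1; have [C hC] := gr (hat b) r (lhat_hat lM Mb) r1.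
  exists C => n; apply: le_trans (hC n); rewrite /g /g' -map_rev !gx_hat !dgX !dgM; exact: nm_dg1.
have p1 : p = 1.
  have [|h|h] := iM _ (ker_csub (1 - p)).
  - move=> b Mb x /= hx.
    have px : p x = x by apply/eqP; rewrite eq_sym -subr_eq0; apply/eqP.
    have := congr1 (fun T : bop V => T x) (pinv b Mb).
    by change (b (p x) - p (b (p x)) = 0 -> b x - p (b x) = 0); rewrite px.
  - case/eqP: p0; apply: bop_ext => x; apply: h; change (p x - (p * p) x = 0).
    by rewrite pp subrr.
  by apply: bop_ext => x; apply/eqP; rewrite eq_sym -subr_eq0; apply/eqP; exact: h.
have f1 : fr (1 : bop V) by rewrite -p1.
case/eqP: hat0; apply: noF; first exact: (lhat_hat lM Ma).
have fa (b : bop V) : fr b by rewrite -[b]mul1r; apply: (frMr b f1).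
by have [] := ftr_dg (fa a) (fa (- a)).
Qed.

End NoFiniteRank.

(** [w] involves finitely many elements of [M]. On the gap of [irreducible_gap] these act
    irreducibly, and [w] keeps its nonzero eigenvalue. *)
Theorem irred_volterra (R : realType) (V : banType R) (M : set (bop V)) : lts M -> volt M -> irred M -> forall a, M a -> a = 0.
Proof.
move=> lM vM iM a Ma; apply: contrapT => /eqP a0.
have [w [z [v [Aw z0 v0 wv]]]] : exists w z v, [/\ alg M w, z != 0, v != 0 & w v = z *: v].
  apply: (compact_algebra_eig (alg_subsp M)).
  - by move=> *; exact: alg_mul.
  - by move=> b; apply: alg_kop => c /vM[].
  - exact: irred_alg.
  by exists a => //; exact: alg_sub.
have [l [hl wE]] := Aw.
pose N : seq (bop V) := flatten [seq q.2 | q <- l].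
have NM b : b \in N -> M b by move=> /flattenP[_ /mapP[q ql ->]]; exact: (hl q ql).1.
have AN : alg [set` N] w.
  exists l; split=> // q ql; split; last exact: (hl q ql).2.
  by move=> b bq; apply/flattenP; exists q.2 => //; exact: map_f.
have [V' [M' [N' [w' [v' [lM' vM' NM' iN' [wN' v0' wv']]]]]]] := irreducible_gap lM vM NM AN v0 z0 wv.
exact: (irred_nonzero_eig lM' vM' iN' NM' wN' v0' z0 wv').
Qed.

(** * Maximal chains *)

Section InvariantChains.
Context {R : realType} {V : banType R}.
Implicit Types (f : bop V) (W U Z : set V) (C F : set (set V)).
Variable M : set (bop V).
Hypotheses (lM : lts M) (vM : volt M).

Definition ichain C := (forall W, C W -> csub W /\ invs M W) /\ total_on C subset.

Lemma max_ichain : exists C, ichain C /\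
  forall W, csub W -> invs M W -> (forall U, C U -> U `<=` W \/ W `<=` U) -> C W.
Proof.
have [F FP tF|C [CP Cmax]] := @Zorn_bigcup (set V) ichain.
  split=> [W [C FC CW]|W U [C FC CW] [C' FC' CU]]; first exact: (FP C FC).1.
  by have [h|h] := tF C C' FC FC'; [apply: (FP C' FC').2 => //; exact: h|apply: (FP C FC).2 => //; exact: h].
exists C; split=> // W cW iW cmp; apply: contrapT => nW.
apply: (Cmax (C `|` [set W])).
  by split=> [U CU|h]; [left | apply/nW/h; right].
split=> [U [/CP.1//|->]//|U U' [CU|->] [CU'|->]]; first exact: CP.2.
- exact: cmp.
- by have [|] := cmp _ CU'; [right|left].
by left.
Qed.

Lemma chain_union_subsp C : (forall W, C W -> subsp W) -> total_on C subset -> (exists W, C W) ->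
  subsp (\bigcup_(W in C) W).
Proof.
move=> sC tC [W0 CW0]; split=> [|a x y [W1 C1 h1] [W2 C2 h2]].
  by exists W0 => //; exact: (sC _ CW0).1.
by have [h|h] := tC _ _ C1 C2; [exists W2|exists W1] => //; apply: (sC _ _).2 => //; exact: h.
Qed.

Lemma clos_invs W : invs M W -> invs M (clos W).
Proof.
move=> iW f Mf x /clos_seq[u Wu hu]; apply: (@seq_clos _ _ _ (fun n => f (u n))).
  by move=> n; exact: iW.
exact: bop_tends.
Qed.

(** A closed [U] comparable with the chain lies in the gap between the closed union [Z'] of the
    members below it and the intersection [Z] of those above. Invariant subspaces between [Z'] and
    [Z] belong to [C], so the gap is irreducible and [M] acts on it by zero; then [M] maps [Z] into
    [Z'] and leaves [U] invariant. *)
Lemma max_ichain_full C : ichain C ->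
  (forall W, csub W -> invs M W -> (forall U, C U -> U `<=` W \/ W `<=` U) -> C W) ->
  forall U, csub U -> (forall W, C W -> W `<=` U \/ U `<=` W) -> C U.
Proof.
move=> [cC tC] maxC U cU cmp.
pose F := [set W | C W /\ W `<=` U]; pose H := [set W | C W /\ U `<=` W].
have F0 : F [set 0].
  split=> [|_ ->]; last exact: cU.1.1.
  apply: maxC; [exact: csub0|by move=> f _ _ ->; exact: bop0|].
  by move=> W /cC[cW _]; right=> _ ->; exact: cW.1.1.
pose Z' := clos (\bigcup_(W in F) W); pose Z := [set x | forall W, H W -> W x].
have cZ' : csub Z'.
  apply/clos_csub/chain_union_subsp; last by exists [set 0].
    by move=> W [/cC[[]]].
  by move=> W W' [CW _] [CW' _]; exact: tC.
have iZ' : invs M Z'.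
  apply: clos_invs => f Mf x [W FW Wx]; exists W => //; exact: (cC _ FW.1).2.
have cZ : csub Z by apply: csubI => W [/cC[]].
have iZ : invs M Z by move=> f Mf x Zx W HW; apply: (cC _ HW.1).2 => //; exact: Zx.
have Z'U : Z' `<=` U.
  by move=> x /(@clos_sub _ _ _ U) h; apply: cU.2; apply: h => y [W [_ WU] /WU].
have UZ : U `<=` Z by move=> x Ux W [_ UW]; exact: UW.
have sZ : Z' `<=` Z by move=> x /Z'U/UZ.
have FZ W : F W -> W `<=` Z' by move=> FW x Wx; apply: sub_clos; exists W.
have ZH W : H W -> Z `<=` W by move=> HW x; apply.
have between X : csub X -> invs M X -> Z' `<=` X -> X `<=` Z -> C X.
  move=> cX iX h1 h2; apply: maxC => // W CW.
  have [WU|UW] := cmp W CW; [left|right].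
    by apply: subset_trans h1; exact: FZ.
  by apply: subset_trans h2 _; exact: ZH.
pose G := GapData cZ cZ' sZ.
have st f : M f -> gstab G f by move=> Mf; split=> x; [exact: iZ|exact: iZ'].
have [lM' vM'] := gind_volterra lM vM st.
have irr : irred [set gind G f | f in M].
  move=> U' cU' iU'; pose X := [set x | Z x /\ U' (cls G x)].
  have cX : csub X by exact: (gapdata_pull (G := G) cU').
  have iX : invs M X.
    move=> f Mf x [Zx Ux]; split; first exact: iZ.
    by rewrite -gindE //; [apply: iU' => //; exists f|exact: st].
  have CX : C X.
    apply: between => // [x Z'x|x []//]; split; first exact: (sZ x Z'x).
    by rewrite ((cls_eq0 (G := G) (sZ _ Z'x)).2 Z'x); exact: cU'.1.1.
  have [XU|UX] := cmp X CX; [left|right] => p.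
    move=> U'p; have [x Zx pE] := gapP p; rewrite pE; apply/cls_eq0 => //.
    by apply: (FZ X); [split|split=> //; rewrite -pE].
  have [x Zx ->] := gapP p; have [] : X x by apply: (ZH X (conj CX UX)).
  by [].
apply: maxC => // f Mf x Ux.
apply: Z'U; have Zx := UZ x Ux; apply: (cls_eq0 (G := G) (iZ f Mf x Zx)).1.
have f0 : gind G f = 0 by apply: (irred_volterra lM' vM' irr); exists f.
by rewrite -gindE //; [rewrite f0|exact: st].
Qed.

Theorem invariant_maximal_chain : exists C, [/\ forall W, C W -> csub W /\ invs M W, total_on C subset &
  forall C', (forall W, C' W -> csub W) -> total_on C' subset -> C `<=` C' -> C' `<=` C].
Proof.
have [C [iC maxC]] := max_ichain; exists C; split; [exact: iC.1|exact: iC.2|].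
move=> C' cC' tC' CC' U C'U; apply: (max_ichain_full iC maxC); first exact: cC'.
by move=> W /CC' C'W; exact: tC'.
Qed.

End InvariantChains.

(** * Transfer to complete normed modules *)

Section BanachOfNormed.
Context {R : realType} (V : completeNormedModType R[i]).

(** An alias that keeps the structure with real norm apart from the normed module structure on the
    same carrier. *)
Definition banach_of : Type := V.
HB.instance Definition _ := GRing.Lmodule.on banach_of.

Definition bnm (x : banach_of) : R := complex.Re `|x : V|.

Lemma bnmE (x : V) : `|x| = (bnm x)%:C%C.
Proof.
have := normr_ge0 x; rewrite /bnm; case: `|x| => a b; rewrite lecE /= => /andP[/eqP-> _].
by [].
Qed.

Lemma gtc0_real (e : R[i]) : 0 < e -> 0 < complex.Re e /\ e = (complex.Re e)%:C%C.
Proof. by case: e => a b; rewrite ltcE /= => /andP[/eqP-> h]. Qed.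

Fact bnm_eq0 (x : banach_of) : bnm x = 0 -> x = 0.
Proof. by move=> h; apply: (@normr0_eq0 _ V); rewrite bnmE h. Qed.

Fact bnmD (x y : banach_of) : bnm (x + y) <= bnm x + bnm y.
Proof. by have := ler_normD (x : V) y; rewrite !bnmE -rmorphD lecR. Qed.

Fact bnmZ (a : R[i]) (x : banach_of) : bnm (a *: x) = cabs a * bnm x.
Proof.
have := normrZ a (x : V); rewrite (bnmE (a *: (x : V))) (bnmE (x : V)) normE => h.
by apply: real_complex_inj; rewrite rmorphM; exact: h.
Qed.

Lemma ball_bnm (x y : V) (e : R) : ball x e%:C%C y <-> bnm (x - y) < e.
Proof. by rewrite -ball_normE /= bnmE ltcR. Qed.

Fact bnm_complete (u : nat -> banach_of) :
  (forall e, 0 < e -> exists N, forall m n, (N <= m)%N -> (N <= n)%N -> bnm (u m - u n) < e) ->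
  exists l, forall e, 0 < e -> exists N, forall n, (N <= n)%N -> bnm (u n - l) < e.
Proof.
move=> hu; pose v : nat -> V := u.
have /cauchy_cvg cv : cauchy (v @ \oo).
  apply/cauchyP => e /gtc0_real[e0 ->]; have [N hN] := hu _ e0; exists (v N).
  by exists N => // n /= Nn; apply/ball_bnm; exact: hN.
exists (lim (v @ \oo)) => e e0.
have e0' : 0 < e%:C%C by rewrite ltcR.
have /cvg_ballP/(_ _ e0') [N _ hN] := cv.
by exists N => n Nn; have /ball_sym/ball_bnm := hN n Nn.
Qed.

HB.instance Definition _ := isBanach.Build R banach_of bnm_eq0 bnmD bnmZ bnm_complete.

Lemma bounded_is_bop (f : V -> V) : bounded_op f -> is_bop (f : banach_of -> banach_of).
Proof.
move=> [lf cf]; split; first exact: lf.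
have f0 : f 0 = 0.
  by have := lf (-1) 0 0; rewrite scaler0 addr0 scaleN1r addNr.
have /nbhs_ballP[d /gtc0_real[d0 dE] hd] := cf 0 _ (nbhsx_ballx (f 0) 1 ltr01).
rewrite dE f0 in hd; set r := complex.Re d in d0 hd.
have fZ (a : R[i]) x : f (a *: x) = a *: f x by have := lf a x 0; rewrite !addr0 f0 addr0.
exists (2 / r) => x; have [->|x0] := eqVneq x 0; first by rewrite f0 (nm0 (V := banach_of)) mulr0.
have nx : 0 < nm (x : banach_of) by rewrite nm_gt0.
pose c : R := r / 2 / nm (x : banach_of).
have c0 : 0 < c by rewrite !divr_gt0.
have hc : nm ((c%:C%C *: x : V) : banach_of) < r.
  by rewrite (nmZ (s := banach_of)) cabs_nneg ?ltW // /c mulfVK ?gt_eqF //; lra.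
have /ball_bnm : ball (0 : V) 1%:C%C (f (c%:C%C *: x)).
  apply: (hd (c%:C%C *: x)); apply/ball_bnm; rewrite sub0r.
  by have := nmN ((c%:C%C *: x : V) : banach_of) => e; rewrite -e in hc.
rewrite sub0r fZ => h; have {}h : nm ((c%:C%C *: f x : V) : banach_of) < 1.
  by have := nmN ((c%:C%C *: f x : V) : banach_of) => e; rewrite -e.
rewrite (nmZ (s := banach_of)) cabs_nneg ?(ltW c0) // in h.
change (nm (f x : banach_of) <= 2 / r * nm (x : banach_of)).
rewrite -(ler_pM2l c0); apply: le_trans (ltW h) _.
have -> : c * (2 / r * nm (x : banach_of)) = 1; last by [].
by rewrite /c; field; rewrite !gt_eqF.
Qed.

Definition to_bop (f : V -> V) (bf : bounded_op f) : bop banach_of := Bop (bounded_is_bop bf).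

Lemma compact_kop (f : V -> V) (cf : compact_op f) : kop (to_bop cf.1).
Proof.
move=> e e0; have e2 : 0 < (e / 2)%:C%C by rewrite ltcR half_gt0.
have cc : cover_compact (closure (f @` ball (0 : V) 1)) by rewrite -compact_cover; exact: cf.2.
have := cc V setT (fun y => (ball y (e / 2)%:C%C)^°); case=> [y _|y _|D _ hD]; first exact: open_interior.
  by exists y => //; apply: nbhsx_ballx.
have Z2 (c : R[i]) x : f (c *: x) = c *: f x by exact: (bopZ (to_bop cf.1) c x).
exists ([seq (2 : R[i]) *: y | y <- (finmap.enum_fset D : seq V)] : seq V) => _ [x /= x1 <-].
(* The ball of [compact_op] is open while [kop] uses the closed unit ball, so vectors are halved and
   the net is doubled. *)
pose x' : V := (2^-1 : R[i]) *: x.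
have cx' : closure (f @` ball (0 : V) 1) (f x').
  apply: subset_closure; exists x' => //.
  apply/(ball_bnm _ _ 1); rewrite sub0r; have h := nmN (x' : banach_of).
  have c2 : cabs (2 : R[i])^-1 = 2^-1 by rewrite cabsV -[2]/(2%:R) cabs_nat.
  have : nm (x' : banach_of) < 1 by rewrite /x' (nmZ (s := banach_of)) c2; lra.
  by rewrite -h.
have [y yD /interior_subset/ball_bnm h] := hD _ cx'.
exists ((2 : R[i]) *: (y : banach_of)); first exact: (map_f (fun y : V => (2 : R[i]) *: y)).
have fE : f x = (2 : R[i]) *: f x' by rewrite /x' Z2 scalerA mulfV ?scale1r ?pnatr_eq0.
change (bnm (f x - (2 : R[i]) *: (y : V)) < e); rewrite fE -scalerBr.
have -> : bnm ((2 : R[i]) *: (f x' - y : V)) = 2 * bnm (y - f x').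
  rewrite (bnmZ (2 : R[i]) (f x' - y : V)) -[X in cabs X]/(2%:R) cabs_nat; congr (_ * _).
  exact: (nmC (f x' : banach_of) y).
lra.
Qed.

Lemma quasinilpotent_qn (f : V -> V) (bf : bounded_op f) : quasinilpotent f -> qn (to_bop bf).
Proof.
move=> [_ hf]; apply: qn_spec => z /hf[g [bg [h1 h2]]].
(* [g] inverts [f - z], whereas [qn_spec] asks for an inverse of [z - f]. *)
exists (- to_bop bg); split; apply: bop_ext => x.
  change (z *: (- g x) - f (- g x) = x :> V).
  have fN y : f (- y) = - f y by exact: (bopN (to_bop bf) y).
  by rewrite fN scalerN opprK addrC h2.
change (- g (z *: x - f x) = x).
have gN y : g (- y) = - g y by exact: (bopN (to_bop bg) y).
by rewrite -gN opprB h1.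
Qed.

Lemma closed_csub (W : set V) : closed_subspace W <-> csub (W : set banach_of).
Proof.
split=> [[cW W0 hW]|[[W0 hW] cW]].
  split=> [//|x hx]; apply: cW => B /nbhs_ballP[e /gtc0_real[e0 ->] hB].
  have [y Wy xy] := hx _ e0; exists y; split=> //; apply: hB; exact/ball_bnm.
split=> // x hx; apply: cW => e e0.
have e0' : 0 < e%:C%C by rewrite ltcR.
by have [y [Wy /ball_bnm xy]] := hx _ (nbhsx_ballx x _ e0'); exists y.
Qed.

End BanachOfNormed.

Theorem mainTheorem18 (R : realType) (V : completeNormedModType R[i])
  (M : set (V -> V)) :
  lie_triple_system M ->
  (forall f, M f -> volterra_op f) ->
  triangularizable M.
Proof.
move=> [bM M0 linM brM] vM.
pose M' : set (bop (banach_of V)) := [set T | M (T : V -> V)].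
have lM' : lts M'.
  split=> [|a b c Ma Mb Mc]; last exact: (brM (a : V -> V) b c Ma Mb Mc).
  by split=> [|a f g Mf Mg]; [exact: M0|exact: (linM a (f : V -> V) g Mf Mg)].
have eqb (T : bop (banach_of V)) (bT : bounded_op (T : V -> V)) : T = to_bop bT by exact: bop_ext.
have vM' : volt M'.
  move=> T /vM[cT qT]; split; first by rewrite (eqb T cT.1); exact: compact_kop.
  by rewrite (eqb T cT.1); exact: quasinilpotent_qn.
have [C [cC tC maxC]] := invariant_maximal_chain lM' vM'.
exists C; split; last first.
  move=> W CW f Mf x Wx; exact: ((cC W CW).2 (to_bop (bM f Mf)) Mf x Wx).
split=> [|C' [cC' tC'] CC'].
  split=> [W /cC[cW _]|W U CW CU]; first exact: (closed_csub _).2 cW.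
  exact: tC.
apply/seteqP; split=> //; apply: maxC => // W C'W; exact: (closed_csub _).1 (cC' W C'W).
Qed.
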